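(* For all integers $r\geq 1$, $d\geq 0$, $\delta\geq 0$, there exists $M<\infty$ (depending only on $r,d,\delta$) with the following property. For every compact semi-algebraic subset $A\subset\, ]0,1[^d$ of maximum dimension $l$ and of degree $\leq\delta$, there exist an integer $N$ and continuous semi-algebraic maps $\phi_1,\dots,\phi_N:[0,1]^l\to\, ]0,1[^d$, of class $C^r$ on $]0,1[^l$, such that $\bigcup_{i=1}^N\phi_i([0,1]^l)=A$ and, for every $i=1,\dots,N$: (1) $\|\phi_i|_{]0,1[^l}\|_r:=\max_{\beta\in\mathbb{N}^l,\,|\beta|\leq r}\|\partial^\beta\phi_i\|_\infty\leq 1$, where $\|\cdot\|_\infty$ is the supremum over $]0,1[^l$ of the largest absolute value of the coordinates; (2) $N\leq M$; (3) $\deg(\phi_i)\leq M$.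
   Context: Intervals: $]a,b[$ denotes the open interval. By convention $]0,1[^0=[0,1]^0=\{0\}$. A set $A\subset\mathbb{R}^d$ is semi-algebraic if it is a finite union of sets of the form $\{x\in\mathbb{R}^d: P_1(x)>0,\dots,P_a(x)>0,\ P_{a+1}(x)=0,\dots,P_{a+s}(x)=0\}$ with $P_j\in\mathbb{R}[X_1,\dots,X_d]$. Such a description is called a presentation of $A$; the degree of a presentation is the sum of the total degrees of all polynomials involved, counted with multiplicity; the degree $\deg(A)$ is the minimum degree of its presentations. A map $f:A\subset\mathbb{R}^p\to\mathbb{R}^q$ is semi-algebraic if its graph is a semi-algebraic set; $\deg(f)$ is the degree of its graph. The maximum dimension of a semi-algebraic set is the maximum of the dimensions of the connected Nash manifolds (analytic submanifolds that are semi-algebraic sets) in a finite stratification of it, i.e. its usual dimension as a semi-algebraic set. *)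

(* Defs.v *)
From HB Require Import structures.
From mathcomp Require Import all_boot all_order all_algebra.
From mathcomp Require Import all_classical all_reals all_analysis.
(* mpoly's notations clash with those of MathComp-Analysis. *)
From mathcomp Require mpoly.
Import (coercions, canonicals) mpoly.

Set Implicit Arguments.
Unset Strict Implicit.
Unset Printing Implicit Defensive.

Import Order.TTheory GRing.Theory Num.Theory.
Import numFieldNormedType.Exports.

Local Open Scope classical_set_scope.
Local Open Scope ring_scope.

(* For d = 0, both cubes are the single point of 'rV[R]_0. *)
Definition open_cube {R : realType} (d : nat) : set 'rV[R]_d :=
  [set x | forall i, 0 < x 0 i < 1].

Definition closed_cube {R : realType} (d : nat) : set 'rV[R]_d :=
  [set x | forall i, 0 <= x 0 i <= 1].

Arguments open_cube {R} d : rename.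
Arguments closed_cube {R} d : rename.

Section SemiAlgebraic.
Context {R : realType}.

(* One block per basic set of the union: the polynomials required to be
   positive, then those required to vanish. *)
Definition presentation (d : nat) : Type :=
  seq (seq (mpoly.mpoly d R) * seq (mpoly.mpoly d R)).

Definition basic_set (d : nat)
    (b : seq (mpoly.mpoly d R) * seq (mpoly.mpoly d R)) : set 'rV[R]_d :=
  [set x | (forall P, P \in b.1 -> 0 < mpoly.meval (x 0) P) /\
           (forall P, P \in b.2 -> mpoly.meval (x 0) P = 0)].

Definition presented_set (d : nat) (p : presentation d) : set 'rV[R]_d :=
  [set x | exists2 b, b \in p & basic_set b x].

(* mpoly.msize is the total degree plus one, and 0 for the zero polynomial,
   whose total degree is taken to be 0. *)
Definition total_degree (d : nat) (P : mpoly.mpoly d R) : nat :=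
  (mpoly.msize P).-1.

Definition presentation_degree (d : nat) (p : presentation d) : nat :=
  (\sum_(b <- p) (\sum_(P <- b.1) total_degree P +
                  \sum_(P <- b.2) total_degree P))%N.

Definition semialgebraic (d : nat) (A : set 'rV[R]_d) : Prop :=
  exists p : presentation d, A = presented_set p.

Definition has_presentation_of_degree (d : nat) (A : set 'rV[R]_d) (n : nat) :
    Prop :=
  exists2 p : presentation d, A = presented_set p & presentation_degree p = n.

(* The minimal degree of a presentation; the default value 0 is only reached
   when A is not semi-algebraic. *)
Definition sa_degree (d : nat) (A : set 'rV[R]_d) : nat :=
  xget 0%N [set n | has_presentation_of_degree A n /\
                    forall m, has_presentation_of_degree A m -> (n <= m)%N].

Definition graph_on (p q : nat) (A : set 'rV[R]_p)
    (f : 'rV[R]_p -> 'rV[R]_q) : set 'rV[R]_(p + q) :=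
  [set row_mx x (f x) | x in A].

Definition semialgebraic_map (p q : nat) (A : set 'rV[R]_p)
    (f : 'rV[R]_p -> 'rV[R]_q) : Prop := semialgebraic (graph_on A f).

Definition map_degree (p q : nat) (A : set 'rV[R]_p)
    (f : 'rV[R]_p -> 'rV[R]_q) : nat := sa_degree (graph_on A f).

End SemiAlgebraic.

Section Dimension.
Context {R : realType}.

Definition monomial_at (d : nat) (a : mpoly.multinom d) (h : 'rV[R]_d) : R :=
  \prod_(i < d) h 0 i ^+ a i.

(* f is, near x, the sum of an absolutely convergent power series;
   mpoly.bmultinom d n is the finite type of the multi-indices of length < n. *)
Definition analytic_at (d : nat) (f : 'rV[R]_d -> R) (x : 'rV[R]_d) : Prop :=
  exists c : mpoly.multinom d -> R,
    \forall y \near x,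
      summable [set: mpoly.multinom d]
        (fun a => (c a * monomial_at a (y - x))%:E) /\
      (\sum_(a : mpoly.bmultinom d n) c a * monomial_at a (y - x))
        @[n --> \oo] --> f y.

Definition analytic_map_on (d : nat) (U : set 'rV[R]_d)
    (h : 'rV[R]_d -> 'rV[R]_d) : Prop :=
  forall x, U x -> forall j, analytic_at (fun y => h y 0 j) x.

(* Around each of its points, S is carried to the coordinate subspace of the
   first k coordinates by an analytic diffeomorphism between open sets. *)
Definition analytic_submanifold (d k : nat) (S : set 'rV[R]_d) : Prop :=
  (k <= d)%N /\
  forall x, S x -> exists (U V : set 'rV[R]_d) (h g : 'rV[R]_d -> 'rV[R]_d),
    [/\ open U /\ U x, open V,
        analytic_map_on U h /\ analytic_map_on V g,
        (forall y, U y -> V (h y) /\ g (h y) = y) /\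
        (forall z, V z -> U (g z) /\ h (g z) = z) &
        forall y, U y ->
          (S y <-> forall i : 'I_d, (k <= i)%N -> h y 0 i = 0)].

Definition nash_manifold (d k : nat) (S : set 'rV[R]_d) : Prop :=
  analytic_submanifold k S /\ semialgebraic S.

Definition nash_stratification (d n : nat) (A : set 'rV[R]_d)
    (S : 'I_n -> set 'rV[R]_d) (k : 'I_n -> nat) : Prop :=
  [/\ forall i, [/\ S i !=set0, connected (S i) & nash_manifold (k i) (S i)],
      A = \bigcup_i S i,
      trivIset setT S &
      forall i j, i != j -> S i `&` closure (S j) !=set0 ->
        S i `<=` closure (S j) /\ (k i < k j)%N].

(* The empty set, whose only stratification has no stratum, gets dimension 0. *)
Definition max_dimension (d : nat) (A : set 'rV[R]_d) (l : nat) : Prop :=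
  exists (n : nat) (S : 'I_n -> set 'rV[R]_d) (k : 'I_n -> nat),
    nash_stratification A S k /\ l = (\max_(i < n) k i)%N.

End Dimension.

Section Differentiability.
Context {R : realType}.
Variables l d : nat.
Implicit Types (U : set 'rV[R]_l) (f : 'rV[R]_l -> 'rV[R]_d).

Definition partial (i : 'I_l) f : 'rV[R]_l -> 'rV[R]_d :=
  fun x => 'D_(delta_mx 0 i) f x.

Definition partial_multi (b : mpoly.multinom l) f : 'rV[R]_l -> 'rV[R]_d :=
  foldr (fun i g => iter (b i) (partial i) g) f (enum 'I_l).

(* U is meant to be open. *)
Fixpoint class_C (r : nat) U f : Prop :=
  {within U, continuous f} /\
  if r is s.+1 then
    forall i, (forall x, U x -> derivable f x (delta_mx 0 i)) /\
              class_C s U (partial i f)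
  else True.

(* The norm of 'rV[R]_d is the largest absolute value of the coordinates. *)
Definition sup_norm U f : \bar R := ereal_sup [set `|f x|%:E | x in U].

Definition C_norm (r : nat) U f : \bar R :=
  \big[maxe/0%E]_(b : mpoly.bmultinom l r.+1) sup_norm U (partial_multi b f).

End Differentiability.

(* Main.v *)
(* The Yomdin-Gromov algebraic lemma, by induction on the number of variables. Sets of
   bounded degree form a definable family, and every bound below is uniform over
   definable families by quantifier elimination, which also bounds the degrees of the
   parametrizations. In one variable, using as parameter the value of the steepest
   function of the family bounds the first derivatives, and substitutions by squares
   bound the next derivatives one at a time. In more variables, the induction
   hypothesis is applied to the fibres over the first variable, then the first variable
   is reparametrized along curves on which the remaining derivatives nearly reach their
   suprema; the exceptional points form sets of smaller dimension. Throughout, the first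
   coordinate of a parametrization depends on the first parameter only. Subdividing the
   cube makes the derivatives at most 1, and McShane's formula extends the maps to the
   closed cube. *)

Require Import Defs.
From HB Require Import structures.
From mathcomp Require Import all_boot all_order all_algebra.
From mathcomp Require Import all_classical all_reals all_analysis.
From mathcomp Require ordered_qelim qe_rcf polyrcf qe_rcf_th mpoly.
From mathcomp Require Import ring lra zify.
Import (coercions, canonicals) mpoly.

Set Implicit Arguments.
Unset Strict Implicit.
Unset Printing Implicit Defensive.

Import Order.TTheory GRing.Theory Num.Theory.
Import numFieldNormedType.Exports.

Local Open Scope classical_set_scope.
Local Open Scope ring_scope.

(** * Definable sets and maps *)

(** Cell decomposition is replaced by definable choice and by Baire's theorem applied to countably
    many rational data, which turns choices made point by point into constants over an open set.
    This gives that definable sets without interior are negligible ([thin]) and that definable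
    functions are smooth off thin sets. Uniformity comes from working with families indexed by a
    parameter [t]: counts and bounds are fixed before [t].

    The obstacle is that a substitution in the first variable must not spoil the bounds already
    obtained. A derivative of order [j] in that variable gets multiplied by the [j]-th power of the
    derivative of the substitution, up to terms of lower order in that variable, so the bounds are
    gained one such order at a time ([subst0_bound]). Keeping the first coordinate a function of the
    first parameter alone ([tri]) sends slices to slices, so bounds on slices survive. The dimension
    given by strata is traded for a recursive one ([dle]) made of projections, and the analytic
    charts serve only as Lipschitz maps. *)

Module ord := ordered_qelim.ord.

(** Types coded by tuples of [ddim] reals. Parameters pile up along the proof (points, end points of
    segments, indices, tuples of earlier parameters); the code lets first-order formulas quantify
    over all of them, and canonical instances supply it. *)
Structure dtype (R : realType) := DType {
  dsort :> Type;
  ddim : nat;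
  denc : dsort -> seq R;
  ddec : seq R -> dsort;
  size_denc : forall t, size (denc t) = ddim;
  dencK : cancel denc ddec;
  ddecK : forall s, size s = ddim -> denc (ddec s) = s }.

Arguments ddim {R} T : rename.
Arguments ddec {R} T s : rename.

Section Dtypes.
Context {R : realType}.

Definition real_dtype : dtype R.
Proof.
refine (@DType R R 1 (fun x => [:: x]) (fun s => head 0 s) _ _ _) => //.
by case=> [|x []].
Defined.

Definition prod_dtype (T U : dtype R) : dtype R.
Proof.
refine (@DType R (T * U)%type (ddim T + ddim U) (fun p => denc p.1 ++ denc p.2)
    (fun s => (ddec T (take (ddim T) s), ddec U (drop (ddim T) s))) _ _ _).
- by move=> [t u] /=; rewrite size_cat !size_denc.
- by move=> [t u] /=; rewrite take_size_cat ?drop_size_cat ?size_denc // !dencK.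
- move=> s hs /=; rewrite !ddecK ?cat_take_drop //.
    by rewrite size_drop hs addKn.
  by rewrite size_take hs; case: ltnP => // h; apply/eqP; rewrite eqn_leq h leq_addr.
Defined.

Definition row_dtype (n : nat) : dtype R.
Proof.
refine (@DType R 'rV[R]_n n (fun x => [seq x 0 i | i <- enum 'I_n])
    (fun s => \row_(i < n) nth 0 s i) _ _ _).
- by move=> t; rewrite size_map size_enum_ord.
- move=> x; apply/rowP => i; rewrite mxE (nth_map i) ?size_enum_ord //.
  by rewrite nth_ord_enum.
- move=> s hs; apply: (@eq_from_nth _ 0); rewrite size_map size_enum_ord // => i ltin.
  by rewrite (nth_map (Ordinal ltin)) ?size_enum_ord // mxE nth_enum_ord.
Defined.

End Dtypes.

Canonical real_dtype.
Canonical prod_dtype.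
Canonical row_dtype.

Section Definable.
Context {R : realType}.
Implicit Types (T U V W : dtype R) (f g : ord.formula R) (e : seq R).

Fixpoint tshift k (t : GRing.term R) : GRing.term R :=
  match t with
  | GRing.Var i => GRing.Var R (k + i)
  | GRing.Const x => GRing.Const x
  | GRing.NatConst n => GRing.NatConst R n
  | GRing.Add a b => GRing.Add (tshift k a) (tshift k b)
  | GRing.Opp a => GRing.Opp (tshift k a)
  | GRing.NatMul a n => GRing.NatMul (tshift k a) n
  | GRing.Mul a b => GRing.Mul (tshift k a) (tshift k b)
  | GRing.Inv a => GRing.Inv (tshift k a)
  | GRing.Exp a n => GRing.Exp (tshift k a) n
  end.

Fixpoint fshift k f : ord.formula R :=
  match f with
  | ord.Bool b => ord.Bool b
  | ord.Equal a b => ord.Equal (tshift k a) (tshift k b)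
  | ord.Lt a b => ord.Lt (tshift k a) (tshift k b)
  | ord.Le a b => ord.Le (tshift k a) (tshift k b)
  | ord.Unit a => ord.Unit (tshift k a)
  | ord.And a b => ord.And (fshift k a) (fshift k b)
  | ord.Or a b => ord.Or (fshift k a) (fshift k b)
  | ord.Implies a b => ord.Implies (fshift k a) (fshift k b)
  | ord.Not a => ord.Not (fshift k a)
  | ord.Exists i a => ord.Exists (k + i) (fshift k a)
  | ord.Forall i a => ord.Forall (k + i) (fshift k a)
  end.

Lemma eval_tshift k e t : GRing.eval e (tshift k t) = GRing.eval (drop k e) t.
Proof.
elim: t => //=; first (by move=> i; rewrite nth_drop).
- by move=> ? -> ? ->.
- by move=> ? ->.
- by move=> ? ->.
- by move=> ? -> ? ->.
- by move=> ? ->.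
- by move=> ? ->.
Qed.

Lemma eq_holdsP e e' f : GRing.same_env e e' -> ord.holds e f <-> ord.holds e' f.
Proof. by move=> h; split; apply: ord.eq_holds => // i; rewrite h. Qed.

Lemma holds_fshift k e f : ord.holds e (fshift k f) <-> ord.holds (drop k e) f.
Proof.
have same i x e' : GRing.same_env (drop k (set_nth 0 e' (k + i) x)) (set_nth 0 (drop k e') i x).
  by move=> j; rewrite nth_drop !nth_set_nth /= eqn_add2l nth_drop.
elim: f e => //=.
- by move=> a b e; rewrite !eval_tshift.
- by move=> a b e; rewrite !eval_tshift.
- by move=> a b e; rewrite !eval_tshift.
- by move=> a e; rewrite !eval_tshift.
- by move=> a iha b ihb e; rewrite iha ihb.
- by move=> a iha b ihb e; rewrite iha ihb.
- by move=> a iha b ihb e; rewrite iha ihb.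
- by move=> a iha e; rewrite iha.
- move=> i a iha e; split=> -[x hx]; exists x; move: hx; rewrite iha;
    apply: (proj1 (eq_holdsP _ _)) => j; rewrite same //.
- move=> i a iha e; split=> h x; move: (h x); rewrite iha;
    apply: (proj1 (eq_holdsP _ _)) => j; rewrite same //.
Qed.

Fixpoint exs n k f := if k is k'.+1 then ord.Exists n (exs n.+1 k' f) else f.

Lemma holds_exs n k f a e : size a = n ->
  ord.holds (a ++ e) (exs n k f) <->
  exists2 s, size s = k & ord.holds (a ++ s ++ drop k e) f.
Proof.
elim: k n a e => [|k ih] n a e sa /=.
  rewrite drop0; split; first by exists [::].
  by case=> s /size0nil ->.
have same x : GRing.same_env (set_nth 0 (a ++ e) n x) (rcons a x ++ behead e).
  move=> j; rewrite nth_set_nth /= !nth_cat size_rcons nth_rcons sa.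
  case: (ltngtP j n) => h.
  - by rewrite ltnS ltnW.
  - rewrite ltnS leqNgt h /= nth_behead; congr nth.
    by rewrite -[LHS](@prednK) ?subn_gt0 // subnS.
  - by rewrite h ltnSn.
split.
- case=> x; rewrite (eq_holdsP _ (same x)) ih ?size_rcons ?sa // => -[s ss hs].
  exists (x :: s); first by rewrite /= ss.
  by move: hs; rewrite -drop1 drop_drop addn1 cat_rcons.
- case=> [[//|x s]] /= [ss] hs; exists x; rewrite (eq_holdsP _ (same x)) ih ?size_rcons ?sa //.
  by exists s => //; rewrite -drop1 drop_drop addn1 cat_rcons.
Qed.

(* Quantifying over an arbitrary tail [e] ensures that only the variables
   of index less than [ddim T] matter. *)
Definition def T (P : T -> Prop) : Prop :=
  exists f, forall t e, ord.holds (denc t ++ e) f <-> P t.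

Definition defm T U (f : T -> U) : Prop := def (fun p : T * U => f p.1 = p.2).

Lemma def_ext T (P Q : T -> Prop) : (forall t, P t <-> Q t) -> def P -> def Q.
Proof. by move=> h [f hf]; exists f => t e; rewrite hf. Qed.

Lemma def_const T (Q : Prop) : def (fun _ : T => Q).
Proof. by exists (ord.Bool `[< Q >]) => t e /=; split=> /asboolP. Qed.

Lemma def_and T (P Q : T -> Prop) : def P -> def Q -> def (fun t => P t /\ Q t).
Proof. by move=> [f hf] [g hg]; exists (ord.And f g) => t e /=; rewrite hf hg. Qed.

Lemma def_or T (P Q : T -> Prop) : def P -> def Q -> def (fun t => P t \/ Q t).
Proof. by move=> [f hf] [g hg]; exists (ord.Or f g) => t e /=; rewrite hf hg. Qed.

Lemma def_imp T (P Q : T -> Prop) : def P -> def Q -> def (fun t => P t -> Q t).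
Proof. by move=> [f hf] [g hg]; exists (ord.Implies f g) => t e /=; rewrite hf hg. Qed.

Lemma def_not T (P : T -> Prop) : def P -> def (fun t => ~ P t).
Proof. by move=> [f hf]; exists (ord.Not f) => t e /=; rewrite hf. Qed.

Lemma def_iff T (P Q : T -> Prop) : def P -> def Q -> def (fun t => P t <-> Q t).
Proof. by move=> hP hQ; apply: def_and; apply: def_imp. Qed.

Lemma def_ex T U (P : T -> U -> Prop) :
  def (fun p : T * U => P p.1 p.2) -> def (fun t => exists u, P t u).
Proof.
move=> [f hf]; exists (exs (ddim T) (ddim U) f) => t e.
rewrite holds_exs ?size_denc //; split.
- case=> s ss hs; exists (ddec U s); apply/(hf (t, ddec U s) (drop (ddim U) e)).
  by rewrite /= ddecK // -catA.
- case=> u hu; exists (denc u); first exact: size_denc.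
  by rewrite catA; apply/(hf (t, u)).
Qed.

Lemma def_all T U (P : T -> U -> Prop) :
  def (fun p : T * U => P p.1 p.2) -> def (fun t => forall u, P t u).
Proof.
move=> h; apply: (@def_ext _ (fun t => ~ exists u, ~ P t u)); last first.
  exact/def_not/def_ex/def_not.
by move=> t; split=> [h1 u | h1 [u]]; [apply: contrapT => h2; apply: h1; exists u | apply].
Qed.

Lemma def_finall T (I : finType) (P : I -> T -> Prop) :
  (forall i, def (P i)) -> def (fun t => forall i, P i t).
Proof.
move=> h; apply: (@def_ext _ (fun t => forall i, i \in enum I -> P i t)).
  by move=> t; split=> h' i; [apply: h'; rewrite mem_enum | move=> _; apply: h'].
elim: (enum I) => [|i s ih].
  by apply: (@def_ext _ (fun=> True)) (def_const _ _) => t.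
apply: (@def_ext _ (fun t => P i t /\ forall j, j \in s -> P j t)); last exact: def_and.
move=> t; split=> [[h1 h2] j|h1].
  by rewrite inE => /predU1P[->//|]; apply: h2.
by split=> [|j js]; apply: h1; rewrite inE ?eqxx // js orbT.
Qed.

Lemma def_finex T (I : finType) (P : I -> T -> Prop) :
  (forall i, def (P i)) -> def (fun t => exists i, P i t).
Proof.
move=> h; apply: (@def_ext _ (fun t => ~ forall i, ~ P i t)); last first.
  by apply/def_not/def_finall => i; exact: def_not.
move=> t; split=> [h1|[i hi] /(_ i)//]; apply: contrapT => h2; apply: h1 => i hi.
by apply: h2; exists i.
Qed.

Definition eqvars (l : seq nat) k : ord.formula R :=
  foldr (fun i f => ord.And (ord.Equal (GRing.Var R (k + i)) (GRing.Var R (nth 0%N l i))) f)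
    (ord.Bool true) (iota 0 (size l)).

Lemma holds_eqvars e l k : ord.holds e (eqvars l k) <->
  (forall i, (i < size l)%N -> nth 0 e (k + i) = nth 0 e (nth 0%N l i)).
Proof.
have -> : (forall i, (i < size l)%N -> nth 0 e (k + i) = nth 0 e (nth 0%N l i)) <->
  (forall i, i \in iota 0 (size l) -> nth 0 e (k + i) = nth 0 e (nth 0%N l i)).
  by split=> h i; have := h i; rewrite mem_iota.
rewrite /eqvars; elim: (iota 0 (size l)) => //= i s ih; rewrite ih.
split=> [[h1 h2] j|h1].
  by rewrite inE => /predU1P[->//|]; apply: h2.
by split=> [|j js]; apply: h1; rewrite inE ?eqxx // js orbT.
Qed.

(** Renaming variables inside [f] could capture bound ones. Instead, a fresh block of variables
    after those of [t] is quantified existentially and equated with the selected coordinates, and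
    [f] is shifted past [t]. *)
Lemma def_reindex T U (h : T -> U) (l : seq nat) (P : U -> Prop) :
  all (fun i => i < ddim T)%N l ->
  (forall t, denc (h t) = [seq nth 0 (denc t) i | i <- l]) ->
  def P -> def (fun t => P (h t)).
Proof.
move=> hl hh [f hf].
have sl : size l = ddim U by rewrite -(size_denc (h (ddec T [::]))) hh size_map.
exists (exs (ddim T) (ddim U) (ord.And (eqvars l (ddim T)) (fshift (ddim T) f))) => t e.
have nthl i s : (i < size l)%N ->
    nth 0 (denc t ++ s) (nth 0%N l i) = nth 0 (denc (h t)) i.
  move=> il; rewrite hh (nth_map 0%N) // nth_cat size_denc.
  by move/all_nthP: hl => /(_ 0%N i il) ->.
rewrite holds_exs ?size_denc //; split.
- case=> s ss /= []; rewrite holds_eqvars holds_fshift drop_size_cat ?size_denc // => h1 h2.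
  suff E : s = denc (h t) by apply/(hf (h t) (drop (ddim U) e)); rewrite -E.
  apply: (@eq_from_nth _ 0); first by rewrite ss size_denc.
  move=> i; rewrite ss -sl => il; have := h1 _ il.
  rewrite nthl // => <-.
  by rewrite nth_cat size_denc ltnNge leq_addr /= addKn nth_cat ss -sl il.
- move=> ht; exists (denc (h t)); first exact: size_denc.
  rewrite /= holds_eqvars holds_fshift drop_size_cat ?size_denc // hf; split=> // i il.
  rewrite nthl // nth_cat size_denc ltnNge leq_addr /= addKn nth_cat size_denc.
  by rewrite -sl il.
Qed.

Lemma map_nth_iota (s1 s2 s3 : seq R) :
  [seq nth 0 (s1 ++ s2 ++ s3) i | i <- iota (size s1) (size s2)] = s2.
Proof.
apply: (@eq_from_nth _ 0); rewrite size_map size_iota // => i il.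
by rewrite (nth_map 0%N) ?size_iota // nth_iota // nth_cat ltnNge leq_addr /= addKn nth_cat il.
Qed.

Lemma def_fst T U (P : T -> Prop) : def P -> def (fun p : T * U => P p.1).
Proof.
apply: (@def_reindex _ _ _ (iota 0 (ddim T))).
  by apply/allP => i; rewrite mem_iota /= add0n => h; rewrite ltn_addr.
by move=> [t u] /=; have := map_nth_iota [::] (denc t) (denc u); rewrite /= size_denc => ->.
Qed.

Lemma def_snd T U (P : U -> Prop) : def P -> def (fun p : T * U => P p.2).
Proof.
apply: (@def_reindex _ _ _ (iota (ddim T) (ddim U))).
  by apply/allP => i; rewrite mem_iota /= => /andP[].
move=> [t u] /=; have := map_nth_iota (denc t) (denc u) [::].
by rewrite /= !size_denc cats0 => ->.
Qed.

Lemma def_drop_mid T U V (P : T * V -> Prop) : def P ->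
  def (fun p : (T * U) * V => P (p.1.1, p.2)).
Proof.
apply: (@def_reindex _ _ _ (iota 0 (ddim T) ++ iota (ddim T + ddim U) (ddim V))).
  rewrite all_cat; apply/andP; split; apply/allP => i; rewrite mem_iota /=.
    by rewrite add0n => h; rewrite -addnA ltn_addr.
  by move=> /andP[].
move=> [[t u] v] /=; rewrite map_cat; congr (_ ++ _).
  have := map_nth_iota [::] (denc t) (denc u ++ denc v).
  by rewrite -catA /= size_denc => ->.
have := map_nth_iota (denc t ++ denc u) (denc v) [::].
by rewrite size_cat !size_denc cats0 => ->.
Qed.

Lemma def_drop_last T U V (P : T * U -> Prop) : def P ->
  def (fun p : T * (U * V) => P (p.1, p.2.1)).
Proof.
apply: (@def_reindex _ _ _ (iota 0 (ddim T + ddim U))).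
  by apply/allP => i; rewrite mem_iota /= add0n addnA => h; rewrite ltn_addr.
move=> [t [u v]] /=.
have := map_nth_iota [::] (denc t ++ denc u) (denc v).
by rewrite /= size_cat !size_denc catA => ->.
Qed.

Lemma def_drop_mid' T U V (P : T * V -> Prop) : def P ->
  def (fun p : T * (U * V) => P (p.1, p.2.2)).
Proof.
apply: (@def_reindex _ _ _ (iota 0 (ddim T) ++ iota (ddim T + ddim U) (ddim V))).
  rewrite all_cat; apply/andP; split; apply/allP => i; rewrite mem_iota /= addnA.
    by rewrite add0n => h; rewrite -addnA ltn_addr.
  by move=> /andP[].
move=> [t [u v]] /=; rewrite map_cat; congr (_ ++ _).
  have := map_nth_iota [::] (denc t) (denc u ++ denc v).
  by rewrite /= size_denc => ->.
have := map_nth_iota (denc t ++ denc u) (denc v) [::].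
by rewrite size_cat !size_denc cats0 catA => ->.
Qed.

Lemma def_eqT T : def (fun p : T * T => p.1 = p.2).
Proof.
exists (eqvars (iota 0 (ddim T)) (ddim T)) => -[t u] e; rewrite holds_eqvars size_iota /=.
split.
- move=> h; rewrite -(dencK t) -(dencK u); congr ddec.
  apply: (@eq_from_nth _ 0); rewrite !size_denc // => i il; have := h i il.
  rewrite nth_iota // add0n -catA !nth_cat !size_denc il ltnNge leq_addr /= addKn il.
  by move->.
- by move=> -> i il; rewrite nth_iota // -catA !nth_cat !size_denc ltnNge leq_addr /= addKn il.
Qed.

Lemma defm_id T : defm (fun t : T => t). Proof. exact: def_eqT. Qed.

Lemma defm_fst T U : defm (fun t : T * U => t.1).
Proof. exact: (def_drop_mid _ (def_eqT T)). Qed.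

Lemma defm_snd T U : defm (fun t : T * U => t.2).
Proof.
apply: (@def_reindex _ _ (fun p : (T * U) * U => (p.1.2, p.2))
  (iota (ddim T) (ddim U + ddim U)) (fun p => p.1 = p.2) _ _ (def_eqT U)).
  by apply/allP => i; rewrite mem_iota /= -addnA => /andP[].
move=> [[t u] v] /=.
have := map_nth_iota (denc t) (denc u ++ denc v) [::].
by rewrite size_cat !size_denc cats0 catA => ->.
Qed.

Lemma def_comp T U (h : T -> U) (P : U -> Prop) :
  defm h -> def P -> def (fun t => P (h t)).
Proof.
move=> dh dP; apply: (@def_ext _ (fun t => exists u, h t = u /\ P u)).
  by move=> t; split=> [[u [-> //]]|]; exists (h t).
by apply: def_ex; apply: def_and => //; apply: def_snd.
Qed.

Lemma defm_pair T U V (f : T -> U) (g : T -> V) :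
  defm f -> defm g -> defm (fun t => (f t, g t)).
Proof.
move=> df dg; apply: (@def_ext _ (fun p => f p.1 = p.2.1 /\ g p.1 = p.2.2)).
  by move=> [t [u v]] /=; split=> [[-> ->]|[-> ->]].
by apply: def_and; [exact: (def_drop_last V df) | exact: (def_drop_mid' U dg)].
Qed.

Lemma defm_comp T U V (f : U -> V) (g : T -> U) :
  defm g -> defm f -> defm (fun t => f (g t)).
Proof.
move=> dg df; apply: (@def_comp _ _ (fun p : T * V => (g p.1, p.2)) _ _ df).
apply: defm_pair; last exact: defm_snd.
exact: (def_drop_mid _ dg).
Qed.

Lemma defm_const T U (u : U) : defm (fun _ : T => u).
Proof.
have h : def (fun v : U => u = v).
  exists (foldr (fun i f => ord.And (ord.Equal (GRing.Var R i) (GRing.Const (nth 0 (denc u) i))) f)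
    (ord.Bool true) (iota 0 (ddim U))) => v e.
  have -> : (u = v) <-> forall i, i \in iota 0 (ddim U) -> nth 0 (denc v) i = nth 0 (denc u) i.
    split=> [-> //|h]; rewrite -(dencK u) -(dencK v); congr ddec; symmetry.
    apply: (@eq_from_nth _ 0); rewrite !size_denc // => i il; apply: h.
    by rewrite mem_iota.
  have : all (fun i => i < ddim U)%N (iota 0 (ddim U)).
    by apply/allP => i; rewrite mem_iota.
  elim: (iota 0 (ddim U)) => //= i s ih /andP[iU /ih ->].
  rewrite nth_cat size_denc iU; split=> [[h1 h2] j|h1].
    by rewrite inE => /predU1P[->//|]; apply: h2.
  by split=> [|j js]; apply: h1; rewrite inE ?eqxx // js orbT.
exact: (def_snd _ h).
Qed.

Lemma def_eq T U (f g : T -> U) : defm f -> defm g -> def (fun t => f t = g t).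
Proof.
move=> df dg; exact: (def_comp (defm_pair df dg) (def_eqT U)).
Qed.

Lemma def_comp2 T U V (P : U -> V -> Prop) (f : T -> U) (g : T -> V) :
  def (fun p : U * V => P p.1 p.2) -> defm f -> defm g -> def (fun t => P (f t) (g t)).
Proof. by move=> dP df dg; exact: (def_comp (defm_pair df dg) dP). Qed.

Lemma defm_comp2 T U V W (P : U -> V -> W) (f : T -> U) (g : T -> V) :
  defm (fun p : U * V => P p.1 p.2) -> defm f -> defm g -> defm (fun t => P (f t) (g t)).
Proof. by move=> dP df dg; exact: (defm_comp (defm_pair df dg) dP). Qed.

Lemma def_lt T (f g : T -> R) : defm f -> defm g -> def (fun t => f t < g t).
Proof.
move=> df dg; apply: (@def_comp2 _ real_dtype real_dtype (fun x y => x < y)) => //.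
by exists (ord.Lt (GRing.Var R 0) (GRing.Var R 1)) => -[t u] e.
Qed.

Lemma def_le T (f g : T -> R) : defm f -> defm g -> def (fun t => f t <= g t).
Proof.
move=> df dg; apply: (@def_comp2 _ real_dtype real_dtype (fun x y => x <= y)) => //.
by exists (ord.Le (GRing.Var R 0) (GRing.Var R 1)) => -[t u] e.
Qed.

Lemma def_andb T (P Q : T -> bool) :
  def (fun t => P t) -> def (fun t => Q t) -> def (fun t => P t && Q t).
Proof.
move=> h1 h2; apply: (@def_ext _ (fun t => P t /\ Q t)); last exact: def_and.
by move=> t; split=> /andP.
Qed.

Lemma defm_add T (f g : T -> R) : defm f -> defm g -> defm (fun t => f t + g t).
Proof.
move=> df dg; apply: (@defm_comp2 _ real_dtype real_dtype real_dtype (fun x y => x + y)) => //.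
by exists (ord.Equal (GRing.Add (GRing.Var R 0) (GRing.Var R 1)) (GRing.Var R 2)) => -[[t u] v] e.
Qed.

Lemma defm_mul T (f g : T -> R) : defm f -> defm g -> defm (fun t => f t * g t).
Proof.
move=> df dg; apply: (@defm_comp2 _ real_dtype real_dtype real_dtype (fun x y => x * y)) => //.
by exists (ord.Equal (GRing.Mul (GRing.Var R 0) (GRing.Var R 1)) (GRing.Var R 2)) => -[[t u] v] e.
Qed.

Lemma defm_opp T (f : T -> R) : defm f -> defm (fun t => - f t).
Proof.
move=> df; apply: (@defm_comp _ real_dtype real_dtype (fun x => - x)) => //.
by exists (ord.Equal (GRing.Opp (GRing.Var R 0)) (GRing.Var R 1)) => -[t u] e.
Qed.

Lemma defm_inv T (f : T -> R) : defm f -> defm (fun t => (f t)^-1).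
Proof.
move=> df; apply: (@defm_comp _ real_dtype real_dtype (fun x => x^-1)) => //.
by exists (ord.Equal (GRing.Inv (GRing.Var R 0)) (GRing.Var R 1)) => -[t u] e.
Qed.

Lemma defm_norm T (f : T -> R) : defm f -> defm (fun t => `|f t|).
Proof.
move=> df; apply: (@defm_comp _ real_dtype real_dtype (fun x => `|x|)) => //.
apply: (@def_ext _ (fun p : R * R => (0 <= p.1 /\ p.1 = p.2) \/ (p.1 <= 0 /\ - p.1 = p.2))).
  move=> [x y] /=; split=> [[[h <-]|[h <-]]|<-].
  - by rewrite ger0_norm.
  - by rewrite ler0_norm.
  - by have [h|/ltW h] := leP 0 x; [left; rewrite ger0_norm|right; rewrite ler0_norm].
apply: def_or; apply: def_and.
- by apply: def_le; [exact: defm_const|exact: defm_fst].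
- by apply: def_eq; [exact: defm_fst|exact: defm_snd].
- by apply: def_le; [exact: defm_fst|exact: defm_const].
- by apply: def_eq; [exact: (defm_opp (@defm_fst _ _))|exact: defm_snd].
Qed.

Lemma defm_exp T (f : T -> R) n : defm f -> defm (fun t => f t ^+ n).
Proof.
move=> df; apply: (@defm_comp _ real_dtype real_dtype (fun x => x ^+ n)) => //.
by exists (ord.Equal (GRing.Exp (GRing.Var R 0) n) (GRing.Var R 1)) => -[t u] e.
Qed.

Lemma defm_sum T (I : Type) (r : seq I) (P : pred I) (F : I -> T -> R) :
  (forall i, defm (F i)) -> defm (fun t => \sum_(i <- r | P i) F i t).
Proof.
move=> h; elim: r => [|i r ih].
  apply: (@def_ext (prod_dtype T real_dtype) (fun p => 0 = p.2)); first by move=> p; rewrite big_nil.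
  exact: (@defm_const T real_dtype 0).
apply: (@def_ext (prod_dtype T real_dtype) (fun p => (if P i then F i p.1 + \sum_(j <- r | P j) F j p.1
   else \sum_(j <- r | P j) F j p.1) = p.2)); first by move=> p; rewrite big_cons.
by case: (P i) => //; exact: defm_add (h i) ih.
Qed.

Lemma defm_prod T (I : Type) (r : seq I) (P : pred I) (F : I -> T -> R) :
  (forall i, defm (F i)) -> defm (fun t => \prod_(i <- r | P i) F i t).
Proof.
move=> h; elim: r => [|i r ih].
  apply: (@def_ext (prod_dtype T real_dtype) (fun p => 1 = p.2)); first by move=> p; rewrite big_nil.
  exact: (@defm_const T real_dtype 1).
apply: (@def_ext (prod_dtype T real_dtype) (fun p => (if P i then F i p.1 * \prod_(j <- r | P j) F j p.1
   else \prod_(j <- r | P j) F j p.1) = p.2)); first by move=> p; rewrite big_cons.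
by case: (P i) => //; exact: defm_mul (h i) ih.
Qed.

Lemma defm_if T U (P : T -> Prop) (f g : T -> U) : def P -> defm f -> defm g ->
  defm (fun t => if `[< P t >] then f t else g t).
Proof.
move=> dP df dg.
apply: (@def_ext (prod_dtype T U) (fun p => (P p.1 /\ f p.1 = p.2) \/ (~ P p.1 /\ g p.1 = p.2))).
  move=> [t u] /=; case: asboolP => h; split; tauto.
by apply: def_or; apply: def_and => //; [exact: def_fst|exact/def_not/def_fst].
Qed.

Lemma defm_coord T n (f : T -> 'rV[R]_n) (i : 'I_1) (k : 'I_n) :
  defm f -> defm (fun t => f t i k).
Proof.
move=> df; apply: (@defm_comp _ (row_dtype n) real_dtype (fun x => x i k)) => //.
exists (ord.Equal (GRing.Var R k) (GRing.Var R n)) => -[x y] e.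
have sx := size_denc (x : row_dtype n); rewrite -[X in _ <-> X]/(x i k = y).
rewrite -[X in X <-> _]/(nth 0 ((@denc _ (row_dtype n) x ++ [:: y]) ++ e) k =
  nth 0 ((@denc _ (row_dtype n) x ++ [:: y]) ++ e) n).
rewrite -catA !nth_cat sx ltn_ord ltnn subnn /= ord1.
by rewrite (nth_map k) ?size_enum_ord // nth_ord_enum.
Qed.

Lemma defm_row T n (f : 'I_n -> T -> R) :
  (forall i, defm (f i)) -> defm (fun t => \row_i f i t).
Proof.
move=> df; apply: (@def_ext (prod_dtype T (row_dtype n)) (fun p => forall i, f i p.1 = p.2 0 i)).
  move=> [t x] /=; split=> [h|<- i]; last by rewrite mxE.
  by apply/rowP => i; rewrite mxE.
apply: def_finall => i; apply: def_eq; first exact: defm_comp (@defm_fst _ _) (df i).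
exact: (defm_coord _ _ (@defm_snd _ _)).
Qed.

End Definable.

Lemma defm_fst_of (R : realType) (T U V : dtype R) (f : T -> U * V) :
  defm f -> defm (fun t => (f t).1).
Proof. by move=> df; exact: (defm_comp df (@defm_fst _ _ _)). Qed.

Lemma defm_snd_of (R : realType) (T U V : dtype R) (f : T -> U * V) :
  defm f -> defm (fun t => (f t).2).
Proof. by move=> df; exact: (defm_comp df (@defm_snd _ _ _)). Qed.

Lemma def_comp3 (R : realType) (T U V W : dtype R) (P : U -> V -> W -> Prop)
    (f : T -> U) (g : T -> V) (h : T -> W) :
  def (fun p : U * V * W => P p.1.1 p.1.2 p.2) -> defm f -> defm g -> defm h ->
  def (fun t => P (f t) (g t) (h t)).
Proof. by move=> dP df dg dh; exact: (def_comp (defm_pair (defm_pair df dg) dh) dP). Qed.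

Lemma defm_comp3 (R : realType) (T U V W Z : dtype R) (P : U -> V -> W -> Z)
    (f : T -> U) (g : T -> V) (h : T -> W) :
  defm (fun p : U * V * W => P p.1.1 p.1.2 p.2) -> defm f -> defm g -> defm h ->
  defm (fun t => P (f t) (g t) (h t)).
Proof. by move=> dP df dg dh; exact: (defm_comp (defm_pair (defm_pair df dg) dh) dP). Qed.

(* The families in the context must be in the curried form [fun p => P p.1 p.2]. *)
Ltac ddef_hyp :=
  match goal with
  | H : def (fun p => ?P (fst (fst p)) (snd (fst p)) (snd p)) |- def (fun t => ?P _ _ _) =>
      simple refine (def_comp3 (P := P) H _ _ _)
  | H : defm (fun p => ?P (fst (fst p)) (snd (fst p)) (snd p)) |- defm (fun t => ?P _ _ _) =>
      simple refine (defm_comp3 (P := P) H _ _ _)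
  | H : forall j, defm (fun p => _ (fst (fst p)) (snd (fst p)) (snd p)) |- defm (fun t => ?P ?i _ _ _) =>
      simple refine (defm_comp3 (P := P i) (H i) _ _ _)
  | H : def (fun p => ?P (fst p) (snd p)) |- def (fun t => ?P _ _) =>
      simple refine (def_comp2 (P := P) H _ _)
  | H : defm (fun p => ?P (fst p) (snd p)) |- defm (fun t => ?P _ _) =>
      simple refine (defm_comp2 (P := P) H _ _)
  | H : forall j, defm (fun p => _ (fst p) (snd p)) |- defm (fun t => ?P ?i _ _) =>
      simple refine (defm_comp2 (P := P i) (H i) _ _)
  | H : forall j, def (fun p => _ (fst p) (snd p)) |- def (fun t => ?P ?i _ _) =>
      simple refine (def_comp2 (P := P i) (H i) _ _)
  | H : def ?P |- def (fun t => ?P _) => simple refine (def_comp _ H)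
  | H : defm ?P |- defm (fun t => ?P _) => simple refine (defm_comp _ H)
  | H : forall j, defm _ |- defm (fun t => ?P ?i _) => simple refine (defm_comp _ (H i))
  | H : forall j, def _ |- def (fun t => ?P ?i _) => simple refine (def_comp _ (H i))
  end.

(** Follows the head symbol of the formula. The families of the context are tried before the
    connectives, so that they get composed and not unfolded. *)
Ltac ddef_step :=
  cbn beta;
  first
  [ assumption
  | lazymatch goal with
    | |- defm (fun _ => _) => fail
    | |- defm ?f => change (defm (fun t => f t))
    | |- def (fun _ => _) => fail
    | |- def ?f => change (def (fun t => f t))
    end
  | apply: def_const | apply: defm_const | apply: defm_id | apply: defm_fst | apply: defm_snd
  | ddef_hyp; cbn beta
  | lazymatch goal with
    | |- def (fun t => _ /\ _) => apply: def_and
    | |- def (fun t => _ \/ _) => apply: def_or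
    | |- def (fun t => ~ _) => apply: def_not
    | |- def (fun t => _ <-> _) => apply: def_iff
    | |- def (fun t => exists _, _) => first [apply: def_ex | apply: def_finex => ?]
    | |- def (fun t => is_true (_ && _)) => apply: def_andb
    | |- def (fun t => is_true (_ < _)) => apply: def_lt
    | |- def (fun t => is_true (_ <= _)) => apply: def_le
    | |- def (fun t => _ = _) => apply: def_eq
    | |- def (fun t => forall _, _) => first [apply: def_imp | apply: def_all | apply: def_finall => ?]
    | |- defm (fun t => (_, _)) => apply: defm_pair
    | |- defm (fun t => _ + _) => apply: defm_add
    | |- defm (fun t => _ * _) => apply: defm_mul
    | |- defm (fun t => - _) => apply: defm_opp
    | |- defm (fun t => _ ^-1) => apply: defm_inv
    | |- defm (fun t => _ ^+ _) => apply: defm_exp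
    | |- defm (fun t => `| _ |) => apply: defm_norm
    | |- defm (fun t => (_).1) => apply: defm_fst_of
    | |- defm (fun t => (_).2) => apply: defm_snd_of
    | |- defm (fun t => if `[< _ >] then _ else _) => apply: defm_if
    | |- defm (fun t => \sum_(i <- _ | _) _) => apply: defm_sum => ?
    | |- defm (fun t => \prod_(i <- _ | _) _) => apply: defm_prod => ?
    | |- defm (fun t => \row_i _) => apply: defm_row => ?
    | |- defm (fun t => fun_of_matrix _ _ _) => apply: defm_coord
    end ].

Ltac ddef := repeat ddef_step.

(** * Uniform finiteness in one variable *)

Section Fin1.
Context {R : realType}.

Definition sgv (e : seq R) (ts : seq (qe_rcf.term R)) :=
  [seq Num.sg (qe_rcf.eval e v) | v <- ts].

Lemma sgv_cat e e' s1 s2 : sgv e (s1 ++ s2) = sgv e' (s1 ++ s2) ->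
  sgv e s1 = sgv e' s1 /\ sgv e s2 = sgv e' s2.
Proof.
by rewrite /sgv !map_cat => /eqP; rewrite eqseq_cat ?size_map // => /andP[/eqP ? /eqP ?].
Qed.

(** An atom compares two terms, so its truth is read off the sign of their difference. *)
Lemma qf_signs (g : ord.formula R) : ord.qf_form g -> ord.rformula g ->
  exists ts : seq (qe_rcf.term R), forall e e' : seq R,
    sgv e ts = sgv e' ts -> ord.qf_eval e g = ord.qf_eval e' g.
Proof.
have ev (t : GRing.term R) e : GRing.rterm t -> qe_rcf.eval e (qe_rcf.to_rterm t) = GRing.eval e t.
  by move=> rt; rewrite qe_rcf.evalE qe_rcf.to_rtermE.
elim: g => //=.
- by exists [::].
- move=> t1 t2 _ /andP[r1 r2]; exists [:: qe_rcf.to_rterm (GRing.Add t1 (GRing.Opp t2))] => e e' [].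
  rewrite !ev // => hs.
  by rewrite -subr_eq0 -[in RHS]subr_eq0 -sgr_eq0 hs sgr_eq0.
- move=> t1 t2 _ /andP[r1 r2]; exists [:: qe_rcf.to_rterm (GRing.Add t1 (GRing.Opp t2))] => e e' [].
  rewrite !ev // => hs.
  by rewrite -subr_lt0 -[in RHS]subr_lt0 -sgr_lt0 hs sgr_lt0.
- move=> t1 t2 _ /andP[r1 r2]; exists [:: qe_rcf.to_rterm (GRing.Add t1 (GRing.Opp t2))] => e e' [].
  rewrite !ev // => hs.
  by rewrite -subr_le0 -[in RHS]subr_le0 -sgr_le0 hs sgr_le0.
- move=> f1 ih1 f2 ih2 /andP[/ih1{}ih1 /ih2{}ih2] /andP[/ih1[s1 h1] /ih2[s2 h2]].
  by exists (s1 ++ s2) => e e' /sgv_cat[/h1-> /h2->].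
- move=> f1 ih1 f2 ih2 /andP[/ih1{}ih1 /ih2{}ih2] /andP[/ih1[s1 h1] /ih2[s2 h2]].
  by exists (s1 ++ s2) => e e' /sgv_cat[/h1-> /h2->].
- move=> f1 ih1 f2 ih2 /andP[/ih1{}ih1 /ih2{}ih2] /andP[/ih1[s1 h1] /ih2[s2 h2]].
  by exists (s1 ++ s2) => e e' /sgv_cat[/h1-> /h2->].
- by move=> f ih /ih{}ih /ih[s h]; exists s => e e' /h->.
Qed.

(** Tarski's quantifier elimination, once [to_rform] has removed the inverses. *)
Lemma holds_qf (f : ord.formula R) : exists g : ord.formula R,
  [/\ ord.qf_form g, ord.rformula g & forall e, ord.holds e f <-> ord.qf_eval e g].
Proof.
exists (ord.quantifier_elim (fun i bc => qe_rcf.qfr_to_formula (@qe_rcf.wproj R i bc)) (ord.to_rform f)).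
have := ord.quantifier_elim_wf (@qe_rcf.wf_QE_wproj R) (ord.to_rform_rformula f).
case/andP=> h1 h2; split=> // e; rewrite -ord.to_rformP.
exact: (rwP (ord.quantifier_elim_rformP (@qe_rcf.wf_QE_wproj R) (@qe_rcf.valid_QE_wproj R) _ (ord.to_rform_rformula f))).
Qed.

(* Uniform o-minimality: the exceptional points are the roots of polynomials whose
   degrees do not depend on [t]. *)
Lemma def_fin1 (T : dtype R) (P : T -> R -> Prop) : def (fun p => P p.1 p.2) ->
  exists N, forall t, exists2 s : seq R, (size s <= N)%N &
    forall a b, (forall x, x \in s -> ~~ (a < x < b)) ->
    forall x y, a < x < b -> a < y < b -> P t x -> P t y.
Proof.
case=> f hf; have [g [g1 g2 hg]] := holds_qf f; have [ts hts] := qf_signs g1 g2.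
(* The term [u] seen as a polynomial in the last variable, with the coordinates of [t] put into its
   coefficients; its size is at most that of [abstrX], whatever [t]. *)
pose q (t : T) (u : qe_rcf.term R) := qe_rcf.eval_poly (denc t) (qe_rcf.abstrX (ddim T) u).
exists (\sum_(u <- ts) size (qe_rcf.abstrX (ddim T) u))%N => t.
pose s := flatten [seq polyrcf.rootsR (q t u) | u <- ts]; exists s.
  rewrite /s; elim: (ts) => [|u us ih] /=; first by rewrite big_nil.
  rewrite big_cons size_cat leq_add //.
  have sz : (size (q t u) <= size (qe_rcf.abstrX (ddim T) u))%N.
    by rewrite /q qe_rcf.eval_polyP (leq_trans (size_Poly _)) // size_map.
  have [->|q0] := eqVneq (q t u) 0; first by rewrite polyrcf.rootsR0.
  apply: leq_trans sz; apply: ltnW; apply: max_poly_roots => //.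
    apply/allP => x; rewrite -(polyrcf.roots_on_rootsR q0).
    by case/andP.
  exact: polyrcf.uniq_roots.
move=> a b hs x y xab yab.
have evx z : GRing.same_env (denc (t, z)) (set_nth 0 (denc t) (ddim T) z).
  move=> i /=; rewrite nth_set_nth /= nth_cat size_denc.
  case: (ltngtP i (ddim T)) => [//|h|->]; last by rewrite subnn.
  by rewrite !nth_default ?size_denc ?(ltnW h) //= subn_gt0.
have hP z : P t z <-> ord.qf_eval (denc (t, z)) g.
  by rewrite -hg -[denc _]cats0 (hf (t, z)).
suff E : sgv (denc (t, x)) ts = sgv (denc (t, y)) ts by rewrite !hP (hts _ _ E).
have main v : (q t v != 0 -> {subset polyrcf.rootsR (q t v) <= s}) ->
    Num.sg (qe_rcf.eval (denc (t, x)) v) = Num.sg (qe_rcf.eval (denc (t, y)) v).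
  move=> sub; rewrite !qe_rcf.evalE !(GRing.eq_eval _ (evx _)) -!qe_rcf.evalE.
  rewrite -!qe_rcf.abstrXP -/(q t v).
  have [->|q0] := eqVneq (q t v) 0; first by rewrite !horner0.
  apply: (@polyrcf.polyrN0_itv _ `]a, b[) => //.
  move=> z zab; apply: contraTN zab => rz; rewrite in_itv /= hs //.
  by apply: sub => //; rewrite -polyrcf.roots_on_rootsR // inE rz in_itv.
rewrite /sgv.
have : forall us1 us2, ts = us1 ++ us2 -> [seq Num.sg (qe_rcf.eval (denc (t, x)) v) | v <- us2] =
    [seq Num.sg (qe_rcf.eval (denc (t, y)) v) | v <- us2]; last by move=> /(_ [::] ts erefl).
move=> us1 us2; elim: us2 us1 => //= v us2 ih us1 E; congr (_ :: _); last first.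
  by apply: (ih (rcons us1 v)); rewrite cat_rcons.
apply: main => _ z zr; rewrite /s E map_cat flatten_cat mem_cat /=.
by rewrite mem_cat zr orbT.
Qed.

End Fin1.

(** * Definable choice *)

Section Choice.
Context {R : realType}.
Implicit Types (T U V : dtype R).

Lemma ddec_inj U (u : U) (s : seq R) : size s = ddim U -> ddec U s = u <-> s = denc u.
Proof. by move=> hs; split=> [<-|->]; rewrite ?ddecK ?dencK. Qed.

Definition dtrans U V (u : U) : V := ddec V (denc u).

Lemma defm_dtrans U V : ddim U = ddim V -> defm (@dtrans U V).
Proof.
move=> dUV; exists (eqvars (iota 0 (ddim U)) (ddim U)) => -[t u] e.
rewrite holds_eqvars size_iota /= /dtrans ddec_inj ?size_denc //; split.
- move=> h; apply: (@eq_from_nth _ 0); rewrite !size_denc // => i il; have := h i il.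
  rewrite nth_iota // add0n -catA !nth_cat !size_denc il ltnNge leq_addr /= addKn -dUV il.
  by move->.
- move=> h i il; rewrite nth_iota // -catA !nth_cat !size_denc ltnNge leq_addr /= addKn.
  by rewrite -dUV il h.
Qed.

Lemma dtransK U V : ddim U = ddim V -> cancel (@dtrans U V) (@dtrans V U).
Proof. by move=> dUV u; rewrite /dtrans ddecK ?size_denc // dencK. Qed.

Definition pickd (A : Type) (a0 : A) (P : A -> Prop) : A :=
  if pselect (exists u, P u) is left h then sval (cid h) else a0.

Variant pickd_spec (A : Type) (a0 : A) (P : A -> Prop) : A -> Prop :=
| PickSome a : P a -> pickd_spec a0 P a
| PickNone : (forall a, ~ P a) -> pickd_spec a0 P a0.

Lemma pickdP (A : Type) (a0 : A) (P : A -> Prop) : pickd_spec a0 P (pickd a0 P).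
Proof.
rewrite /pickd; case: pselect => [h|h]; last by right=> a Pa; apply: h; exists a.
by case: cid => a Pa; left.
Qed.

(** As the witness is unique, [M] itself describes the graph where there is one. *)
Lemma defm_pickd T U (u0 : U) (M : T -> U -> Prop) : def (fun p => M p.1 p.2) ->
  (forall t u v, M t u -> M t v -> u = v) -> defm (fun t => pickd u0 (M t)).
Proof.
move=> dM uM; apply: (@def_ext _ _ (fun p : T * U => M p.1 p.2 \/ (~ (exists u, M p.1 u) /\ u0 = p.2))).
  move=> [t u] /=; case: pickdP => [v hv|hM]; split.
  - by case=> [/(uM _ _ _ hv)//|[[]]]; exists v.
  - by move=> <-; left.
  - by case=> [/hM//|[]].
  - by move=> <-; right; split=> // -[v /hM].
by ddef.
Qed.

Lemma finite_min (B : R -> Prop) (s : seq R) : (exists2 z, z \in s & B z) ->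
  exists m, [/\ m \in s, B m & forall z, z \in s -> B z -> m <= z].
Proof.
elim: s => [|a s ih]; first by case=> z.
have [/ih [m [ms Bm hm]] _|ns] := pselect (exists2 z, z \in s & B z); last first.
  case=> z; rewrite inE => /predU1P[-> Ba|zs Bz]; last by case: ns; exists z.
  exists a; split; rewrite ?mem_head // => w; rewrite inE => /predU1P[->//|ws Bw].
  by case: ns; exists w.
have [[Ba am]|h] := pselect (B a /\ a <= m).
  exists a; split; rewrite ?mem_head // => w; rewrite inE => /predU1P[->//|ws Bw].
  exact: le_trans am (hm _ ws Bw).
exists m; split=> //; first by rewrite inE ms orbT.
move=> w; rewrite inE => /predU1P[-> Ba|]; last exact: hm.
by rewrite leNgt; apply/negP => ha; apply: h; split=> //; exact: ltW.
Qed.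

Lemma finite_max (B : R -> Prop) (s : seq R) : (exists2 z, z \in s & B z) ->
  exists m, [/\ m \in s, B m & forall z, z \in s -> B z -> z <= m].
Proof.
case=> z zs Bz; have := @finite_min (fun x => B (- x)) [seq - x | x <- s].
case=> [|m [/mapP[x xs ->]]]; first by exists (- z); rewrite ?opprK // map_f.
rewrite opprK => Bx hm; exists x; split=> // w ws Bw.
by rewrite -lerN2; apply: hm; rewrite ?opprK ?map_f.
Qed.

(** Topological boundary. Unlike the list of points given by [def_fin1], it depends definably on
    [X], as choice and subdivision into segments require. *)
Definition bdpt (X : R -> Prop) (x : R) := forall e, 0 < e -> exists y z,
  [/\ `|y - x| < e, `|z - x| < e, X y & ~ X z].

Lemma bdpt_between0 (X : R -> Prop) x y : x < y -> X x -> ~ X y ->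
  exists2 c, x <= c <= y & bdpt X c.
Proof.
move=> xy Xx nXy; pose S := [set z | x <= z <= y /\ X z].
have Sx : S x by split=> //; rewrite lexx ltW.
have hS : has_sup S by split; [exists x|exists y => z [/andP[]]].
have ubS : ubound S (sup S) by exact: ub_le_sup hS.2.
have xc : x <= sup S by exact: ubS.
have cy : sup S <= y by apply: ge_sup; [exists x|move=> z [/andP[]]].
exists (sup S); first by rewrite xc.
move=> e e0; have [z Sz zc] := sup_adherent e0 hS.
have zS := ubS _ Sz; case: Sz => zxy Xz.
have hz : `|z - sup S| < e by rewrite ler0_norm ?subr_le0 // opprB ltrBlDr -ltrBlDl.
have [Xc|nXc] := pselect (X (sup S)); last by exists z, (sup S); rewrite subrr normr0.
have cy' : sup S < y by rewrite lt_neqAle cy andbT; apply: contra_notN nXy => /eqP <-.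
pose w := Num.min y (sup S + e / 2).
have cw : sup S < w by rewrite lt_min cy' ltrDl divr_gt0.
exists z, w; split=> //.
  rewrite gtr0_norm ?subr_gt0 // ltrBlDl gt_min; apply/orP; right.
  by rewrite ltrD2l ltr_pdivrMr // ltr_pMr // ltr1n.
move=> Xw; have : w <= sup S.
  by apply: ubS; split=> //; apply/andP; split; [exact: le_trans xc (ltW cw)|rewrite ge_min lexx].
by rewrite leNgt cw.
Qed.

Lemma bdpt_between (X : R -> Prop) x y a b : a < x < b -> a < y < b ->
  (forall c, a < c < b -> ~ bdpt X c) -> X x -> X y.
Proof.
move=> /andP[ax xb] /andP[ay yb] hc Xx; apply: contrapT => nXy.
have [xy|yx|xy] := ltgtP x y; last by rewrite xy in Xx.
  have [c /andP[xc cy] Bc] := bdpt_between0 xy Xx nXy.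
  by apply: (hc c) => //; rewrite (lt_le_trans ax) //= (le_lt_trans cy).
have [|c /andP[yc cx] Bc] := bdpt_between0 (X := fun z => ~ X z) yx nXy; first exact.
apply: (hc c); first by rewrite (lt_le_trans ay) //= (le_lt_trans cx).
move=> e e0; have [u [v [hu hv nXu Xv]]] := Bc e e0; exists v, u; split=> //.
exact: contrapT Xv.
Qed.

(** A point off the list of [def_fin1] has a neighbourhood without any point of the list, on which
    membership is constant. *)
Lemma bdpt_fin T (X : T -> R -> Prop) : def (fun p => X p.1 p.2) ->
  exists N, forall t, exists2 s : seq R, (size s <= N)%N & forall x, bdpt (X t) x -> x \in s.
Proof.
move=> dX; have [N hN] := def_fin1 dX; exists N => t; have [s sN hs] := hN t.
exists s => // x bx; apply: contrapT => /negP xs.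
have [e e0 he] : exists2 e, 0 < e & forall z, z \in s -> e <= `|z - x|.
  elim: (s) xs => [|a s' ih]; first by exists 1.
  rewrite inE negb_or => /andP[xa /ih [e e0 he]].
  exists (Num.min e `|a - x|); first by rewrite lt_min e0 normr_gt0 subr_eq0 eq_sym.
  by move=> z; rewrite inE => /predU1P[->|/he]; rewrite ge_min ?lexx ?orbT // => ->.
have [y [z [hy hz Xy nXz]]] := bx e e0; apply: nXz.
apply: (hs (x - e) (x + e) _ y) => //.
- move=> w ws; apply/negP => hw; have := he w ws; apply/negP.
  by rewrite -ltNge ltr_norml; lra.
- by move: hy; rewrite ltr_norml; lra.
- by move: hz; rewrite ltr_norml; lra.
Qed.

Definition dchoice U := forall T (X : T -> U -> Prop), def (fun p => X p.1 p.2) ->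
  exists2 c : T -> U, defm c & forall t u, X t u -> X t (c t).

(** Boundary points cut the line into intervals on which membership is constant. The candidates of
    [spec] meet all the pieces: boundary points ([p = q]), midpoints for bounded intervals, [p + 1]
    and [p - 1] for half-lines, 0 for the whole line. They are finitely many, and the least one in
    [X t] is chosen. *)
Lemma dchoice_real : dchoice real_dtype.
Proof.
move=> T X dX; have [N hN] := bdpt_fin dX.
pose spec t (y : R) := y = 0 \/ exists p q, [/\ bdpt (X t) p, bdpt (X t) q &
  [\/ y = (p + q) / 2, y = p + 1 | y = p - 1]].
pose M t (y : R) := (X t y /\ spec t y) /\ forall z, X t z -> spec t z -> y <= z.
have dB : def (fun p : T * R => bdpt (X p.1) p.2).
  apply: (@def_ext _ _ (fun p : T * R => forall e : R, 0 < e -> exists y z : R,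
    (`|y - p.2| < e) /\ (`|z - p.2| < e) /\ X p.1 y /\ ~ X p.1 z)); last by ddef.
  move=> [t x]; split=> h e /h [y [z]]; first by move=> [? [? [? ?]]]; exists y, z; split.
  by move=> [? ? ? ?]; exists y, z.
have dS : def (fun p : T * R => spec p.1 p.2).
  apply: (@def_ext _ _ (fun p : T * R => p.2 = 0 \/ exists a b : R, bdpt (X p.1) a /\ bdpt (X p.1) b /\
    (p.2 = (a + b) / 2 \/ p.2 = a + 1 \/ p.2 = a - 1))).
    move=> [t y]; rewrite /spec /=; split=> -[->|[a [b]]]; first by left.
    - by move=> [h1 [h2 h3]]; right; exists a, b; split=> //; rewrite or3E.
    - by left.
    - by case=> h1 h2; rewrite or3E => h3; right; exists a, b.
  have dB' := dB.
  have h (f : T * R * R * R -> R) : defm f -> def (fun p => bdpt (X p.1.1.1) (f p)).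
    move=> df; apply: (def_comp2 (P := fun t => bdpt (X t)) dB) => //; ddef.
  apply: def_or; first by ddef.
  apply: def_ex; apply: def_ex; apply: def_and; first by apply: h; ddef.
  by apply: def_and; [apply: h; ddef|ddef].
have dM : def (fun p => M p.1 p.2).
  have h (V : dtype R) (f : V -> R) (g : V -> T) : defm f -> defm g -> def (fun p => spec (g p) (f p)).
    by move=> df dg; apply: (def_comp2 (P := spec) dS).
  rewrite /M; apply: def_and; last apply: def_all; last apply: def_imp; last apply: def_imp.
  - by apply: def_and; [ddef|exact: dS].
  - by ddef.
  - by apply: h; ddef.
  - by ddef.
have uM t u v : M t u -> M t v -> u = v.
  by move=> [[Xu su] hu] [[Xv sv] hv]; apply/eqP; rewrite eq_le hu // hv.
exists (fun t => pickd 0 (M t)); first exact: (@defm_pickd T real_dtype).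
move=> t x Xx; suff [y Yy] : exists y, M t y by case: pickdP => [z [[]]//|/(_ y)].
have [s _ hs] := hN t.
have [y Xy Sy] : exists2 y, X t y & spec t y.
  have [Bx|nBx] := pselect (bdpt (X t) x).
    by exists x => //; right; exists x, x; split=> //; apply: Or31; rewrite -mulr2n -(mulr_natr x) mulfK.
  have lo := @finite_max (fun z => bdpt (X t) z /\ z < x) s.
  have hi := @finite_min (fun z => bdpt (X t) z /\ x < z) s.
  have [[p Bp px]|nlo] := pselect (exists2 p, bdpt (X t) p & p < x); last first.
    have [[q Bq xq]|nhi] := pselect (exists2 q, bdpt (X t) q & x < q); last first.
      exists 0; last by left.
      apply: (@bdpt_between (X t) x 0 (- `|x| - 1) (`|x| + 1)) => //.
      - by have := normr_ge0 x; have := ler_norm x; have := ler_norm (- x); rewrite normrN; lra.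
      - by have := normr_ge0 x; lra.
      move=> c _ Bc; have [cx|xc|cx] := ltgtP c x.
      + by apply: nlo; exists c.
      + by apply: nhi; exists c.
      + by apply: nBx; rewrite -cx.
    case: hi => [|{Bq xq}q [qs [Bq xq] hq]]; first by exists q => //; exact: hs.
    exists (q - 1); last by right; exists q, q; split=> //; exact: Or33.
    have m1 : Num.min x (q - 1) <= x by rewrite ge_min lexx.
    have m2 : Num.min x (q - 1) <= q - 1 by rewrite ge_min lexx orbT.
    apply: (@bdpt_between (X t) x _ (Num.min x (q - 1) - 1) q) => //; try by lra.
    move=> c /andP[_ cq] Bc; have [cx|xc|cx] := ltgtP c x.
    + by apply: nlo; exists c.
    + by have := hq c (hs _ Bc) (conj Bc xc); rewrite leNgt cq.
    + by apply: nBx; rewrite -cx.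
  case: lo => [|{Bp px}p [ps [Bp px] hp]]; first by exists p => //; exact: hs.
  have [[q Bq xq]|nhi] := pselect (exists2 q, bdpt (X t) q & x < q); last first.
    exists (p + 1); last by right; exists p, p; split=> //; exact: Or32.
    have m1 : x <= Num.max x (p + 1) by rewrite le_max lexx.
    have m2 : p + 1 <= Num.max x (p + 1) by rewrite le_max lexx orbT.
    apply: (@bdpt_between (X t) x _ p (Num.max x (p + 1) + 1)) => //; try by lra.
    move=> c /andP[pc _] Bc; have [cx|xc|cx] := ltgtP c x.
    + by have := hp c (hs _ Bc) (conj Bc cx); rewrite leNgt pc.
    + by apply: nhi; exists c.
    + by apply: nBx; rewrite -cx.
  case: hi => [|{Bq xq}q [qs [Bq xq] hq]]; first by exists q => //; exact: hs.
  exists ((p + q) / 2); last by right; exists p, q; split=> //; exact: Or31.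
  apply: (@bdpt_between (X t) x _ p q) => //; first by rewrite px.
    by have := lt_trans px xq; lra.
  move=> c /andP[pc cq] Bc; have [cx|xc|cx] := ltgtP c x.
  + by have := hp c (hs _ Bc) (conj Bc cx); rewrite leNgt pc.
  + by have := hq c (hs _ Bc) (conj Bc xc); rewrite leNgt cq.
  + by apply: nBx; rewrite -cx.
pose l := 0 :: [seq (p + q) / 2 | p <- s, q <- s] ++ [seq p + 1 | p <- s] ++ [seq p - 1 | p <- s].
have hl z : spec t z -> z \in l.
  rewrite inE !mem_cat => -[->|[p [q [/hs ps /hs qs]]]]; first by rewrite eqxx.
  case=> ->; apply/orP; right; apply/orP.
  - by left; apply/allpairsP; exists (p, q).
  - by right; apply/orP; left; exact: map_f.
  - by right; apply/orP; right; exact: (map_f (fun p => p - 1)).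
have [|m [_ [Xm Sm] hm]] := @finite_min (fun z => X t z /\ spec t z) l.
  by exists y; rewrite ?hl.
by exists m; split=> // z Xz Sz; apply: hm; rewrite ?hl.
Qed.

Lemma dchoice_prod U V : dchoice U -> dchoice V -> dchoice (prod_dtype U V).
Proof.
move=> cU cV T X dX; have [c1 d1 h1] := cU T (fun t u => exists v, X t (u, v)) ltac:(by ddef).
have [c2 d2 h2] := cV T (fun t v => X t (c1 t, v)) ltac:(by ddef).
exists (fun t => (c1 t, c2 t)); first by ddef.
by move=> t [u v] Xuv; have [|v' Xv'] := h1 t u; [exists v|exact: h2 Xv'].
Qed.

Lemma dchoice_trans U V : ddim U = ddim V -> dchoice U -> dchoice V.
Proof.
move=> dUV cU T X dX; have dt := defm_dtrans dUV.
have [c dc hc] := cU T (fun t u => X t (dtrans V u)) ltac:(by ddef).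
exists (fun t => dtrans V (c t)); first by ddef.
by move=> t v Xv; apply: (hc t (dtrans U v)); rewrite dtransK.
Qed.

Lemma dchoiceT U : dchoice U.
Proof.
suff h n : dchoice (row_dtype n) by apply: dchoice_trans (h (ddim U)).
elim: n => [|n ih].
  move=> T X dX; exists (fun=> 0); first by ddef.
  by move=> t u; rewrite [u]thinmx0.
exact: (dchoice_trans (U := prod_dtype real_dtype (row_dtype n))) (dchoice_prod dchoice_real ih).
Qed.

Definition fbound U (N : nat) (Y : U -> Prop) :=
  exists e : nat -> U, forall y, Y y -> exists2 i, (i < N)%N & e i = y.

(** One definably chosen element is removed at a time; each removal frees one index of the
    enumeration. *)
Lemma def_enum T U N (Y : T -> U -> Prop) : def (fun p => Y p.1 p.2) ->
  (forall t, fbound N (Y t)) ->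
  exists2 c : nat -> T -> U, forall i, defm (c i) &
    forall t y, Y t y -> exists2 i, (i < N)%N & c i t = y.
Proof.
elim: N Y => [|N ih] Y dY bY.
  exists (fun _ _ => ddec U (nseq (ddim U) 0)) => [i|t y]; first by ddef.
  by have [e he] := bY t => /he [].
have [c dc hc] := dchoiceT dY.
have [||d dd hd] := ih (fun t y => Y t y /\ y <> c t); first by ddef.
  move=> t; have [e he] := bY t.
  have [[y0 /hc /he [i0 li0 e0]]|nY] := pselect (exists y, Y t y); last first.
    by exists e => y [Yy]; case: nY; exists y.
  (* The index [i0] of the removed element [c t] is skipped. *)
  exists (fun i => e (bump i0 i)) => y [/he [i li <-] nyc].
  have ii0 : i != i0 by apply: contra_notN nyc => /eqP ->.
  exists (unbump i0 i); last by rewrite unbumpK.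
  by move: ii0 li li0; rewrite /unbump; case: ltngtP => //=; lia.
exists (fun i => if i is i'.+1 then d i' else c) => [[|i]|t y Yy] //.
have [->|nyc] := pselect (y = c t); first by exists 0%N.
by have [|i li e] := hd t y; [split|exists i.+1].
Qed.

End Choice.

(** * Boxes and the definable Baire property *)

HB.instance Definition _ (R : realType) (m n : nat) :=
  Complete.copy 'M[R]_(m, n) 'M[R]_(m, n).

Section Boxes.
Context {R : realType}.

(** Balls of the supremum norm in first-order form. For [n = 0] a box is the whole space, even when
    [e] is not positive. *)
Definition box n (x : 'rV[R]_n) (e : R) : set 'rV[R]_n :=
  [set y | forall i, `|y 0 i - x 0 i| < e].

Lemma boxE n (x : 'rV[R]_n) e : 0 < e -> box x e = ball x e.
Proof.
move=> e0; apply/seteqP; split=> y.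
  by move=> h; split=> // i j; rewrite ord1 /ball /= distrC; exact: h.
by move=> [_ h] i; have := h 0 i; rewrite /ball /= distrC.
Qed.

Lemma box_center n (x : 'rV[R]_n) e : 0 < e -> box x e x.
Proof. by move=> e0 i; rewrite subrr normr0. Qed.

Lemma nbhs_box n (x : 'rV[R]_n) e : 0 < e -> nbhs x (box x e).
Proof. by move=> e0; rewrite boxE //; exact: nbhsx_ballx. Qed.

Lemma nbhs_boxP n (x : 'rV[R]_n) (A : set 'rV[R]_n) :
  nbhs x A <-> exists2 e, 0 < e & box x e `<=` A.
Proof.
rewrite nbhs_ballP; split=> -[e e0 he]; exists e => //; first by rewrite boxE.
by rewrite -boxE.
Qed.

Lemma open_boxP n (A : set 'rV[R]_n) :
  open A <-> forall x, A x -> exists2 e, 0 < e & box x e `<=` A.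
Proof. by rewrite openE; split=> h x /h /nbhs_boxP. Qed.

Lemma box_tri n (x y z : 'rV[R]_n) e e' : box x e y -> box y e' z -> box x (e + e') z.
Proof.
move=> h1 h2 i; rewrite -(subrK (y 0 i) (z 0 i)) -addrA addrC.
by rewrite (le_lt_trans (ler_normD _ _)) // ltrD.
Qed.

Lemma open_box n (x : 'rV[R]_n) e : open (box x e).
Proof.
case: (ltP 0 e) => [e0|e0]; first by rewrite boxE //; exact: ball_open.
case: n x => [|n] x.
  have -> : box x e = setT by apply/seteqP; split=> // y _ [].
  exact: openT.
suff -> : box x e = set0 by exact: open0.
apply/seteqP; split=> // y /(_ ord0) h.
by have := le_lt_trans (normr_ge0 _) (lt_le_trans h e0); rewrite ltxx.
Qed.

Definition cons n (s : R) (y : 'rV[R]_n) : 'rV[R]_n.+1 :=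
  \row_i (if unlift ord0 i is Some j then y 0 j else s).
Definition hd n (x : 'rV[R]_n.+1) : R := x 0 ord0.
Definition tl n (x : 'rV[R]_n.+1) : 'rV[R]_n := \row_j x 0 (lift ord0 j).

Lemma hd_cons n s (y : 'rV[R]_n) : hd (cons s y) = s.
Proof. by rewrite /hd mxE unlift_none. Qed.

Lemma tl_cons n s (y : 'rV[R]_n) : tl (cons s y) = y.
Proof. by apply/rowP => j; rewrite !mxE liftK. Qed.

Lemma cons_hd_tl n (x : 'rV[R]_n.+1) : cons (hd x) (tl x) = x.
Proof. by apply/rowP => i; rewrite mxE; case: unliftP => [j|] ->; rewrite ?mxE. Qed.

Lemma cons0 n s (y : 'rV[R]_n) : cons s y 0 ord0 = s. Proof. exact: hd_cons. Qed.

Lemma consS n s (y : 'rV[R]_n) j : cons s y 0 (lift ord0 j) = y 0 j.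
Proof. by rewrite mxE liftK. Qed.

Lemma tlE n (x : 'rV[R]_n.+1) j : tl x 0 j = x 0 (lift ord0 j).
Proof. by rewrite mxE. Qed.

Lemma forall_ordS n (P : 'I_n.+1 -> Prop) :
  (forall i, P i) <-> P ord0 /\ forall j, P (lift ord0 j).
Proof. by split=> [h|[h0 h] i]; [split|case: (unliftP ord0 i) => [j|] ->]. Qed.

Lemma box_cons n (s s' : R) (y y' : 'rV[R]_n) e :
  box (cons s y) e (cons s' y') <-> `|s' - s| < e /\ box y e y'.
Proof.
rewrite /box /= forall_ordS !cons0.
by split=> -[h1 h2]; split=> // j; have := h2 j; rewrite !consS.
Qed.

Lemma box_hd_tl n (x x' : 'rV[R]_n.+1) e :
  box x e x' <-> `|hd x' - hd x| < e /\ box (tl x) e (tl x').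
Proof. by rewrite -{1}(cons_hd_tl x) -{1}(cons_hd_tl x') box_cons. Qed.

Lemma open_cylinder n (a b : R) (O : set 'rV[R]_n) : open O ->
  open [set x : 'rV[R]_n.+1 | a < hd x < b /\ O (tl x)].
Proof.
move=> /open_boxP oO; apply/open_boxP => x [/andP[ax xb] /oO [e e0 he]].
exists (Num.min e (Num.min (hd x - a) (b - hd x))); first by rewrite !lt_min e0 !subr_gt0 ax.
move=> y /box_hd_tl [h1 h2]; split.
  by move: h1; rewrite !lt_min ltr_norml ltr_norml ltr_norml => /and3P[_ ? ?]; lra.
by apply: he => i; have := h2 i; rewrite !lt_min => /and3P[].
Qed.

Lemma avoid_fin (s : seq R) a b : a < b ->
  exists a' b', [/\ a <= a', a' < b', b' <= b & forall x, x \in s -> ~~ (a' < x < b')].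
Proof.
move=> ab; elim: s => [|x s [a' [b' [h1 h2 h3 h4]]]]; first by exists a, b; split.
have [/andP[ax xb]|nx] := boolP (a' < x < b').
  exists a', x; split=> //; first by rewrite (le_trans (ltW xb)).
  move=> y; rewrite inE => /predU1P[->|/h4]; first by rewrite ltxx andbF.
  by apply: contra => /andP[-> /lt_trans]; apply.
exists a', b'; split=> // y; rewrite inE => /predU1P[->//|]; exact: h4.
Qed.

End Boxes.

Section Defcons.
Context {R : realType}.
Implicit Types (T : dtype R).

Lemma defm_cons T n (f : T -> R) (g : T -> 'rV[R]_n) :
  defm f -> defm g -> defm (fun t => cons (f t) (g t)).
Proof.
move=> df dg; apply: defm_row => i.
by case: (unlift ord0 i) => [j|] //; exact: defm_coord.
Qed.

Lemma defm_hd T n (f : T -> 'rV[R]_n.+1) : defm f -> defm (fun t => hd (f t)).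
Proof. by move=> df; exact: defm_coord. Qed.

Lemma defm_tl T n (f : T -> 'rV[R]_n.+1) : defm f -> defm (fun t => tl (f t)).
Proof. by move=> df; apply: defm_row => i; exact: defm_coord. Qed.

End Defcons.

Ltac ddef_step2 :=
  first [ ddef_step
  | lazymatch goal with
    | |- defm (fun t => cons _ _) => apply: defm_cons
    | |- defm (fun t => hd _) => apply: defm_hd
    | |- defm (fun t => tl _) => apply: defm_tl
    end ].
Ltac ddef ::= repeat ddef_step2.

Section DefBaire.
Context {R : realType}.

(** Equivalently, the boundary of a definable set has no interior. The induction alternates: the
    dichotomy in [n] variables gives the Baire property in [n] variables, which gives the dichotomy
    in [n.+1]. *)
Definition dichotomy n := forall A : set 'rV[R]_n, def A ->
  forall O, open O -> O !=set0 -> exists Q', [/\ open Q', Q' !=set0, Q' `<=` O &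
    Q' `<=` A \/ Q' `<=` ~` A].

(** By the dichotomy, a definable set without interior in [O] is nowhere dense there. If all the
    [E i] were so, the complements of the closures would be open and dense, and Baire's theorem
    would give a point of [O] in none of them. *)
Lemma dbaire0 n (I : countType) (E : I -> set 'rV[R]_n) (O : set 'rV[R]_n) : dichotomy n ->
  (forall i, def (E i)) -> open O -> O !=set0 -> O `<=` \bigcup_i E i ->
  exists i Q', [/\ open Q', Q' !=set0, Q' `<=` O & Q' `<=` E i].
Proof.
move=> dich dE oO O0 OE; apply: contrapT => nE.
pose F m : set 'rV[R]_n := if (unpickle m : option I) is Some i then ~` closure (E i `&` O) else setT.
have dF m : open (F m) /\ dense (F m).
  rewrite /F; case: (unpickle m : option I) => [i|]; last first.
    by split; [exact: openT|move=> W W0 _; rewrite setIT].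
  split; first exact/closed_openC/closed_closure.
  move=> W W0 oW; have [[x [Wx Ox]]|WO] := pselect (W `&` O !=set0).
    have [Q' [oQ' Q'0 Q'W [Q'E|Q'nE]]] := dich _ (dE i) (W `&` O) (openI oW oO) (ex_intro _ x (conj Wx Ox)).
      by case: nE; exists i, Q'; split=> // z /Q'W[].
    have [z Q'z] := Q'0; exists z; split; first by have [] := Q'W _ Q'z.
    move=> /(_ Q'); case; first by apply: open_nbhs_nbhs.
    by move=> w [[Ew _] /Q'nE].
  have [z Wz] := W0; exists z; split=> // /(_ W); case; first exact: open_nbhs_nbhs.
  by move=> w [[_ Ow] Ww]; apply: WO; exists w.
have [x [Ox Fx]] := Baire dF O0 oO.
have [i _ Eix] := OE x Ox.
have := Fx (pickle i) Logic.I; rewrite /F pickleK; apply.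
by apply: subset_closure.
Qed.

(** The code [i] gives a rational interval and tells whether the fibre over [y] contains it or
    misses it. Rational end points leave countably many codes, which Baire's theorem can
    separate. *)
Definition fibE n (A : set 'rV[R]_n.+1) (y : 'rV[R]_n) (i : rat * rat * bool) : Prop :=
  (ratr i.1.1 < ratr i.1.2 :> R) /\
  forall s : R, ratr i.1.1 < s < ratr i.1.2 -> if i.2 then A (cons s y) else ~ A (cons s y).

Lemma def_fibE n (A : set 'rV[R]_n.+1) i : def A -> def (fun y => fibE A y i).
Proof.
move=> dA; rewrite /fibE; apply: def_and; first by ddef.
by case: i.2; ddef.
Qed.

(** Over each [y], uniform finiteness gives an interval on which membership is constant, and it can
    be shrunk to rational end points. By Baire's theorem in [n] variables one code holds over an
    open set of [y]; its product with the interval is the open set sought. *)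
Lemma dichotomyT n : dichotomy n.
Proof.
elim: n => [|n ih] A dA O oO [x0 Ox0].
  exists O; split=> //; first by exists x0.
  have [Ax|nAx] := pselect (A x0); [left|right] => y _.
    by rewrite [y]thinmx0 -[0](thinmx0 x0).
  by rewrite [y]thinmx0 -[0](thinmx0 x0).
have /open_boxP /(_ _ Ox0) [e e0 he] := oO.
pose a := hd x0 - e; pose b := hd x0 + e.
have [N hN] := @def_fin1 _ (row_dtype n) (fun y s => A (cons s y)) ltac:(by ddef).
pose E (i : rat * rat * bool) : set 'rV[R]_n := fun y =>
  (a < ratr i.1.1 /\ ratr i.1.2 < b) /\ fibE A y i.
have [||||i [Q' [oQ' [y Q'y] Q'O1 Q'E]]] := @dbaire0 n _ E (box (tl x0) e) ih.
- move=> i; apply: def_and; [by ddef|exact: def_fibE].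
- exact: open_box.
- by exists (tl x0); exact: box_center.
- move=> y yO1; have [s _ hs] := hN y.
  have ab : a < b by rewrite /a /b; lra.
  have [a' [b' [h1 h2 h3 h4]]] := avoid_fin s ab.
  have [q] := rat_in_itvoo h2; rewrite in_itv /= => /andP[a'q qb'].
  have [p] := rat_in_itvoo a'q; rewrite in_itv /= => /andP[a'p pq].
  have inp z : ratr p < z < ratr q -> a' < z < b'.
    by move=> /andP[pz zq]; rewrite (lt_trans a'p) //= (lt_trans zq).
  pose m : R := (ratr p + ratr q) / 2.
  have mpq : ratr p < m < ratr q by rewrite /m; lra.
  exists (p, q, `[< A (cons m y) >]) => //; split; first by split=> /=; lra.
  split=> //= z zpq; case: asboolP => Am.
    exact: (hs a' b' h4 _ _ (inp _ mpq) (inp _ zpq)).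
  by move=> Az; apply: Am; exact: (hs a' b' h4 _ _ (inp _ zpq) (inp _ mpq)).
have [[ap qb] [pq _]] := Q'E _ Q'y.
exists [set x | ratr i.1.1 < hd x < ratr i.1.2 /\ Q' (tl x)]; split.
- exact: open_cylinder.
- exists (cons ((ratr i.1.1 + ratr i.1.2) / 2) y); rewrite /= hd_cons tl_cons; split=> //; lra.
- move=> x [hx /Q'O1 hy]; apply: he; apply/box_hd_tl; split=> //.
  by move: hx; rewrite ltr_norml /a /b in ap qb *; lra.
- have hE z s : Q' z -> ratr i.1.1 < s < ratr i.1.2 -> if i.2 then A (cons s z) else ~ A (cons s z).
    by move=> /Q'E[_ [_]]; apply.
  by case: i.2 hE => hE; [left|right] => x [hx hy]; rewrite -(cons_hd_tl x); exact: hE.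
Qed.

Lemma dbaire n (I : countType) (E : I -> set 'rV[R]_n) (O : set 'rV[R]_n) :
  (forall i, def (E i)) -> open O -> O !=set0 -> O `<=` \bigcup_i E i ->
  exists i Q', [/\ open Q', Q' !=set0, Q' `<=` O & Q' `<=` E i].
Proof. exact/dbaire0/dichotomyT. Qed.

(** The intervals may vary wildly with [y]; rational end points and Baire's theorem make one of them
    work over an open set. *)
Lemma open_fibers n (A : set 'rV[R]_n.+1) (O : set 'rV[R]_n) : def A -> open O -> O !=set0 ->
  (forall y, O y -> exists a b, a < b /\ forall s, a < s < b -> A (cons s y)) ->
  exists Q', [/\ open Q', Q' !=set0 & Q' `<=` A].
Proof.
move=> dA oO O0 hO.
have [||i [Q' [oQ' [y Q'y] Q'O1 Q'E]]] := @dbaire n _ (fun (i : rat * rat * bool) y => i.2 = true /\ fibE A y i) O _ oO O0.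
- by move=> i; apply: def_and; [ddef|exact: def_fibE].
- move=> y /hO [a [b [ab h]]].
  have [q] := rat_in_itvoo ab; rewrite in_itv /= => /andP[aq qb].
  have [p] := rat_in_itvoo aq; rewrite in_itv /= => /andP[ap pq].
  exists (p, q, true) => //; split=> //; split=> //= s /andP[ps sq]; apply: h.
  by rewrite (lt_trans ap) //= (lt_trans sq).
have [i2 [pq _]] := Q'E _ Q'y.
exists [set x | ratr i.1.1 < hd x < ratr i.1.2 /\ Q' (tl x)]; split.
- exact: open_cylinder.
- exists (cons ((ratr i.1.1 + ratr i.1.2) / 2) y); rewrite /= hd_cons tl_cons; split=> //; lra.
- by move=> x [hx /Q'E[_ [_]]]; rewrite i2 -{2}(cons_hd_tl x); exact.
Qed.

(* For definable sets, having no interior point is the same as being nowhere dense. *)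
Definition thin n (A : set 'rV[R]_n) := forall O, open O -> O `<=` A -> O = set0.

Lemma thinP n (A : set 'rV[R]_n) O : def A -> thin A -> open O -> O !=set0 ->
  exists Q', [/\ open Q', Q' !=set0, Q' `<=` O & Q' `<=` ~` A].
Proof.
move=> dA tA oO O0; have [Q' [oQ' Q'0 Q'O [/tA h|?]]] := dichotomyT dA oO O0; last by exists Q'.
by move: Q'0; rewrite h // => -[].
Qed.

Lemma thin_sub n (A B : set 'rV[R]_n) : A `<=` B -> thin B -> thin A.
Proof. by move=> AB tB O oO OA; apply: tB => //; exact: subset_trans AB. Qed.

Lemma thinU n (A B : set 'rV[R]_n) : def A -> thin A -> thin B -> thin (A `|` B).
Proof.
move=> dA tA tB O oO OAB; apply: contrapT => /eqP/set0P O0.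
have [Q' [oQ' [x Q'x] Q'O Q'A]] := thinP dA tA oO O0.
have /tB h : Q' `<=` B by move=> z Q'z; have [/(Q'A _ Q'z)|] := OAB z (Q'O _ Q'z).
by move: Q'x; rewrite h.
Qed.

Lemma thin_fin n (I : finType) (A : I -> set 'rV[R]_n) : (forall i, def (A i)) ->
  (forall i, thin (A i)) -> thin [set x | exists i, A i x].
Proof.
move=> dA tA; suff h (s : seq I) : thin [set x | exists2 i, i \in s & A i x].
  by apply: thin_sub (h (enum I)) => x [i Ai]; exists i => //; rewrite mem_enum.
elim: s => [|i s ih].
  by move=> O oO h; apply/seteqP; split=> // x /h[].
apply: thin_sub (thinU (dA i) (tA i) ih) => x [j]; rewrite inE => /predU1P[->|js] Aj.
  by left.
by right; exists j.
Qed.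

End DefBaire.

(** * Generic smoothness *)

Section DefDeriv.
Context {R : realType}.
Implicit Types (T : dtype R).

Lemma defm_addv T n (f g : T -> 'rV[R]_n) : defm f -> defm g -> defm (fun t => f t + g t).
Proof.
move=> df dg; apply: (@def_ext _ _ (fun p : T * 'rV[R]_n => \row_i (f p.1 0 i + g p.1 0 i) = p.2)).
  by move=> p; rewrite (_ : \row_i _ = f p.1 + g p.1) //; apply/rowP => i; rewrite !mxE.
by apply: (@defm_row _ T n (fun i t => f t 0 i + g t 0 i)) => i; ddef.
Qed.

Lemma defm_scalev T n (f : T -> R) (g : T -> 'rV[R]_n) :
  defm f -> defm g -> defm (fun t => f t *: g t).
Proof.
move=> df dg; apply: (@def_ext _ _ (fun p : T * 'rV[R]_n => \row_i (f p.1 * g p.1 0 i) = p.2)).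
  by move=> p; rewrite (_ : \row_i _ = f p.1 *: g p.1) //; apply/rowP => i; rewrite !mxE.
by apply: (@defm_row _ T n (fun i t => f t * g t 0 i)) => i; ddef.
Qed.

End DefDeriv.

Ltac ddef_step3 :=
  first [ ddef_step2
  | lazymatch goal with
    | |- defm (fun t => _ + _) => apply: defm_addv
    | |- defm (fun t => _ *: _) => apply: defm_scalev
    end ].
Ltac ddef ::= repeat ddef_step3.

Section DefDeriv2.
Context {R : realType}.
Implicit Types (T : dtype R).

Definition dlim (V : normedModType R) (f : V -> R) (x v : V) (l : R) :=
  forall e, 0 < e -> exists d, 0 < d /\ forall h, h <> 0 -> `|h| < d ->
    `|h^-1 * (f (h *: v + x) - f x) - l| < e.

Lemma dlimE (V : normedModType R) (f : V -> R) x v l :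
  dlim f x v l <-> (h^-1 *: ((f \o shift x) (h *: v) - f x) @[h --> 0^'] --> l).
Proof.
split.
- move=> h; apply/cvgrPdist_lt => e e0; have [d [d0 hd]] := h e e0.
  near=> k; rewrite distrC; apply: hd; first by apply/eqP; near: k; exact: nbhs_dnbhs_neq.
  by near: k; apply: dnbhs0_lt.
- move=> /cvgrPdist_lt h e e0; have := h e e0.
  rewrite near_withinE => /nbhs_ballP[d /= d0 hd]; exists d; split=> // k /eqP k0 kd.
  by rewrite distrC; apply: hd => //; rewrite /ball /= sub0r normrN.
Unshelve. all: by end_near. Qed.

Lemma dlimP (V : normedModType R) (f : V -> R) x v l :
  dlim f x v l <-> derivable f x v /\ 'D_v f x = l.
Proof.
rewrite dlimE; split=> [h|[h <-]]; last exact: h.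
by split; [apply/cvg_ex; exists l|exact: cvg_lim].
Qed.

Lemma derivable_dlim (V : normedModType R) (f : V -> R) x v :
  derivable f x v <-> exists l, dlim f x v l.
Proof. by split=> [h|[l /dlimP[]//]]; exists ('D_v f x); apply/dlimP. Qed.

(** Where the limit does not exist, the derivative has the default value [point]. Covering this case
    makes [pd] definable everywhere, without any assumption of differentiability. *)
Lemma derive_dlim (V : normedModType R) (f : V -> R) x v l :
  'D_v f x = l <-> dlim f x v l \/ ~ (exists l, dlim f x v l) /\ l = point.
Proof.
split.
- move=> <-; have [h|h] := pselect (derivable f x v); first by left; apply/dlimP.
  right; split; first by rewrite -derivable_dlim.
  exact: dvgP.
- case=> [/dlimP[]//|[]]; rewrite -derivable_dlim => h ->; exact: dvgP.
Qed.

Lemma def_dlim T n (F : T -> 'rV[R]_n -> R) (v : 'rV[R]_n) : defm (fun p => F p.1 p.2) ->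
  def (fun p : (T * 'rV[R]_n) * R => dlim (F p.1.1) p.1.2 v p.2).
Proof.
by move=> dF; rewrite /dlim; ddef.
Qed.

Definition ee n (i : 'I_n) : 'rV[R]_n := delta_mx 0 i.
Definition pd n (i : 'I_n) (f : 'rV[R]_n -> R) : 'rV[R]_n -> R := fun x => 'D_(ee i) f x.
Definition cont n (f : 'rV[R]_n -> R) (x : 'rV[R]_n) : Prop := {for x, continuous f}.

Lemma contP n (f : 'rV[R]_n -> R) x : cont f x <->
  forall e, 0 < e -> exists d, 0 < d /\ forall y, box x d y -> `|f y - f x| < e.
Proof.
split.
- move=> /cvgrPdist_lt h e e0; have /nbhs_boxP[d d0 hd] := h e e0.
  by exists d; split=> // y /hd; rewrite /= distrC.
- move=> h; apply/(@cvgrPdist_lt _ _ _ (nbhs x) (nbhs_filter x)) => e e0; have [d [d0 hd]] := h e e0.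
  by apply/nbhs_boxP; exists d => // y /hd /=; rewrite distrC.
Qed.

Lemma def_cont T n (F : T -> 'rV[R]_n -> R) : defm (fun p => F p.1 p.2) ->
  def (fun p : T * 'rV[R]_n => cont (F p.1) p.2).
Proof.
move=> dF; apply: (@def_ext _ _ (fun p : T * 'rV[R]_n => forall e : R, 0 < e -> exists d : R,
    0 < d /\ forall y : 'rV[R]_n, (forall i, `|y 0 i - p.2 0 i| < d) ->
      `|F p.1 y - F p.1 p.2| < e)).
  by move=> p; rewrite contP.
by ddef.
Qed.

Lemma def_derivable T n (F : T -> 'rV[R]_n -> R) v : defm (fun p => F p.1 p.2) ->
  def (fun p : T * 'rV[R]_n => derivable (F p.1) p.2 v).
Proof.
move=> /def_dlim dF; apply: (@def_ext _ _ (fun p : T * 'rV[R]_n => exists l : R, dlim (F p.1) p.2 v l)).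
  by move=> p; rewrite derivable_dlim.
exact: (@def_ex R (prod_dtype T (row_dtype n)) real_dtype (fun q l => dlim (F q.1) q.2 v l) (dF v)).
Qed.

Lemma defm_pd T n (F : T -> 'rV[R]_n -> R) i : defm (fun p => F p.1 p.2) ->
  defm (fun p : T * 'rV[R]_n => pd i (F p.1) p.2).
Proof.
move=> /def_dlim dF; apply: (@def_ext _ _ (fun p : (T * 'rV[R]_n) * R =>
    dlim (F p.1.1) p.1.2 (ee i) p.2 \/ ~ (exists l : R, dlim (F p.1.1) p.1.2 (ee i) l) /\ p.2 = point)).
  by move=> p; rewrite /pd derive_dlim.
have h := dF (ee i); apply: def_or => //; apply: def_and; last by ddef.
apply: def_not.
apply: (@def_comp R (prod_dtype (prod_dtype T (row_dtype n)) real_dtype) (prod_dtype T (row_dtype n)) fst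
  (fun q => exists l : R, dlim (F q.1) q.2 (ee i) l)); first exact: defm_fst.
exact: (@def_ex R (prod_dtype T (row_dtype n)) real_dtype (fun q l => dlim (F q.1) q.2 (ee i) l) h).
Qed.

(** A condition at the single point [x], so that the set of points where it holds is definable. The
    rules of calculus are derived when it holds on an open set. *)
Fixpoint Cr n (r : nat) (f : 'rV[R]_n -> R) (x : 'rV[R]_n) : Prop :=
  cont f x /\ if r is s.+1 then forall i, derivable f x (ee i) /\ Cr s (pd i f) x else True.

Fixpoint bnd n (r : nat) (B : R) (f : 'rV[R]_n -> R) (x : 'rV[R]_n) : Prop :=
  `|f x| <= B /\ if r is s.+1 then forall i, bnd s B (pd i f) x else True.

Lemma def_Cr T n r (F : T -> 'rV[R]_n -> R) : defm (fun p => F p.1 p.2) ->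
  def (fun p : T * 'rV[R]_n => Cr r (F p.1) p.2).
Proof.
elim: r F => [|r ih] F dF /=; (apply: def_and; first exact: def_cont); first exact: def_const.
apply: def_finall => i; apply: def_and; first exact: def_derivable.
exact: (ih (fun t => pd i (F t)) (defm_pd i dF)).
Qed.

Lemma def_bnd T n r (B : R) (F : T -> 'rV[R]_n -> R) : defm (fun p => F p.1 p.2) ->
  def (fun p : T * 'rV[R]_n => bnd r B (F p.1) p.2).
Proof.
elim: r F => [|r ih] F dF /=; (apply: def_and; first by ddef); first exact: def_const.
apply: def_finall => i; exact: (ih (fun t => pd i (F t)) (defm_pd i dF)).
Qed.

End DefDeriv2.

(** * Generic continuity, and differentiability in one variable *)

Section OneVar.
Context {R : realType}.

Lemma ratr_between (a b : R) : a < b -> exists p : rat, a < ratr p < b.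
Proof. by move=> /rat_in_itvoo[p]; rewrite in_itv /=; exists p. Qed.

Lemma dbaire1 (I : countType) (E : I -> R -> Prop) a b : a < b ->
  (forall i, def (E i)) -> (forall x, a < x < b -> exists i, E i x) ->
  exists i a' b', [/\ a <= a', a' < b', b' <= b & forall x, a' < x < b' -> E i x].
Proof.
move=> ab dE hE.
pose O : set 'rV[R]_1 := [set x | a < hd x < b /\ setT (tl x)].
have [||||i [Q [oQ [q Qq] QO QE]]] := @dbaire R 1 I (fun i x => E i (hd x)) O.
- by move=> i; ddef.
- exact: open_cylinder openT.
- by exists (cons ((a + b) / 2) 0); split=> //; rewrite hd_cons; lra.
- by move=> x [/hE[i Ei] _]; exists i.
move/open_boxP : oQ => /(_ _ Qq)[e e0 he].
exists i, (hd q - e), (hd q + e).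
have hx (x : R) : `|x - hd q| < e -> E i x /\ a < x < b.
  move=> xe; have Qx : Q (cons x (tl q)).
    by apply: he; rewrite -{1}(cons_hd_tl q) box_cons; split=> //; exact: box_center.
  by have := QE _ Qx; have [] := QO _ Qx; rewrite hd_cons.
split; first (rewrite leNgt; apply/negP => h).
- pose m := Num.max (hd q - e) (a - 1); have [] := hx ((Num.min a (hd q) + (hd q - e)) / 2).
    have h1 : Num.min a (hd q) <= a by rewrite ge_min lexx.
    have h2 : Num.min a (hd q) <= hd q by rewrite ge_min lexx orbT.
    have h3 : hd q - e < Num.min a (hd q) by rewrite lt_min h; lra.
    by rewrite ltr_norml; lra.
  have h1 : Num.min a (hd q) <= a by rewrite ge_min lexx.
  by lra.
- by lra.
- rewrite leNgt; apply/negP => h.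
  have h1 : b <= Num.max b (hd q) by rewrite le_max lexx.
  have h2 : hd q <= Num.max b (hd q) by rewrite le_max lexx orbT.
  have h3 : Num.max b (hd q) < hd q + e by rewrite gt_max h; lra.
  have [] := hx ((Num.max b (hd q) + (hd q + e)) / 2); last by lra.
  by rewrite ltr_norml; lra.
- by move=> x hxe; have [] // := hx x; rewrite ltr_norml; lra.
Qed.

Definition cont1 (f : R -> R) (x : R) := forall e, 0 < e -> exists d, 0 < d /\
  forall y, `|y - x| < d -> `|f y - f x| < e.

(** At a discontinuity, some rational interval contains [F x] but not the image of any
    neighbourhood. If all points of [O] were discontinuities, by Baire's theorem one interval would
    serve on an open set, which it would then contain the image of. *)
Lemma def_cont_pt n (F : 'rV[R]_n -> R) O : defm F -> open O -> O !=set0 ->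
  exists2 x, O x & cont F x.
Proof.
move=> dF oO O0; apply: contrapT => nc.
pose E (i : rat * rat) (x : 'rV[R]_n) := ratr i.1 < F x < ratr i.2 /\
  ~ exists d : R, 0 < d /\ forall y : 'rV[R]_n, (forall k, `|y 0 k - x 0 k| < d) -> ratr i.1 < F y < ratr i.2.
have [||i [Q [oQ [q Qq] QO QE]]] := @dbaire R n _ E O _ oO O0.
- by move=> i; rewrite /E; ddef.
- move=> x Ox; apply: contrapT => h; apply: nc; exists x => //; apply/contP => e e0.
  have [|p /andP[p1 p2]] := @ratr_between (F x - e) (F x); first by lra.
  have [|p' /andP[p3 p4]] := @ratr_between (F x) (F x + e); first by lra.
  apply: contrapT => h2; apply: h; exists (p, p') => //; split=> /=; first by rewrite p2.
  case=> d [d0 hd]; apply: h2; exists d; split=> // y /hd.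
  by rewrite ltr_norml; lra.
have [_] := QE _ Qq; apply; move/open_boxP: oQ => /(_ _ Qq)[d d0 hd]; exists d; split=> // y yq.
by have [] := QE y (hd _ yq).
Qed.

Lemma def_cont_thin n (F : 'rV[R]_n -> R) : defm F -> thin [set x | ~ cont F x].
Proof.
move=> dF O oO h; apply: contrapT => /eqP/set0P O0.
by have [x Ox] := def_cont_pt dF oO O0; exact: h.
Qed.

Lemma def_cont1 (f : R -> R) a b : defm f -> a < b ->
  exists a' b', [/\ a <= a', a' < b', b' <= b & forall x, a' < x < b' -> cont1 f x].
Proof.
move=> df ab; have dC : def (cont1 f) by rewrite /cont1; ddef.
have [i|x hx|i [a' [b' [h1 h2 h3]]]] := @dbaire1 bool (fun i x => if i then cont1 f x else ~ cont1 f x) a b ab.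
- by case: i; ddef.
- by have [h|h] := pselect (cont1 f x); [exists true|exists false].
case: i => h; first by exists a', b'.
pose O : set 'rV[R]_1 := [set x | a' < hd x < b' /\ setT (tl x)].
have [|||x [hx _] cx] := @def_cont_pt 1 (fun x => f (hd x)) O; first by ddef.
- exact: open_cylinder openT.
- by exists (cons ((a' + b') / 2) 0); split=> //; rewrite hd_cons; lra.
case: (h _ hx) => e e0; move/contP : cx => /(_ e e0) [d [d0 hd]]; exists d; split=> // y yd.
have := hd (cons y (tl x)); rewrite hd_cons; apply.
by rewrite -{1}(cons_hd_tl x) box_cons; split=> //; exact: box_center.
Qed.

(** Mean value inequality from right-hand slopes only: the supremum of the points where it holds
    satisfies it by continuity, and could be pushed further if it were less than [b]. *)
Lemma dini (f : R -> R) (K a b : R) : a <= b -> (forall x, a <= x <= b -> cont1 f x) ->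
  (forall x, a <= x < b -> exists2 d, 0 < d & forall h, 0 < h < d -> K * h <= f (x + h) - f x) ->
  K * (b - a) <= f b - f a.
Proof.
move=> ab cf hf; pose S := [set x | a <= x <= b /\ K * (x - a) <= f x - f a].
have Sa : S a by split; rewrite ?lexx // !subrr mulr0.
have hS : has_sup S by split; [exists a|exists b => x [/andP[]]].
have ub : ubound S (sup S) by exact: ub_le_sup hS.2.
have ac : a <= sup S by exact: ub.
have cb : sup S <= b by apply: ge_sup; [exists a|move=> z [/andP[]]].
set c := sup S in ub ac cb.
have Sc : K * (c - a) <= f c - f a.
  rewrite leNgt; apply/negP => h.
  pose e := (K * (c - a) - (f c - f a)) / 2; have e0 : 0 < e by rewrite /e; lra.
  have [d [d0 hd]] := cf c (introT andP (conj ac cb)) e e0.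
  pose d' := Num.min d (e / (`|K| + 1)); have K1 : 0 < `|K| + 1 by have := normr_ge0 K; lra.
  have d'0 : 0 < d' by rewrite lt_min d0 divr_gt0.
  have [x Sx xc] := sup_adherent d'0 hS; have xS := ub _ Sx; rewrite -/c in xS xc.
  case: Sx => /andP[ax xb] Kx.
  have xd : `|x - c| < d.
    rewrite ler0_norm ?subr_le0 // opprB; have : d' <= d by rewrite ge_min lexx.
    by rewrite -/c in xc; lra.
  have := hd x xd; rewrite ltr_norml => /andP[_ h2].
  have h3 : K * (c - x) <= e.
    have m2 : d' <= e / (`|K| + 1) by rewrite ge_min lexx orbT.
    have h4 : c - x <= e / (`|K| + 1) by lra.
    have := ler_norm K; have := normr_ge0 K; move: h4; rewrite ler_pdivlMr // => h4 h5 h6.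
    have : K * (c - x) <= `|K| * (c - x) by rewrite ler_wpM2r // subr_ge0.
    have h7 : 0 <= c - x by rewrite subr_ge0.
    by nra.
  have : K * (c - a) = K * (c - x) + K * (x - a) by ring.
  by rewrite /e in h2 h3 *; lra.
have [cltb|bc] := ltP c b; last by have -> : b = c by apply/eqP; rewrite eq_le cb bc.
have [d d0 hd] := hf c (introT andP (conj ac cltb)).
pose h := Num.min d (b - c) / 2.
have m0 : 0 < Num.min d (b - c) by rewrite lt_min d0 subr_gt0.
have m1 : Num.min d (b - c) <= d by rewrite ge_min lexx.
have m2 : Num.min d (b - c) <= b - c by rewrite ge_min lexx orbT.
have := hd h; rewrite /h => /(_ _) hh.
have {}hh : K * h <= f (c + h) - f c by apply: hd; rewrite /h; lra.
have : c + h <= c.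
  apply: ub; split; first by rewrite /h; lra.
  have -> : K * (c + h - a) = K * h + K * (c - a) by ring.
  by lra.
by rewrite /h; lra.
Qed.

(** For each [c], uniform finiteness makes the truth of [f h < c] constant for small positive [h].
    The limit is the infimum of the eventual upper bounds; the infinite cases are those where there
    is none, or where they are unbounded below. *)
Lemma def_rlim (f : R -> R) : defm f ->
  [\/ exists l, forall e, 0 < e -> exists2 d, 0 < d & forall h, 0 < h < d -> `|f h - l| < e,
      forall K, exists2 d, 0 < d & forall h, 0 < h < d -> K < f h |
      forall K, exists2 d, 0 < d & forall h, 0 < h < d -> f h < K ].
Proof.
move=> df; have [N hN] := @def_fin1 R real_dtype (fun c h => f h < c) ltac:(by ddef).
have ev c : (exists2 d, 0 < d & forall h, 0 < h < d -> f h < c) \/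
            (exists2 d, 0 < d & forall h, 0 < h < d -> c <= f h).
  have [s _ hs] := hN c.
  have [d d0 hd] : exists2 d, 0 < d & forall x, x \in s -> ~~ (0 < x < d).
    elim: (s) => [|x s' [d d0 hd]]; first by exists 1.
    have [x0|x0] := ltP 0 x; last first.
      exists d => // y; rewrite inE => /predU1P[->|/hd//]; by rewrite ltNge x0.
    exists (Num.min d x); first by rewrite lt_min d0.
    move=> y; rewrite inE => /predU1P[->|/hd]; first by rewrite lt_min ltxx !andbF.
    by apply: contra; rewrite lt_min => /and3P[-> ->].
  have [h1|h1] := ltP (f (d / 2)) c; [left|right]; exists d => // h hd'.
    by apply: (hs 0 d hd (d / 2) h) => //; lra.
  rewrite leNgt; apply/negP => h2.
  have : f (d / 2) < c by apply: (hs 0 d hd h (d / 2)) => //; lra.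
  by rewrite ltNge h1.
pose S := [set c | exists2 d, 0 < d & forall h, 0 < h < d -> f h < c].
have [S0|nS] := pselect (S !=set0); last first.
  apply: Or32 => K; have [h|[d d0 hd]] := ev (K + 1); first by case: nS; exists (K + 1).
  by exists d => // h /hd; lra.
have [lb|nlb] := pselect (has_lbound S); last first.
  apply: Or33 => K; apply: contrapT => h; apply: nlb; exists K => c [d d0 hd].
  rewrite leNgt; apply/negP => cK; apply: h; exists d => // h /hd; lra.
apply: Or31; exists (inf S) => e e0.
have hI : has_inf S by split.
have [c [d d0 hd] cl] := inf_adherent e0 hI.
have [h|[d' d'0 hd']] := ev (inf S - e / 2).
  have := ge_inf hI.2 (h : S _); lra.
exists (Num.min d d'); first by rewrite lt_min d0.
move=> h; rewrite lt_min => /and3P[h0 h1 h2].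
have := hd h (introT andP (conj h0 h1)); have := hd' h (introT andP (conj h0 h2)).
by rewrite ltr_norml; lra.
Qed.

(** By [def_rlim] the right derivative exists everywhere, possibly infinite, and by Baire's theorem
    it is of one kind on an interval. Infinite kinds contradict [dini] on a chord. In the finite
    case the right derivative [g] is continuous on a smaller interval, where [dini] encloses all
    slopes near [g x], on both sides. *)
Lemma def_derivable_pt (f : R -> R) a b : defm f -> a < b ->
  exists2 x, a < x < b & derivable f x 1.
Proof.
move=> df ab; have [a1 [b1 [aa1 ab1 bb1 cf]]] := def_cont1 df ab.
pose q (x h : R) := h^-1 * (f (x + h) - f x).
pose E (i : option bool) (x : R) : Prop := match i with
  | None => exists l : R, forall e : R, 0 < e -> exists d : R, 0 < d /\ forall h : R, 0 < h < d -> `|q x h - l| < e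
  | Some true => forall K : R, exists d : R, 0 < d /\ forall h : R, 0 < h < d -> K < q x h
  | Some false => forall K : R, exists d : R, 0 < d /\ forall h : R, 0 < h < d -> q x h < K end.
have dE i : def (E i).
  by rewrite /E /q; case: i => [[]|]; ddef.
have [|i [a2 [b2 [aa2 ab2 bb2 hE]]]] := @dbaire1 _ E a1 b1 ab1 dE.
  move=> x _; have [||] := @def_rlim (q x) ltac:(rewrite /q; ddef).
  - case=> l h; exists None; exists l => e /h[d d0 hd]; exists d; split=> //.
  - by move=> h; exists (Some true) => K; have [d d0 hd] := h K; exists d; split.
  - by move=> h; exists (Some false) => K; have [d d0 hd] := h K; exists d; split.
have sub x : a2 < x < b2 -> a1 < x < b1 by lra.
have slope (u v K : R) : a2 < u -> u < v -> v < b2 ->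
    (forall x, a2 < x < b2 -> u <= x <= v -> exists2 d, 0 < d & forall h, 0 < h < d -> K < q x h) ->
    K * (v - u) <= f v - f u.
  move=> au uv vb hK; apply: dini; first exact: ltW.
    by move=> x hx; apply: cf; apply: sub; lra.
  move=> x hx; have [||d d0 hd] := hK x; [lra|lra|exists d => // h hh].
  by have := hd h hh; rewrite /q mulrC ltr_pdivlMr ?(andP hh).1 // => /ltW.
have slope' (u v K : R) : a2 < u -> u < v -> v < b2 ->
    (forall x, a2 < x < b2 -> u <= x <= v -> exists2 d, 0 < d & forall h, 0 < h < d -> q x h < K) ->
    f v - f u <= K * (v - u).
  move=> au uv vb hK; have := @dini (fun x => - f x) (- K) u v (ltW uv).
  have : forall x, u <= x <= v -> cont1 (fun x => - f x) x.
    move=> x hx e e0; have [|d [d0 hd]] := cf x _ e e0; first by apply: sub; lra.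
    by exists d; split=> // y /hd; rewrite -opprD normrN.
  move=> h1 /(_ h1) h2; suff : - K * (v - u) <= - f v - - f u by lra.
  apply: h2 => x hx; have [||d d0 hd] := hK x; [lra|lra|exists d => // h hh].
  have := hd h hh; rewrite /q mulrC ltr_pdivrMr ?(andP hh).1 //; lra.
pose u := (2 * a2 + b2) / 3; pose v := (a2 + 2 * b2) / 3.
case: i hE => [[]|] hE; rewrite /E /= in hE; last first.
- pose g (x : R) := pickd 0 (fun l => forall e : R, 0 < e -> exists d : R, 0 < d /\ forall h : R, 0 < h < d -> `|q x h - l| < e).
  have dg : defm g.
    apply: (@defm_pickd R real_dtype real_dtype); first by rewrite /q; ddef.
    move=> x l l' h h'; apply/eqP; rewrite -subr_eq0 -normr_le0 leNgt; apply/negP => n0.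
    have e0 : 0 < `|l - l'| / 2 by lra.
    have [d [d0 hd]] := h _ e0; have [d' [d'0 hd']] := h' _ e0.
    pose k := Num.min d d' / 2; have m0 : 0 < Num.min d d' by rewrite lt_min d0.
    have m1 : Num.min d d' <= d by rewrite ge_min lexx.
    have m2 : Num.min d d' <= d' by rewrite ge_min lexx orbT.
    have := hd k; have := hd' k; rewrite /k => /(_ ltac:(lra)) + /(_ ltac:(lra)).
    rewrite -/k => h1 h2; have := ler_normD (l - q x k) (q x k - l').
    by rewrite addrA subrK (distrC l (q x k)); lra.
  have hg x : a2 < x < b2 -> forall e : R, 0 < e -> exists d : R, 0 < d /\ forall h : R, 0 < h < d -> `|q x h - g x| < e.
    by move=> /hE [l hl]; rewrite /g; case: pickdP => // /(_ l).
  have [a3 [b3 [aa3 ab3 bb3 cg]]] := def_cont1 dg ab2.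
  pose x := (a3 + b3) / 2; exists x; first by rewrite /x; lra.
  apply/derivable_dlim; exists (g x) => e e0.
  have [||d [d0 hd]] := cg x _ (e / 2); [rewrite /x; lra|lra|].
  pose d' := Num.min d ((b3 - a3) / 2).
  have m1 : d' <= d by rewrite ge_min lexx.
  have m2 : d' <= (b3 - a3) / 2 by rewrite ge_min lexx orbT.
  have d'0 : 0 < d' by rewrite lt_min d0; lra.
  exists d'; split=> // h /eqP h0 hd'.
  have key u1 v1 : u1 < v1 -> `|u1 - x| < d' -> `|v1 - x| < d' ->
      (g x - e / 2) * (v1 - u1) <= f v1 - f u1 <= (g x + e / 2) * (v1 - u1).
    move=> uv; rewrite !ltr_norml /x => hu hv; apply/andP; split.
      apply: slope => //; [rewrite /x in hu hv *; lra|rewrite /x in hu hv *; lra|].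
      move=> y hy uy; have : `|y - x| < d by rewrite ltr_norml /x; lra.
      move=> /hd; rewrite ltr_norml => hgy.
      have [|k [k0 hk]] := hg y hy ((g y - (g x - e / 2))); first by lra.
      by exists k => // h' /hk; rewrite ltr_norml; lra.
    apply: slope' => //; [rewrite /x in hu hv *; lra|rewrite /x in hu hv *; lra|].
    move=> y hy uy; have : `|y - x| < d by rewrite ltr_norml /x; lra.
    move=> /hd; rewrite ltr_norml => hgy.
    have [|k [k0 hk]] := hg y hy ((g x + e / 2) - g y); first by lra.
    by exists k => // h' /hk; rewrite ltr_norml; lra.
  have -> : h^-1 * (f (h *: 1 + x) - f x) - g x = h^-1 * (f (h + x) - f x - h * g x).
    by rewrite [h *: 1]mulr1; field.
  rewrite normrM normfV ltr_pdivrMl ?normr_gt0 //.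
  have [h00|h00] := ltrP 0 h.
    have := key x (h + x); rewrite subrr normr0 addrK (gtr0_norm h00) => /(_ ltac:(lra) d'0).
    rewrite gtr0_norm // in hd' => /(_ hd'); rewrite ltr_norml; nra.
  have {h00} h00 : h < 0 by rewrite lt_neqAle h0.
  have := key (h + x) x; rewrite subrr normr0 addrK (ltr0_norm h00) => /(_ ltac:(lra)).
  rewrite ltr0_norm // in hd' => /(_ hd' d'0); rewrite ltr_norml; nra.
(* If the right slopes tend to minus infinity, every [K] bounds them from above; one less than the
   slope of the chord is absurd. *)
- exfalso; pose K := (f v - f u) / (v - u) - 1.
  have uv : u < v by rewrite /u /v; lra.
  have KE : K * (v - u) = f v - f u - (v - u) by rewrite /K; field; rewrite subr_eq0 gt_eqF.
  have := @slope' u v K; rewrite KE.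
  suff h : forall x, a2 < x < b2 -> u <= x <= v -> exists2 d, 0 < d & forall h, 0 < h < d -> q x h < K.
    by move=> /(_ ltac:(rewrite /u; lra) uv ltac:(rewrite /v; lra) h); lra.
  by move=> x hx _; have [d [d0 hd]] := hE x hx K; exists d.
- exfalso; pose K := (f v - f u) / (v - u) + 1.
  have uv : u < v by rewrite /u /v; lra.
  have KE : K * (v - u) = f v - f u + (v - u) by rewrite /K; field; rewrite subr_eq0 gt_eqF.
  have := @slope u v K; rewrite KE.
  suff h : forall x, a2 < x < b2 -> u <= x <= v -> exists2 d, 0 < d & forall h, 0 < h < d -> K < q x h.
    by move=> /(_ ltac:(rewrite /u; lra) uv ltac:(rewrite /v; lra) h); lra.
  by move=> x hx _; have [d [d0 hd]] := hE x hx K; exists d.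
Qed.

End OneVar.

Section Generic.
Context {R : realType}.

(** An open set contains a segment of direction [ee i], on which the one-variable result provides a
    point of differentiability. *)
Lemma def_pd_thin n (F : 'rV[R]_n -> R) i : defm F -> thin [set x | ~ derivable F x (ee i)].
Proof.
move=> dF O oO h; apply: contrapT => /eqP/set0P [x0 Ox0].
move/open_boxP: (oO) => /(_ _ Ox0)[e e0 he].
have [||s hs] := @def_derivable_pt R (fun s => F (s *: ee i + x0)) (- e) e; last first.
- move=> /derivable_dlim [l hl]; apply: (h (s *: ee i + x0)).
    apply: he => j; rewrite !mxE addrK /= ; have [|] := boolP (j == i) => _.
      by rewrite mulr1 ltr_norml; lra.
    by rewrite mulr0 normr0.
  apply/derivable_dlim; exists l => d d0; have [k [k0 hk]] := hl d d0.
  exists k; split=> // y y0 yk; have := hk y y0 yk.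
  by rewrite scaler1 scalerDl addrA.
- by lra.
- by ddef.
Qed.

Lemma def_Cr_thin n r (F : 'rV[R]_n -> R) : defm F -> thin [set x | ~ Cr r F x].
Proof.
elim: r F => [|r ih] F dF.
  by apply: thin_sub (def_cont_thin dF) => x /= h cx; apply: h.
(* A dummy parameter, because definability of derivatives is stated for families. *)
have dF' : defm (fun p : R * 'rV[R]_n => (fun _ : R => F) p.1 p.2) by ddef.
have dpd i : defm (pd i F).
  apply: (@defm_comp _ (row_dtype n) (prod_dtype real_dtype (row_dtype n)) real_dtype
    (fun p => pd i F p.2) (fun x => (0, x))); first by ddef.
  exact: (defm_pd i dF').
have fib (P : 'rV[R]_n -> Prop) : def (fun p : R * 'rV[R]_n => P p.2) -> def P.
  by move=> dP; apply: (@def_comp _ (row_dtype n) (prod_dtype real_dtype (row_dtype n))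
    (fun x => (0, x)) (fun p => P p.2)) => //; ddef.
pose A (i : 'I_n) := [set x | ~ derivable F x (ee i)].
pose B (i : 'I_n) := [set x | ~ Cr r (pd i F) x].
have dA i : def (A i) by apply/def_not/fib; exact: (def_derivable (ee i) dF').
have dB i : def (B i).
  apply/def_not/fib; apply: (@def_Cr R real_dtype n r (fun _ => pd i F)).
  exact: (defm_pd i dF').
have dC : def [set x | ~ cont F x] by apply/def_not/fib; exact: (def_cont dF').
have tA := thin_fin dA (fun i => def_pd_thin dF).
have tB := thin_fin dB (fun i => ih _ (dpd i)).
have tC := def_cont_thin dF.
apply: thin_sub (thinU dC tC (thinU (def_finex dA) tA tB)) => x /=.
move=> h; apply: contrapT => h2; apply: h; split; first by apply: contrapT => h3; apply: h2; left.
move=> i; split; apply: contrapT => h3; apply: h2; right; [left|right]; by exists i.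
Qed.

End Generic.

(** * Differential calculus *)

Section Calculus.
Context {R : realType}.

Lemma fin_pos (I : finType) (P : I -> R -> Prop) :
  (forall i d d', 0 < d' <= d -> P i d -> P i d') ->
  (forall i, exists d, 0 < d /\ P i d) -> exists d, 0 < d /\ forall i, P i d.
Proof.
move=> hP h; suff [d [d0 hd]] : exists d, 0 < d /\ forall i, i \in enum I -> P i d.
  by exists d; split=> // i; apply: hd; rewrite mem_enum.
elim: (enum I) => [|i s [d [d0 hd]]]; first by exists 1.
have [d' [d'0 hd']] := h i; exists (Num.min d d'); split; first by rewrite lt_min d0.
have m1 : 0 < Num.min d d' <= d by rewrite lt_min d0 d'0 /= ge_min lexx.
have m2 : 0 < Num.min d d' <= d' by rewrite lt_min d0 d'0 /= ge_min lexx orbT.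
by move=> j; rewrite inE => /predU1P[->|/hd h']; [exact: hP m2 hd'|exact: hP m1 h'].
Qed.

Lemma line_near (V : normedModType R) (U : set V) x v : open U -> U x ->
  exists d, 0 < d /\ forall h : R, `|h| < d -> U (h *: v + x).
Proof.
move=> oU Ux; have /nbhs_ballP[e /= e0 he] := open_nbhs_nbhs (conj oU Ux).
have v1 : 0 < `|v| + 1 by have := normr_ge0 v; lra.
exists (e / (`|v| + 1)); split; first exact: divr_gt0.
move=> h; rewrite ltr_pdivlMr // => hh; apply: he; rewrite -ball_normE /ball_ /=.
rewrite opprD addrCA subrr addr0 normrN normrZ.
have := normr_ge0 v; have := normr_ge0 h; nra.
Qed.

Lemma eq_near_dlim (V : normedModType R) (f g : V -> R) (U : set V) x v l : open U -> U x ->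
  (forall y, U y -> f y = g y) -> dlim f x v l -> dlim g x v l.
Proof.
move=> oU Ux fg h e e0; have [d [d0 hd]] := h e e0.
have [d' [d'0 hd']] := line_near v oU Ux.
exists (Num.min d d'); split; first by rewrite lt_min d0.
move=> k k0; rewrite lt_min => /andP[kd kd'].
by rewrite -!fg //; [exact: hd|exact: hd'].
Qed.

Lemma eq_near_derivable (V : normedModType R) (f g : V -> R) (U : set V) x v : open U -> U x ->
  (forall y, U y -> f y = g y) -> derivable f x v -> derivable g x v.
Proof.
move=> oU Ux fg /derivable_dlim[l hl]; apply/derivable_dlim; exists l.
exact: eq_near_dlim fg hl.
Qed.

Lemma eq_near_derive (V : normedModType R) (f g : V -> R) (U : set V) x v : open U -> U x ->
  (forall y, U y -> f y = g y) -> 'D_v f x = 'D_v g x.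
Proof.
move=> oU Ux fg; apply/derive_dlim.
have [h|h] := pselect (exists l, dlim g x v l).
  left; apply: (eq_near_dlim oU Ux (fun y Uy => esym (fg y Uy))).
  by apply/dlimP; split=> //; apply/derivable_dlim.
right; split.
  by move=> [l hl]; apply: h; exists l; exact: eq_near_dlim fg hl.
by apply/derive_dlim; right.
Qed.

Lemma eq_near_cont n (f g : 'rV[R]_n -> R) (U : set 'rV[R]_n) x : open U -> U x ->
  (forall y, U y -> f y = g y) -> cont f x -> cont g x.
Proof.
move=> oU Ux fg /contP h; apply/contP => e e0; have [d [d0 hd]] := h e e0.
move/open_boxP : oU => /(_ _ Ux)[d' d'0 hd'].
exists (Num.min d d'); split; first by rewrite lt_min d0.
move=> y hy; rewrite -!fg //; last first.
  by apply: hd' => i; have := hy i; rewrite lt_min => /andP[].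
by apply: hd => i; have := hy i; rewrite lt_min => /andP[].
Qed.

Lemma Cr_ext n r (f g : 'rV[R]_n -> R) (U : set 'rV[R]_n) x : open U -> U x ->
  (forall y, U y -> f y = g y) -> Cr r f x -> Cr r g x.
Proof.
move=> oU; elim: r f g x => [|r ih] f g x Ux fg /= [cf h]; split.
- exact: eq_near_cont fg cf.
- by [].
- exact: eq_near_cont fg cf.
- move=> i; have [df cr] := h i; split; first exact: eq_near_derivable fg df.
  apply: ih cr => // y Uy; exact: (@eq_near_derive _ _ _ U).
Qed.

Lemma bnd_ext n r B (f g : 'rV[R]_n -> R) (U : set 'rV[R]_n) x : open U -> U x ->
  (forall y, U y -> f y = g y) -> bnd r B f x -> bnd r B g x.
Proof.
move=> oU; elim: r f g x => [|r ih] f g x Ux fg /= [cf h]; rewrite -(fg _ Ux); split=> //.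
move=> i; apply: ih (h i) => // y Uy; exact: (@eq_near_derive _ _ _ U).
Qed.

Lemma pd_ext n i (f g : 'rV[R]_n -> R) (U : set 'rV[R]_n) x : open U -> U x ->
  (forall y, U y -> f y = g y) -> pd i f x = pd i g x.
Proof. by move=> oU Ux fg; exact: (@eq_near_derive _ _ _ U). Qed.

Lemma Cr_cont n r (f : 'rV[R]_n -> R) x : Cr r f x -> cont f x.
Proof. by case: r => [|r] []. Qed.

Lemma CrS n r (f : 'rV[R]_n -> R) x : Cr r.+1 f x -> Cr r f x.
Proof. by elim: r f => [|r ih] f [cf h]; split=> // i; have [df /ih] := h i. Qed.

Lemma Cr_le n r s (f : 'rV[R]_n -> R) x : (s <= r)%N -> Cr r f x -> Cr s f x.
Proof.
by elim: r => [|r ih]; [rewrite leqn0 => /eqP->|rewrite leq_eqVlt => /predU1P[->//|/ih h /CrS]].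
Qed.

Lemma bnd0 n r B (f : 'rV[R]_n -> R) x : bnd r B f x -> `|f x| <= B.
Proof. by case: r => [|r] []. Qed.

Lemma bndS n r B (f : 'rV[R]_n -> R) x : bnd r.+1 B f x -> bnd r B f x.
Proof. by elim: r f => [|r ih] f [cf h]; split=> // i; apply: ih. Qed.

Lemma bnd_le n r B B' (f : 'rV[R]_n -> R) x : B <= B' -> bnd r B f x -> bnd r B' f x.
Proof.
move=> BB'; elim: r f => [|r ih] f [h1 h2]; split=> //; try exact: le_trans h1 BB'.
by move=> i; apply: ih; exact: h2.
Qed.

Lemma cont_add n (f g : 'rV[R]_n -> R) x : cont f x -> cont g x -> cont (fun x => f x + g x) x.
Proof. by move=> hf hg; exact: continuousD. Qed.

Lemma cont_mul n (f g : 'rV[R]_n -> R) x : cont f x -> cont g x -> cont (fun x => f x * g x) x.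
Proof. by move=> hf hg; exact: continuousM. Qed.

Lemma Cr_cst n r (c : R) x : Cr r (fun _ : 'rV[R]_n => c) x.
Proof.
elim: r c => [|r ih] c /=; split=> //; try exact: cst_continuous.
move=> i; split; first exact: derivable_cst.
apply: (@Cr_ext _ _ (fun=> 0) _ setT) => //; first exact: openT.
by move=> y _; rewrite /pd derive_cst.
Qed.

Lemma bnd_cst n r (B c : R) x : `|c| <= B -> bnd r B (fun _ : 'rV[R]_n => c) x.
Proof.
elim: r c => [|r ih] c hc /=; split=> // i.
apply: (@bnd_ext _ _ _ (fun=> 0) _ setT) => //; first exact: openT.
  by move=> y _; rewrite /pd derive_cst.
by apply: ih; rewrite normr0 (le_trans _ hc).
Qed.

Section Open.
Variables (n : nat) (U : set 'rV[R]_n) (oU : open U).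

Lemma Cr_add r (f g : 'rV[R]_n -> R) : (forall x, U x -> Cr r f x) -> (forall x, U x -> Cr r g x) ->
  forall x, U x -> Cr r (fun x => f x + g x) x.
Proof.
elim: r f g => [|r ih] f g hf hg x Ux.
  by split=> //; apply: cont_add; [case: (hf _ Ux)|case: (hg _ Ux)].
split=> [|i]; first by apply: cont_add; [case: (hf _ Ux)|case: (hg _ Ux)].
split; first by apply: derivableD; [case: (hf _ Ux) => _ /(_ i)[]|case: (hg _ Ux) => _ /(_ i)[]].
apply: (@Cr_ext _ _ (fun y => pd i f y + pd i g y) _ U) => //.
  move=> y Uy; rewrite /pd -deriveD //.
    by case: (hf _ Uy) => _ /(_ i)[].
  by case: (hg _ Uy) => _ /(_ i)[].
apply: ih => // y Uy; first by case: (hf _ Uy) => _ /(_ i)[].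
by case: (hg _ Uy) => _ /(_ i)[].
Qed.

Lemma bnd_add r (f g : 'rV[R]_n -> R) : (forall x, U x -> Cr r f x) -> (forall x, U x -> Cr r g x) ->
  forall x B B', U x -> bnd r B f x -> bnd r B' g x -> bnd r (B + B') (fun x => f x + g x) x.
Proof.
elim: r f g => [|r ih] f g hf hg x B B' Ux [f1 f2] [g1 g2].
  by split=> //; rewrite (le_trans (ler_normD _ _)) ?lerD.
split=> [|i]; first by rewrite (le_trans (ler_normD _ _)) ?lerD.
apply: (@bnd_ext _ _ _ (fun y => pd i f y + pd i g y) _ U) => //.
  move=> y Uy; rewrite /pd -deriveD //.
    by case: (hf _ Uy) => _ /(_ i)[].
  by case: (hg _ Uy) => _ /(_ i)[].
apply: ih => //; [move=> y Uy|move=> y Uy|exact: f2|exact: g2].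
  by case: (hf _ Uy) => _ /(_ i)[].
by case: (hg _ Uy) => _ /(_ i)[].
Qed.

Lemma Cr_mul r (f g : 'rV[R]_n -> R) : (forall x, U x -> Cr r f x) -> (forall x, U x -> Cr r g x) ->
  forall x, U x -> Cr r (fun x => f x * g x) x.
Proof.
elim: r f g => [|r ih] f g hf hg x Ux.
  by split=> //; apply: cont_mul; [case: (hf _ Ux)|case: (hg _ Ux)].
split=> [|i]; first by apply: cont_mul; [case: (hf _ Ux)|case: (hg _ Ux)].
split; first by apply: derivableM; [case: (hf _ Ux) => _ /(_ i)[]|case: (hg _ Ux) => _ /(_ i)[]].
apply: (@Cr_ext _ _ (fun y => f y * pd i g y + g y * pd i f y) _ U) => //.
  move=> y Uy; rewrite /pd -[RHS]/('D_(ee i) (f * g) y) deriveM //.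
    by case: (hf _ Uy) => _ /(_ i)[].
  by case: (hg _ Uy) => _ /(_ i)[].
apply: Cr_add => // y Uy; apply: ih => // z Uz; try exact: CrS (hf _ Uz); try exact: CrS (hg _ Uz).
  by case: (hg _ Uz) => _ /(_ i)[].
by case: (hf _ Uz) => _ /(_ i)[].
Qed.

Lemma Cr_sum r (I : Type) (s : seq I) (f : I -> 'rV[R]_n -> R) :
  (forall i x, U x -> Cr r (f i) x) -> forall x, U x -> Cr r (fun x => \sum_(i <- s) f i x) x.
Proof.
move=> hf; elim: s => [|i s ih] x Ux.
  apply: (@Cr_ext _ _ (fun=> 0) _ U) => //; last exact: Cr_cst.
  by move=> y _; rewrite big_nil.
apply: (@Cr_ext _ _ (fun y => f i y + \sum_(j <- s) f j y) _ U) => //.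
  by move=> y _; rewrite big_cons.
by apply: Cr_add => //; exact: hf.
Qed.

Lemma bnd_sum r (I : Type) (s : seq I) (f : I -> 'rV[R]_n -> R) B :
  (forall i x, U x -> Cr r (f i) x) -> forall x, U x -> (forall i, bnd r B (f i) x) ->
  bnd r (B *+ size s) (fun x => \sum_(i <- s) f i x) x.
Proof.
move=> hf x Ux hb; elim: s => [|i s ih].
  apply: (@bnd_ext _ _ _ (fun=> 0) _ U) => //; last by apply: bnd_cst; rewrite normr0.
  by move=> y _; rewrite big_nil.
rewrite /= mulrS.
apply: (@bnd_ext _ _ _ (fun y => f i y + \sum_(j <- s) f j y) _ U) => //.
  by move=> y _; rewrite big_cons.
by apply: bnd_add => //; [exact: hf|exact: Cr_sum].
Qed.

End Open.

Lemma bnd_mul n r B B' : exists B'', forall (U : set 'rV[R]_n) (f g : 'rV[R]_n -> R), open U ->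
  (forall x, U x -> Cr r f x) -> (forall x, U x -> Cr r g x) ->
  forall x, U x -> bnd r B f x -> bnd r B' g x -> bnd r B'' (fun x => f x * g x) x.
Proof.
suff [B'' h] : exists B'', (B * B' <= B'') /\ forall (U : set 'rV[R]_n) (f g : 'rV[R]_n -> R), open U ->
  (forall x, U x -> Cr r f x) -> (forall x, U x -> Cr r g x) ->
  forall x, U x -> bnd r B f x -> bnd r B' g x -> bnd r B'' (fun x => f x * g x) x.
  by exists B''; case: h.
elim: r B B' => [|r ih] B B'.
  exists (B * B'); split=> // U f g oU hf hg x Ux [f1 _] [g1 _]; split=> //.
  by rewrite normrM ler_pM.
have [B1 [hB1 h1]] := ih B B'; have [B2 [hB2 h2]] := ih B' B.
exists (Num.max (B * B') (B1 + B2)); split; first by rewrite le_max lexx.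
move=> U f g oU hf hg x Ux bf bg; split=> [|i].
  by rewrite normrM le_max ler_pM // ?(bnd0 bf) ?(bnd0 bg).
have hf' i' y : U y -> Cr r (pd i' f) y by move=> Uy; case: (hf _ Uy) => _ /(_ i')[].
have hg' i' y : U y -> Cr r (pd i' g) y by move=> Uy; case: (hg _ Uy) => _ /(_ i')[].
have hfr y : U y -> Cr r f y by move=> Uy; exact: CrS (hf _ Uy).
have hgr y : U y -> Cr r g y by move=> Uy; exact: CrS (hg _ Uy).
apply: (@bnd_ext _ _ _ (fun y => f y * pd i g y + g y * pd i f y) _ U) => //.
  move=> y Uy; rewrite /pd -[RHS]/('D_(ee i) (f * g) y) deriveM //.
    by case: (hf _ Uy) => _ /(_ i)[].
  by case: (hg _ Uy) => _ /(_ i)[].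
apply: (@bnd_le _ _ (B1 + B2)); first by rewrite le_max lexx orbT.
apply: (bnd_add oU) => //.
- by apply: (Cr_mul oU); [exact: hfr|exact: hg'].
- by apply: (Cr_mul oU); [exact: hgr|exact: hf'].
- by apply: h1; [exact: oU|exact: hfr|exact: hg'|exact: Ux|exact: bndS bf|exact: (proj2 bg i)].
- by apply: h2; [exact: oU|exact: hgr|exact: hf'|exact: Ux|exact: bndS bg|exact: (proj2 bf i)].
Qed.


Lemma pd_coord n (i j : 'I_n) (x : 'rV[R]_n) : derivable (fun x : 'rV[R]_n => x 0 j) x (ee i) /\
  pd i (fun x : 'rV[R]_n => x 0 j) x = (i == j)%:R.
Proof.
apply/dlimP => e e0; exists 1; split=> // h /eqP h0 _.
rewrite !mxE addrK eqxx /= mulrA mulVf // mul1r eq_sym subrr normr0 //.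
Qed.

Lemma Cr_coord n r (j : 'I_n) (x : 'rV[R]_n) : Cr r (fun x : 'rV[R]_n => x 0 j) x.
Proof.
have c : cont (fun x : 'rV[R]_n => x 0 j) x by exact: coord_continuous.
case: r => [|r] //=; split=> // i; split; first by case: (pd_coord i j x).
apply: (@Cr_ext _ _ (fun=> (i == j)%:R) _ setT) => //; first exact: openT.
  by move=> y _; case: (pd_coord i j y).
exact: Cr_cst.
Qed.

Lemma bnd_coord n r (j : 'I_n) (x : 'rV[R]_n) B : 1 <= B -> `|x 0 j| <= B -> bnd r B (fun x : 'rV[R]_n => x 0 j) x.
Proof.
move=> B1 hx; case: r => [|r] //=; split=> // i.
apply: (@bnd_ext _ _ _ (fun=> (i == j)%:R) _ setT) => //; first exact: openT.
  by move=> y _; case: (pd_coord i j y).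
by apply: bnd_cst; case: (i == j); rewrite ?normr1 ?normr0 // (le_trans ler01).
Qed.

Lemma pd_line n (f : 'rV[R]_n -> R) i z (t : R) : derivable f (t *: ee i + z) (ee i) ->
  is_derive t (1 : R^o) (fun s : R => f (s *: ee i + z)) (pd i f (t *: ee i + z)).
Proof.
move=> df; have /dlimP h : derivable f (t *: ee i + z) (ee i) /\ pd i f (t *: ee i + z) = pd i f (t *: ee i + z) by [].
have [d e] : derivable (fun s : R => f (s *: ee i + z)) t 1 /\
    'D_1 (fun s : R => f (s *: ee i + z)) t = pd i f (t *: ee i + z).
  apply/dlimP => e e0; have [d [d0 hd]] := h e e0; exists d; split=> // k k0 kd.
  have := hd k k0 kd; rewrite addrA -scalerDl.
  by rewrite [k *: 1]mulr1.
exact: DeriveDef.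
Qed.

Lemma line_mvt n (f : 'rV[R]_n -> R) i z (t c e : R) :
  (forall s, Num.min 0 t <= s <= Num.max 0 t -> derivable f (s *: ee i + z) (ee i) /\
     `|pd i f (s *: ee i + z) - c| <= e) ->
  `|f (t *: ee i + z) - f z - c * t| <= e * `|t|.
Proof.
move=> h; pose g (s : R) := f (s *: ee i + z).
have g0 : f z = g 0 by rewrite /g scale0r add0r.
rewrite g0 -/(g t).
have cg a b : Num.min 0 t <= a -> b <= Num.max 0 t -> {within `[a, b], continuous g}.
  move=> ha hb; apply: derivable_within_continuous => s; rewrite in_itv /= => /andP[as_ sb].
  have [|df _] := h s; first by rewrite (le_trans ha) //= (le_trans sb).
  by have [] := pd_line df.
have key a b : Num.min 0 t <= a -> a < b -> b <= Num.max 0 t ->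
    `|g b - g a - c * (b - a)| <= e * (b - a).
  move=> ha ab hb.
  have [||s] := @MVT R g (fun s => pd i f (s *: ee i + z)) a b ab; last first.
  - rewrite in_itv /= => /andP[as_ sb] ->.
    have [|_ hs] := h s; first by rewrite (le_trans ha (ltW as_)) (le_trans (ltW sb)).
    rewrite -mulrBl normrM (gtr0_norm (_ : 0 < b - a)) ?subr_gt0 //.
    by rewrite ler_pM2r ?subr_gt0.
  - exact: cg.
  - move=> s; rewrite in_itv /= => /andP[as_ sb].
    have [|df _] := h s; first by rewrite (le_trans ha (ltW as_)) (le_trans (ltW sb)).
    exact: pd_line.
have [t0|t0|<-] := ltgtP 0 t.
- rewrite (gtr0_norm t0); have := key 0 t; rewrite !subr0; apply => //.
    by rewrite ge_min lexx.
  by rewrite le_max lexx orbT.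
- rewrite (ltr0_norm t0); have := key t 0; rewrite !sub0r -normrN => h1.
  have -> : g t - g 0 - c * t = - (g 0 - g t - c * - t) by ring.
  apply: h1 => //; first by rewrite ge_min lexx orbT.
  by rewrite le_max lexx.
- by rewrite subrr mulr0 subr0 normr0 mulr0.
Qed.

(** Allows one to go from [x] to [y] by changing one coordinate at a time without leaving [W]. *)
Definition boxconvex n (W : set 'rV[R]_n) := forall x y z : 'rV[R]_n, W x -> W y ->
  (forall i, Num.min (x 0 i) (y 0 i) <= z 0 i <= Num.max (x 0 i) (y 0 i)) -> W z.

Lemma mvt n (W : set 'rV[R]_n) (f : 'rV[R]_n -> R) (c : 'I_n -> R) (e : R) (x y : 'rV[R]_n) : boxconvex W ->
  (forall z i, W z -> derivable f z (ee i) /\ `|pd i f z - c i| <= e) -> W x -> W y ->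
  `|f y - f x - \sum_i c i * (y 0 i - x 0 i)| <= e * \sum_i `|y 0 i - x 0 i|.
Proof.
move=> cW hf Wx Wy.
(* Consecutive points of this path differ in one coordinate, where [line_mvt] applies. *)
pose z (j : nat) : 'rV[R]_n := \row_i (if (i < j)%N then y 0 i else x 0 i).
have Wz j (i : 'I_n) (s : R) : Num.min 0 (y 0 i - x 0 i) <= s <= Num.max 0 (y 0 i - x 0 i) ->
    j = i :> nat -> W (s *: ee i + z j).
  move=> hs ji; apply: cW Wx Wy _ => k; rewrite !mxE eqxx /=.
  have [->|nki] := eqVneq k i.
    rewrite ji ltnn mulr1; move: hs.
    by case: (leP 0 (y 0 i - x 0 i)); case: (leP (x 0 i) (y 0 i)); lra.
  rewrite mulr0 add0r; case: ifP => _; first by rewrite ge_min le_max !lexx !orbT.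
  by rewrite ge_min le_max !lexx.
have main j : (j <= n)%N ->
    `|f (z j) - f x - \sum_(i < n | (i < j)%N) c i * (y 0 i - x 0 i)| <=
    e * \sum_(i < n | (i < j)%N) `|y 0 i - x 0 i|.
  elim: j => [_|j ih jn].
    rewrite !big_pred0 // subr0 mulr0 (_ : z 0%N = x) ?subrr ?normr0 //.
    by apply/rowP => i; rewrite mxE ltn0.
  pose i := Ordinal jn; pose t := y 0 i - x 0 i.
  have zE : z j.+1 = t *: ee i + z j.
    apply/rowP => k; rewrite !mxE eqxx /= ltnS leq_eqVlt.
    have [->|nki] := eqVneq k i; first by rewrite /= ltnn eqxx mulr1 subrK.
    by rewrite (negPf (_ : val k != j)) ?mulr0 ?add0r //.
  have /line_mvt h : forall s, Num.min 0 t <= s <= Num.max 0 t -> derivable f (s *: ee i + z j) (ee i) /\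
     `|pd i f (s *: ee i + z j) - c i| <= e.
    by move=> s hs; apply: hf; apply: Wz.
  have eqk (k : 'I_n) : (k < j.+1)%N && (k != i) = (k < j)%N.
    by rewrite ltnS leq_eqVlt (_ : (k == i) = (val k == j)) //; case: ltngtP.
  have S1 (F : 'I_n -> R) : \sum_(k < n | (k < j.+1)%N) F k = F i + \sum_(k < n | (k < j)%N) F k.
    by rewrite (bigD1 i) //=; congr (_ + _); apply: eq_bigl => k; rewrite eqk.
  rewrite !S1 [e * (_ + _)]mulrDr.
  have := ih (ltnW jn); move: h; rewrite -zE -/t => h1 h2.
  apply: le_trans (lerD h1 h2); rewrite -[X in X <= _]normrN.
  apply: le_trans _ (ler_normD _ _); rewrite -normrN le_eqVlt; apply/orP; left; apply/eqP.
  by congr `|_|; ring.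
have := main n (leqnn n); rewrite (_ : z n = y); last by apply/rowP => i; rewrite mxE ltn_ord.
by under eq_bigl do rewrite ltn_ord; under [X in _ <= e * X]eq_bigl do rewrite ltn_ord.
Qed.

Lemma box_convex n (x : 'rV[R]_n) e : boxconvex (box x e).
Proof.
move=> y z w hy hz hw i; have := hy i; have := hz i; have := hw i.
by rewrite !ltr_norml; case: (leP (y 0 i) (z 0 i)); lra.
Qed.

Lemma cube_convex n : boxconvex (@open_cube R n).
Proof.
move=> y z w hy hz hw i; have := hy i; have := hz i; have := hw i.
by case: (leP (y 0 i) (z 0 i)); lra.
Qed.

Lemma open_cube_open n : open (@open_cube R n).
Proof.
apply/open_boxP => x hx.
have [||d [d0 hd]] := @fin_pos 'I_n (fun i d => d <= x 0 i /\ d <= 1 - x 0 i).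
- by move=> i d d' /andP[_ dd'] [h1 h2]; lra.
- move=> i; exists (Num.min (x 0 i) (1 - x 0 i)); have := hx i.
  by rewrite lt_min !ge_min !lexx orbT; lra.
exists d => // y hy i; have := hy i; have := hd i; have := hx i.
by rewrite ltr_norml; lra.
Qed.

End Calculus.

(** * Chain rule and symmetry of derivatives *)

Section Composition.
Context {R : realType}.

(** [mvt] on a small box, with the partial derivatives at [p] as reference slopes. *)
Lemma frechet n (f : 'rV[R]_n -> R) (V : set 'rV[R]_n) p : open V -> V p ->
  (forall z i, V z -> derivable f z (ee i)) -> (forall i, cont (pd i f) p) ->
  forall e, 0 < e -> exists d, 0 < d /\ forall y : 'rV[R]_n, box p d y ->
    `|f y - f p - \sum_i pd i f p * (y 0 i - p 0 i)| <= e * \sum_i `|y 0 i - p 0 i|.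
Proof.
move=> oV Vp dV cf e e0.
have [||d [d0 hd]] := @fin_pos R 'I_n (fun i d => forall y, box p d y -> `|pd i f y - pd i f p| <= e).
- by move=> i d d' /andP[_ dd'] h y hy; apply: h => k; exact: lt_le_trans (hy k) dd'.
- move=> i; move/contP : (cf i) => /(_ e e0)[d [d0 hd]]; exists d; split=> // y /hd; exact: ltW.
move/open_boxP : oV => /(_ _ Vp)[d' d'0 hd'].
have m0 : 0 < Num.min d d' by rewrite lt_min d0.
exists (Num.min d d'); split=> // y hy; apply: (mvt (W := box p (Num.min d d'))) => //.
- exact: box_convex.
- move=> z i hz; split.
    by apply/dV/hd' => k; have := hz k; rewrite lt_min => /andP[].
  by apply: hd => k; have := hz k; rewrite lt_min => /andP[].
- exact: box_center.
Qed.

Lemma chain n (W : normedModType R) (f : 'rV[R]_n -> R) (V : set 'rV[R]_n)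
    (psi : W -> 'rV[R]_n) (x v : W) (c : 'I_n -> R) : open V -> V (psi x) ->
  (forall z i, V z -> derivable f z (ee i)) -> (forall i, cont (pd i f) (psi x)) ->
  (forall k, dlim (fun z => psi z 0 k) x v (c k)) ->
  dlim (fun z => f (psi z)) x v (\sum_k pd k f (psi x) * c k).
Proof.
move=> oV Vp dV cf hpsi e e0; set p := psi x.
pose S1 := \sum_k `|pd k f p|; pose S2 := \sum_k (`|c k| + 1).
have S10 : 0 <= S1 by apply: sumr_ge0.
have S20 : 0 <= S2 by apply: sumr_ge0 => k _; have := normr_ge0 (c k); lra.
(* [eta] is the error allowed on the difference quotients of [psi], and [eps] below controls the
   remainder of [f]; each contributes at most [e / 2]. *)
pose eta := Num.min 1 (e / (2 * (S1 + 1))).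
have eta0 : 0 < eta by rewrite lt_min ltr01 divr_gt0 //; lra.
have eta1 : eta <= 1 by rewrite ge_min lexx.
have etaS : S1 * eta <= e / 2.
  have h : eta <= e / (2 * (S1 + 1)) by rewrite ge_min lexx orbT.
  have S11 : 0 < 2 * (S1 + 1) by lra.
  by move: h; rewrite ler_pdivlMr //; nra.
pose eps := e / (4 * (S2 + 1)).
have eps0 : 0 < eps by rewrite divr_gt0 //; lra.
have epsS : eps * S2 < e / 2.
  have h : eps * (4 * (S2 + 1)) = e by rewrite /eps divfK // gt_eqF //; lra.
  by nra.
have [d [d0 hd]] := frechet oV Vp dV cf eps0.
have [||d' [d'0 hd']] := @fin_pos R 'I_n (fun k d => forall h, h <> 0 -> `|h| < d ->
  `|h^-1 * (psi (h *: v + x) 0 k - p 0 k) - c k| < eta).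
- by move=> i a a' /andP[_ aa'] h y y0 hy; apply: h => //; exact: lt_le_trans hy aa'.
- by move=> k; have := hpsi k eta eta0.
pose d1 := Num.min d' (d / (S2 + 1)).
have d10 : 0 < d1 by rewrite lt_min d'0 divr_gt0 //; lra.
exists d1; split=> // h h0; rewrite lt_min => /andP[hd1 hd2].
have h0' : h != 0 by apply/eqP.
have q k := hd' k h h0 hd1.
pose Q k := h^-1 * (psi (h *: v + x) 0 k - p 0 k).
have Qle k : `|Q k| <= `|c k| + 1.
  have := ler_normD (Q k - c k) (c k); rewrite subrK; have := q k; rewrite -/(Q k); lra.
have QE k : psi (h *: v + x) 0 k - p 0 k = h * Q k by rewrite /Q mulVKf.
have hS2 : 0 < S2 + 1 by lra.
have near : box p d (psi (h *: v + x)).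
  move=> k; rewrite QE normrM; move: hd2; rewrite ltr_pdivlMr // => hd2.
  have h1 : `|Q k| <= S2.
    apply: le_trans (Qle k) _; rewrite /S2 (bigD1 k) //= lerDl.
    by apply: sumr_ge0 => j _; have := normr_ge0 (c j); lra.
  by have := normr_ge0 h; nra.
have {hd} := hd _ near.
set rem := _ - \sum_i _ => hrem.
have E : h^-1 * (f (psi (h *: v + x)) - f p) - \sum_k pd k f p * c k =
    h^-1 * rem + \sum_k pd k f p * (Q k - c k).
  have -> : \sum_k pd k f p * (Q k - c k) =
      h^-1 * (\sum_k pd k f p * (psi (h *: v + x) 0 k - p 0 k)) - \sum_k pd k f p * c k.
    by rewrite mulr_sumr -sumrB; apply: eq_bigr => k _; rewrite QE; field.
  by rewrite /rem; ring.
rewrite E (le_lt_trans (ler_normD _ _)) //.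
have h1 : `|h^-1 * rem| <= eps * S2.
  rewrite normrM normfV ler_pdivrMl ?normr_gt0 //; apply: le_trans hrem _.
  rewrite mulrCA ler_pM2l // mulr_sumr; apply: ler_sum => k _.
  by rewrite QE normrM ler_wpM2l.
have h2 : `|\sum_k pd k f p * (Q k - c k)| <= S1 * eta.
  apply: le_trans (ler_norm_sum _ _ _) _; rewrite mulr_suml; apply: ler_sum => k _.
  by rewrite normrM ler_wpM2l // ltW // q.
by lra.
Qed.

Lemma cont_comp m n (f : 'rV[R]_n -> R) (psi : 'rV[R]_m -> 'rV[R]_n) x :
  cont f (psi x) -> (forall k, cont (fun z => psi z 0 k) x) -> cont (fun z => f (psi z)) x.
Proof.
move=> /contP cf cp; apply/contP => e e0; have [d [d0 hd]] := cf e e0.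
have [||d' [d'0 hd']] := @fin_pos R 'I_n (fun k d' => forall y, box x d' y -> `|psi y 0 k - psi x 0 k| < d).
- by move=> i a a' /andP[_ aa'] h y hy; apply: h => k; exact: lt_le_trans (hy k) aa'.
- by move=> k; move/contP : (cp k) => /(_ d d0).
by exists d'; split=> // y hy; apply: hd => k; exact: hd'.
Qed.

Lemma pd_comp m n (U : set 'rV[R]_m) (V : set 'rV[R]_n) (f : 'rV[R]_n -> R)
    (psi : 'rV[R]_m -> 'rV[R]_n) i x : open V -> V (psi x) ->
  (forall z, V z -> Cr 1 f z) -> (forall k, derivable (fun z => psi z 0 k) x (ee i)) ->
  derivable (fun z => f (psi z)) x (ee i) /\
  pd i (fun z => f (psi z)) x = \sum_k pd k f (psi x) * pd i (fun z => psi z 0 k) x.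
Proof.
move=> oV Vx hf hp; apply/dlimP; apply: (chain oV Vx).
- by move=> z j /hf[_ /(_ j)[]].
- by move=> j; have [_ /(_ j)[_ []]] := hf _ Vx.
- by move=> k; apply/dlimP; split=> //; exact: hp.
Qed.

Lemma Cr_comp r m n (U : set 'rV[R]_m) (V : set 'rV[R]_n) (f : 'rV[R]_n -> R)
    (psi : 'rV[R]_m -> 'rV[R]_n) : open U -> open V -> (forall x, U x -> V (psi x)) ->
  (forall z, V z -> Cr r f z) -> (forall k x, U x -> Cr r (fun z => psi z 0 k) x) ->
  forall x, U x -> Cr r (fun z => f (psi z)) x.
Proof.
move=> oU oV UV; elim: r f => [|r ih] f hf hp x Ux.
  by split=> //; apply: cont_comp => [|k]; apply: Cr_cont; [apply: hf; exact: UV|exact: hp].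
split=> [|i].
  by apply: cont_comp => [|k]; apply: Cr_cont; [apply: hf; exact: UV|exact: hp].
have hf1 z : V z -> Cr 1 f z by move=> Vz; apply: Cr_le (hf z Vz).
have hd y k : U y -> derivable (fun z => psi z 0 k) y (ee i) by move=> /(hp k)[_ /(_ i)[]].
split; first by have [] := @pd_comp m n U V f psi i x oV (UV _ Ux) hf1 (fun k => hd x k Ux).
apply: (@Cr_ext _ _ _ (fun y => \sum_k pd k f (psi y) * pd i (fun z => psi z 0 k) y) _ U) => //.
  by move=> y Uy; have [] := @pd_comp m n U V f psi i y oV (UV _ Uy) hf1 (fun k => hd y k Uy).
apply: (Cr_sum oU) => // k y Uy; apply: (Cr_mul oU) => // z Uz.
  apply: (ih (pd k f)) => //; first by move=> w /hf[_ /(_ k)[]].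
  by move=> j w Uw; apply: CrS; exact: hp.
by have [_ /(_ i)[]] := hp k z Uz.
Qed.

Lemma bnd_comp r m n B B0 : exists B', forall (U : set 'rV[R]_m) (V : set 'rV[R]_n)
    (f : 'rV[R]_n -> R) (psi : 'rV[R]_m -> 'rV[R]_n),
  open U -> open V -> (forall x, U x -> V (psi x)) ->
  (forall z, V z -> Cr r f z) -> (forall k x, U x -> Cr r (fun z => psi z 0 k) x) ->
  forall x, U x -> bnd r B f (psi x) -> (forall k, bnd r B0 (fun z => psi z 0 k) x) ->
  bnd r B' (fun z => f (psi z)) x.
Proof.
suff [B' [_ h]] : exists B', B <= B' /\ forall (U : set 'rV[R]_m) (V : set 'rV[R]_n)
    (f : 'rV[R]_n -> R) (psi : 'rV[R]_m -> 'rV[R]_n),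
  open U -> open V -> (forall x, U x -> V (psi x)) ->
  (forall z, V z -> Cr r f z) -> (forall k x, U x -> Cr r (fun z => psi z 0 k) x) ->
  forall x, U x -> bnd r B f (psi x) -> (forall k, bnd r B0 (fun z => psi z 0 k) x) ->
  bnd r B' (fun z => f (psi z)) x by exists B'.
elim: r B => [|r ih] B.
  by exists B; split=> // U V f psi oU oV UV hf hp x Ux [h _] hb; split.
have [B1 [hB1 h1]] := ih B; have [B2 h2] := @bnd_mul R m r B1 B0.
exists (Num.max B (B2 *+ size (index_enum 'I_n))); split; first by rewrite le_max lexx.
move=> U V f psi oU oV UV hf hp x Ux bf bp; split=> [|i].
  by rewrite le_max (bnd0 bf).
have hf1 z : V z -> Cr 1 f z by move=> Vz; apply: Cr_le (hf z Vz).
have hd y k : U y -> derivable (fun z => psi z 0 k) y (ee i) by move=> /(hp k)[_ /(_ i)[]].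
have hfr k z : V z -> Cr r (pd k f) z by move=> /hf[_ /(_ k)[]].
have hpr k z : U z -> Cr r (fun z => psi z 0 k) z by move=> Uz; apply: CrS; exact: hp.
have hpi k z : U z -> Cr r (pd i (fun z => psi z 0 k)) z by move=> Uz; have [_ /(_ i)[]] := hp k z Uz.
apply: (@bnd_ext _ _ _ _ (fun y => \sum_k pd k f (psi y) * pd i (fun z => psi z 0 k) y) _ U) => //.
  by move=> y Uy; have [] := @pd_comp m n U V f psi i y oV (UV _ Uy) hf1 (fun k => hd y k Uy).
apply: (@bnd_le _ _ _ (B2 *+ size (index_enum 'I_n))); first by rewrite le_max lexx orbT.
apply: (bnd_sum oU) => // [k y Uy|k].
  apply: (Cr_mul oU) => // z Uz; last exact: hpi.
  exact: (Cr_comp oU oV UV (hfr k) hpr).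
apply: (h2 U) => //.
- move=> z Uz; exact: (Cr_comp oU oV UV (hfr k) hpr).
- exact: hpi.
- apply: (h1 U V) => //; first exact: hfr.
    by case: bf => _ /(_ k).
  by move=> j; apply: bndS; exact: bp.
- by have [_ /(_ i)] := bp k.
Qed.

(** The second difference of [f] over a square of small side [h] is, by [line_mvt] used twice,
    within [e / 2 * h * h] of [h * h] times either mixed derivative at [x]. *)
Lemma schwarz n (f : 'rV[R]_n -> R) (V : set 'rV[R]_n) i j x : open V -> V x ->
  (forall z, V z -> Cr 2 f z) -> pd i (pd j f) x = pd j (pd i f) x.
Proof.
move=> oV Vx hf; have [->//|nij] := eqVneq i j.
apply/eqP; rewrite -subr_eq0 -normr_le0; apply/ler_addgt0Pr => e e0; rewrite add0r.
have cc a b : cont (pd a (pd b f)) x.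
  by have [_ /(_ b)[_ [_ /(_ a)[_ []]]]] := hf _ Vx.
have e20 : 0 < e / 2 by lra.
have /contP/(_ _ e20)[d1 [d10 hd1]] := cc i j.
have /contP/(_ _ e20)[d2 [d20 hd2]] := cc j i.
move/open_boxP : oV => /(_ _ Vx)[d3 d30 hd3].
pose d := Num.min d1 (Num.min d2 d3); have d0 : 0 < d by rewrite !lt_min d10 d20.
have dd1 : d <= d1 by rewrite ge_min lexx.
have dd2 : d <= d2 by rewrite !ge_min lexx !orbT.
have dd3 : d <= d3 by rewrite !ge_min lexx !orbT.
pose h : R := d / 2; have h0 : 0 < h by rewrite /h; lra.
pose P (a b : 'I_n) (s t : R) : 'rV[R]_n := s *: ee a + (t *: ee b + x).
have Pbox (a b : 'I_n) (s t : R) : a != b -> 0 <= s <= h -> 0 <= t <= h -> box x d (P a b s t).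
  move=> nab hs ht k; rewrite !mxE addrA addrK !eqxx /=.
  have [->|ka] := eqVneq k a; first by rewrite (negPf nab) mulr0 mulr1 addr0 ltr_norml /h in hs *; lra.
  rewrite mulr0 add0r; case: eqP => _; first by rewrite mulr1 ltr_norml /h in ht *; lra.
  by rewrite mulr0 normr0.
have PV (a b : 'I_n) (s t : R) : a != b -> 0 <= s <= h -> 0 <= t <= h -> V (P a b s t).
  move=> nab hs ht; apply: hd3 => k; apply: lt_le_trans dd3; exact: Pbox.
have h0h : Num.min 0 h = 0 by apply/min_idPl; exact: ltW.
have h1h : Num.max 0 h = h by apply/max_idPr; exact: ltW.
have key (a b : 'I_n) : a != b -> (forall y, box x d y -> `|pd b (pd a f) y - pd b (pd a f) x| <= e / 2) ->
   `|f (P a b h h) - f (P a b h 0) - f (P a b 0 h) + f (P a b 0 0) - pd b (pd a f) x * h * h| <= e / 2 * h * h.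
  move=> nab hb; have hh : 0 <= h <= h by rewrite lexx ltW.
  have h00 : (0 : R) <= 0 <= h by rewrite lexx ltW.
  pose g z := f (h *: ee b + z) - f z.
  have gP s : g (s *: ee a + x) = f (P a b s h) - f (P a b s 0).
    by rewrite /g /P scale0r add0r addrCA.
  have Px a' b' : P a' b' 0 0 = x by rewrite /P !scale0r !add0r.
  have trans z : pd a (fun z => f (h *: ee b + z)) z = pd a f (h *: ee b + z) /\
      (derivable f (h *: ee b + z) (ee a) -> derivable (fun z => f (h *: ee b + z)) z (ee a)).
    have tr l : dlim f (h *: ee b + z) (ee a) l <-> dlim (fun z => f (h *: ee b + z)) z (ee a) l.
      by split=> H e' e'0; have [dd [dd0 hdd]] := H e' e'0; exists dd; split=> // k k0 kd;
        have := hdd k k0 kd; rewrite addrCA.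
    split; last by move=> /derivable_dlim[l /tr hl]; apply/derivable_dlim; exists l.
    apply/derive_dlim; have [l|nd] := pselect (derivable f (h *: ee b + z) (ee a)).
      by left; apply/tr/dlimP.
    right; split; first by move=> [l /tr hl]; apply: nd; apply/derivable_dlim; exists l.
    by apply: dvgP.
  have /line_mvt H : forall s, Num.min 0 h <= s <= Num.max 0 h ->
      derivable g (s *: ee a + x) (ee a) /\ `|pd a g (s *: ee a + x) - pd b (pd a f) x * h| <= e / 2 * h.
    rewrite h0h h1h => s hs.
    have V1 : V (h *: ee b + (s *: ee a + x)) by rewrite addrCA; exact: PV.
    have V2 : V (s *: ee a + x) by rewrite -[x]add0r -(scale0r (ee b)); exact: PV.
    have D1 : derivable f (h *: ee b + (s *: ee a + x)) (ee a) by have [_ /(_ a)[]] := hf _ V1.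
    have D2 : derivable f (s *: ee a + x) (ee a) by have [_ /(_ a)[]] := hf _ V2.
    have [T1 /(_ D1) T2] := trans (s *: ee a + x).
    split; first exact: derivableB.
    have -> : pd a g (s *: ee a + x) = pd a f (h *: ee b + (s *: ee a + x)) - pd a f (s *: ee a + x).
      by rewrite -T1; exact: (deriveB T2 D2).
    rewrite -[X in _ <= _ * X](gtr0_norm h0); apply: line_mvt; rewrite h0h h1h => t ht.
    have V3 : V (t *: ee b + (s *: ee a + x)) by rewrite addrCA; exact: PV.
    split; first by have [_ /(_ a)[_ [_ /(_ b)[]]]] := hf _ V3.
    by apply: hb; rewrite addrCA; exact: Pbox.
  move: H; rewrite !gP -[g x]/(f (h *: ee b + x) - f x) (gtr0_norm h0).
  have -> : f (h *: ee b + x) = f (P a b 0 h) by rewrite /P scale0r add0r.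
  rewrite !Px; move=> H; rewrite (_ : _ + f x - _ = f (P a b h h) - f (P a b h 0) - (f (P a b 0 h) - f x) - pd b (pd a f) x * h * h) //.
  by ring.
have K1 : `|f (P i j h h) - f (P i j h 0) - f (P i j 0 h) + f (P i j 0 0) - pd j (pd i f) x * h * h| <= e / 2 * h * h.
  by apply: key => // y hy; apply/ltW/hd2 => k; exact: lt_le_trans (hy k) dd2.
have K2 : `|f (P j i h h) - f (P j i h 0) - f (P j i 0 h) + f (P j i 0 0) - pd i (pd j f) x * h * h| <= e / 2 * h * h.
  by apply: key; rewrite 1?eq_sym // => y hy; apply/ltW/hd1 => k; exact: lt_le_trans (hy k) dd1.
have Psw s t : P j i s t = P i j t s by rewrite /P addrCA.
move: K1 K2; rewrite !Psw.
set A := f (P i j h h); set A1 := f (P i j h 0); set A2 := f (P i j 0 h); set A3 := f (P i j 0 0).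
set c1 := pd j (pd i f) x; set c2 := pd i (pd j f) x.
move: A A1 A2 A3 c1 c2 => A A1 A2 A3 c1 c2.
rewrite ler_norml => K1; rewrite ler_norml => K2; rewrite ler_norml.
have hh0 : 0 < h * h by rewrite mulr_gt0.
have E1 : c1 * h * h = c1 * (h * h) by rewrite mulrA.
have E2 : c2 * h * h = c2 * (h * h) by rewrite mulrA.
have E3 : e / 2 * h * h = e / 2 * (h * h) by rewrite !mulrA.
rewrite E1 E3 in K1; rewrite E2 E3 in K2.
have : (c2 - c1) * (h * h) <= e * (h * h) by lra.
have : - e * (h * h) <= (c2 - c1) * (h * h) by lra.
by rewrite !ler_pM2r // => -> ->.
Qed.

Definition dw n (w : seq 'I_n) (f : 'rV[R]_n -> R) : 'rV[R]_n -> R := foldr (@pd R n) f w.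

Lemma dw_cat n (w w' : seq 'I_n) f : dw (w ++ w') f = dw w (dw w' f).
Proof. by rewrite /dw foldr_cat. Qed.

Lemma Cr_dw n (w : seq 'I_n) r f x : Cr (size w + r) f x -> Cr r (dw w f) x.
Proof.
elim/last_ind: w r f => [|w i ih] r f //; rewrite size_rcons addSn => -[_ /(_ i)[_ h]].
by rewrite -cats1 dw_cat; apply: ih.
Qed.

Lemma bnd_dw n (w : seq 'I_n) r B f x : (size w <= r)%N -> bnd r B f x -> `|dw w f x| <= B.
Proof.
elim/last_ind: w r f => [|w i ih] r f; first by move=> _ /bnd0.
by rewrite size_rcons -cats1 dw_cat; case: r => // r wr [_ /(_ i) h]; exact: ih h.
Qed.

Lemma dw_bnd n r B (f : 'rV[R]_n -> R) x :
  (forall w, (size w <= r)%N -> `|dw w f x| <= B) -> bnd r B f x.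
Proof.
elim: r f => [|r ih] f h; split; try exact: (h [::]); first by [].
move=> i; apply: ih => w wr; have := h (rcons w i).
by rewrite size_rcons -cats1 dw_cat; apply.
Qed.

Lemma dw_ext n (w : seq 'I_n) (f g : 'rV[R]_n -> R) (U : set 'rV[R]_n) : open U ->
  (forall y, U y -> f y = g y) -> forall x, U x -> dw w f x = dw w g x.
Proof. by move=> oU fg; elim: w => //= i w ih x Ux; exact: (pd_ext _ oU Ux ih). Qed.

(** Sorts a word by [schwarz]: the derivatives in the first variable come outermost, as the
    expansion of a substitution in that variable needs them. *)
Lemma dw_normal n (w : seq 'I_n.+1) (f : 'rV[R]_n.+1 -> R) (U : set 'rV[R]_n.+1) : open U ->
  (forall y, U y -> Cr (size w) f y) -> forall x, U x ->
  dw w f x = dw (nseq (count_mem ord0 w) ord0 ++ [seq i <- w | i != ord0]) f x.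
Proof.
move=> oU; elim: w => [|i w ih] hf x Ux //=.
have {}ih y : U y -> dw w f y = dw (nseq (count_mem ord0 w) ord0 ++ [seq i <- w | i != ord0]) f y.
  by apply: ih => z Uz; apply: CrS; exact: hf.
rewrite -[LHS]/(pd i (dw w f) x) (pd_ext i oU Ux ih).
have [->|ni] //= := eqVneq i ord0; rewrite add0n.
set v := [seq _ <- _ | _]; set a := count_mem _ _.
have sz : (a + size v = size w)%N by rewrite size_filter count_predC.
rewrite !dw_cat /=; have : forall y, U y -> Cr (size v + a.+1) f y.
  by move=> y /hf /=; rewrite addnS addnC sz.
move: (a) => b; elim: b x Ux => //= b ihb x Ux hb.
pose g := dw (nseq b ord0) (dw v f).
have hg y : U y -> Cr 2 g y.
  move=> Uy; rewrite /g -dw_cat; apply: Cr_dw; rewrite size_cat size_nseq.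
  by apply: Cr_le (hb y Uy); lia.
rewrite -/(dw _ _) -[LHS]/(pd i (pd ord0 g) x) (schwarz i ord0 oU Ux hg).
apply: (pd_ext ord0 oU Ux) => y Uy.
by apply: ihb => // z /hb; apply: Cr_le; rewrite leq_add2l.
Qed.

End Composition.

(** * Functions with bounded derivatives on the open cube *)

Section Jets.
Context {R : realType}.

Definition jet n r (B : R) (f : 'rV[R]_n -> R) : Prop :=
  forall x, open_cube n x -> Cr r f x /\ bnd r B f x.

Lemma jet_ext n r B (f g : 'rV[R]_n -> R) : (forall x, open_cube n x -> f x = g x) ->
  jet r B f -> jet r B g.
Proof.
move=> fg hf x cx; have [h1 h2] := hf x cx.
by split; [exact: Cr_ext (@open_cube_open R n) cx fg h1|exact: bnd_ext (@open_cube_open R n) cx fg h2].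
Qed.

Lemma jet_le n r B B' (f : 'rV[R]_n -> R) : B <= B' -> jet r B f -> jet r B' f.
Proof. by move=> BB' hf x /hf[h1 h2]; split=> //; exact: bnd_le h2. Qed.

Lemma jet_comp r m n (B B0 : R) : exists B', forall (f : 'rV[R]_n -> R) (psi : 'rV[R]_m -> 'rV[R]_n),
  (forall x, open_cube m x -> open_cube n (psi x)) -> jet r B f ->
  (forall k, jet r B0 (fun z => psi z 0 k)) -> jet r B' (fun z => f (psi z)).
Proof.
have [B' h] := @bnd_comp R r m n B B0; exists B' => f psi hc hf hp x cx.
have h1 z : open_cube n z -> Cr r f z by move=> /hf[].
have h2 k z : open_cube m z -> Cr r (fun z => psi z 0 k) z by move=> cz; have [] := hp k z cz.
split; first exact: (@Cr_comp R r m n _ _ f psi (@open_cube_open R m) (@open_cube_open R n) hc h1 h2 x cx).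
apply: (h _ _ f psi (@open_cube_open R m) (@open_cube_open R n) hc h1 h2) => //.
  by have [] := hf _ (hc _ cx).
by move=> k; have [] := hp k _ cx.
Qed.

Lemma jet_add n r B B' (f g : 'rV[R]_n -> R) : jet r B f -> jet r B' g ->
  jet r (B + B') (fun x => f x + g x).
Proof.
move=> hf hg x cx; split.
  by apply: (Cr_add (@open_cube_open R n)) => // y cy; [case: (hf y cy)|case: (hg y cy)].
apply: (bnd_add (@open_cube_open R n)) => //.
- by move=> y /hf[].
- by move=> y /hg[].
- by case: (hf x cx).
- by case: (hg x cx).
Qed.

Lemma jet_mul n r B B' : exists B'', forall (f g : 'rV[R]_n -> R), jet r B f -> jet r B' g ->
  jet r B'' (fun x => f x * g x).
Proof.
have [B'' h] := @bnd_mul R n r B B'; exists B'' => f g hf hg x cx; split.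
  by apply: (Cr_mul (@open_cube_open R n)) => // y cy; [case: (hf y cy)|case: (hg y cy)].
apply: (h _ _ _ (@open_cube_open R n)) => //.
- by move=> y /hf[].
- by move=> y /hg[].
- by case: (hf x cx).
- by case: (hg x cx).
Qed.

Lemma jet_cst n r B (c : R) : `|c| <= B -> jet r B (fun _ : 'rV[R]_n => c).
Proof. by move=> cB x _; split; [exact: Cr_cst|exact: bnd_cst]. Qed.

Lemma jet_coord n r (j : 'I_n) : jet r 1 (fun x : 'rV[R]_n => x 0 j).
Proof.
move=> x cx; split; first exact: Cr_coord.
by apply: bnd_coord => //; have := cx j; rewrite ler_norml; lra.
Qed.

Lemma def_jet (T : dtype R) n r B (F : T -> 'rV[R]_n -> R) : defm (fun p => F p.1 p.2) ->
  def (fun t => jet r B (F t)).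
Proof.
move=> dF; have dC := def_Cr r dF; have dB := def_bnd r B dF.
rewrite /jet /open_cube /=; apply: (@def_all _ _ (row_dtype n)); apply: def_imp; first by ddef.
exact: def_and.
Qed.

Lemma cube_cons n (s : R) (y : 'rV[R]_n) :
  open_cube n.+1 (cons s y) <-> 0 < s < 1 /\ open_cube n y.
Proof.
rewrite /open_cube /= forall_ordS cons0; split=> -[h1 h2]; split=> // j; have := h2 j;
by rewrite consS.
Qed.

Lemma cube_hdtl n (x : 'rV[R]_n.+1) :
  open_cube n.+1 x <-> 0 < hd x < 1 /\ open_cube n (tl x).
Proof. by rewrite -{1}(cons_hd_tl x) cube_cons. Qed.

Lemma pd_cons n j (f : 'rV[R]_n.+1 -> R) s y :
  (derivable f (cons s y) (ee (lift ord0 j)) <-> derivable (fun y => f (cons s y)) y (ee j)) /\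
  pd j (fun y => f (cons s y)) y = pd (lift ord0 j) f (cons s y).
Proof.
have E h : cons s (h *: ee j + y) = h *: ee (lift ord0 j) + cons s y.
  apply/rowP => i; rewrite !mxE eqxx /=; case: unliftP => [k|] ->.
    by rewrite !mxE eqxx (inj_eq lift_inj).
  by rewrite (negPf (neq_lift _ _)) mulr0 add0r.
have tr l : dlim f (cons s y) (ee (lift ord0 j)) l <-> dlim (fun y => f (cons s y)) y (ee j) l.
  by split=> H e e0; have [d [d0 hd]] := H e e0; exists d; split=> // h h0 hh; have := hd h h0 hh;
    rewrite E.
have dtr : derivable f (cons s y) (ee (lift ord0 j)) <-> derivable (fun y => f (cons s y)) y (ee j).
  by rewrite !derivable_dlim; split=> -[l /tr]; exists l.
split=> //; apply/derive_dlim.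
have [d|nd] := pselect (derivable f (cons s y) (ee (lift ord0 j))).
  by left; apply/tr/dlimP.
right; split; first by rewrite -derivable_dlim -dtr.
exact: dvgP.
Qed.

Lemma dw_cons n (w : seq 'I_n) (f : 'rV[R]_n.+1 -> R) s :
  dw w (fun y => f (cons s y)) = fun y => dw (map (lift ord0) w) f (cons s y).
Proof.
elim: w => //= j w ih; rewrite -[LHS]/(pd j (dw w (fun y => f (cons s y)))) ih.
by apply/funext => y; have [_ ->] := pd_cons j (dw (map (lift ord0) w) f) s y.
Qed.

Lemma map_unlift n (v : seq 'I_n.+1) : all (fun i => i != ord0) v ->
  exists v', v = map (lift ord0) v'.
Proof.
elim: v => [|i v ih] /=; first by exists [::].
case/andP => i0 /ih[v' ->]; case: (unliftP ord0 i) i0 => [j ->|->]; last by rewrite eqxx.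
by exists (j :: v').
Qed.

(* Homothety: the derivatives of order at least one get multiplied by powers of [kappa]. *)
Lemma jet_scale n r B (kappa : R) (a : 'rV[R]_n) (f : 'rV[R]_n -> R) :
  0 < kappa <= 1 -> kappa * B <= 1 -> 0 <= B ->
  (forall x, open_cube n x -> open_cube n (kappa *: x + a)) ->
  (forall x, open_cube n x -> `|f x| <= 1) ->
  jet r B f -> jet r 1 (fun x => f (kappa *: x + a)).
Proof.
move=> /andP[k0 k1] kB B0 hA f1 hf x cx.
have cA i z : Cr r (fun z : 'rV[R]_n => (kappa *: z + a) 0 i) z.
  apply: (@Cr_ext _ _ _ (fun z : 'rV[R]_n => kappa * z 0 i + a 0 i) _ setT) => //; first exact: openT.
    by move=> y _; rewrite !mxE.
  apply: (Cr_add openT) => // y _; last exact: Cr_cst.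
  by apply: (Cr_mul openT) => // w _; [exact: Cr_cst|exact: Cr_coord].
split.
  by apply: (Cr_comp (@open_cube_open R n) (@open_cube_open R n) hA) => // z /hf[].
have main w z : (size w <= r)%N -> open_cube n z ->
    dw w (fun x => f (kappa *: x + a)) z = kappa ^+ size w * dw w f (kappa *: z + a).
  elim: w z => [|i w ih] z /= wr cz; first by rewrite expr0 mul1r.
  have /(pd_ext i (@open_cube_open R n) cz) : forall y, open_cube n y ->
    dw w (fun x => f (kappa *: x + a)) y = kappa ^+ size w * dw w f (kappa *: y + a).
    by move=> y cy; apply: ih => //; exact: ltnW.
  rewrite -/(dw w (fun x => f (kappa *: x + a))) => ->; rewrite -/(dw w f).
  have [c1 _] := hf _ (hA _ cz).
  have : Cr 1 (dw w f) (kappa *: z + a) by apply: Cr_dw; apply: Cr_le c1; rewrite addn1.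
  case=> _ /(_ i)[/derivable_dlim[l hl] _].
  have -> : pd i (dw w f) (kappa *: z + a) = l by have /dlimP[_ <-] := hl.
  apply/derive_dlim; left => e e0.
  have [d [d0 hd]] := hl e e0; exists (d / kappa); split; first exact: divr_gt0.
  move=> h h0 hh; have kh0 : kappa * h <> 0.
    by apply/eqP; rewrite mulf_neq0 ?(gt_eqF k0) //; apply/eqP.
  have := hd (kappa * h) kh0; rewrite normrM (gtr0_norm k0) mulrC -ltr_pdivlMr // => /(_ hh).
  have -> : kappa *: (h *: ee i + z) + a = (kappa * h) *: ee i + (kappa *: z + a).
    by rewrite scalerDr scalerA addrA.
  set D := _ - dw w f _ => hD.
  have kw : 0 < kappa ^+ (size w).+1 <= 1.
    by rewrite exprn_gt0 //= exprn_ile1 // ltW.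
  have -> : h^-1 * (kappa ^+ size w * dw w f (kappa * h *: ee i + (kappa *: z + a)) -
      kappa ^+ size w * dw w f (kappa *: z + a)) - kappa ^+ (size w).+1 * l =
    kappa ^+ (size w).+1 * ((kappa * h)^-1 * D - l).
    rewrite /D exprS; have : h != 0 by apply/eqP. have := gt_eqF k0; move=> /negbT kn0 hn0.
    by field; rewrite hn0 kn0.
  rewrite normrM gtr0_norm; last by case/andP: kw.
  case/andP: kw => kw0 kw1; apply: le_lt_trans hD; rewrite mulrC.
  have := normr_ge0 ((kappa * h)^-1 * D - l).
  by rewrite /= in kw1; nra.
(* Order zero gains no factor [kappa] and relies on the bound 1 for [f]; each higher order gains at
   least one, and [kappa * B <= 1]. *)
apply: dw_bnd => w wr; rewrite main //; case: w wr => [|i w] wr; first by rewrite mul1r f1 //; exact: hA.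
have [_ hb] := hf _ (hA _ cx); have hw := bnd_dw wr hb.
rewrite normrM normrX (gtr0_norm k0) /= exprS -mulrA.
apply: le_trans _ kB; rewrite ler_pM2l //.
have k2 : 0 <= kappa ^+ size w <= 1.
  by apply/andP; split; [exact/exprn_ge0/ltW|apply: exprn_ile1 => //; exact: ltW].
have := normr_ge0 (dw (i :: w) f (kappa *: x + a)); case/andP: k2 => k2 k3.
by rewrite -/(dw (i :: w) f); nra.
Qed.

End Jets.

(** * Substitutions in the first variable *)

Section Substitution.
Context {R : realType}.

Lemma jet_low n r s B (f : 'rV[R]_n -> R) : (s <= r)%N -> jet r B f -> jet s B f.
Proof.
move=> sr hf x cx; have [h1 h2] := hf x cx; split; first exact: Cr_le h1.
by apply: dw_bnd => w ws; apply: bnd_dw h2; exact: leq_trans sr.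
Qed.

Lemma jet_pd n r B i (f : 'rV[R]_n -> R) : jet r.+1 B f -> jet r B (pd i f).
Proof. by move=> hf x /hf[[_ /(_ i)[_ h1]] [_ /(_ i) h2]]. Qed.

Lemma jet_bound n r B (f : 'rV[R]_n -> R) x : jet r B f -> open_cube n x -> `|f x| <= B.
Proof. by move=> hf /hf[_ /bnd0]. Qed.

Variable n : nat.
Implicit Types (F G H : 'rV[R]_n.+1 -> R).

(** The admissible changes of the first variable: their other derivatives vanish, so they depend on
    that variable alone. *)
Definition only_hd r B1 H := [/\ jet r B1 H,
  forall i x, open_cube n.+1 x -> pd (lift ord0 i) H x = 0 &
  forall x, open_cube n.+1 x -> 0 < H x < 1].

Definition subst0 H (x : 'rV[R]_n.+1) : 'rV[R]_n.+1 := cons (H x) (tl x).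

Lemma subst0_cube r B1 H x : only_hd r B1 H -> open_cube n.+1 x -> open_cube n.+1 (subst0 H x).
Proof. by move=> [_ _ h] cx; apply/cube_cons; split; [exact: h|case/cube_hdtl: cx]. Qed.

Lemma subst0_coord H k : (fun z => subst0 H z 0 (lift ord0 k)) = (fun z => z 0 (lift ord0 k)).
Proof. by apply/funext => z; rewrite consS tlE. Qed.

Lemma subst0_hd H : (fun z => subst0 H z 0 ord0) = H.
Proof. by apply/funext => z; rewrite cons0. Qed.

Lemma subst0_Cr r B1 H k x : only_hd r B1 H -> open_cube n.+1 x ->
  Cr r (fun z => subst0 H z 0 k) x.
Proof.
move=> [hH _ _] cx; case: (unliftP ord0 k) => [j|] ->; last by rewrite subst0_hd; case: (hH x cx).
by rewrite subst0_coord; exact: Cr_coord.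
Qed.

Lemma Cr_subst0 r B1 F H x : only_hd r B1 H -> (forall x, open_cube n.+1 x -> Cr r F x) ->
  open_cube n.+1 x -> Cr r (fun z => F (subst0 H z)) x.
Proof.
move=> hH hF cx.
apply: (@Cr_comp R r _ _ _ _ F (subst0 H) (@open_cube_open R _) (@open_cube_open R _)) => //.
  by move=> y cy; exact: subst0_cube hH cy.
by move=> k y cy; exact: subst0_Cr hH cy.
Qed.

Lemma pd_subst0 B1 F H i x : only_hd 1 B1 H -> (forall x, open_cube n.+1 x -> Cr 1 F x) ->
  open_cube n.+1 x -> pd i (fun z => F (subst0 H z)) x =
  pd i F (subst0 H x) * (if i == ord0 then pd ord0 H x else 1).
Proof.
move=> hH hF cx.
have [_ ->] := @pd_comp R _ _ (open_cube n.+1) (open_cube n.+1) F (subst0 H) i x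
   (@open_cube_open R _) (subst0_cube hH cx) hF
   (fun k => let h := subst0_Cr k hH cx in (proj2 h i).1).
rewrite big_ord_recl subst0_hd.
have E k : pd i (fun z => subst0 H z 0 (lift ord0 k)) x = (i == lift ord0 k)%:R.
  by rewrite subst0_coord; case: (pd_coord i (lift ord0 k) x).
rewrite (eq_bigr (fun k => pd (lift ord0 k) F (subst0 H x) * (i == lift ord0 k)%:R)); last first.
  by move=> k _; rewrite E.
case: (unliftP ord0 i) => [j|] ->.
  have -> : (lift ord0 j == ord0 :> 'I_n.+1) = false by [].
  case: hH => _ -> // _; rewrite mulr0 add0r (bigD1 j) //= eqxx big1 ?addr0 // => k kj.
  by rewrite (inj_eq lift_inj) eq_sym (negPf kj) mulr0.
rewrite eqxx big1 ?addr0 // => k _.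
by rewrite (negPf (neq_lift _ _)) mulr0.
Qed.

(** The substitution is the identity in the other variables, so no derivative of [H] appears. *)
Lemma dw_subst0 r B1 F H v x : only_hd r.+1 B1 H -> (forall x, open_cube n.+1 x -> Cr r F x) ->
  all (fun i => i != ord0) v -> (size v <= r)%N -> open_cube n.+1 x ->
  dw v (fun z => F (subst0 H z)) x = dw v F (subst0 H x).
Proof.
move=> hH hF; elim: v x => //= i v ih x /andP[i0 v0] vr cx.
rewrite -!/(dw v _) (pd_ext i (@open_cube_open R _) cx (fun y cy => ih y v0 (ltnW vr) cy)).
have hH1 : only_hd 1 B1 H by case: hH => h1 h2 h3; split=> //; exact: jet_low h1.
rewrite (pd_subst0 _ hH1) ?(negPf i0) ?mulr1 // => y cy.
by apply: Cr_dw; apply: Cr_le (hF y cy); rewrite addn1.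
Qed.

(* The shape of the chain rule for iterated derivatives: the coefficients are
   controlled by [H] only, and the leading one is a power of the derivative. *)
Lemma expand_subst0 a s B1 : exists C, forall G H, only_hd (a + s) B1 H ->
  (forall x, open_cube n.+1 x -> Cr (a + s) G x) ->
  exists p : nat -> 'rV[R]_n.+1 -> R,
  [/\ forall b, jet s C (p b), forall x, open_cube n.+1 x -> p a x = pd ord0 H x ^+ a &
      forall x, open_cube n.+1 x -> dw (nseq a ord0) (fun z => G (subst0 H z)) x =
        \sum_(b < a.+1) dw (nseq b ord0) G (subst0 H x) * p b x].
Proof.
elim: a s => [|a ih] s.
  exists 1 => G H hH hG; exists (fun _ _ => 1); split.
  - by move=> b; apply: jet_cst; rewrite normr1.
  - by move=> x _; rewrite expr0.
  - by move=> x _; rewrite big_ord1 mulr1.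
have [C hC] := ih s.+1; have [K hK] := @jet_mul R n.+1 s B1 C.
exists (Num.max (`|K|) 0 + Num.max C 0) => G H; rewrite addSnnS => hH hG.
have [p [pj pa pE]] := hC G H hH hG.
(* Leibniz rule: [p1] collects the terms where [G] is differentiated once more, [p2] those where the
   coefficient is. The latter lose one order, hence the use of the induction hypothesis at
   [s.+1]. *)
pose p1 b := if b is b'.+1 then (fun x => pd ord0 H x * p b' x) else fun=> 0.
pose p2 b := if (b < a.+1)%N then pd ord0 (p b) else fun=> 0.
have hH1 : only_hd 1 B1 H by case: hH => h1 h2 h3; split=> //; apply: jet_low h1; lia.
have jH : jet s B1 (pd ord0 H) by apply: jet_pd; case: hH => h _ _; apply: jet_low h; lia.
have j1 b : jet s (Num.max (`|K|) 0) (p1 b).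
  case: b => [|b] /=; first by apply: jet_cst; rewrite normr0 le_max lexx orbT.
  apply: (jet_le (B := K)); first by rewrite le_max ler_norm.
  by apply: hK => //; apply: jet_low (pj b).
have j2 b : jet s (Num.max C 0) (p2 b).
  rewrite /p2; case: ifP => _; last by apply: jet_cst; rewrite normr0 le_max lexx orbT.
  by apply: (jet_le (B := C)); [rewrite le_max lexx|exact: jet_pd].
exists (fun b x => p1 b x + p2 b x); split.
- by move=> b; exact: jet_add.
- by move=> x cx; rewrite /p1 /p2 ltnn addr0 pa // exprS.
move=> x cx; pose g b := dw (nseq b ord0) G.
have hg b y : (b < a.+1)%N -> open_cube n.+1 y -> Cr 1 (g b) y.
  move=> ba cy; apply: Cr_dw; rewrite size_nseq; apply: Cr_le (hG y cy); lia.
pose h (b : 'I_a.+1) z := g b (subst0 H z) * p b z.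
rewrite -[LHS]/(pd ord0 (dw (nseq a ord0) (fun z => G (subst0 H z))) x).
have -> : pd ord0 (dw (nseq a ord0) (fun z => G (subst0 H z))) x = pd ord0 (\sum_(b < a.+1) h b) x.
  apply: (pd_ext _ (@open_cube_open R _) cx) => y cy; rewrite pE // fct_sumE.
  by apply: eq_bigr.
have dg (b : 'I_a.+1) : derivable (fun z => g b (subst0 H z)) x (ee ord0).
  have := @Cr_subst0 1 B1 (g b) H x hH1 (fun y => @hg b y (ltn_ord b)) cx.
  by case=> _ /(_ ord0)[].
have dp (b : 'I_a.+1) : derivable (p b) x (ee ord0).
  by have [[_ /(_ ord0)[]]] := pj b x cx.
have dh (b : 'I_a.+1) : derivable (h b) x (ee ord0) by exact: derivableM.
rewrite /pd derive_sum //.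
rewrite (eq_bigr (fun b : 'I_a.+1 => g b.+1 (subst0 H x) * (pd ord0 H x * p b x) +
   g b (subst0 H x) * pd ord0 (p b) x)); last first.
  move=> b _; rewrite -[LHS]/('D_(ee ord0) ((fun z => g b (subst0 H z)) * p b) x) deriveM //.
  rewrite -!/(pd ord0 _ x) (pd_subst0 _ hH1) //; last by move=> y; exact: hg.
  by rewrite eqxx -[g b.+1]/(pd ord0 (g b)) /GRing.scale /=; ring.
rewrite big_split /= [in RHS](eq_bigr (fun b : 'I_a.+2 => g b (subst0 H x) * p1 b x +
   g b (subst0 H x) * p2 b x)); last by move=> b _; rewrite mulrDr.
rewrite [RHS]big_split /=; congr (_ + _).
  by rewrite [RHS]big_ord_recl /= mulr0 add0r; apply: eq_bigr => b _.
rewrite [RHS]big_ord_recr /= /p2 ltnn mulr0 addr0; apply: eq_bigr => b _.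
by rewrite ltn_ord.
Qed.

(** In the expansion of [expand_subst0], the derivatives of order [j.+1] in the first variable, the
    only ones without a bound, carry the factor [pd ord0 H x ^+ j.+1]. A substitution slow enough
    where they are large thus gains one order. *)
Lemma subst0_bound r j B B1 C : exists B', forall F H,
  (forall x, open_cube n.+1 x -> Cr r F x) -> only_hd r.+1 B1 H ->
  (forall w x, open_cube n.+1 x -> (size w <= r)%N -> (count_mem ord0 w <= j)%N -> `|dw w F x| <= B) ->
  (forall v x, open_cube n.+1 x -> all (fun i => i != ord0) v -> (j.+1 + size v <= r)%N ->
     `|dw (nseq j.+1 ord0 ++ v) F (subst0 H x)| * `|pd ord0 H x| ^+ j.+1 <= C) ->
  forall w x, open_cube n.+1 x -> (size w <= r)%N -> (count_mem ord0 w <= j.+1)%N ->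
    `|dw w (fun z => F (subst0 H z)) x| <= B'.
Proof.
have [Cf hCf] := choice (fun a => expand_subst0 a 0 B1).
(* The sum over all [a] makes the constant independent of the word [w]. *)
exists (\sum_(a < j.+2) \sum_(b < a.+1) (`|B| * `|Cf a| + `|C|)).
move=> F H hF hH hB hC w x cx wr wj.
rewrite (dw_normal (@open_cube_open R _)) //; last first.
  move=> y cy; apply: (@Cr_subst0 (size w) B1) => //.
    by case: hH => h1 h2 h3; split=> //; apply: jet_low h1; exact: leqW.
  by move=> z cz; apply: Cr_le (hF z cz).
set a := count_mem _ _; set v := [seq _ <- _ | _].
have av : (a + size v = size w)%N by rewrite /v size_filter count_predC.
have v0 : all (fun i => i != ord0) v by apply/allP => i; rewrite mem_filter => /andP[].
rewrite dw_cat (dw_ext _ (@open_cube_open R _) (fun y cy => dw_subst0 hH hF v0 _ cy)) //; last by lia.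
have [||p [pj pa pE]] := hCf a (dw v F) H.
- by case: hH => h1 h2 h3; split=> //; apply: jet_low h1; lia.
- by move=> y cy; apply: Cr_dw; apply: Cr_le (hF y cy); rewrite addn0 addnC av.
rewrite pE //.
have aj : (a < j.+2)%N by rewrite ltnS.
apply: le_trans (ler_norm_sum _ _ _) _.
rewrite (bigD1 (Ordinal aj)) //=; apply: (@le_trans _ _ (\sum_(b < a.+1) (`|B| * `|Cf a| + `|C|))); last first.
  by rewrite lerDl; apply: sumr_ge0 => i _; apply: sumr_ge0 => k _; rewrite addr_ge0 ?mulr_ge0.
apply: ler_sum => b _; rewrite normrM.
have cs := subst0_cube hH cx.
have [bj|bj] := leqP b j.
  apply: ler_wpDr => //; apply: ler_pM => //.
    apply: le_trans (ler_norm B); rewrite -dw_cat; apply: hB => //.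
      by rewrite size_cat size_nseq; have := ltn_ord b; lia.
    rewrite count_cat count_nseq /= mul1n.
    rewrite (_ : count_mem ord0 v = 0%N) ?addn0 //; apply/eqP; rewrite eqn0Ngt -has_count.
    by apply/hasPn => i /(allP v0).
  by apply: le_trans (ler_norm (Cf a)); exact: jet_bound (pj b) cx.
have bE : nat_of_ord b = j.+1 by have := ltn_ord b; lia.
have aE : a = j.+1 by have := ltn_ord b; lia.
rewrite bE -{2}aE pa // aE normrX -dw_cat; apply: ler_wpDl; first by rewrite mulr_ge0.
by apply: le_trans (ler_norm C); apply: hC => //; lia.
Qed.

End Substitution.

(** * Reparametrizations *)

Section Solutions.
Context {R : realType}.
Implicit Types (T U W : dtype R) (J : finType).

Definition dpt U : U := ddec U (nseq (ddim U) 0).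

(** Slices of constant first coordinate are sent into such slices, so bounds on the derivatives
    along slices are kept by composition. *)
Definition tri n (phi : 'rV[R]_n.+1 -> 'rV[R]_n.+1) := forall z z',
  open_cube n.+1 z -> open_cube n.+1 z' -> hd z = hd z' -> hd (phi z) = hd (phi z').

(** No bound is put on [phi] itself; when it must be controlled, its coordinates are included among
    the functions [F j]. *)
Definition good n r B J (X : set 'rV[R]_n.+1) (F : J -> 'rV[R]_n.+1 -> R)
    (phi : 'rV[R]_n.+1 -> 'rV[R]_n.+1) : Prop :=
  [/\ forall z, open_cube n.+1 z -> X (phi z), tri phi &
      forall j, jet r B (fun z => F j (phi z))].

(* A bounded reparametrization of the family [F], over the family of domains
   [X]: the maps belong to one definable family [Phi], but their parameters
   need not depend definably on [t]. *)
Definition Sol n r T J (X : T -> set 'rV[R]_n.+1) (F : J -> T -> 'rV[R]_n.+1 -> R) : Prop :=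
  exists (U : dtype R) (Phi : U -> 'rV[R]_n.+1 -> 'rV[R]_n.+1) (N : nat) (B : R),
    defm (fun p => Phi p.1 p.2) /\
    forall t, exists us : nat -> U, forall x, X t x ->
      exists2 i, (i < N)%N & good r B (X t) (fun j => F j t) (Phi (us i)) /\
        exists2 z, open_cube n.+1 z & Phi (us i) z = x.

Lemma good_le n r B B' J (X X' : set 'rV[R]_n.+1) (F : J -> 'rV[R]_n.+1 -> R) phi :
  B <= B' -> X `<=` X' -> good r B X F phi -> good r B' X' F phi.
Proof.
by move=> BB' XX' [h1 h2 h3]; split=> // [z /h1/XX'//|j]; exact: jet_le (h3 j).
Qed.

Lemma Sol_ext n r T J (X X' : T -> set 'rV[R]_n.+1) (F : J -> T -> 'rV[R]_n.+1 -> R) :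
  (forall t x, X t x <-> X' t x) -> Sol r X F -> Sol r X' F.
Proof.
move=> XX'; have -> // : X = X'.
by apply/funext => t; apply/funext => x; apply/propext.
Qed.

Lemma Sol_empty n r T J (X : T -> set 'rV[R]_n.+1) (F : J -> T -> 'rV[R]_n.+1 -> R) :
  (forall t x, ~ X t x) -> Sol r X F.
Proof.
move=> X0; exists T, (fun _ z => z), 0%N, 0; split; first by ddef.
by move=> t; exists (fun=> t) => x /X0.
Qed.

(** A real flag joins the two families of maps into one definable family; each map keeps its own
    parameter and gets a dummy one. *)
Lemma Sol_union n r T J (X X1 X2 : T -> set 'rV[R]_n.+1) (F : J -> T -> 'rV[R]_n.+1 -> R) :
  (forall t x, X t x <-> X1 t x \/ X2 t x) -> Sol r X1 F -> Sol r X2 F -> Sol r X F.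
Proof.
move=> hX [U1 [P1 [N1 [B1 [d1 h1]]]]] [U2 [P2 [N2 [B2 [d2 h2]]]]].
exists (prod_dtype (prod_dtype U1 U2) real_dtype),
  (fun u z => if `[< u.2 = 0 >] then P1 u.1.1 z else P2 u.1.2 z), (N1 + N2)%N, (Num.max B1 B2).
split; first by ddef.
move=> t; have [us1 g1] := h1 t; have [us2 g2] := h2 t.
exists (fun i => if (i < N1)%N then (us1 i, dpt U2, 0) else (dpt U1, us2 (i - N1)%N, 1)) => x /hX[/g1|/g2] [i il [hg hz]].
  exists i; first exact: ltn_addr; rewrite il.
  split; last by case: hz => z cz e; exists z => //=; rewrite asboolT.
  rewrite (_ : (fun z => _) = P1 (us1 i)); last by apply/funext => z /=; rewrite asboolT.
  by apply: good_le hg; [rewrite le_max lexx|move=> y Xy; apply/hX; left].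
exists (N1 + i)%N; first by rewrite ltn_add2l.
rewrite ltnNge leq_addr /= addKn.
have n10 : (1 : R) <> 0 by apply/eqP; exact: oner_neq0.
split; last by case: hz => z cz e; exists z => //=; rewrite asboolF.
rewrite (_ : (fun z => _) = P2 (us2 i)); last by apply/funext => z /=; rewrite asboolF.
by apply: good_le hg; [rewrite le_max lexx orbT|move=> y Xy; apply/hX; right].
Qed.

Lemma Sol_bigU n r T J K (X : T -> set 'rV[R]_n.+1) (Xk : nat -> T -> set 'rV[R]_n.+1)
    (F : J -> T -> 'rV[R]_n.+1 -> R) :
  (forall t x, X t x <-> exists2 k, (k < K)%N & Xk k t x) ->
  (forall k, (k < K)%N -> Sol r (Xk k) F) -> Sol r X F.
Proof.
elim: K X => [|K ih] X hX hS.
  by apply: Sol_empty => t x /hX[].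
apply: (@Sol_union _ _ _ _ _ (fun t => [set x | exists2 k, (k < K)%N & Xk k t x]) (Xk K)).
- move=> t x; rewrite hX; split.
    move=> [k]; rewrite ltnS leq_eqVlt => /predU1P[->|kK] h; first by right.
    by left; exists k.
  by case=> [[k kK h]|h]; [exists k => //; exact: ltnW|exists K].
- by apply: ih => // k kK; apply: hS; exact: ltnW.
- exact: hS.
Qed.

(** Used to turn a map on a cube of smaller dimension into one on a larger cube that ignores some
    coordinates. *)
Definition rho m n (sg : 'I_m -> 'I_n) (x : 'rV[R]_n) : 'rV[R]_m := \row_i x 0 (sg i).

Lemma rho_cube m n (sg : 'I_m -> 'I_n) x : open_cube n x -> open_cube m (rho sg x).
Proof. by move=> cx i; rewrite mxE. Qed.

Lemma rho_onto m n (sg : 'I_m -> 'I_n) z : injective sg -> open_cube m z ->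
  exists2 x, open_cube n x & rho sg x = z.
Proof.
move=> isg cz; exists (\row_k (if [pick i | sg i == k] is Some i then z 0 i else 2^-1)).
  by move=> k; rewrite mxE; case: pickP => [i _|_]; [exact: cz|lra].
apply/rowP => i; rewrite !mxE; case: pickP => [j /eqP /isg -> //|/(_ i)].
by rewrite eqxx.
Qed.

Lemma defm_rho T m n (sg : 'I_m -> 'I_n) (f : T -> 'rV[R]_n) : defm f -> defm (fun t => rho sg (f t)).
Proof. by move=> df; apply: defm_row => i; ddef. Qed.

Lemma jet_rho m n r B (sg : 'I_m -> 'I_n) : exists B', forall f : 'rV[R]_m -> R, jet r B f ->
  jet r B' (fun x => f (rho sg x)).
Proof.
have [B' h] := @jet_comp R r n m B 1; exists B' => f hf; apply: h => //.
  by move=> x cx; exact: rho_cube.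
by move=> k; apply: jet_ext (@jet_coord R n r (sg k)) => x _; rewrite mxE.
Qed.

(** The transfer principle behind every reduction: a bounded number of maps [g (t, w)] cover [X t],
    and the problem is pulled back along them. The data [w] are added to the parameter [t], so the
    bounds of the pulled-back problem do not depend on them. *)
Lemma Sol_img n n' r T W J (X : T -> set 'rV[R]_n.+1) (F : J -> T -> 'rV[R]_n.+1 -> R)
    (X' : T * W -> set 'rV[R]_n'.+1) (g : T * W -> 'rV[R]_n'.+1 -> 'rV[R]_n.+1)
    (sg : 'I_n'.+1 -> 'I_n.+1) : injective sg -> defm (fun p => g p.1 p.2) ->
  (exists N, forall t, exists ws : nat -> W, forall x, X t x ->
     exists2 i, (i < N)%N & exists2 x', X' (t, ws i) x' & g (t, ws i) x' = x) ->
  (forall tw x', X' tw x' -> X tw.1 (g tw x')) ->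
  (forall tw phi, tri phi -> (forall z, open_cube n'.+1 z -> X' tw (phi z)) ->
     tri (fun z => g tw (phi (rho sg z)))) ->
  Sol r X' (fun j tw x' => F j tw.1 (g tw x')) -> Sol r X F.
Proof.
move=> isg dg [N0 hN0] hX htri [U [Phi [N1 [B [dPhi hPhi]]]]].
have [B' hB'] := @jet_rho n'.+1 n.+1 r B sg.
exists (prod_dtype (prod_dtype T W) U), (fun u z => g u.1 (Phi u.2 (rho sg z))), (N0 * N1)%N, B'.
split.
  apply: (@defm_comp2 _ _ _ _ _ g) => //; first by ddef.
  by apply: (@defm_comp2 _ _ _ _ _ Phi) => //; [ddef|apply: defm_rho; ddef].
move=> t; have [ws hws] := hN0 t.
have [us hus] := choice (fun i => hPhi (t, ws i)).
(* Quotient and remainder by [N1] code the pair formed by a covering map and a reparametrization of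
   its source. *)
exists (fun m => ((t, ws (m %/ N1)%N), us (m %/ N1)%N (m %% N1)%N)) => x /hws[i iN [x' Xx' <-]].
have [k kN [[h1 h2 h3] [z cz e]]] := hus i x' Xx'.
have N10 : (0 < N1)%N by exact: leq_ltn_trans kN.
exists (i * N1 + k)%N.
  by rewrite (leq_trans (_ : _ < i * N1 + N1)%N) ?ltn_add2l // addnC -mulSn leq_mul2r iN orbT.
rewrite divnMDl // divn_small // addn0 modnMDl modn_small //.
split; last first.
  have [y cy yz] := rho_onto isg cz; exists y => //=.
  by rewrite yz e.
split.
- by move=> y cy /=; apply: (hX (t, ws i)); apply: h1; exact: rho_cube.
- exact: (htri (t, ws i)).
- by move=> j /=; exact: (hB' _ (h3 j)).
Qed.

(** The induction statement, in [k.+1] variables. The interval [[0, 1]] is a normalization; other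
    bounded functions go through [nrm]. *)
Definition Pn k r := forall T J (X : T -> set 'rV[R]_k.+1) (F : J -> T -> 'rV[R]_k.+1 -> R),
  def (fun p => X p.1 p.2) -> (forall j, defm (fun p => F j p.1 p.2)) ->
  (forall t x, X t x -> open_cube k.+1 x) -> (forall j t x, X t x -> 0 <= F j t x <= 1) ->
  Sol r X F.

(** The value of the first coordinate becomes a parameter, which leaves one variable less; [tri] is
    automatic because the first coordinate is constant. *)
Lemma Sol_fib k r T J (X : T -> set 'rV[R]_k.+2) (F : J -> T -> 'rV[R]_k.+2 -> R) (E : T -> R -> Prop) N :
  Pn k r -> def (fun p => X p.1 p.2) -> (forall j, defm (fun p => F j p.1 p.2)) ->
  (forall t x, X t x -> open_cube k.+2 x) -> (forall j t x, X t x -> 0 <= F j t x <= 1) ->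
  (forall t, fbound (U := real_dtype) N (E t)) -> (forall t x, X t x -> E t (hd x)) -> Sol r X F.
Proof.
move=> hP dX dF cX F01 bE XE.
apply: (@Sol_img _ _ r T real_dtype J X F (fun tc y => X tc.1 (cons tc.2 y))
  (fun tc y => cons tc.2 y) (lift ord0)).
- exact: lift_inj.
- by ddef.
- exists N => t; have [e he] := bE t; exists e => x Xx.
  have [i iN ei] := he _ (XE _ _ Xx); exists i => //; exists (tl x); rewrite /= ei cons_hd_tl //.
- by [].
- by move=> [t c] phi _ _ z z' _ _ _; rewrite !hd_cons.
- apply: hP.
  + by ddef.
  + by move=> j; ddef.
  + by move=> [t c] y /= /cX /cube_cons[].
  + by move=> j [t c] y /=; exact: F01.
Qed.

Lemma fbound_seq (V : eqType) U (f : V -> U) (s : seq V) N (Y : U -> Prop) : (size s <= N)%N ->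
  (forall y, Y y -> exists2 v, v \in s & f v = y) -> fbound N Y.
Proof.
case: s => [|v0 s] sN h; first by exists (fun=> dpt U) => y /h[].
exists (fun i => f (nth v0 (v0 :: s) i)) => y /h[v vs <-].
by exists (index v (v0 :: s)); rewrite ?nth_index // (leq_trans _ sN) // index_mem.
Qed.

Lemma def_bdpt T (X : T -> R -> Prop) : def (fun p => X p.1 p.2) ->
  def (fun p : T * R => bdpt (X p.1) p.2).
Proof.
move=> dX; apply: (@def_ext _ _ (fun p : T * R => forall e : R, 0 < e -> exists y z : R,
  (`|y - p.2| < e) /\ (`|z - p.2| < e) /\ X p.1 y /\ ~ X p.1 z)); last by ddef.
move=> [t x]; split=> h e /h [y [z]]; first by move=> [? [? [? ?]]]; exists y, z; split.
by move=> [? ? ? ?]; exists y, z.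
Qed.

(* A segment may degenerate to a point, when its end points coincide. *)
Lemma def_segments T (X : T -> R -> Prop) : def (fun p => X p.1 p.2) ->
  (forall t z, X t z -> 0 < z < 1) ->
  exists N (c : nat -> T -> R * R), (forall i, defm (c i)) /\
    forall t z, X t z -> exists2 i, (i < N)%N &
      [/\ 0 <= (c i t).1 <= 1, 0 <= (c i t).2 <= 1,
        forall a, 0 < a < 1 -> X t ((1 - a) * (c i t).1 + a * (c i t).2) &
        exists2 a, 0 < a < 1 & z = (1 - a) * (c i t).1 + a * (c i t).2].
Proof.
move=> dX X01; have dB := def_bdpt dX; have [N hN] := bdpt_fin dX.
pose spec t (a : R) := a = 0 \/ a = 1 \/ bdpt (X t) a.
pose Y t (ab : R * R) := [/\ spec t ab.1, spec t ab.2, 0 <= ab.1 <= 1, 0 <= ab.2 <= 1 &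
  forall a, 0 < a < 1 -> X t ((1 - a) * ab.1 + a * ab.2)].
have dS : def (fun p : T * R => spec p.1 p.2).
  by rewrite /spec; apply: def_or; [ddef|apply: def_or; [ddef|exact: dB]].
have dY : def (fun p : T * (R * R) => Y p.1 p.2).
  apply: (@def_ext _ _ (fun p : T * (R * R) => spec p.1 p.2.1 /\ spec p.1 p.2.2 /\
    0 <= p.2.1 <= 1 /\ 0 <= p.2.2 <= 1 /\
    forall a : R, 0 < a < 1 -> X p.1 ((1 - a) * p.2.1 + a * p.2.2))).
    by move=> [t [a b]]; split=> [[? [? [? [? ?]]]]|[? ? ? ? ?]].
  by ddef.
have [|c dc hc] := @def_enum R T (prod_dtype real_dtype real_dtype) ((N + 2) * (N + 2)) Y dY.
- move=> t; have [s sN hs] := hN t.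
  apply: (@fbound_seq (R * R)%type (prod_dtype real_dtype real_dtype) (fun v => v) [seq (a, b) | a <- [:: 0, 1 & s], b <- [:: 0, 1 & s]]).
    by rewrite size_allpairs /= !addn2 leq_mul.
  have hsp a : spec t a -> a \in [:: 0, 1 & s].
    by rewrite !inE => -[->|[->|/hs ->]]; rewrite ?eqxx ?orbT.
  move=> [a b] [/hsp ha /hsp hb _ _ _]; exists (a, b) => //.
  by apply/allpairsP; exists (a, b).
exists ((N + 2) * (N + 2))%N, c; split=> // t z Xz.
suff [ab Yab [a a01 za]] : exists2 ab, Y t ab & exists2 a, 0 < a < 1 & z = (1 - a) * ab.1 + a * ab.2.
  have [i iN ci] := hc t ab Yab; exists i => //; rewrite ci.
  by case: Yab => _ _ h1 h2 h3; split=> //; exists a.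
have z01 := X01 t z Xz.
have [Bz|nBz] := pselect (bdpt (X t) z).
  exists (z, z); last by exists 2^-1 => /=; lra.
  split=> /=; rewrite ?/spec; try by tauto.
  - by lra.
  - by lra.
  - by move=> a _; rewrite (_ : _ + _ = z) //; ring.
have [s _ hs] := hN t.
(* The nearest candidates on the two sides of [z]: no boundary point lies between them, so the open
   segment is inside [X t]. *)
have [|lo [_ [Slo loz] hlo]] := @finite_max R (fun w => spec t w /\ w < z) [:: 0, 1 & s].
  by exists 0; rewrite ?mem_head //; split; [left|case/andP: z01].
have [|hi [_ [Shi zhi] hhi]] := @finite_min R (fun w => spec t w /\ z < w) [:: 0, 1 & s].
  by exists 1; rewrite ?inE ?eqxx ?orbT //; split; [right; left|case/andP: z01].
have lo0 : 0 <= lo by apply: hlo; rewrite ?mem_head //; split; [left|lra].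
have hi1 : hi <= 1 by apply: hhi; rewrite ?inE ?eqxx ?orbT //; split; [right; left|lra].
have lohi : lo < hi by lra.
exists (lo, hi).
  split=> //=; try by lra.
  move=> a a01; apply: (@bdpt_between R (X t) z _ lo hi) => //; first by rewrite loz.
    by nra.
  move=> w /andP[low whi] Bw; have ws : w \in [:: 0, 1 & s] by rewrite !inE hs ?orbT.
  have Sw : spec t w by right; right.
  have [wz|zw|wz] := ltgtP w z.
  - by have := hlo w ws (conj Sw wz); lra.
  - by have := hhi w ws (conj Sw zw); lra.
  - by apply: nBz; rewrite -wz.
exists ((z - lo) / (hi - lo)) => /=.
  by rewrite divr_gt0 ?subr_gt0 //= ltr_pdivrMr ?subr_gt0 // mul1r ltrD2r.
by field; rewrite subr_eq0 gt_eqF.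
Qed.

(** The second coordinate [mid] is split off and the first one kept in the base, for the sake of
    [tri]. *)
Definition base n (x : 'rV[R]_n.+2) : 'rV[R]_n.+1 := cons (hd x) (tl (tl x)).
Definition mid n (x : 'rV[R]_n.+2) : R := hd (tl x).
Definition mk n (b : 'rV[R]_n.+1) (z : R) : 'rV[R]_n.+2 := cons (hd b) (cons z (tl b)).

Lemma mkK n (x : 'rV[R]_n.+2) : mk (base x) (mid x) = x.
Proof. by rewrite /mk /base /mid hd_cons tl_cons !cons_hd_tl. Qed.
Lemma base_mk n (b : 'rV[R]_n.+1) z : base (mk b z) = b.
Proof. by rewrite /base /mk hd_cons !tl_cons cons_hd_tl. Qed.
Lemma mid_mk n (b : 'rV[R]_n.+1) z : mid (mk b z) = z.
Proof. by rewrite /mid /mk tl_cons hd_cons. Qed.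

Lemma cube_mk n (b : 'rV[R]_n.+1) z : open_cube n.+2 (mk b z) <-> open_cube n.+1 b /\ 0 < z < 1.
Proof.
rewrite /mk cube_cons cube_cons (cube_hdtl b); tauto.
Qed.

Definition sgbase n (i : 'I_n.+1) : 'I_n.+2 :=
  if unlift ord0 i is Some j then lift ord0 (lift ord0 j) else ord0.

Lemma sgbase_inj n : injective (@sgbase n).
Proof.
move=> i j; rewrite /sgbase; case: (unliftP ord0 i) => [a|] ->; case: (unliftP ord0 j) => [b|] -> //.
by move=> /lift_inj/lift_inj ->.
Qed.

Lemma rho_base n (x : 'rV[R]_n.+2) : rho (@sgbase n) x = base x.
Proof.
apply/rowP => i; rewrite mxE /sgbase; case: (unliftP ord0 i) => [j|] ->.
  by rewrite consS !tlE.
by rewrite cons0.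
Qed.

(** In the direction of the second coordinate, fibres are unions of boundedly many segments with
    definable end points. The induction hypothesis regularizes the base point together with the end
    points; affine interpolation, a polynomial in these data and one new variable, fills the
    segments. *)
Lemma Sol_id k r T (X : T -> set 'rV[R]_k.+2) : Pn k r -> def (fun p => X p.1 p.2) ->
  (forall t x, X t x -> open_cube k.+2 x) -> Sol r X (fun (j : 'I_k.+2) t x => x 0 j).
Proof.
move=> hP dX cX.
pose P (tb : T * 'rV[R]_k.+1) z := X tb.1 (mk tb.2 z).
have dmk : defm (fun p : 'rV[R]_k.+1 * R => mk p.1 p.2) by rewrite /mk; ddef.
have dP : def (fun p => P p.1 p.2) by rewrite /P; ddef.
have [|N [c [dc hc]]] := def_segments dP; first by move=> [t b] z /cX /cube_mk[].
pose dom i t b := [/\ open_cube k.+1 b, 0 <= (c i (t, b)).1 <= 1, 0 <= (c i (t, b)).2 <= 1 &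
   forall a, 0 < a < 1 -> X t (mk b ((1 - a) * (c i (t, b)).1 + a * (c i (t, b)).2))].
pose Xi i t : set 'rV[R]_k.+2 := fun x => dom i t (base x) /\ exists2 a, 0 < a < 1 &
   mid x = (1 - a) * (c i (t, base x)).1 + a * (c i (t, base x)).2.
apply: (@Sol_bigU _ _ _ _ N X Xi).
  move=> t x; split.
    move=> Xx; have Px : P (t, base x) (mid x) by rewrite /P /= mkK.
    have [i iN [h1 h2 h3 h4]] := hc _ _ Px; exists i => //; split=> //; split=> //.
    by have /cX := Xx; rewrite -{1}(mkK x) => /cube_mk[].
  by case=> i iN [[h1 h2 h3 h4] [a a01 e]]; rewrite -(mkK x) e; exact: h4.
move=> i _.
pose J : finType := ('I_k.+1 + bool)%type.
pose F (j : J) t b := match j with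
  | inl j' => (b : 'rV[R]_k.+1) 0 j' | inr true => (c i (t, b)).1 | inr false => (c i (t, b)).2 end.
have dc' := dc i.
have [||||U [Phi [N1 [B [dPhi hPhi]]]]] := hP T J (fun t => [set b | dom i t b]) F.
- apply: (@def_ext _ _ (fun p : T * 'rV[R]_k.+1 => open_cube k.+1 p.2 /\ 0 <= (c i p).1 <= 1 /\ 0 <= (c i p).2 <= 1 /\
    forall a : R, 0 < a < 1 -> X p.1 (mk p.2 ((1 - a) * (c i p).1 + a * (c i p).2)))).
    by move=> [t b]; split=> [[? [? [? ?]]]|[? ? ? ?]].
  by rewrite /open_cube /=; ddef.
- by move=> [j|[]] /=; ddef.
- by move=> t b [].
- move=> [j|[]] t b [cb h1 h2 _] //=; have := cb j; lra.
have [B1 hB1] := @jet_rho _ _ r B (@sgbase k).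
have [B3 hB3] := @jet_mul R k.+2 r 1 1.
have [B2 hB2] := @jet_mul R k.+2 r (1 + `|B3|) B1.
have dbase : defm (@base k) by rewrite /base; ddef.
have dmid : defm (@mid k) by rewrite /mid; ddef.
exists (prod_dtype T U), (fun u x => let b := Phi u.2 (base x) in
  mk b ((1 - mid x) * (c i (u.1, b)).1 + mid x * (c i (u.1, b)).2)), N1, (Num.max B1 (B2 + B2)).
split; first by rewrite /=; ddef.
move=> t; have [us hus] := hPhi t; exists (fun m => (t, us m)) => x [dx [a a01 xa]].
have [m mN [[h1 h2 h3] [z cz e]]] := hus _ dx; exists m => //=.
have cbase (y : 'rV[R]_k.+2) : open_cube k.+2 y -> open_cube k.+1 (base y) /\ 0 < mid y < 1.
  by rewrite -{1}(mkK y) => /cube_mk.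
split; last first.
  exists (mk z a); first by apply/cube_mk.
  by rewrite base_mk mid_mk e -xa mkK.
split.
- move=> y /cbase [cb m01] /=; rewrite /Xi base_mk mid_mk; split; first exact: h1.
  by exists (mid y).
- move=> y y' /cbase[cb _] /cbase[cb' _] hyy'; rewrite /mk !hd_cons; apply: h2 => //.
  by rewrite /base !hd_cons.
have jb : forall j, jet r B1 (fun y => F j t (Phi (us m) (base y))).
  move=> j; apply: jet_ext (hB1 _ (h3 j)) => y _.
  by rewrite rho_base.
have jm0 : jet r 1 (@mid k).
  apply: jet_ext (@jet_coord R k.+2 r (lift ord0 ord0)) => y _.
  by rewrite /mid /hd tlE.
have jm1 : jet r (1 + `|B3|) (fun y => 1 - @mid k y).
  have hp1 : `|1 : R| <= 1 by rewrite normr1.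
  have hN1 : `|-1 : R| <= 1 by rewrite normrN normr1.
  have := jet_le (ler_norm B3) (hB3 _ _ (@jet_cst R _ _ _ _ hN1) jm0).
  by move=> /(jet_add (@jet_cst R _ _ _ _ hp1)); apply: jet_ext => y _; rewrite mulN1r.
have jm : jet r (1 + `|B3|) (@mid k) by apply: jet_le jm0; rewrite lerDl.
move=> j /=; case: (unliftP ord0 j) => [j'|] ->; last first.
  apply: (jet_le (B := B1)); first by rewrite le_max lexx.
  by apply: jet_ext (jb (inl ord0)) => y _; rewrite /mk cons0.
case: (unliftP ord0 j') => [j''|] ->.
  apply: (jet_le (B := B1)); first by rewrite le_max lexx.
  by apply: jet_ext (jb (inl (lift ord0 j''))) => y _; rewrite /mk !consS tlE.
apply: (jet_le (B := B2 + B2)); first by rewrite le_max lexx orbT.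
apply: jet_ext (jet_add (hB2 _ _ jm1 (jb (inr true))) (hB2 _ _ jm (jb (inr false)))) => y _.
by rewrite /mk consS cons0.
Qed.

End Solutions.



(** * Dimension *)

Section Dimension.
Context {R : realType}.
Implicit Types (T U W : dtype R) (J : finType).

Definition fopen d (A : set 'rV[R]_d.+1) : set 'rV[R]_d.+1 :=
  [set x | exists e, 0 < e /\ forall s, `|s - hd x| < e -> A (cons s (tl x))].

Definition proj d (A : set 'rV[R]_d.+1) : set 'rV[R]_d := [set y | exists s, A (cons s y)].

(* [dle d l A] expresses that [A] has dimension at most [l]: the part of [A]
   whose fibres over the last [d] coordinates are discrete keeps its dimension
   under projection, and the part with open fibres loses one dimension. *)
Fixpoint dle d l : set 'rV[R]_d -> Prop :=
  match d with
  | 0 => fun _ => True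
  | d'.+1 => fun A => dle l (proj (A `\` fopen A)) /\
      match l with
      | 0 => A `&` fopen A = set0
      | l'.+1 => dle l' (proj (A `&` fopen A))
      end
  end.

Lemma def_fopen T d (A : T -> set 'rV[R]_d.+1) : def (fun p => A p.1 p.2) ->
  def (fun p => fopen (A p.1) p.2).
Proof. by move=> dA; rewrite /fopen /=; ddef. Qed.

Lemma dle_ge d l (A : set 'rV[R]_d) : (d <= l)%N -> dle l A.
Proof.
elim: d l A => [//|d ih] [//|l] A dl /=; split; apply: ih => //; exact: ltnW.
Qed.

Lemma half_cube n : open_cube n (\row_i 2^-1 : 'rV[R]_n).
Proof. by move=> i; rewrite mxE; lra. Qed.

Lemma fopen_bd d (A : set 'rV[R]_d.+1) x : A x -> ~ fopen A x -> bdpt (fun s => A (cons s (tl x))) (hd x).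
Proof.
move=> Ax nfx e e0; apply: contrapT => h; apply: nfx; exists e; split=> // s hs.
apply: contrapT => nA; apply: h; exists (hd x), s; split=> //; first by rewrite subrr normr0.
by rewrite cons_hd_tl.
Qed.

(** Discrete fibres are finite, hence enumerated by definable functions over a cover of the
    projection; for open fibres the first coordinate is a parameter of its own. The maps have no
    regularity yet and may leave [A t]. *)
Lemma dle_cover d l T (A : T -> set 'rV[R]_d) : def (fun p => A p.1 p.2) ->
  (forall t x, A t x -> open_cube d x) ->
  exists K (g : nat -> T -> 'rV[R]_l -> 'rV[R]_d), (forall k, defm (fun p => g k p.1 p.2)) /\
    forall t, dle l (A t) -> forall x, A t x ->
      exists2 k, (k < K)%N & exists2 y, open_cube l y & g k t y = x.
Proof.
elim: d l A => [|d ih] l A dA cA.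
  exists 1%N, (fun _ _ _ => 0); split; first by move=> k; ddef.
  move=> t _ x _; exists 0%N => //; exists (\row_i 2^-1); first exact: half_cube.
  by rewrite [x]thinmx0.
have dF := def_fopen dA.
pose Af t := A t `\` fopen (A t); pose Ao t := A t `&` fopen (A t).
have dAf : def (fun p => Af p.1 p.2) by apply: def_and; [|apply: def_not].
have dAo : def (fun p => Ao p.1 p.2) by apply: def_and.
have [||K1 [g1 [dg1 hg1]]] := ih l (fun t => proj (Af t)).
- by rewrite /proj /=; ddef.
- by move=> t x [s [/cA /cube_cons[]]].
have [N hN] := @bdpt_fin R (prod_dtype T (row_dtype d)) (fun p s => A p.1 (cons s p.2)) ltac:(by ddef).
have [||c dc hc] := @def_enum R (prod_dtype T (row_dtype d)) real_dtype N
    (fun p s => Af p.1 (cons s p.2)).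
- by ddef.
- move=> [t y]; have [s sN hs] := hN (t, y).
  apply: (@fbound_seq R R real_dtype (fun v => v) s) => // v [Av nfv]; exists v => //; apply: hs.
  by have := fopen_bd Av nfv; rewrite hd_cons tl_cons.
have main1 k : defm (fun p : T * 'rV[R]_l => cons (c (k %/ K1)%N (p.1, g1 (k %% K1)%N p.1 p.2)) (g1 (k %% K1)%N p.1 p.2)).
  have := dg1 (k %% K1)%N; have := dc (k %/ K1)%N => h1 h2.
  apply: defm_cons; last exact: h2.
  by apply: (defm_comp _ h1); apply: defm_pair; [ddef|exact: h2].
have cov1 t x : dle l (proj (Af t)) -> Af t x -> exists2 k, (k < N * K1)%N & exists2 y, open_cube l y &
    cons (c (k %/ K1)%N (t, g1 (k %% K1)%N t y)) (g1 (k %% K1)%N t y) = x.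
  move=> dl Ax; have [|k kK [y cy gy]] := hg1 t dl (tl x).
    by exists (hd x); rewrite cons_hd_tl.
  have [|i iN ci] := hc (t, tl x) (hd x); first by rewrite /= cons_hd_tl.
  exists (i * K1 + k)%N.
    by rewrite (leq_trans (_ : _ < i * K1 + K1)%N) ?ltn_add2l // addnC -mulSn leq_mul2r iN orbT.
  have K10 : (0 < K1)%N by exact: leq_ltn_trans kK.
  exists y => //; rewrite divnMDl // divn_small // addn0 modnMDl modn_small //.
  by rewrite gy ci cons_hd_tl.
case: l => [|l] in g1 dg1 hg1 main1 cov1 *.
  exists (N * K1)%N, (fun k t y => cons (c (k %/ K1)%N (t, g1 (k %% K1)%N t y)) (g1 (k %% K1)%N t y)).
  split; first exact: main1.
  move=> t [dl Ao0] x Ax; apply: cov1 => //; split=> // fx.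
  have : (A t `&` fopen (A t)) x by []; by rewrite Ao0.
have [||K2 [g2 [dg2 hg2]]] := ih l (fun t => proj (Ao t)).
- by rewrite /proj /=; ddef.
- by move=> t x [s [/cA /cube_cons[]]].
exists (N * K1 + K2)%N, (fun k t y => if (k < N * K1)%N
  then cons (c (k %/ K1)%N (t, g1 (k %% K1)%N t y)) (g1 (k %% K1)%N t y)
  else cons (hd y) (g2 (k - N * K1)%N t (tl y))); split.
  move=> k; case: (k < N * K1)%N; first exact: main1.
  have := dg2 (k - N * K1)%N => h.
  apply: defm_cons; first by ddef.
  exact: (defm_comp2 (P := g2 (k - N * K1)%N) h (@defm_fst _ _ _) (defm_tl (@defm_snd _ _ _))).
move=> t [dl1 dl2] x Ax; have [fx|nfx] := pselect (fopen (A t) x); last first.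
  have [//|k kK h] := cov1 t x dl1; exists k; first exact: ltn_addr.
  by rewrite kK.
have [|k kK [y cy gy]] := hg2 t dl2 (tl x); first by exists (hd x); rewrite cons_hd_tl.
exists (N * K1 + k)%N; first by rewrite ltn_add2l.
rewrite ltnNge leq_addr /= addKn; exists (cons (hd x) y).
  by apply/cube_cons; split=> //; have /cube_hdtl[] := cA _ _ Ax.
by rewrite hd_cons tl_cons gy cons_hd_tl.
Qed.

Lemma fopen_interior d (A : set 'rV[R]_d.+1) O : def A -> open O -> O !=set0 ->
  O `<=` proj (A `&` fopen A) -> exists Q, [/\ open Q, Q !=set0 & Q `<=` A].
Proof.
move=> dA oO O0 hO; apply: (open_fibers dA oO O0) => y /hO[s [As [e [e0 he]]]].
exists (s - e), (s + e); split; first by lra.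
move=> z hz; have := he z; rewrite hd_cons tl_cons; apply; rewrite ltr_norml; lra.
Qed.

(** The part with discrete fibres projects into [m] variables, where the bound is free. The
    projection of the part with open fibres is again thin, since over an open set [open_fibers]
    would produce interior points of [A]. *)
Lemma thin_dle m (A : set 'rV[R]_m.+1) : def A -> thin A -> dle m A.
Proof.
elim: m A => [|m ih] A dA tA.
  split=> //; apply/eqP; apply: contrapT => /negP/set0P[x Ax].
  have [||Q [oQ Q0 QA]] := @fopen_interior 0 A setT dA openT.
  - by exists 0.
  - move=> y _; exists (hd x); rewrite [y]thinmx0 -[0](thinmx0 (tl x)) cons_hd_tl //.
  - by move: Q0; rewrite (tA _ oQ QA) => -[].
split; first exact: dle_ge.
have dA' : def (fun p : R * 'rV[R]_m.+2 => (fun=> A) p.1 p.2) by ddef.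
have dF : def (fopen A).
  apply: (@def_comp _ (row_dtype m.+2) (prod_dtype real_dtype (row_dtype m.+2))
    (fun x => (0, x)) (fun p => fopen A p.2)); first by ddef.
  exact: (def_fopen dA').
have dp : def (proj (A `&` fopen A)).
  rewrite /proj; apply: (@def_ex _ (row_dtype m.+1) real_dtype); apply: def_and; first by ddef.
  exact: (def_comp (defm_cons (@defm_snd _ _ _) (@defm_fst _ _ _)) dF).
apply: ih => //.
move=> O oO OP; apply: contrapT => /eqP/set0P O0.
have [Q [oQ Q0 QA]] := fopen_interior dA oO O0 OP.
by move: Q0; rewrite (tA _ oQ QA) => -[].
Qed.

(** Along the recursion of [dle], discrete fibres drop the first coordinate and open fibres keep it
    among the selected ones; [open_fibers] then thickens the image. *)
Lemma not_dle d l (A : set 'rV[R]_d) : def A -> ~ dle l A ->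
  exists (sg : 'I_l.+1 -> 'I_d) Q, [/\ open Q, Q !=set0 & Q `<=` [set rho sg x | x in A]].
Proof.
elim: d l A => [|d ih] l A dA nd; first by case: nd.
have dA' : def (fun p : R * 'rV[R]_d.+1 => (fun=> A) p.1 p.2) by ddef.
have dF : def (fopen A).
  apply: (@def_comp _ (row_dtype d.+1) (prod_dtype real_dtype (row_dtype d.+1))
    (fun x => (0, x)) (fun p => fopen A p.2)); first by ddef.
  exact: (def_fopen dA').
have dp (P : set 'rV[R]_d.+1) : def P -> def (proj P).
  move=> dP; rewrite /proj; apply: (@def_ex _ (row_dtype d) real_dtype).
  exact: (def_comp (defm_cons (@defm_snd _ _ _) (@defm_fst _ _ _)) dP).
have [h1|h1] := pselect (dle l (proj (A `\` fopen A))); last first.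
  have [|sg [Q [oQ Q0 hQ]]] := ih l _ _ h1; first by apply: dp; apply: def_and => //; exact: def_not.
  exists (fun i => lift ord0 (sg i)), Q; split=> // y /hQ[x [s [As _]] <-].
  by exists (cons s x) => //; apply/rowP => i; rewrite !mxE liftK.
have dI : def (proj (A `&` fopen A)) by apply: dp; exact: def_and.
case: l nd h1 => [|l] /= nd h1.
  have /eqP/set0P[x [Ax [e [e0 he]]]] : A `&` fopen A <> set0 by move=> h; apply: nd; split.
  exists (fun=> ord0), (box (\row__ hd x) e); split; first exact: open_box.
    by exists (\row__ hd x); exact: box_center.
  move=> y /(_ ord0); rewrite mxE => /he h; exists (cons (y 0 ord0) (tl x)) => //.
  by apply/rowP => i; rewrite mxE cons0 (ord1 i).
have h2 : ~ dle l (proj (A `&` fopen A)) by move=> h; apply: nd; split.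
have [sg [Q [oQ Q0 hQ]]] := ih l _ dI h2.
pose sg' (i : 'I_l.+2) : 'I_d.+1 := if unlift ord0 i is Some j then lift ord0 (sg j) else ord0.
pose A' : set 'rV[R]_l.+2 := [set rho sg' x | x in A].
have dA2 : def A'.
  apply: (@def_ext _ (row_dtype l.+2) (fun y => exists x : 'rV[R]_d.+1, A x /\ rho sg' x = y)).
    by move=> y; split=> [[x [Ax e]]|[x Ax e]]; exists x.
  apply: def_ex; apply: def_and; first by ddef.
  by apply: def_eq; [apply: defm_rho; ddef|ddef].
have E s x : rho sg' (cons s x) = cons s (rho sg x).
  apply/rowP => i; rewrite mxE /sg'; case: (unliftP ord0 i) => [j|] ->.
    by rewrite !consS mxE.
  by rewrite !cons0.
have [|Q' [oQ' Q'0 Q'A]] := @open_fibers R l.+1 A' Q dA2 oQ Q0.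
  move=> y /hQ[x [s [As [e [e0 he]]]] <-]; exists (s - e), (s + e); split; first by lra.
  move=> z hz; exists (cons z x); last exact: E.
  by have := he z; rewrite hd_cons tl_cons; apply; rewrite ltr_norml; lra.
by exists sg', Q'.
Qed.

(** Without intervals, all points of [E t] are boundary points. *)
Lemma noint_fin T (E : T -> R -> Prop) : def (fun p => E p.1 p.2) ->
  (forall t a b, a < b -> exists2 s, a < s < b & ~ E t s) ->
  exists N, forall t, fbound (U := real_dtype) N (E t).
Proof.
move=> dE nE; have [N hN] := bdpt_fin dE; exists N => t; have [s sN hs] := hN t.
apply: (@fbound_seq R R real_dtype (fun v => v) s) => // v Ev; exists v => //; apply: hs => e e0.
have [|w hw nw] := nE t (v - e) (v + e); first by lra.
by exists v, w; split=> //; [rewrite subrr normr0|rewrite ltr_norml; lra].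
Qed.

(** Each slice contains a box with rational centre and radius, and Baire's theorem in the first
    variable makes one box common to an interval of slices. *)
Lemma open_slices n (A : set 'rV[R]_n.+1) a b : def A -> a < b ->
  (forall s, a < s < b -> exists O, [/\ open O, O !=set0 & O `<=` [set y | A (cons s y)]]) ->
  exists Q, [/\ open Q, Q !=set0 & Q `<=` A].
Proof.
move=> dA ab h.
pose bx (i : 'rV[rat]_n * rat) : set 'rV[R]_n := box (\row_k ratr (i.1 0 k)) (ratr i.2).
pose E (i : 'rV[rat]_n * rat) (s : R) : Prop := (0 : R) < ratr i.2 /\
  forall y : 'rV[R]_n, (forall k, `|y 0 k - ratr (i.1 0 k)| < ratr i.2) -> A (cons s y).
have [||i [a' [b' [h1 h2 h3 h4]]]] := @dbaire1 R _ E a b ab.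
- by move=> i; rewrite /E; ddef.
- move=> s /h[V [/open_boxP oV [y Vy] OA]]; have [e e0 he] := oV _ Vy.
  have [|q hq] := @ratr_between R 0 (e / 2); first by lra.
  have hc k : exists p : rat, y 0 k - ratr q < ratr p < y 0 k + ratr q.
    by apply: ratr_between; lra.
  have [p hp] := choice hc; exists (\row_k p k, q); split=> /=; first by lra.
  move=> z hz; apply: OA; apply: he => k; have := hz k; have := hp k; rewrite mxE !ltr_norml; lra.
have m : a' < (a' + b') / 2 < b' by lra.
exists [set x | a' < hd x < b' /\ bx i (tl x)]; split.
- by apply: open_cylinder; exact: open_box.
- have [q0 _] := h4 _ m; exists (cons ((a' + b') / 2) (\row_k ratr (i.1 0 k))); rewrite /= hd_cons tl_cons.
  by split=> //; exact: box_center.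
- move=> x [hx bxx]; rewrite -(cons_hd_tl x); have [_] := h4 _ hx; apply.
  by move=> k; have := bxx k; rewrite [X in _ - X]mxE.
Qed.

(** By [open_slices] only finitely many slices have interior (the set [E]), and [Sol_fib] treats
    them. The other slices have dimension at most [k]; keeping the first coordinate and covering
    them by maps of [k] variables leaves [k.+1] variables in all. *)
Lemma Sol_thin k r T J (X : T -> set 'rV[R]_k.+2) (F : J -> T -> 'rV[R]_k.+2 -> R) :
  @Pn R k r -> def (fun p => X p.1 p.2) -> (forall j, defm (fun p => F j p.1 p.2)) ->
  (forall t x, X t x -> open_cube k.+2 x) -> (forall j t x, X t x -> 0 <= F j t x <= 1) ->
  (forall t, thin (X t)) -> Sol r X F.
Proof.
move=> hP dX dF cX F01 tX.
pose E t (s : R) := exists y : 'rV[R]_k.+1, exists e : R, 0 < e /\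
  forall z : 'rV[R]_k.+1, (forall i, `|z 0 i - y 0 i| < e) -> X t (cons s z).
have dE : def (fun p => E p.1 p.2) by rewrite /E; ddef.
have [|N hN] := noint_fin dE.
  move=> t a b ab; apply: contrapT => h.
  have dXt : def (X t) by ddef.
  have [|Q [oQ Q0 QX]] := open_slices dXt ab.
    move=> s hs; have [y [e [e0 he]]] : E t s by apply: contrapT => nE; apply: h; exists s.
    exists (box y e); split; [exact: open_box|by exists y; exact: box_center|].
    by move=> z hz; apply: he.
  by move: Q0; rewrite (tX t Q oQ QX) => -[].
apply: (@Sol_union _ _ _ _ _ _ (fun t => [set x | X t x /\ E t (hd x)])
   (fun t => [set x | X t x /\ ~ E t (hd x)])).
- by move=> t x; split=> [Xx|[[]|[]]//]; have [h|h] := pselect (E t (hd x)); [left|right].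
- apply: (@Sol_fib _ _ _ _ _ _ _ E N) => //.
  + by rewrite /=; ddef.
  + by move=> t x [/cX].
  + by move=> j t x [/F01].
  + by move=> t x [].
pose A (ts : T * R) : set 'rV[R]_k.+1 := fun y => X ts.1 (cons ts.2 y).
have [||K [g [dg hg]]] := @dle_cover k.+1 k (prod_dtype T real_dtype) A.
- by rewrite /A; ddef.
- by move=> [t s] y /= /cX /cube_cons[].
have dl t s : ~ E t s -> dle k (A (t, s)).
  move=> nE; apply: thin_dle; first by rewrite /A /=; ddef.
  move=> O oO OA; apply: contrapT => /eqP/set0P[y Oy]; apply: nE.
  move/open_boxP : oO => /(_ _ Oy)[e e0 he]; exists y, e; split=> // z hz.
  by apply: OA; exact: he.
pose Xk k0 t : set 'rV[R]_k.+2 := [set x | (X t x /\ ~ E t (hd x)) /\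
  exists2 y, open_cube k y & g k0 (t, hd x) y = tl x].
apply: (@Sol_bigU _ _ _ _ _ K _ Xk).
  move=> t x; split; last by case=> k0 _ [].
  move=> [Xx nE]; have [|k0 kK h] := hg (t, hd x) (dl _ _ nE) (tl x).
    by rewrite /A /= cons_hd_tl.
  by exists k0.
move=> k0 _; have dgk := dg k0.
pose g' (tw : T * R) (x' : 'rV[R]_k.+1) := cons (hd x') (g k0 (tw.1, hd x') (tl x')).
have dg' : defm (fun p => g' p.1 p.2).
  by rewrite /g'; ddef.
pose X' (tw : T * R) : set 'rV[R]_k.+1 := [set x' | open_cube k.+1 x' /\
  (X tw.1 (g' tw x') /\ ~ E tw.1 (hd (g' tw x')))].
apply: (@Sol_img _ _ _ _ _ real_dtype _ _ _ X' g' (@sgbase k)).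
- exact: sgbase_inj.
- exact: dg'.
- exists 1%N => t; exists (fun=> 0) => x [[Xx nE] [y cy gy]]; exists 0%N => //.
  exists (cons (hd x) y); last by rewrite /g' hd_cons tl_cons /= gy cons_hd_tl.
  have /cube_hdtl[hx _] := cX _ _ Xx.
  split; first by apply/cube_cons.
  by rewrite /g' hd_cons tl_cons /= gy cons_hd_tl.
- move=> [t w] x' [cx' [h1 h2]]; split=> //=.
  rewrite /g' hd_cons tl_cons /=; exists (tl x') => //.
  by case/cube_hdtl: cx'.
- move=> [t w] phi tphi _ z z' cz cz' hzz'; rewrite /g' !hd_cons; apply: tphi.
  + exact: rho_cube.
  + exact: rho_cube.
  + by rewrite !rho_base /base !hd_cons.
- apply: hP.
  + by rewrite /X' /open_cube /=; ddef.
  + by move=> j; ddef.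
  + by move=> tw x' [].
  + by move=> j [t w] x' [_ [h _]]; exact: F01 h.
Qed.

End Dimension.

(** * One variable *)

Section OneVariable.
Context {R : realType}.
Implicit Types (T U W : dtype R) (J : finType).

Definition pt1 (s : R) : 'rV[R]_1 := cons s 0.
Definition aff (a b s : R) : R := (1 - s) * a + s * b.

Lemma hd_pt1 s : hd (pt1 s) = s. Proof. exact: hd_cons. Qed.

Lemma pt1K (z : 'rV[R]_1) : pt1 (hd z) = z.
Proof. by rewrite /pt1 -[X in cons _ X](thinmx0 (tl z)) cons_hd_tl. Qed.

Lemma cube1 (z : 'rV[R]_1) : open_cube 1 z <-> 0 < hd z < 1.
Proof. by rewrite cube_hdtl; split=> [[]//|h]; split=> // -[]. Qed.

Lemma tri1 (phi : 'rV[R]_1 -> 'rV[R]_1) : tri phi.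
Proof. by move=> z z' _ _ h; rewrite -(pt1K z) -(pt1K z') h. Qed.

Lemma Sol_pts r T J N (X : T -> set 'rV[R]_1) (F : J -> T -> 'rV[R]_1 -> R) :
  (forall j t x, X t x -> 0 <= F j t x <= 1) ->
  (forall t, fbound (U := real_dtype) N (fun s => X t (pt1 s))) -> Sol r X F.
Proof.
move=> F01 bX; exists real_dtype, (fun c _ => pt1 c), N, 1; split; first by rewrite /pt1; ddef.
move=> t; have [e he] := bX t; exists e => x Xx.
have [|i iN ei] := he (hd x); first by rewrite pt1K.
exists i => //; rewrite ei pt1K; split; last by exists (\row_i 2^-1) => //; exact: half_cube.
split=> [//| |j]; first exact: tri1.
by apply: jet_cst; have := F01 j t x Xx; rewrite ler_norml; lra.
Qed.

Lemma Sol_finU n r T J (I : finType) (X : T -> set 'rV[R]_n.+1) (Xi : I -> T -> set 'rV[R]_n.+1)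
    (F : J -> T -> 'rV[R]_n.+1 -> R) : (forall t x, X t x <-> exists i, Xi i t x) ->
  (forall i, Sol r (Xi i) F) -> Sol r X F.
Proof.
move=> hX hS; apply: (@Sol_bigU R _ _ _ _ #|I| X (fun k t => [set x | exists2 i, val (enum_rank i) = k & Xi i t x])).
  move=> t x; rewrite hX; split=> [[i Xx]|[k _ [i _ Xx]]]; last by exists i.
  by exists (enum_rank i); [exact: ltn_ord|exists i].
move=> k kI; apply: Sol_ext (hS (enum_val (Ordinal kI))) => t x; split.
  by move=> Xx; exists (enum_val (Ordinal kI)); rewrite ?enum_valK.
move=> [i ik Xx]; rewrite (_ : enum_val _ = i) //.
by rewrite -(enum_rankK i); congr enum_val; apply: val_inj.
Qed.

Definition inn n (A : set 'rV[R]_n) (x : 'rV[R]_n) := exists e, 0 < e /\ forall y, box x e y -> A y.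

Lemma def_inn T n (A : T -> set 'rV[R]_n) : def (fun p => A p.1 p.2) ->
  def (fun p => inn (A p.1) p.2).
Proof. by move=> dA; rewrite /inn /box /=; ddef. Qed.

Lemma open_inn n (A : set 'rV[R]_n) : open [set x | inn A x].
Proof.
apply/open_boxP => x [e [e0 he]]; exists (e / 2); first by lra.
move=> y hy; exists (e / 2); split; first by lra.
move=> z hz; apply: he; have := box_tri hy hz; by rewrite -splitr.
Qed.

Lemma inn_sub n (A : set 'rV[R]_n) x : inn A x -> A x.
Proof. by move=> [e [e0 he]]; apply: he; exact: box_center. Qed.

(** Every nonempty open set contains a smaller one inside [A], whose points are interior. *)
Lemma thin_inn n (A : set 'rV[R]_n) : def A -> thin [set x | ~ A x] -> thin [set x | ~ inn A x].
Proof.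
move=> dA tA O oO hO; apply: contrapT => /eqP/set0P O0.
have [Q [oQ [y Qy] QO QA]] := thinP (def_not dA) tA oO O0.
apply: (hO y (QO _ Qy)); move/open_boxP : oQ => /(_ _ Qy)[e e0 he].
by exists e; split=> // z /he/QA h; exact: contrapT.
Qed.

Lemma thin1_fin T (A : T -> set 'rV[R]_1) : def (fun p => A p.1 p.2) -> (forall t, thin (A t)) ->
  exists N, forall t, fbound (U := real_dtype) N (fun s => A t (pt1 s)).
Proof.
move=> dA tA; apply: noint_fin; first by rewrite /pt1; ddef.
move=> t a b ab; apply: contrapT => h.
have oc : open [set x : 'rV[R]_1 | a < hd x < b /\ setT (tl x)].
  by apply: open_cylinder; exact: openT.
have := tA t _ oc.
have sub : [set x : 'rV[R]_1 | a < hd x < b /\ setT (tl x)] `<=` A t.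
  move=> x [hx _]; apply: contrapT => nA; apply: h; exists (hd x) => //.
  by rewrite pt1K.
move=> /(_ sub) /seteqP[/(_ (pt1 ((a + b) / 2))) h' _]; apply: h'.
by split=> //; rewrite hd_pt1; lra.
Qed.

(** The points where the generic property [Q] fails are finitely many and get constant maps; the
    rest is cut into segments, whose end points join the parameters. *)
Lemma seg_red r T J (X Q : T -> set 'rV[R]_1) (F : J -> T -> 'rV[R]_1 -> R) :
  def (fun p => X p.1 p.2) -> def (fun p => Q p.1 p.2) ->
  (forall t x, X t x -> open_cube 1 x) -> (forall j t x, X t x -> 0 <= F j t x <= 1) ->
  (forall t, thin [set x | ~ Q t x]) ->
  Sol r (fun tw : T * (R * R) => [set z | open_cube 1 z /\
      [/\ 0 <= tw.2.1 <= 1, 0 <= tw.2.2 <= 1 & forall s, 0 < s < 1 ->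
        X tw.1 (pt1 (aff tw.2.1 tw.2.2 s)) /\ Q tw.1 (pt1 (aff tw.2.1 tw.2.2 s))]])
    (fun j tw z => F j tw.1 (pt1 (aff tw.2.1 tw.2.2 (hd z)))) -> Sol r X F.
Proof.
move=> dX dQ cX F01 tQ hS.
apply: (@Sol_union _ _ _ _ _ _ (fun t => [set x | X t x /\ Q t x]) (fun t => [set x | X t x /\ ~ Q t x])).
- by move=> t x; split=> [Xx|[[]|[]]//]; have [h|h] := pselect (Q t x); [left|right].
- pose P t s := X t (pt1 s) /\ Q t (pt1 s).
  have [||N [c [dc hc]]] := @def_segments R T P.
  + by rewrite /P /pt1; ddef.
  + by move=> t z [/cX/cube1]; rewrite hd_pt1.
  apply: (@Sol_img _ _ _ _ _ (prod_dtype real_dtype real_dtype) _ _ _ _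
    (fun tw z => pt1 (aff tw.2.1 tw.2.2 (hd z))) id _ _ _ _ _ hS).
  + by [].
  + by rewrite /pt1 /aff; ddef.
  + exists N => t; exists (fun i => c i t) => x [Xx Qx].
    have [|i iN [h1 h2 h3 [s s01 e]]] := hc t (hd x); first by rewrite /P pt1K.
    exists i => //; exists (pt1 s); last by rewrite hd_pt1 /= /aff -e pt1K.
    by split; [apply/cube1; rewrite hd_pt1|split].
  + move=> [t w] z /= [/cube1 cz [_ _ h]]; exact: h.
  + by move=> tw phi _ _; exact: tri1.
- have [|N hN] := @thin1_fin T (fun t => [set x | ~ Q t x]) _ tQ; first by exact: def_not.
  apply: (@Sol_pts r T J N) => [j t x [/F01]//|t]; have [e he] := hN t.
  by exists e => s [_ /he].
Qed.

Lemma pd_mul n (f g : 'rV[R]_n -> R) i x : derivable f x (ee i) -> derivable g x (ee i) ->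
  derivable (fun x => f x * g x) x (ee i) /\ pd i (fun x => f x * g x) x = f x * pd i g x + g x * pd i f x.
Proof.
by move=> df dg; split; [exact: (derivableM df dg)|exact: (deriveM df dg)].
Qed.

Lemma pd_add n (f g : 'rV[R]_n -> R) i x : derivable f x (ee i) -> derivable g x (ee i) ->
  derivable (fun x => f x + g x) x (ee i) /\ pd i (fun x => f x + g x) x = pd i f x + pd i g x.
Proof. by move=> df dg; split; [exact: derivableD|exact: deriveD]. Qed.

Lemma pd_cst n (c : R) i (x : 'rV[R]_n) : derivable (fun=> c) x (ee i) /\ pd i (fun=> c) x = 0.
Proof. by split; [exact: derivable_cst|exact: derive_cst]. Qed.

Lemma aff_coordE a b (k : 'I_1) : (fun z : 'rV[R]_1 => pt1 (aff a b (hd z)) 0 k) =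
  fun z => a + (b - a) * z 0 ord0.
Proof. by apply/funext => z; rewrite (ord1 k) cons0 /aff /hd; ring. Qed.

Lemma pd_affine a b (z : 'rV[R]_1) : pd ord0 (fun z : 'rV[R]_1 => a * hd z + b) z = a.
Proof.
have [d1 e1] := pd_cst a ord0 z; have [d2 e2] := pd_cst b ord0 z.
have [d3 e3] := pd_coord ord0 ord0 z; have [d4 e4] := pd_mul d1 d3.
by have [_ ->] := pd_add d4 d2; rewrite e2 e4 e1 e3 mulr0 mulr1 !addr0.
Qed.

Lemma aff_Cr r a b (k : 'I_1) z : Cr r (fun z : 'rV[R]_1 => pt1 (aff a b (hd z)) 0 k) z.
Proof.
rewrite aff_coordE; apply: (Cr_add openT) => // y _; first exact: Cr_cst.
by apply: (Cr_mul openT) => // w _; [exact: Cr_cst|exact: Cr_coord].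
Qed.

Lemma aff_pd a b (k i : 'I_1) z : pd i (fun z : 'rV[R]_1 => pt1 (aff a b (hd z)) 0 k) z = b - a.
Proof.
rewrite aff_coordE (ord1 i).
have [d1 e1] := pd_cst a ord0 z; have [d2 e2] := pd_cst (b - a) ord0 z.
have [d3 e3] := pd_coord ord0 ord0 z; have [d4 e4] := pd_mul d2 d3.
by have [_ ->] := pd_add d1 d4; rewrite e1 e4 e2 e3 mulr0 addr0 add0r mulr1.
Qed.

Lemma aff01 a b s : 0 <= a <= 1 -> 0 <= b <= 1 -> 0 < s < 1 -> 0 <= aff a b s <= 1.
Proof. by rewrite /aff => ha hb hs; apply/andP; split; nra. Qed.

(** The problem on the whole interval when derivatives up to order [k] are already bounded. It is
    solved from [k = r], where the identity suffices, down to [k = 0]. The condition [c] retains the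
    parameters for which the hypotheses hold. *)
Definition P1 r k B := forall T J (c : T -> Prop) (F : J -> T -> 'rV[R]_1 -> R),
  def c -> (forall j, defm (fun p => F j p.1 p.2)) ->
  (forall j t z, c t -> open_cube 1 z -> 0 <= F j t z <= 1) ->
  (forall j t z, c t -> open_cube 1 z -> Cr r (F j t) z /\ bnd k B (F j t) z) ->
  Sol r (fun t => [set z | open_cube 1 z /\ c t]) F.

Lemma P1_top r B : P1 r r B.
Proof.
move=> T J c F dc dF F01 hF; exists real_dtype, (fun _ z => z), 1%N, B; split; first by ddef.
move=> t; exists (fun=> 0) => x [cx ct]; exists 0%N => //; split; last by exists x.
by split=> // j z cz; exact: hF.
Qed.

Lemma def_locCr r T J n (F : J -> T -> 'rV[R]_n -> R) : (forall j, defm (fun p => F j p.1 p.2)) ->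
  def (fun p : T * 'rV[R]_n => inn [set y | forall j, Cr r (F j p.1) y] p.2).
Proof.
move=> dF; apply: (@def_inn T n (fun t => [set y | forall j, Cr r (F j t) y])).
by apply: def_finall => j; exact: def_Cr.
Qed.

Lemma thin_locCr r T J n (F : J -> T -> 'rV[R]_n -> R) t : (forall j, defm (fun p => F j p.1 p.2)) ->
  thin [set x | ~ inn [set y | forall j, Cr r (F j t) y] x].
Proof.
move=> dF; apply: thin_inn.
  have h := @def_Cr R T n r; apply: def_finall => j.
  have dFj := dF j; have := h (F j) dFj => {}h.
  exact: (def_comp2 (P := fun t => Cr r (F j t)) h (@defm_const _ (row_dtype n) T t) (@defm_id _ _)).
have dFt j : defm (F j t) by ddef.
apply: (thin_sub (B := [set x | exists j, ~ Cr r (F j t) x])).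
  by move=> x h; apply: contrapT => h2; apply: h => j; apply: contrapT => h3; apply: h2; exists j.
apply: thin_fin => j; last exact: def_Cr_thin.
apply: def_not; have h := @def_Cr R T n r (F j) (dF j).
exact: (def_comp2 (P := fun t => Cr r (F j t)) h (@defm_const _ (row_dtype n) T t) (@defm_id _ _)).
Qed.

Lemma Pn0_of_P1 r : P1 r 0 1 -> @Pn R 0 r.
Proof.
move=> hP T J X F dX dF cX F01.
pose Q t : set 'rV[R]_1 := [set x | inn [set y | forall j, Cr r (F j t) y] x].
have dQ : def (fun p => Q p.1 p.2) by exact: def_locCr.
apply: (seg_red dX dQ cX F01); first by move=> t; exact: thin_locCr.
apply: (hP (prod_dtype T (prod_dtype real_dtype real_dtype))).
- apply: (@def_ext _ _ (fun tw : T * (R * R) => 0 <= tw.2.1 <= 1 /\ 0 <= tw.2.2 <= 1 /\ forall s : R, 0 < s < 1 ->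
        X tw.1 (pt1 (aff tw.2.1 tw.2.2 s)) /\ Q tw.1 (pt1 (aff tw.2.1 tw.2.2 s)))).
    by move=> tw; split=> [[? [? ?]]|[? ? ?]].
  by rewrite /pt1 /aff; ddef.
- by move=> j; rewrite /pt1 /aff; ddef.
- by move=> j [t [a b]] z [_ _ h] /cube1 /h [Xz _]; exact: F01.
- move=> j [t [a b]] z [ha hb h] cz /=; split.
    have oQ : open (Q t) by exact: open_inn.
    apply: (@Cr_comp R r 1 1 _ _ (F j t) (fun z => pt1 (aff a b (hd z))) (@open_cube_open R 1) oQ) => //.
    + by move=> y /cube1 /h[].
    + by move=> y /inn_sub; apply.
    + by move=> k y _; exact: aff_Cr.
  split=> //; have /F01 : X t (pt1 (aff a b (hd z))) by move/cube1 : cz => /h[].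
  by move=> /(_ j); rewrite ler_norml; lra.
Qed.

Lemma pd_hd (z : 'rV[R]_1) : pd ord0 (@hd R 0) z = 1.
Proof. by have [_ ->] := pd_coord ord0 ord0 z; rewrite eqxx. Qed.

Lemma hd_Cr r (z : 'rV[R]_1) : Cr r (@hd R 0) z.
Proof. exact: (@Cr_coord R 1 r ord0). Qed.

Lemma aff_inv a b y : b != a -> Num.min a b < y < Num.max a b -> exists2 s, 0 < s < 1 & y = aff a b s.
Proof.
move=> ba hy; have dba : b - a != 0 by rewrite subr_eq0.
exists ((y - a) / (b - a)); last by rewrite /aff; field.
move: hy; have [ab|ab] := ltP a b.
  by move=> /andP[y1 y2]; rewrite ltr_pdivlMr ?subr_gt0 // ltr_pdivrMr ?subr_gt0 // mul0r mul1r; lra.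
have {}ab : b - a < 0 by rewrite subr_lt0 lt_neqAle ba.
by move=> /andP[y1 y2]; rewrite ltr_ndivlMr // ltr_ndivrMr // mul0r mul1r; lra.
Qed.

Lemma aff_between a b s : b != a -> 0 < s < 1 -> Num.min a b < aff a b s < Num.max a b.
Proof.
move=> ba hs; rewrite /aff; have [ab|ab] := ltP a b; first by nra.
have {}ab : b < a by rewrite lt_neqAle ba.
nra.
Qed.

(** Rolle's theorem. The points are equal, not necessarily their parameters, as the segment may be a
    single point. *)
Lemma rolle_inj (f : 'rV[R]_1 -> R) (a b : R) :
  (forall s, 0 < s < 1 -> derivable f (pt1 (aff a b s)) (ee ord0) /\ pd ord0 f (pt1 (aff a b s)) != 0) ->
  forall s s', 0 < s < 1 -> 0 < s' < 1 -> f (pt1 (aff a b s)) = f (pt1 (aff a b s')) ->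
  aff a b s = aff a b s'.
Proof.
move=> hf; have ptE t : t *: ee ord0 + 0 = pt1 t :> 'rV[R]_1.
  by apply/rowP => i; rewrite (ord1 i) !mxE unlift_none eqxx mulr1 addr0.
suff key s s' : 0 < s < 1 -> 0 < s' < 1 -> f (pt1 (aff a b s)) = f (pt1 (aff a b s')) ->
    ~ aff a b s < aff a b s'.
  move=> s s' hs hs' e; have [|/key|] := ltgtP (aff a b s) (aff a b s') => //.
    by move=> /key; case.
  by case.
move=> hs hs' e lt.
have inv y : aff a b s <= y <= aff a b s' -> exists2 v, 0 < v < 1 & y = aff a b v.
  move=> hy; have ab : a != b by apply: contraTneq lt => ->; rewrite /aff -leNgt; lra.
  have dab : b - a != 0 by rewrite subr_eq0 eq_sym.
  exists ((y - a) / (b - a)); last by rewrite /aff; field.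
  move: hy lt; rewrite /aff; have [ba|ba] := ltP 0 (b - a).
    move=> /andP[y1 y2] _; rewrite ltr_pdivlMr // ltr_pdivrMr // mul0r mul1r; nra.
  have {}ba : b - a < 0 by rewrite lt_neqAle dab.
  by move=> /andP[y1 y2] _; rewrite ltr_ndivlMr // ltr_ndivrMr // mul0r mul1r; nra.
pose g t := f (t *: ee ord0 + 0).
have dg y : aff a b s <= y <= aff a b s' -> is_derive y 1 g (pd ord0 f (pt1 y)).
  move=> /inv[v hv ->]; have [d _] := hf v hv; rewrite -ptE; apply: pd_line.
  by rewrite ptE.
have [|||y] := @Rolle R g (aff a b s) (aff a b s') lt.
- by move=> y; rewrite in_itv /= => /andP[y1 y2]; have [] := dg y; rewrite // !ltW.
- apply: derivable_within_continuous => y; rewrite in_itv /= => hy.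
  by have [] := dg y hy.
- by rewrite /g !ptE.
rewrite in_itv /= => /andP[y1 y2] [_ d0].
have hy : aff a b s <= y <= aff a b s' by rewrite !ltW.
have [_ d1] := dg y hy; have [v hv ev] := inv y hy; have [_ /eqP] := hf v hv; apply.
by rewrite -ev -d1 d0.
Qed.

(* The new variable is, up to scaling, the value of the steepest function of the family. *)
Lemma P1_first r : (1 <= r)%N -> P1 r 1 2 -> P1 r 0 1.
Proof.
move=> r1 hP T J c F dc dF F01 hF.
(* The coordinate itself joins the family: the largest slope is then at least 1, so the steepest
   function is injective on a segment where it remains the steepest. *)
pose f (i : option J) t (z : 'rV[R]_1) := if i is Some j then F j t z else hd z.
have df i : defm (fun p => f i p.1 p.2) by case: i => [j|] /=; ddef.
have Crf i t z : c t -> open_cube 1 z -> Cr r (f i t) z.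
  by move=> ct cz; case: i => [j|]; [case: (hF j t z ct cz)|exact: hd_Cr].
have f01 i t z : c t -> open_cube 1 z -> 0 <= f i t z <= 1.
  by move=> ct cz; case: i => [j|]; [exact: F01|move/cube1: cz => /=; lra].
have dpd i : defm (fun p => (fun t z => pd ord0 (f i t) z) p.1 p.2) by exact: defm_pd.
pose X i t : set 'rV[R]_1 := [set z | (open_cube 1 z /\ c t) /\ forall j, `|pd ord0 (f j t) z| <= `|pd ord0 (f i t) z|].
apply: (@Sol_finU _ _ _ _ _ _ X).
  move=> t z; split=> [[cz ct]|[i []]//].
  pose i := [arg max_(i > None) `|pd ord0 (f i t) z|]%O.
  exists i; split=> // j; rewrite /i; case: arg_maxP => // k _ hk; exact: hk.
move=> i.
have dX : def (fun p => X i p.1 p.2).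
  have dab j : defm (fun p : T * 'rV[R]_1 => `|pd ord0 (f j p.1) p.2|) by apply: defm_norm; exact: dpd.
  by rewrite /X /open_cube /=; apply: def_and; [ddef|apply: def_finall => j; apply: def_le].
pose W : dtype R := prod_dtype real_dtype real_dtype.
pose TW := prod_dtype T W.
pose c1 (tw : T * (R * R)) := [/\ 0 <= tw.2.1 <= 1, 0 <= tw.2.2 <= 1 & forall s : R, 0 < s < 1 ->
  X i tw.1 (pt1 (aff tw.2.1 tw.2.2 s))].
have dc1 : def (T := TW) c1.
  apply: (@def_ext _ TW (fun tw => 0 <= tw.2.1 <= 1 /\ 0 <= tw.2.2 <= 1 /\ forall s : R, 0 < s < 1 ->
    X i tw.1 (pt1 (aff tw.2.1 tw.2.2 s)))).
    by move=> tw; split=> [[? [? ?]]|[? ? ?]].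
  by rewrite /pt1 /aff; ddef.
(* Values in [[0, 1]] are sent into [[1/4, 3/4]], inside the open interval. *)
pose Rl (p : TW * 'rV[R]_1) (s : R) := [/\ 0 < s < 1, c1 p.1 &
  hd p.2 = 4^-1 + f i p.1.1 (pt1 (aff p.1.2.1 p.1.2.2 s)) / 2].
have dRl : def (fun q : (TW * 'rV[R]_1) * R => Rl q.1 q.2).
  apply: (@def_ext _ _ (fun q : (TW * 'rV[R]_1) * R => 0 < q.2 < 1 /\ c1 q.1.1 /\
    hd q.1.2 = 4^-1 + f i q.1.1.1 (pt1 (aff q.1.1.2.1 q.1.1.2.2 q.2)) / 2)).
    by move=> q; split=> [[? [? ?]]|[? ? ?]].
  have dfi := df i; rewrite /pt1 /aff; ddef.
(* A definable inverse of the steepest function; by injectivity the point reached does not depend on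
   the choice. *)
have [sel dsel hsel] := @dchoiceT R real_dtype (prod_dtype TW (row_dtype 1)) Rl dRl.
pose X' (tw : TW) : set 'rV[R]_1 := [set z | exists s, Rl (tw, z) s].
have dX' : def (fun p : TW * 'rV[R]_1 => X' p.1 p.2) by rewrite /X' /=; ddef.
have X'P tw z : X' tw z -> Rl (tw, z) (sel (tw, z)) by move=> [s /hsel].
have X'c tw z : X' tw z -> open_cube 1 z.
  move=> /X'P[hs [_ _ h] /= e]; apply/cube1; rewrite e.
  by have [[cx ct] _] := h _ hs; have := f01 i _ _ ct cx; lra.
have injf tw : c1 tw -> forall s s', 0 < s < 1 -> 0 < s' < 1 ->
    f i tw.1 (pt1 (aff tw.2.1 tw.2.2 s)) = f i tw.1 (pt1 (aff tw.2.1 tw.2.2 s')) ->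
    aff tw.2.1 tw.2.2 s = aff tw.2.1 tw.2.2 s'.
  move=> [_ _ h]; apply: rolle_inj => s /h[[cx ct] hm]; split.
    have := Cr_le r1 (Crf i _ _ ct cx); by case=> _ /(_ ord0)[].
  have := hm None; rewrite [f None _]/= pd_hd normr1.
  by apply: contraTneq => ->; rewrite normr0 -ltNge.
pose h (tw : TW) (z : 'rV[R]_1) := pt1 (aff tw.2.1 tw.2.2 (sel (tw, z))).
have dh : defm (fun p : TW * 'rV[R]_1 => h p.1 p.2) by rewrite /h /pt1 /aff; ddef.
have hX tw z : X' tw z -> X i tw.1 (h tw z) by move=> /X'P[hs [_ _ hc] _]; exact: hc.
have fh tw z : X' tw z -> f i tw.1 (h tw z) = 2 * hd z - 2^-1.
  by move=> /X'P[_ _ /= ->]; rewrite /h; field.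
pose F1 (j : option J) (tw : TW) (z : 'rV[R]_1) := f j tw.1 (h tw z).
have dF1 j : defm (fun p : TW * 'rV[R]_1 => F1 j p.1 p.2).
  by have dfj := df j; rewrite /F1; ddef.
apply: (@Sol_img _ _ _ r T W J (X i) F X' h id) => //; [|by move=> tw phi _ _; exact: tri1|].
  have [||N [e [de he]]] := @def_segments R T (fun t s => X i t (pt1 s)).
  - by rewrite /pt1; ddef.
  - by move=> t s [[/cube1]]; rewrite hd_pt1.
  exists N => t; exists (fun k => e k t) => x Xx.
  have [|k kN [e1 e2 e3 [s s01 es]]] := he t (hd x); first by rewrite pt1K.
  have ck : c1 (t, e k t) by [].
  exists k => //; pose z := pt1 (4^-1 + f i t (pt1 (aff (e k t).1 (e k t).2 s)) / 2).
  have Rz : Rl ((t, e k t), z) s by split=> //; rewrite /= hd_pt1.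
  have Xz : X' (t, e k t) z by exists s.
  exists z => //; have [s'01 _ _] := X'P _ _ Xz.
  have := fh _ _ Xz; rewrite {2}/z hd_pt1 mulrDr mulrCA divff ?pnatr_eq0 // mulr1.
  rewrite (_ : 2 * 4^-1 = 2^-1); last by field.
  rewrite addrC addKr => /(injf _ ck _ _ s'01 s01) E.
  by rewrite /h E /= /aff -es pt1K.
(* [F1 None] is the new parametrization, so this includes its smoothness. *)
pose Q (tw : TW) : set 'rV[R]_1 := [set x | inn [set y | forall j, Cr r (F1 j tw) y] x].
have dQ : def (fun p : TW * 'rV[R]_1 => Q p.1 p.2) by exact: (@def_locCr r TW _ _ F1 dF1).
apply: (@seg_red r TW J X' Q (fun j tw x' => F j tw.1 (h tw x'))) => //.
- by move=> j tw z /hX[[cx ct] _]; exact: F01.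
- by move=> tw; exact: (@thin_locCr r TW _ _ F1 tw dF1).
apply: (hP (prod_dtype TW W)).
- apply: (@def_ext _ (prod_dtype TW W) (fun tw => 0 <= tw.2.1 <= 1 /\ 0 <= tw.2.2 <= 1 /\ forall s : R, 0 < s < 1 ->
        X' tw.1 (pt1 (aff tw.2.1 tw.2.2 s)) /\ Q tw.1 (pt1 (aff tw.2.1 tw.2.2 s)))).
    by move=> tw; split=> [[? [? ?]]|[? ? ?]].
  by rewrite /pt1 /aff; ddef.
- by move=> j; have := dF1 (Some j); rewrite /F1 /= /pt1 /aff => ?; ddef.
- by move=> j [tw [p q]] z [_ _ H] /cube1 /H[/hX[[cx ct] _] _]; exact: F01.
move=> j [tw [p q]] z [/= hp hq H] cz.
pose psi (z : 'rV[R]_1) := pt1 (aff p q (hd z)).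
have oQ : open (Q tw) by exact: open_inn.
have QC y : Q tw y -> forall j, Cr r (F1 j tw) y by move/inn_sub.
have Qpsi y : open_cube 1 y -> Q tw (psi y) by move=> /cube1 /H[].
have Xpsi y : open_cube 1 y -> X' tw (psi y) by move=> /cube1 /H[].
split.
  apply: (@Cr_comp R r 1 1 _ _ (F1 (Some j) tw) psi (@open_cube_open R 1) oQ) => // [y /QC|k y _] //.
  exact: aff_Cr.
split; first by have /hX[[cx ct] _] := Xpsi z cz; have := F01 j _ _ ct cx; rewrite ler_norml /=; lra.
move=> k; rewrite /bnd; split=> //; rewrite (ord1 k).
have [||_ e1] := @pd_comp R 1 1 setT _ (F1 (Some j) tw) psi ord0 z oQ (Qpsi z cz).
- by move=> y Qy; apply: Cr_le (QC y Qy _).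
- by move=> l; have [_ /(_ ord0)[]] := aff_Cr 1 p q l z.
rewrite -[X in `|X|]/(pd ord0 (fun z => F1 (Some j) tw (psi z)) z) e1 big_ord1 aff_pd.
have [->|pq] := eqVneq q p; first by rewrite subrr mulr0 normr0.
set y := psi z; have Xy : X' tw y by exact: Xpsi.
have [[ch ctw] hmax] := hX _ _ Xy.
have hE v : h tw v = pt1 (F1 None tw v) by rewrite /F1 /= /h hd_pt1.
have eF l : pd ord0 (F1 l tw) y = pd ord0 (f l tw.1) (h tw y) * pd ord0 (F1 None tw) y.
  have [||_ e2] := @pd_comp R 1 1 setT _ (f l tw.1) (h tw) ord0 y (@open_cube_open R 1) ch.
  - by move=> v cv; apply: Cr_le (Crf l _ _ ctw cv).
  - move=> l'; rewrite (ord1 l') (_ : (fun z0 => _) = F1 None tw); last first.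
      by apply/funext => v; rewrite hE cons0.
    by have := Cr_le r1 (QC y (Qpsi z cz) None) => -[_ /(_ ord0)[]].
  rewrite [LHS]e2 big_ord1 (_ : (fun z0 => h tw z0 0 ord0) = F1 None tw) //.
(* By construction [F1 i] is [2 * hd x - 2^-1]. All slopes are multiplied by the same factor, so the
   others remain at most this one: hence the constant 2 of the hypothesis. *)
have e2 : pd ord0 (F1 i tw) y = 2.
  pose V := [set x : 'rV[R]_1 | Num.min p q < hd x < Num.max p q /\ setT (tl x)].
  have oV : open V by apply: open_cylinder; exact: openT.
  have Vy : V y by split=> //; rewrite hd_pt1; apply: aff_between => //; rewrite 1?eq_sym //; exact/cube1.
  rewrite (@pd_ext R 1 ord0 _ (fun x => 2 * hd x + - 2^-1) V y oV Vy).
    exact: (pd_affine 2 (- 2^-1) y).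
  move=> x [/(aff_inv pq)[s s01 es] _]; apply: fh; rewrite -(pt1K x) es.
  by have [] := H s s01.
have le2 : `|pd ord0 (F1 (Some j) tw) y| <= 2.
  have le1 : `|pd ord0 (F1 (Some j) tw) y| <= `|pd ord0 (F1 i tw) y|.
    rewrite (eF (Some j)) (eF i) !normrM; apply: ler_wpM2r; [exact: normr_ge0|exact: hmax].
  have n2 : `|2 : R| = 2 by rewrite ger0_norm.
  by rewrite -n2; apply: le_trans le1 _; rewrite e2.
rewrite normrM; have : `|q - p| <= 1 by rewrite ler_norml; lra.
by have := normr_ge0 (q - p); have := normr_ge0 (pd ord0 (F1 (Some j) tw) y); nra.
Qed.

End OneVariable.

(** * Higher derivatives in one variable *)

Section HighOrder.
Context {R : realType}.
Implicit Types (T U W : dtype R) (J : finType).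

Lemma pt1_line s : s *: ee ord0 + 0 = pt1 s :> 'rV[R]_1.
Proof. by apply/rowP => i; rewrite (ord1 i) !mxE unlift_none eqxx mulr1 addr0. Qed.

Lemma is_derive_seg (V : set 'rV[R]_1) (G : 'rV[R]_1 -> R) a b s : open V -> V (pt1 (aff a b s)) ->
  (forall y, V y -> Cr 1 G y) ->
  is_derive s 1 (fun s => G (pt1 (aff a b s))) (pd ord0 G (pt1 (aff a b s)) * (b - a)).
Proof.
move=> oV Vs hG; pose psi (z : 'rV[R]_1) := pt1 (aff a b (hd z)).
have Vpsi : V (psi (pt1 s)) by rewrite /psi hd_pt1.
have [|d e] := @pd_comp R 1 1 setT V G psi ord0 (pt1 s) oV Vpsi hG.
  by move=> k; have [_ /(_ ord0)[]] := aff_Cr 1 a b k (pt1 s).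
have := @pd_line R 1 (fun z => G (psi z)) ord0 0 s; rewrite pt1_line => /(_ d).
rewrite e big_ord1 aff_pd /psi hd_pt1.
rewrite (_ : (fun s0 => _) = (fun s => G (pt1 (aff a b s)))) //.
by apply/funext => v; rewrite pt1_line hd_pt1.
Qed.

(** As [e] increases, [u] grows by at least [e s * (1 - s) / 2] between [s] and the midpoint [s'] of
    [s] and 1, and it cannot grow by more than [2 * B]. *)
Lemma decay0 (u e e' : R -> R) (B : R) :
  (forall s : R, 0 < s < 1 -> [/\ is_derive s (1 : R^o) u (e s), is_derive s (1 : R^o) e (e' s), 0 <= e s, 0 <= e' s & `|u s| <= B]) ->
  forall s : R, 0 < s < 1 -> e s * (1 - s) <= 4 * B.
Proof.
move=> h s s01; pose s' := (1 + s) / 2.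
have s's : s < s' by rewrite /s'; lra.
have h01 v : s <= v <= s' -> 0 < v < 1 by rewrite /s'; lra.
have mon v : s <= v <= s' -> e s <= e v.
  move=> /andP[]; rewrite le_eqVlt => /predU1P[->//|sv] vs'.
  have [w|v'|w] := @MVT R e e' s v sv.
  - rewrite in_itv /= => /andP[w1 w2]; have [|_ d2 _ _ _] := h w; first by apply: h01; lra.
    exact: d2.
  - apply: derivable_within_continuous => w; rewrite in_itv /= => /andP[w1 w2].
    by have [|_ [] ] := h w; first by apply: h01; lra.
  rewrite in_itv /= => /andP[w1 w2] E.
  have [|_ _ _ e'0 _] := h w; first by apply: h01; lra.
  have : 0 <= e' w * (v - s) by apply: mulr_ge0 => //; lra.
  by rewrite -E; lra.
have [w|v'|w] := @MVT R u e s s' s's.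
- rewrite in_itv /= => /andP[w1 w2]; have [|d1 _ _ _ _] := h w; first by apply: h01; lra.
  exact: d1.
- apply: derivable_within_continuous => w; rewrite in_itv /= => /andP[w1 w2].
  by have [|[]] := h w; first by apply: h01; lra.
rewrite in_itv /= => /andP[w1 w2] E.
have [|_ _ es0 _ Bs] := h s; first by apply: h01; lra.
have [|_ _ _ _ Bs'] := h s'; first by apply: h01; lra.
have le : e s * (s' - s) <= e w * (s' - s) by apply: ler_wpM2r; [lra|apply: mon; lra].
have : e w * (s' - s) <= 2 * B by rewrite -E; move: Bs Bs'; rewrite ler_norml => ?; rewrite ler_norml; lra.
by move: le; rewrite /s'; lra.
Qed.

(** For increasing [e], [s <= 1 - s] on the first half reduces this to [decay0]; for decreasing [e],
    the reflection of the interval does. *)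
Lemma decay1 (u e e' : R -> R) (B : R) :
  (forall s : R, 0 < s < 1 -> [/\ is_derive s (1 : R^o) u (e s), is_derive s (1 : R^o) e (e' s), 0 <= e s & `|u s| <= B]) ->
  (forall s : R, 0 < s < 1 -> 0 <= e' s) \/ (forall s : R, 0 < s < 1 -> e' s <= 0) ->
  forall s : R, 0 < s < 1 -> s <= 2^-1 -> e s * s <= 4 * B.
Proof.
move=> h [he'|he'] s s01 s2.
  have := @decay0 u e e' B _ s s01; have es : e s * s <= e s * (1 - s).
    by have [_ _ e0 _] := h s s01; apply: ler_wpM2l => //; lra.
  move=> H; apply: (le_trans es); apply: H => v v01.
  by have [d1 d2 e0 uB] := h v v01; split=> //; exact: he'.
have flip (f : R -> R) (v d : R) : is_derive (1 - v) (1 : R^o) f d -> is_derive v (1 : R^o) (fun v => f (1 - v)) (- d).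
  move=> df; have d1 : is_derive v (1 : R^o) (fun v : R => 1 - v) (- 1).
    have := @is_deriveB R R^o R^o (cst 1) id v 1 0 1 _ _.
    by move/(_ (is_derive_cst _ _ _) (is_derive_id _ _)); rewrite sub0r.
  have := @is_derive1_comp R f (fun v : R => 1 - v) v d (- 1) df d1.
  by rewrite mulrN1.
have := @decay0 (fun v => - u (1 - v)) (fun v => e (1 - v)) (fun v => - e' (1 - v)) B _ (1 - s).
rewrite (_ : 1 - (1 - s) = s); last by ring.
apply; last by lra.
move=> v v01; have [|d1 d2 e0 uB] := h (1 - v); first by lra.
split=> //.
- have := flip _ _ _ d1 => /is_deriveN; rewrite opprK; exact.
- exact: flip.
- by rewrite oppr_ge0; apply: he'; lra.
- by rewrite normrN.
Qed.

Lemma decay (u e e' : R -> R) (B : R) :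
  (forall s : R, 0 < s < 1 -> [/\ is_derive s (1 : R^o) u (e s), is_derive s (1 : R^o) e (e' s) & `|u s| <= B]) ->
  (forall s : R, 0 < s < 1 -> 0 <= e s) \/ (forall s : R, 0 < s < 1 -> e s <= 0) ->
  (forall s : R, 0 < s < 1 -> 0 <= e' s) \/ (forall s : R, 0 < s < 1 -> e' s <= 0) ->
  forall s : R, 0 < s < 1 -> s <= 2^-1 -> `|e s| * s <= 4 * B.
Proof.
move=> h [he|he] he' s s01 s2.
  rewrite ger0_norm; last exact: he.
  apply: (@decay1 u e e' B) => // v v01; have [d1 d2 uB] := h v v01; split=> //; exact: he.
rewrite ler0_norm; last exact: he.
apply: (@decay1 (fun v => - u v) (fun v => - e v) (fun v => - e' v) B) => //.
  move=> v v01; have [d1 d2 uB] := h v v01; split; rewrite ?normrN ?oppr_ge0 //; last exact: he.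
- exact: is_deriveN.
- exact: is_deriveN.
case: he' => he'; [right|left] => v v01; rewrite ?oppr_le0 ?oppr_ge0; exact: he'.
Qed.

(* The square slows the parametrization down at the end point [p], where the next
   derivative may blow up like the inverse of the distance. *)
Definition hq (p q : R) (z : 'rV[R]_1) : R := aff p q (hd z ^+ 2 / 2).

Lemma hqE p q : hq p q = fun z => p + ((q - p) / 2) * (z 0 ord0 * z 0 ord0).
Proof. by apply/funext => z; rewrite /hq /aff /hd expr2; field. Qed.

Lemma jet_hq r : exists B1, forall p q, 0 <= p <= 1 -> 0 <= q <= 1 -> jet r B1 (hq p q).
Proof.
have [B2 h2] := @jet_mul R 1 r 1 1; have [B3 h3] := @jet_mul R 1 r 1 B2.
exists (1 + B3) => p q hp hq'; rewrite hqE; apply: jet_add.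
  by apply: jet_cst; rewrite ler_norml; lra.
apply: h3; first by apply: jet_cst; rewrite ler_norml; lra.
by apply: h2; exact: jet_coord.
Qed.

Lemma hq_onto p q (v : R) : 0 < v < 2^-1 -> exists2 z, open_cube 1 z & hq p q z = aff p q v.
Proof.
move=> hv; have s2 : Num.sqrt (2 * v) ^+ 2 = 2 * v by apply: sqr_sqrtr; lra.
have s0 : 0 < Num.sqrt (2 * v) by rewrite sqrtr_gt0; lra.
exists (pt1 (Num.sqrt (2 * v))).
  apply/cube1; rewrite hd_pt1 s0 /= -(ltr_pXn2r (ltn0Sn 1)) ?nnegrE ?ltW // s2 expr1n; lra.
by rewrite /hq hd_pt1 s2 mulrC mulrA mulVf ?pnatr_eq0 // mul1r.
Qed.

Lemma half_sqr (v : R) : 0 < v < 1 -> 0 < v ^+ 2 / 2 < 1 /\ v ^+ 2 / 2 <= 2^-1.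
Proof. by move=> hv; rewrite expr2; split; nra. Qed.

Lemma pd_hq p q z : pd ord0 (hq p q) z = (q - p) * hd z.
Proof.
have [d1 e1] := pd_cst p ord0 z; have [d2 e2] := pd_cst ((q - p) / 2) ord0 z.
have [d3 e3] := pd_coord ord0 ord0 z; have [d4 e4] := pd_mul d3 d3; have [d5 e5] := pd_mul d2 d4.
have [_ e6] := pd_add d1 d5.
rewrite hqE e6 e5 e4 e3 e2 e1 eqxx mulr0 addr0 mulr1 add0r /hd; by field.
Qed.

Definition hsgn (b : bool) (v : R) : Prop := if b then 0 <= v else v < 0.

(** [decay] for the derivative of order [k] restricted to the segment; the chain rule contributes
    the factor [q - p]. *)
Lemma seg_decay k b b' (V : set 'rV[R]_1) f (p q B : R) : open V -> (forall y, V y -> Cr k.+2 f y) ->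
  let e := dw (nseq k.+1 ord0) f in
  (forall s, 0 < s < 1 -> let x := pt1 (aff p q s) in
     [/\ V x, `|dw (nseq k ord0) f x| <= B, hsgn b (e x) & hsgn b' (pd ord0 e x)]) ->
  forall s, 0 < s < 1 -> s <= 2^-1 -> `|e (pt1 (aff p q s))| * `|q - p| * s <= 4 * B.
Proof.
move=> oV hC e h s s01 s2; rewrite -normrM.
have Ce y : V y -> Cr 1 e y.
  by move=> Vy; apply: (@Cr_dw R 1 (nseq k.+1 ord0)); rewrite size_nseq addn1; exact: hC.
apply: (@decay (fun s => dw (nseq k ord0) f (pt1 (aff p q s))) (fun s => e (pt1 (aff p q s)) * (q - p))
  (fun s => pd ord0 e (pt1 (aff p q s)) * (q - p) * (q - p)) B) => //.
- move=> v v01; have [Vv Bv _ _] := h v v01; split=> //.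
  + apply: (is_derive_seg oV Vv) => y Vy; apply: (@Cr_dw R 1 (nseq k ord0)); rewrite size_nseq.
    by apply: Cr_le (hC _ Vy); rewrite addn1 leqnSn.
  + have [|d1 e1] := @is_derive_seg V (fun y => e y * (q - p)) p q v oV Vv.
      move=> y Vy; apply: (@Cr_mul R _ _ oV 1 e (fun=> q - p) _ _ y Vy) => z Vz; [exact: Ce|exact: Cr_cst].
    have [d2 e2] := pd_cst (q - p) ord0 (pt1 (aff p q v)).
    have [|d3 e3] := @pd_mul R 1 e _ ord0 (pt1 (aff p q v)) _ d2.
      by have [_ /(_ ord0)[]] := Ce _ Vv.
    by split; [exact: d1|rewrite e1 e3 e2 mulr0 add0r (mulrC (q - p))].
- have sgnM v : 0 < v < 1 -> hsgn b (e (pt1 (aff p q v))) by move=> /h[].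
  case: b sgnM {h} => hb; have [pq|pq] := leP p q; [left|right|right|left] => v /hb /= hv.
  + by apply: mulr_ge0 => //; rewrite subr_ge0.
  + by apply: mulr_ge0_le0 => //; rewrite subr_le0 ltW.
  + by apply: mulr_le0_ge0; [exact: ltW|rewrite subr_ge0].
  + by apply: mulr_le0; [exact: ltW|rewrite subr_le0 ltW].
- have sgnM v : 0 < v < 1 -> hsgn b' (pd ord0 e (pt1 (aff p q v))) by move=> /h[].
  case: b' sgnM {h} => hb; [left|right] => v /hb /= hv; rewrite -mulrA.
  + by apply: mulr_ge0 => //; rewrite -expr2 sqr_ge0.
  + by apply: mulr_le0_ge0; [exact: ltW|rewrite -expr2 sqr_ge0].
Qed.

(** Where the derivatives of orders [k.+1] and [k.+2] keep their signs, the former is bounded by the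
    inverse of the distance to the end point. After the substitution [hq] this distance is quadratic
    in the variable while the derivative of [hq] is linear, and its power [k.+1] is at least 2: the
    product is bounded. Order one escapes this argument and needs [P1_first]. *)
Lemma P1_next r k : (1 <= k)%N -> (k < r)%N -> (forall B : R, P1 r k.+1 B) -> forall B : R, P1 r k B.
Proof.
move=> k1 kr hP B T J c F dc dF F01 hF.
pose w : seq 'I_1 := nseq k ord0; have sw : size w = k by rewrite size_nseq.
pose u j t := dw w (F j t); pose e j t := dw (ord0 :: w) (F j t).
have ddw (w' : seq 'I_1) j : defm (fun p : T * 'rV[R]_1 => dw w' (F j p.1) p.2).
  elim: w' => [|i w' ih] /=; first exact: dF.
  exact: (@defm_pd R T 1 (fun t => dw w' (F j t)) i ih).
(* The sign conditions may involve order [r.+1], one more than assumed; it exists off finitely many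
   points. *)
pose Q t : set 'rV[R]_1 := [set x | inn [set y | forall j, Cr k.+2 (F j t) y] x].
have dQ : def (fun p => Q p.1 p.2) by exact: def_locCr.
pose Y t : set 'rV[R]_1 := [set z | open_cube 1 z /\ c t].
apply: (@Sol_union _ _ _ _ _ _ (fun t => [set x | Q t x /\ Y t x]) (fun t => [set x | ~ Q t x /\ Y t x])).
- by move=> t x; rewrite /Y /=; have := pselect (Q t x); tauto.
- have sE (v : R) : hsgn (0 <= v) v by rewrite /hsgn; case: leP.
  (* One piece for each pattern of signs of the derivatives of orders [k.+1] and [k.+2] of all the
     functions. *)
  pose Xe (ep : {ffun J -> bool * bool}) t : set 'rV[R]_1 := [set x | (Q t x /\ Y t x) /\
    forall j, hsgn (ep j).1 (e j t x) /\ hsgn (ep j).2 (pd ord0 (e j t) x)].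
  have dXe ep : def (fun p => Xe ep p.1 p.2).
    rewrite /Xe /=; apply: def_and; first by rewrite /Y /open_cube /=; ddef.
    apply: def_finall => j; have h1 := ddw (ord0 :: w) j; have h2 := ddw [:: ord0, ord0 & w] j.
    by apply: def_and; rewrite /hsgn; [case: (ep j).1|case: (ep j).2];
      [apply: def_le|apply: def_lt|apply: def_le|apply: def_lt] => //; ddef.
  apply: (@Sol_finU _ _ _ _ _ _ _ Xe).
    move=> t x; split=> [h|[ep []]//]; exists [ffun j => (0 <= e j t x, 0 <= pd ord0 (e j t) x)].
    by split=> // j; rewrite ffunE; split; exact: sE.
  move=> ep; pose W : dtype R := prod_dtype real_dtype real_dtype.
  pose TW := prod_dtype T W.
  pose g (tw : TW) (z : 'rV[R]_1) := pt1 (hq tw.2.1 tw.2.2 z).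
  pose cc (tw : TW) := [/\ 0 <= tw.2.1 <= 1, 0 <= tw.2.2 <= 1 & forall z : 'rV[R]_1, open_cube 1 z ->
    Xe ep tw.1 (g tw z) /\ forall j, `|e j tw.1 (g tw z)| * (`|tw.2.2 - tw.2.1| * hd z ^+ 2) <= 8 * B].
  have dg : defm (fun p : TW * 'rV[R]_1 => g p.1 p.2) by rewrite /g /pt1 /hq /aff; ddef.
  have dcc : def cc.
    apply: (@def_ext _ TW (fun tw => 0 <= tw.2.1 <= 1 /\ 0 <= tw.2.2 <= 1 /\ forall z : 'rV[R]_1, open_cube 1 z ->
      Xe ep tw.1 (g tw z) /\ forall j, `|e j tw.1 (g tw z)| * (`|tw.2.2 - tw.2.1| * hd z ^+ 2) <= 8 * B)).
      by move=> tw; split=> [[? [? ?]]|[? ? ?]].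
    apply: def_and; first by ddef.
    apply: def_and; first by ddef.
    apply: (@def_all _ _ (row_dtype 1)); apply: def_imp; first by rewrite /open_cube /=; ddef.
    apply: def_and; first by have := dXe ep => ?; ddef.
    apply: def_finall => j; have h1 := ddw (ord0 :: w) j.
    have h2 : defm (fun p : TW * 'rV[R]_1 => e j p.1.1 (g p.1 p.2)).
      by apply: (@defm_comp2 _ _ _ _ _ (e j)) => //; ddef.
    by apply: def_le; [apply: defm_mul; [apply: defm_norm; exact: h2|ddef]|ddef].
  apply: (@Sol_img _ _ _ r T W J (Xe ep) F (fun tw => [set z | open_cube 1 z /\ cc tw]) g id) => //.
  + have [||N [a [da ha]]] := @def_segments R T (fun t v => Xe ep t (pt1 v)).
    * by have := dXe ep => ?; rewrite /pt1; ddef.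
    * by move=> t v [[_ [/cube1]]]; rewrite hd_pt1.
    (* Three maps for each segment: the halves next to either end, the ends being exchanged for the
       second, and the midpoint that the open halves miss. *)
    exists (N * 3)%N => t.
    pose m i : R := aff (a i t).1 (a i t).2 2^-1.
    exists (fun i => let i' := (i %/ 3)%N in if (i %% 3 == 0)%N then a i' t
       else if (i %% 3 == 1)%N then ((a i' t).2, (a i' t).1) else (m i', m i')) => x Xx.
    have [|i iN [h1 h2 h3 [v v01 hv]]] := ha t (hd x); first by rewrite pt1K.
    have ax : x = pt1 (aff (a i t).1 (a i t).2 v) by rewrite /aff -hv pt1K.
    have dec : forall ab : R * R, 0 <= ab.1 <= 1 -> 0 <= ab.2 <= 1 ->
        (forall v, 0 < v < 1 -> Xe ep t (pt1 (aff ab.1 ab.2 v))) -> cc (t, ab).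
      move=> [p q] hp hq' hX; split; [exact: hp|exact: hq'|move=> z /cube1 hz].
      have [z2 z2'] := half_sqr hz.
      split; first exact: hX.
      move=> j; have oQ : open (Q t) by exact: open_inn.
      have hC y : Q t y -> Cr k.+2 (F j t) y by move/inn_sub.
      have D : `|e j t (pt1 (aff p q (hd z ^+ 2 / 2)))| * `|q - p| * (hd z ^+ 2 / 2) <= 4 * B.
        apply: (@seg_decay k (ep j).1 (ep j).2 (Q t) (F j t) p q B oQ hC _ _ z2 z2') => y hy.
        have [[Qy [cy ct]] /(_ j)[]] := hX y hy; split=> //.
        by have [_ hb] := hF j t _ ct cy; apply: (bnd_dw _ hb); rewrite sw.
      rewrite /g /hq /= mulrA; move: D; set D1 := (_ * `|q - p|); lra.
    have pt_in (p q v' : R) : 0 < v' < 2^-1 -> exists2 z : 'rV[R]_1, open_cube 1 z & g (t, (p, q)) z = pt1 (aff p q v').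
      by move=> /(@hq_onto p q)[z cz e0]; exists z; rewrite // /g /= e0.
    have N3 l : (l < 3)%N -> (i * 3 + l < N * 3)%N by lia.
    have D3 l : (l < 3)%N -> ((i * 3 + l) %/ 3 = i)%N /\ ((i * 3 + l) %% 3 = l)%N by lia.
    have flip v' : aff (a i t).1 (a i t).2 v' = aff (a i t).2 (a i t).1 (1 - v') by rewrite /aff; ring.
    have [v2|v2|v2] := ltgtP v 2^-1.
    * have [D1 D2] := D3 0%N isT; exists (i * 3 + 0)%N; rewrite ?N3 // D1 D2 /=.
      have [|z cz gz] := pt_in (a i t).1 (a i t).2 v; first by lra.
      have Ea : ((a i t).1, (a i t).2) = a i t by case: (a i t).
      exists z; last by rewrite ax -gz Ea.
      by split; [exact: cz|exact: (dec _ h1 h2 h3)].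
    * have [D1 D2] := D3 1%N isT; exists (i * 3 + 1)%N; rewrite ?N3 // D1 D2 /=.
      have [|z cz gz] := pt_in (a i t).2 (a i t).1 (1 - v); first by lra.
      exists z; last by rewrite ax flip -gz.
      split; [exact: cz|apply: (dec (_, _) h2 h1) => v' hv'].
      by rewrite -[v'](subKr 1) /= -flip; apply: h3; lra.
    * have [D1 D2] := D3 2%N isT; exists (i * 3 + 2)%N; rewrite ?N3 // D1 D2 /=.
      have Em p v' : aff p p v' = p by rewrite /aff; ring.
      have [|z cz gz] := pt_in (m i) (m i) (4^-1); first by lra.
      exists z; last by rewrite ax gz Em /m -v2.
      have mi : 0 <= m i <= 1 by have := aff01 h1 h2 (_ : 0 < 2^-1 < 1); apply; lra.
      split; [exact: cz|apply: (dec (_, _) mi mi) => v' hv'].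
      by rewrite Em; apply: h3; lra.
  + by move=> tw z [cz [_ _ /(_ z cz)[]]].
  + by move=> tw phi _ _; exact: tri1.
  have [B1 hB1] := jet_hq k.+2.
  have [B' hB'] := @subst0_bound R 0 k.+1 k B B1 (8 * B).
  apply: (hP B' TW J cc (fun j tw x' => F j tw.1 (g tw x'))) => //.
  + move=> j; have := dF j => ?; ddef.
  + by move=> j tw z [_ _ h] /h[[[_ [cz ct]] _] _]; exact: F01.
  move=> j tw z hcc cz; have [hp hq' h] := hcc.
  have [[[_ [_ ct]] _] _] := h z cz.
  have gE z' : g tw z' = subst0 (hq tw.2.1 tw.2.2) z'.
    by rewrite /g /pt1 /subst0 -[X in cons _ X](thinmx0 (tl z')).
  have oh : only_hd k.+2 B1 (hq tw.2.1 tw.2.2).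
    split; [exact: hB1|by case|move=> y /h[[[_ [/cube1]]]]]; by rewrite hd_pt1.
  have -> : (fun x' => F j tw.1 (g tw x')) = (fun x' => F j tw.1 (subst0 (hq tw.2.1 tw.2.2) x')).
    by apply/funext => y; rewrite gE.
  have [B2 hB2] := jet_hq r.
  have oh2 : only_hd r B2 (hq tw.2.1 tw.2.2).
    split; [exact: hB2|by case|move=> y /h[[[_ [/cube1]]]]]; by rewrite hd_pt1.
  split; first by apply: (Cr_subst0 oh2) => // y cy; have [] := hF j _ _ ct cy.
  apply: dw_bnd => w' sw'; apply: hB' => //.
  + by move=> y cy; have [/(Cr_le kr)] := hF j _ _ ct cy.
  + move=> w2 y cy _ cw; have [_ hb] := hF j _ _ ct cy; apply: (bnd_dw _ hb).
    by move: cw; rewrite (eq_in_count (a2 := predT)) ?count_predT // => i _; rewrite /= (ord1 i) eqxx.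
  + move=> v y cy hv _; have -> : v = [::] by case: v hv => // i v /=; rewrite (ord1 i).
    (* The derivative of [hq] is the length of the segment, up to sign, times [hd y]. Both factors
       are at most 1 in absolute value, so the power [k.+1] is at most the length times [hd y ^+ 2],
       which the condition [cc] balances. *)
    rewrite cats0 -gE pd_hq; have [_ /(_ j)] := h y cy; apply: le_trans.
    rewrite -[nseq _ _]/(ord0 :: w) -/(e j tw.1); apply: ler_wpM2l; first exact: normr_ge0.
    have /cube1 hy := cy; rewrite normrM exprMn [X in _ * X ^+ _]ger0_norm; last by lra.
    apply: ler_pM; rewrite ?exprn_ge0 //; first by lra.
      by rewrite exprS -[leRHS]mulr1 ler_wpM2l // exprn_ile1 // ler_norml; lra.
    rewrite -(subnKC (_ : 2 <= k.+1)%N) // exprD -[leRHS]mulr1 ler_wpM2l ?sqr_ge0 // exprn_ile1 //; lra.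
  + apply: leq_trans sw'; exact: count_size.
- have [||N hN] := @thin1_fin R T (fun t => [set x | ~ Q t x]).
  + exact: def_not.
  + by move=> t; exact: thin_locCr.
  apply: (@Sol_pts R r T J N) => [j t x [_ [cx ct]]|t]; first exact: F01.
  by have [a ha] := hN t; exists a => v [/ha].
Qed.

Lemma Pn0 r : (1 <= r)%N -> @Pn R 0 r.
Proof.
move=> r1; apply: Pn0_of_P1; apply: P1_first => //.
suff h k : (1 <= r - k)%N -> forall B : R, P1 r (r - k) B.
  by have := h (r - 1)%N; rewrite subKn //; apply.
elim: k => [|k ih] k1 B; first by rewrite subn0; exact: P1_top.
have e : (r - k.+1).+1 = (r - k)%N by lia.
by apply: P1_next => //; [lia|move=> B'; rewrite e; apply: ih; lia].
Qed.

End HighOrder.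

(** * Induction on the number of variables *)

Section Curves.
Context {R : realType}.
Implicit Types (T U : dtype R) (I J : finType).

Definition nrm (B v : R) : R := (2 * B)^-1 * v + 2^-1.

Lemma nrm01 B v : 0 < B -> `|v| <= B -> 0 <= nrm B v <= 1.
Proof.
move=> B0; rewrite /nrm ler_norml => /andP[h1 h2].
have e : (2 * B)^-1 * B = 2^-1 by field; rewrite gt_eqF.
have i0 : 0 <= (2 * B)^-1 by rewrite invr_ge0; lra.
have := ler_wpM2l i0 h1; have := ler_wpM2l i0 h2; rewrite mulrN e; lra.
Qed.

(** The functions to regularize along the curves of points [cons s (ga i t s)]: the variable, the
    coordinates of each curve and the values of [G i] on it. Their derivatives are all the terms of
    the chain rule but the slope of [G i] in the first variable, for which it is solved. *)
Definition curves n I T B (G : I -> T -> 'rV[R]_n.+1 -> R) (ga : I -> T -> R -> 'rV[R]_n)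
    (q : option (I * option 'I_n)) (t : T) (z : 'rV[R]_1) : R :=
  match q with
  | None => hd z
  | Some (i, None) => nrm B (G i t (cons (hd z) (ga i t (hd z))))
  | Some (i, Some l) => ga i t (hd z) 0 l
  end.

Lemma defm_curves n I T B (G : I -> T -> 'rV[R]_n.+1 -> R) (ga : I -> T -> R -> 'rV[R]_n) q :
  (forall i, defm (fun p => G i p.1 p.2)) -> (forall i, defm (fun p => ga i p.1 p.2)) ->
  defm (fun p => curves B G ga q p.1 p.2).
Proof. by move=> dG dga; case: q => [[i [l|]]|] /=; rewrite /nrm; ddef. Qed.

(* Where the derivative of [G] in the first variable is large along a curve, the
   parametrization must be slow. *)
Lemma curve_bound n I T B B0 (G : I -> T -> 'rV[R]_n.+1 -> R) (ga : I -> T -> R -> 'rV[R]_n) t phi i :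
  0 < B ->
  (forall x, open_cube n.+1 x -> Cr 1 (G i t) x /\ forall l, `|pd (lift ord0 l) (G i t) x| <= B) ->
  (forall z, open_cube 1 z -> open_cube n.+1 (cons (hd (phi z)) (ga i t (hd (phi z))))) ->
  (forall q, jet 1 B0 (fun z => curves B G ga q t (phi z))) ->
  forall z, open_cube 1 z ->
  `|pd ord0 (G i t) (cons (hd (phi z)) (ga i t (hd (phi z))))| * `|pd ord0 (fun z => hd (phi z)) z|
    <= 2 * B * B0 + n%:R * (B * B0).
Proof.
move=> Bp hG cphi hj z cz; pose psi z := cons (hd (phi z)) (ga i t (hd (phi z))).
have dc q : derivable (fun z => curves B G ga q t (phi z)) z (ee ord0) /\
    `|pd ord0 (fun z => curves B G ga q t (phi z)) z| <= B0.
  by have [[_ /(_ ord0)[d _]] [_ /(_ ord0)[]]] := hj q z cz.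
have dpsi k : derivable (fun z => psi z 0 k) z (ee ord0).
  case: (unliftP ord0 k) => [l|] ->.
    rewrite (_ : (fun z => _) = fun z => curves B G ga (Some (i, Some l)) t (phi z)); first by case: (dc (Some (i, Some l))).
    by apply/funext => v; rewrite /psi consS.
  rewrite (_ : (fun z => _) = fun z => curves B G ga None t (phi z)); first by case: (dc None).
  by apply/funext => v; rewrite /psi cons0.
have hG1 y : open_cube n.+1 y -> Cr 1 (G i t) y by move=> /hG[].
have [d e] := @pd_comp R 1 n.+1 setT _ (G i t) psi ord0 z (@open_cube_open R n.+1) (cphi z cz) hG1 dpsi.
have [d1 e1] := pd_cst (2 * B)^-1 ord0 z; have [d2 e2] := pd_cst (2^-1) ord0 z.
have [d3 e3] := pd_mul d1 d; have [_ e4] := pd_add d3 d2.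
have [_] := dc (Some (i, None)); rewrite /= -[fun z => _]/(fun z => (2 * B)^-1 * G i t (psi z) + 2^-1).
rewrite e4 e2 e3 e1 mulr0 !addr0 normrM ger0_norm; last by rewrite invr_ge0; lra.
rewrite ler_pdivrMl; last by lra.
(* The chain rule bounds the total derivative; the terms of the other variables are bounded too,
   which leaves the first one. *)
rewrite e big_ord_recl => h1.
rewrite (_ : (fun z => psi z 0 ord0) = fun z => hd (phi z)) in h1; last first.
  by apply/funext => v; rewrite /psi cons0.
have h2 : `|\sum_(l < n) pd (lift ord0 l) (G i t) (psi z) * pd ord0 (fun z => psi z 0 (lift ord0 l)) z| <= n%:R * (B * B0).
  apply: le_trans (ler_norm_sum _ _ _) _.
  rewrite mulr_natl -[X in _ *+ X](card_ord n) -sumr_const; apply: ler_sum => l _.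
  rewrite normrM; apply: ler_pM; rewrite ?normr_ge0 //; first by have [_ /(_ l)] := hG _ (cphi z cz).
  have [_] := dc (Some (i, Some l)); rewrite /=.
  by rewrite (_ : (fun z => psi z 0 (lift ord0 l)) = fun z => ga i t (hd (phi z)) 0 l) //; apply/funext => v; rewrite /psi consS.
rewrite -normrM.
set u := (X in `|X|); set v := (X in u + X) in h1; rewrite -[u](addrK v).
by apply: le_trans (ler_normB _ _) _; apply: lerD.
Qed.

Lemma dist_natr (p q : nat) : p != q -> 1 <= `|p.+1%:R - q.+1%:R| :> R.
Proof.
have key (p' q' : nat) : (p' < q')%N -> p'.+1%:R + 1 <= q'.+1%:R :> R by move=> h; rewrite natr1 ler_nat.
by rewrite neq_ltn ler_normr => /orP[] /key h; apply/orP; [right|left]; lra.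
Qed.

(** Among the [N.+1] points that cut the interval into [N.+2] equal parts, two lie in the same
    set. *)
Lemma cover_len N (S : nat -> R -> Prop) (a b l : R) : a < b ->
  (forall x, a < x < b -> exists2 i, (i < N)%N & S i x) ->
  (forall i x y, S i x -> S i y -> `|x - y| <= l) -> b - a <= N.+2%:R * l.
Proof.
move=> ab hS hl; pose d := (b - a) / N.+2%:R.
have N0 : 0 < N.+2%:R :> R by rewrite ltr0n.
have d0 : 0 < d by rewrite /d divr_gt0 // subr_gt0.
have dN : N.+2%:R * d = b - a by rewrite /d mulrC divfK ?gt_eqF.
pose x (m : 'I_N.+1) : R := a + m.+1%:R * d.
have hx m : a < x m < b.
  have h1 : 0 < m.+1%:R * d by rewrite mulr_gt0 // ltr0n.
  have h2 : m.+1%:R * d < N.+2%:R * d by rewrite ltr_pM2r // ltr_nat ltnS ltn_ord.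
  by move: h2; rewrite /x dN; lra.
have /choice[f hf] : forall m, exists i : 'I_N, S i (x m).
  by move=> m; have [i iN h] := hS _ (hx m); exists (Ordinal iN).
have /injectivePn[m [m' mm' e]] : ~~ injectiveb f.
  by apply/negP => /injectiveP /leq_card; rewrite !card_ord ltnn.
have le1 : `|x m - x m'| <= l by apply: (hl (f m)); [|rewrite e]; exact: hf.
rewrite -dN ler_pM2l //; apply: le_trans le1.
have -> : x m - x m' = (m.+1%:R - m'.+1%:R) * d by rewrite /x; ring.
rewrite normrM (ger0_norm (ltW d0)) ler_peMl //; [exact: ltW|exact: (dist_natr mm')].
Qed.

(* Otherwise, for every [K], curves along which the slope exceeds [K] would be covered
   by a number of parametrizations independent of [K], each of length O(1/K). *)
Lemma slope_bounded n (g : 'rV[R]_n.+1 -> R) (B a b : R) : @Pn R 0 1 -> defm g -> 0 < B ->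
  (forall x, open_cube n.+1 x ->
     [/\ Cr 1 g x, `|g x| <= B & forall l, `|pd (lift ord0 l) g x| <= B]) ->
  a < b -> 0 <= a -> b <= 1 ->
  ~ (forall s, a < s < b -> forall K, exists2 y, open_cube n y & K < `|pd ord0 g (cons s y)|).
Proof.
move=> hP dg Bp hg ab a0 b1 hunb.
have dpg : defm (pd ord0 g).
  have dG : defm (fun p : R * 'rV[R]_n.+1 => (fun=> g) p.1 p.2) by ddef.
  exact: (defm_comp (defm_pair (@defm_const _ _ real_dtype 0) (@defm_id _ _)) (defm_pd ord0 dG)).
pose Rl (p : R * R) (y : 'rV[R]_n) := open_cube n y /\ p.1 < `|pd ord0 g (cons p.2 y)|.
have dRl : def (fun q : R * R * 'rV[R]_n => Rl q.1 q.2) by rewrite /Rl /open_cube /=; ddef.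
have [c dc hc] := dchoiceT dRl.
pose G (i : unit) (K : R) := g; pose ga (i : unit) (K : R) (s : R) := c (K, s).
have dG i : defm (fun p : R * 'rV[R]_n.+1 => G i p.1 p.2) by rewrite /G; ddef.
have dga i : defm (fun p : R * R => ga i p.1 p.2) by rewrite /ga; ddef.
have hga K s i : a < s < b -> open_cube n.+1 (cons s (ga i K s)) /\ K < `|pd ord0 g (cons s (ga i K s))|.
  move=> hs; have [y cy hy] := hunb s hs K; have [h1 h2] := hc (K, s) y (conj cy hy).
  by split=> //; apply/cube_cons; split=> //; lra.
pose X (K : R) : set 'rV[R]_1 := [set z | a < hd z < b].
(* The threshold [K] is the parameter of this family, so [N] and [B0] are known before it. *)
have [||||U [Phi [N [B0 [dPhi hPhi]]]]] := hP real_dtype _ X (curves B G ga).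
- by rewrite /X /=; ddef.
- by move=> q; exact: defm_curves.
- by move=> K z; rewrite /X /= => hz; apply/cube1; lra.
- move=> [[i [l|]]|] K z hz /=.
  + by have [/(_ (lift ord0 l)) + _] := hga K _ i hz; rewrite consS; lra.
  + by apply: nrm01 => //; have [h _] := hga K _ i hz; have [] := hg _ h.
  + by move: hz; rewrite /X /=; lra.
pose C := 2 * B * B0 + n%:R * (B * B0).
(* Makes [N.+2] times the length [|C| / K] smaller than [b - a]. *)
pose K := (N.+2%:R * (`|C| + 1)) / (b - a).
have C1 : 0 < `|C| + 1 by have := normr_ge0 C; lra.
have K0 : 0 < K by rewrite /K divr_gt0 ?subr_gt0 // mulr_gt0.
have [us hus] := hPhi K.
pose S i (x : R) := good 1 B0 (X K) (fun q => curves B G ga q K) (Phi (us i)) /\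
  exists2 z, open_cube 1 z & Phi (us i) z = pt1 x.
have := @cover_len N S a b (`|C| / K) ab.
have e : N.+2%:R * (`|C| / K) = (b - a) * (`|C| / (`|C| + 1)).
  by rewrite /K; field; rewrite ?gt_eqF // ?subr_gt0 ?ltr0n.
rewrite e; suff lt : (b - a) * (`|C| / (`|C| + 1)) < b - a.
  move=> h; have {}h : b - a <= (b - a) * (`|C| / (`|C| + 1)).
    apply: h.
    - move=> x hx; have [|i iN h] := hus (pt1 x); first by rewrite /X /= hd_pt1.
      by exists i.
    move=> i x y [[h1 h2 h3] [z cz ez]] [_ [z' cz' ez']].
    have cphi v : open_cube 1 v -> open_cube n.+1 (cons (hd (Phi (us i) v)) (ga tt K (hd (Phi (us i) v)))).
      by move=> /h1 hv; have [] := hga K _ tt hv.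
    have hG v : open_cube n.+1 v -> Cr 1 (G tt K) v /\ forall l, `|pd (lift ord0 l) (G tt K) v| <= B.
      by move=> /hg[].
    have cb := curve_bound Bp hG cphi h3.
    have := @mvt R 1 (open_cube 1) (fun z => hd (Phi (us i) z)) (fun=> 0) (`|C| / K) z' z (@cube_convex R 1).
    rewrite ez ez' !hd_pt1 !big_ord1 mul0r subr0 => H; apply: le_trans (H _ cz' cz) _.
      move=> v k cv; rewrite (ord1 k) subr0; split.
        by have [[_ /(_ ord0)[]]] := h3 None v cv.
      rewrite ler_pdivlMr // mulrC; apply: le_trans (ler_norm C); apply: le_trans (cb v cv).
      rewrite ler_wpM2r //; have [_] := hga K _ tt (h1 v cv); exact: ltW.
    rewrite -[leRHS]mulr1 ler_wpM2l //; first by rewrite divr_ge0 // ltW.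
    by have := cz ord0; have := cz' ord0; rewrite ler_norml; lra.
  by have := lt_le_trans lt h; rewrite ltxx.
rewrite -[ltRHS]mulr1 ltr_pM2l ?subr_gt0 // ltr_pdivrMr // mul1r; lra.
Qed.

End Curves.

(** * Bounding the derivatives in the first variable *)

Section Straighten.
Context {R : realType}.
Implicit Types (T U : dtype R) (I J : finType).

(** The counterpart of [P1] in several variables: [m] counts the derivatives in the first variable
    only, and descends from [r] to 0. *)
Definition Pfull n r m := forall T J (c : T -> Prop) (F : J -> T -> 'rV[R]_n.+1 -> R) (B : R),
  def c -> (forall j, defm (fun p => F j p.1 p.2)) ->
  (forall j t z, c t -> open_cube n.+1 z -> 0 <= F j t z <= 1) ->
  (forall j t z, c t -> open_cube n.+1 z -> Cr r (F j t) z) ->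
  (forall j t z w, c t -> open_cube n.+1 z -> (size w <= r)%N -> (count_mem ord0 w <= m)%N ->
     `|dw w (F j t) z| <= B) ->
  Sol r (fun t => [set z | open_cube n.+1 z /\ c t]) F.

Lemma Pfull_top n r : Pfull n r r.
Proof.
move=> T J c F B dc dF F01 hC hB; exists real_dtype, (fun _ z => z), 1%N, B; split; first by ddef.
move=> t; exists (fun=> 0) => x [cx ct]; exists 0%N => //; split; last by exists x.
split=> // j z cz; split; first exact: hC.
apply: dw_bnd => w sw; apply: hB => //; apply: leq_trans sw; exact: count_size.
Qed.

(** The supremum over an open fibre need not be attained; a factor 2 is given up instead. *)
Lemma near_max n (D : set 'rV[R]_n) (f : 'rV[R]_n -> R) (K : R) : D !=set0 ->
  (forall y, D y -> 0 <= f y <= K) -> exists2 y, D y & forall y', D y' -> f y' <= 2 * f y.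
Proof.
move=> [y0 Dy0] hK; pose A := [set f y | y in D].
have sA : has_sup A.
  by split; [exists (f y0), y0|exists K => _ [y Dy <-]; have /andP[] := hK y Dy].
have le y : D y -> f y <= sup A by move=> Dy; apply: (sup_upper_bound sA); exists y.
have [M0|M0] := leP (sup A) 0.
  exists y0 => // y' Dy'; have := le y' Dy'; have := hK y0 Dy0; lra.
have [|_ [y Dy <-] hy] := @sup_adherent R A (sup A / 2) _ sA; first by lra.
by exists y => // y' /le; lra.
Qed.

Lemma def_dw T n (w : seq 'I_n) (F : T -> 'rV[R]_n -> R) : defm (fun p => F p.1 p.2) ->
  defm (fun p : T * 'rV[R]_n => dw w (F p.1) p.2).
Proof.
move=> dF; elim: w => [|i w ih] /=; first exact: dF.
exact: (@defm_pd R T n (fun t => dw w (F t)) i ih).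
Qed.

Lemma fbound_noint T I (E : I -> T -> R -> Prop) : (forall i, def (fun p => E i p.1 p.2)) ->
  (forall i t a b, a < b -> ~ forall s, a < s < b -> E i t s) ->
  exists N, forall t, fbound (U := real_dtype) N (fun s => exists i, E i t s).
Proof.
move=> dE nE; apply: noint_fin; first exact: def_finex.
move=> t a b ab; apply: contrapT => h.
have [||i [a' [b' [_ ab' _ h']]]] := @dbaire1 R I (fun i => E i t) a b ab.
- by move=> i; have := dE i => ?; ddef.
- by move=> s hs; apply: contrapT => nEs; apply: h; exists s.
exact: nE ab' h'.
Qed.

Lemma pd_lift_hd n (h : 'rV[R]_1 -> R) i (x : 'rV[R]_n.+1) : pd (lift ord0 i) (fun x => h (pt1 (hd x))) x = 0.
Proof.
have [_ e] := pd_cons i (fun x => h (pt1 (hd x))) (hd x) (tl x).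
rewrite -[X in pd _ _ X](cons_hd_tl x) -e.
rewrite (_ : (fun y => _) = fun=> h (pt1 (hd x))); first by case: (pd_cst (h (pt1 (hd x))) i (tl x)).
by apply/funext => y; rewrite hd_cons.
Qed.

Lemma pd_hd_comp n (h : 'rV[R]_1 -> R) (x : 'rV[R]_n.+1) : (forall z, open_cube 1 z -> Cr 1 h z) ->
  open_cube n.+1 x -> pd ord0 (fun x => h (pt1 (hd x))) x = pd ord0 h (pt1 (hd x)).
Proof.
move=> hh cx; have c1 : open_cube 1 (pt1 (hd x)).
  by apply/cube1; rewrite hd_pt1; case/cube_hdtl: cx.
have E : (fun z : 'rV[R]_n.+1 => pt1 (hd z) 0 ord0) = fun z => z 0 ord0.
  by apply/funext => z; rewrite /pt1 cons0.
have [|_ ->] := @pd_comp R n.+1 1 setT _ h (fun z => pt1 (hd z)) ord0 x (@open_cube_open R 1) c1 hh.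
  by move=> k; rewrite (ord1 k) E; case: (pd_coord ord0 ord0 x).
by rewrite big_ord1 E; have [_ ->] := pd_coord ord0 ord0 x; rewrite eqxx mulr1.
Qed.

(* The first variable is reparametrized along curves on which the derivatives to be
   bounded nearly reach their suprema over the fibres. *)
Lemma Pfull_step k r m : @Pn R k r -> (m < r)%N -> Pfull k.+1 r m.+1 -> Pfull k.+1 r m.
Proof.
move=> hP mr hS T J c F B0 dc dF F01 hC hB0.
pose n := k.+1; pose B := `|B0| + 1.
have Bp : 0 < B by rewrite /B; have := normr_ge0 B0; lra.
have hB j t z w : c t -> open_cube n.+1 z -> (size w <= r)%N -> (count_mem ord0 w <= m)%N -> `|dw w (F j t) z| <= B.
  move=> ct cz sw cw; apply: le_trans (hB0 j t z w ct cz sw cw) _; rewrite /B.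
  by have := ler_norm B0; lra.
(* A function and a word in the other variables. With the [m] derivatives added by [wd] and one more
   in the first variable, these are all the derivatives to bound next; the length bound leaves room
   for that one. *)
pose I : finType := (J * (r - m.+1).-bseq 'I_n)%type.
pose wd (i : I) : seq 'I_n.+1 := nseq m ord0 ++ map (lift ord0) i.2.
have swd i : (size (wd i) < r)%N.
  by rewrite /wd size_cat size_nseq size_map; have := size_bseq i.2; rewrite -(leq_add2l m.+1) subnKC.
have cwd i : count_mem ord0 (wd i) = m.
  by rewrite /wd count_cat count_nseq /= mul1n count_map (eq_count (a2 := pred0)) ?count_pred0 ?addn0.
pose G (i : I) t := dw (wd i) (F i.1 t).
have dG i : defm (fun p : T * 'rV[R]_n.+1 => G i p.1 p.2) by exact: def_dw.
pose pG (i : I) t (x : 'rV[R]_n.+1) := pd ord0 (G i t) x.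
have dpG i : defm (fun p : T * 'rV[R]_n.+1 => pG i p.1 p.2) by exact: (@defm_pd R T n.+1 (G i) ord0 (dG i)).
have hG i t x : c t -> open_cube n.+1 x ->
    [/\ Cr 1 (G i t) x, `|G i t x| <= B & forall l, `|pd (lift ord0 l) (G i t) x| <= B].
  move=> ct cx; split.
  - by apply: Cr_dw; apply: Cr_le (hC _ _ _ ct cx); rewrite addn1.
  - by apply: hB; rewrite ?cwd // ltnW.
  - by move=> l; apply: (hB i.1 t x (lift ord0 l :: wd i)) => //; [exact: swd|rewrite /= cwd].
(* Fibres on which the slope is unbounded, so that no nearly maximal point exists. By
   [slope_bounded] they are finitely many, and [Sol_fib] treats them. *)
pose Eb (i : I) t (s : R) := (c t /\ 0 < s < 1) /\
  forall K : R, exists y : 'rV[R]_n, open_cube n y /\ K < `|pG i t (cons s y)|.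
have dEb i : def (fun p : T * R => Eb i p.1 p.2) by rewrite /Eb /open_cube /=; have := dpG i => ?; ddef.
pose Ebad t (s : R) := exists i, Eb i t s.
have dEbad : def (fun p : T * R => Ebad p.1 p.2) by apply: def_finex => i; exact: dEb.
have r1 : (1 <= r)%N by exact: leq_ltn_trans mr.
have [|N1 hN1] := @fbound_noint T I Eb dEb.
  move=> i t a b ab h.
  have [|[ct h1] _] := h ((2 * a + b) / 3); first by apply/andP; split; lra.
  have [|[_ h2] _] := h ((a + 2 * b) / 3); first by apply/andP; split; lra.
  apply: (@slope_bounded R n (G i t) B ((2 * a + b) / 3) ((a + 2 * b) / 3)) => //; try by lra.
  + exact: Pn0.
  + by have := dG i => ?; ddef.
  + by move=> x cx; exact: hG.
  move=> s hs K; have [|_ /(_ K)[y [cy hy]]] := h s; first by apply/andP; split; lra.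
  by exists y.
pose X t : set 'rV[R]_n.+1 := [set z | open_cube n.+1 z /\ c t].
have dX : def (fun p : T * 'rV[R]_n.+1 => X p.1 p.2) by rewrite /X /open_cube /=; ddef.
pose X2 t : set 'rV[R]_n.+1 := [set x | X t x /\ ~ Ebad t (hd x)].
apply: (@Sol_union _ _ _ _ _ _ (fun t => [set x | X t x /\ Ebad t (hd x)]) X2).
  by move=> t x; have := pselect (Ebad t (hd x)); rewrite /X2 /X /=; tauto.
  apply: (@Sol_fib _ _ _ _ _ _ _ Ebad N1) => //.
  - by rewrite /=; ddef.
  - by move=> t x [[]].
  - by move=> j t x [[cx ct] _]; exact: F01.
  - by move=> t x [].
pose Rl (i : I) (p : T * R) (y : 'rV[R]_n) := open_cube n y /\ forall y' : 'rV[R]_n, open_cube n y' ->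
  `|pG i p.1 (cons p.2 y')| <= 2 * `|pG i p.1 (cons p.2 y)|.
have dRl i : def (fun q : (T * R) * 'rV[R]_n => Rl i q.1 q.2).
  by rewrite /Rl /open_cube /=; have := dpG i => ?; ddef.
have /choice[ci hci] : forall i, exists ci : T * R -> 'rV[R]_n, defm ci /\ forall p y, Rl i p y -> Rl i p (ci p).
  by move=> i; have [ci d h] := dchoiceT (dRl i); exists ci.
pose ga (i : I) t (s : R) := ci i (t, s).
have dga i : defm (fun p : T * R => ga i p.1 p.2) by have [d _] := hci i; rewrite /ga; ddef.
pose X0 t : set 'rV[R]_1 := [set z | (c t /\ 0 < hd z < 1) /\ ~ Ebad t (hd z)].
have dX0 : def (fun p : T * 'rV[R]_1 => X0 p.1 p.2) by rewrite /X0 /=; ddef.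
have gaP i t z : X0 t z -> Rl i (t, hd z) (ga i t (hd z)).
  move=> [[ct h01] nE]; have [K hK] : exists K : R, forall y, open_cube n y -> `|pG i t (cons (hd z) y)| <= K.
    apply: contrapT => h; apply: nE; exists i; split=> // K; apply: contrapT => h2; apply: h; exists K => y cy.
    by rewrite leNgt; apply/negP => lt; apply: h2; exists y.
  have [_ hh] := hci i.
  have [||y cy hy] := @near_max n (open_cube n) (fun y => `|pG i t (cons (hd z) y)|) K.
  - by exists (\row_l 2^-1); exact: half_cube.
  - by move=> y cy; rewrite normr_ge0 hK.
  by apply: (hh (t, hd z) y).
(* Order [r.+1] is what [subst0_bound] asks of the substitution. *)
have [|||U [Phi [N2 [B1 [dPhi hPhi]]]]] := @Pn0 R r.+1 isT T _ X0 (curves B G ga) dX0.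
- by move=> q; exact: defm_curves.
- by move=> t z [[_ h01] _]; apply/cube1.
- move=> [[i [l|]]|] t z Xz /=.
  + by have [/(_ l) + _] := gaP i t z Xz; lra.
  + apply: nrm01 => //; have [cy _] := gaP i t z Xz; case: Xz => -[ct h01] _.
    by have [] := hG i t (cons (hd z) (ga i t (hd z))) ct (proj2 (cube_cons _ _) (conj h01 cy)).
  + by case: Xz => -[_ h01] _; lra.
pose TU : dtype R := prod_dtype T U.
(* The parameters provided by [Sol] need not depend definably on [t]. All those for which the
   conclusion holds are kept instead, which is a definable condition. *)
pose c' (tu : TU) := (forall z, open_cube 1 z -> X0 tu.1 (Phi tu.2 z)) /\
  forall q, jet r.+1 B1 (fun z => curves B G ga q tu.1 (Phi tu.2 z)).
have dc' : def c'.
  apply: def_and; first by rewrite /open_cube /=; apply: (@def_all _ _ (row_dtype 1)); ddef.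
  apply: def_finall => q; apply: (@def_jet R TU 1 r.+1 B1 (fun tu z => curves B G ga q tu.1 (Phi tu.2 z))).
  by have := @defm_curves R n I T B G ga q dG dga => ?; ddef.
pose h u (z : 'rV[R]_1) := hd (Phi u z); pose H u (x : 'rV[R]_n.+1) := h u (pt1 (hd x)).
have dH : defm (fun p : U * 'rV[R]_n.+1 => H p.1 p.2) by rewrite /H /h /pt1; ddef.
pose g (tu : TU) (x : 'rV[R]_n.+1) := subst0 (H tu.2) x.
have dg : defm (fun p : TU * 'rV[R]_n.+1 => g p.1 p.2) by rewrite /g /subst0; ddef.
have c1 (x : 'rV[R]_n.+1) : open_cube n.+1 x -> open_cube 1 (pt1 (hd x)).
  by move=> /cube_hdtl[h01 _]; apply/cube1; rewrite hd_pt1.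
have gX (tu : TU) x : c' tu -> open_cube n.+1 x -> X2 tu.1 (g tu x).
  move=> [h1 _] cx; have [[ct h01] nE] := h1 _ (c1 _ cx).
  rewrite /X2 /X /= /g /subst0 hd_cons; split=> //; split=> //.
  by apply/cube_cons; split=> //; case/cube_hdtl: cx.
apply: (@Sol_img _ _ _ r T U J X2 F (fun tu => [set x | open_cube n.+1 x /\ c' tu]) g id) => //.
- exists N2 => t; have [us hus] := hPhi t; exists us => x [[/cube_hdtl[h01 cx] ct] nE].
  have [|i iN [[h1 _ h3] [z cz ez]]] := hus (pt1 (hd x)); first by rewrite /X0 /= hd_pt1.
  exists i => //; exists (cons (hd z) (tl x)).
    by split; [apply/cube_cons; split=> //; exact/cube1|split].
  by rewrite /g /subst0 /H /h hd_cons tl_cons pt1K ez hd_pt1 cons_hd_tl.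
- by move=> tu x [cx ctu]; exact: gX.
- move=> tu phi tphi hphi z z' cz cz' e; rewrite /g /subst0 !hd_cons /H; congr (h _ (pt1 _)).
  by apply: tphi; [exact: rho_cube|exact: rho_cube|rewrite /hd !mxE].
have [B2 hB2] := @jet_rho R 1 n.+1 r.+1 B1 (fun=> ord0).
pose C0 := 2 * B * B1 + n%:R * (B * B1).
(* One of the [m.+1] factors pays for the slope, bounded through [curve_bound] by [C0] on the curve
   and by twice that on the whole fibre; the other factors are at most [|B1| + 1]. *)
pose C := 2 * (C0 * (`|B1| + 1) ^+ m).
have [B3 hB3] := @subst0_bound R n r m B B2 C.
have oh (tu : TU) : c' tu -> only_hd r.+1 B2 (H tu.2).
  move=> [h1 h2]; split.
  - apply: jet_ext (hB2 _ (h2 None)) => x _; rewrite /H /h /=; congr (hd (Phi _ _)).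
    by apply/rowP => l; rewrite mxE (ord1 l) /pt1 cons0.
  - by move=> l x _; exact: pd_lift_hd.
  - by move=> x /c1 /h1[[]].
apply: (hS TU J c' (fun j tu x => F j tu.1 (g tu x)) B3) => //.
- by move=> j; have := dF j => ?; ddef.
- by move=> j tu z ctu cz; have [[cg ct] _] := gX tu z ctu cz; exact: F01.
- move=> j tu z ctu cz; have [[_ ct] _] := gX tu z ctu cz.
  have [oh1 oh2 oh3] := oh tu ctu.
  have oh' : only_hd r B2 (H tu.2) by split=> //; apply: jet_low oh1.
  by apply: (Cr_subst0 oh') => // y cy; exact: hC.
move=> j tu z w ctu cz sw cw; have [[_ ct] _] := gX tu z ctu cz.
apply: (hB3 (F j tu.1) (H tu.2) _ (oh tu ctu)) => //.
- by move=> y cy; exact: hC.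
- by move=> w' y cy sw' cw'; exact: hB.
move=> v y cy /map_unlift[v' ev] sv; have sv' : (size v' <= r - m.+1)%N.
  by move: sv; rewrite ev size_map leq_subRL.
pose i : I := (j, Bseq sv').
have -> : dw (nseq m.+1 ord0 ++ v) (F j tu.1) = pG i tu.1.
  by rewrite /pG /G /wd ev.
have [h1 h2] := ctu; have cy1 := c1 y cy; have Xy := h1 _ cy1.
have cphi z' : open_cube 1 z' -> open_cube n.+1 (cons (hd (Phi tu.2 z')) (ga i tu.1 (hd (Phi tu.2 z')))).
  move=> cz'; have Xz := h1 _ cz'; have [cga _] := gaP i _ _ Xz.
  by apply/cube_cons; split=> //; case: Xz => -[].
have hG' x : open_cube n.+1 x -> Cr 1 (G i tu.1) x /\ forall l, `|pd (lift ord0 l) (G i tu.1) x| <= B.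
  by move=> cx; have [] := hG i tu.1 x ct cx.
have hj q : jet 1 B1 (fun z => curves B G ga q tu.1 (Phi tu.2 z)) by exact: jet_low (h2 q).
have cb := curve_bound Bp hG' cphi hj cy1.
have hh z' : open_cube 1 z' -> Cr 1 (h tu.2) z' by move=> /(hj None)[].
have pH : pd ord0 (H tu.2) y = pd ord0 (h tu.2) (pt1 (hd y)) by exact: pd_hd_comp.
have [_ gmax] := gaP i _ _ Xy.
have cty : open_cube n (tl y) by case/cube_hdtl: cy.
have := gmax _ cty; rewrite -/(h tu.2 _) -/(H tu.2 y) -/(subst0 (H tu.2) y) => le1.
have B1h : `|pd ord0 (H tu.2) y| <= `|B1| + 1.
  rewrite pH; have [_ [_ /(_ ord0)[h3 _]]] := hj None _ cy1.
  by apply: le_trans h3 _; have := ler_norm B1; lra.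
rewrite exprS mulrA; rewrite -pH -/(h tu.2 _) -/(H tu.2 y) in cb.
set P := `|pG i tu.1 (subst0 _ _)| in le1 *; set D := `|pd ord0 (H tu.2) y| in cb B1h *.
set P0 := `|pd ord0 (G i tu.1) _| in cb.
have D0 : 0 <= D by exact: normr_ge0.
have le2 : P * D <= 2 * C0.
  apply: le_trans (_ : (2 * P0) * D <= _); first by apply: ler_wpM2r.
  by rewrite -mulrA ler_wpM2l.
have PD0 : 0 <= P * D by rewrite mulr_ge0 // normr_ge0.
rewrite /C mulrA; apply: ler_pM => //; first exact: exprn_ge0.
by apply: lerXn2r; rewrite ?nnegrE //; have := normr_ge0 B1; lra.
Qed.

End Straighten.

(** * From bounds on the slices to bounds in all variables *)

Section Induction.
Context {R : realType}.
Implicit Types (T U : dtype R) (I J : finType).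

Lemma Pfull0 k r : (1 <= r)%N -> @Pn R k r -> @Pfull R k.+1 r 0.
Proof.
move=> r1 hP; suff h m : @Pfull R k.+1 r (r - m) by rewrite -(subnn r).
elim: m => [|m ih]; first by rewrite subn0; exact: Pfull_top.
have [rm|mr] := leqP r m; first by rewrite (_ : r - m.+1 = r - m)%N //; lia.
by apply: Pfull_step => //; [lia|rewrite (_ : (r - m.+1).+1 = r - m)%N //; lia].
Qed.

Lemma jet_slice n r B (f : 'rV[R]_n.+1 -> R) s : 0 < s < 1 -> jet r B f -> jet r B (fun y => f (cons s y)).
Proof.
move=> hs hf y cy; have csy z : open_cube n z -> open_cube n.+1 (cons s z).
  by move=> cz; apply/cube_cons.
split.
  apply: (@Cr_comp R r n n.+1 _ _ f (cons s) (@open_cube_open R _) (@open_cube_open R _)) => // [z cz|l z cz].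
    by case: (hf z cz).
  case: (unliftP ord0 l) => [l'|] ->.
    apply: (Cr_ext (@open_cube_open R n) cz _ (@Cr_coord R n r l' z)).
    by move=> v _; rewrite consS.
  apply: (Cr_ext (@open_cube_open R n) cz _ (@Cr_cst R n r s z)).
  by move=> v _; rewrite cons0.
apply: dw_bnd => w sw; rewrite dw_cons; have [_ hb] := hf _ (csy y cy).
by apply: bnd_dw hb; rewrite size_map.
Qed.

(** Regularity is assumed on each slice separately, and none across slices. *)
Definition Pfib k r := forall T J (E : T -> R -> Prop) (F : J -> T -> 'rV[R]_k.+2 -> R) (B : R),
  def (fun p => E p.1 p.2) -> (forall j, defm (fun p => F j p.1 p.2)) ->
  (forall t s, E t s -> 0 < s < 1) ->
  (forall j t x, open_cube k.+2 x -> E t (hd x) -> 0 <= F j t x <= 1) ->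
  (forall j t s, E t s -> jet r B (fun y => F j t (cons s y))) ->
  Sol r (fun t => [set x | open_cube k.+2 x /\ E t (hd x)]) F.

(** Joint smoothness holds off a thin set, left to [Sol_thin]. The open set [V] of smoothness is
    parametrized by [Sol_id]; by [tri] the derivatives of the composites that avoid the first
    variable are computed inside slices, where they are bounded, which is the hypothesis of [Pfull]
    at [m = 0]. *)
Lemma Pfib_all k r : (1 <= r)%N -> @Pn R k r -> Pfib k r.
Proof.
move=> r1 hP T J E F B dE dF E01 F01 hj.
pose n := k.+1; pose X t : set 'rV[R]_n.+1 := [set x | open_cube n.+1 x /\ E t (hd x)].
have dX : def (fun p : T * 'rV[R]_n.+1 => X p.1 p.2) by rewrite /X /open_cube /=; ddef.
pose L t : set 'rV[R]_n.+1 := [set x | inn [set y | forall j, Cr r (F j t) y] x].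
have dL : def (fun p : T * 'rV[R]_n.+1 => L p.1 p.2) by exact: def_locCr.
pose V t : set 'rV[R]_n.+1 := [set x | inn [set y | X t y /\ L t y] x].
have dV : def (fun p : T * 'rV[R]_n.+1 => V p.1 p.2).
  by apply: (@def_inn R T n.+1 (fun t => [set y | X t y /\ L t y])); rewrite /=; ddef.
have VX t x : V t x -> X t x by move=> /inn_sub[].
have oV t : open (V t) by exact: open_inn.
apply: (@Sol_union _ _ _ _ _ _ V (fun t => [set x | X t x /\ ~ V t x])).
- by move=> t x; have := VX t x; have := pselect (V t x); rewrite -/(X t x) /=; tauto.
- have [U [Psi [N2 [B2 [dPsi hPsi]]]]] := Sol_id hP dV (fun t x h => proj1 (VX t x h)).
  pose TU : dtype R := prod_dtype T U.
  pose c (tw : TU) := [/\ forall z, open_cube n.+1 z -> V tw.1 (Psi tw.2 z), tri (Psi tw.2) &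
     forall l, jet r B2 (fun z => Psi tw.2 z 0 l)].
  have dc : def c.
    apply: (@def_ext _ TU (fun tw => (forall z, open_cube n.+1 z -> V tw.1 (Psi tw.2 z)) /\
      tri (Psi tw.2) /\ forall l, jet r B2 (fun z => Psi tw.2 z 0 l))).
      by move=> tw; split=> [[? [? ?]]|[? ? ?]].
    apply: def_and; first by rewrite /open_cube /=; apply: (@def_all _ _ (row_dtype n.+1)); ddef.
    apply: def_and.
      rewrite /tri /open_cube /=; apply: (@def_all _ _ (row_dtype n.+1)); apply: (@def_all _ _ (row_dtype n.+1)).
      by ddef.
    apply: def_finall => l; apply: (@def_jet R TU n.+1 r B2 (fun tw z => Psi tw.2 z 0 l)).
    by ddef.
  apply: (@Sol_img _ _ _ r T U J V F (fun tw => [set x | open_cube n.+1 x /\ c tw]) (fun tw z => Psi tw.2 z) id) => //.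
  + by ddef.
  + exists N2 => t; have [us hus] := hPsi t; exists us => x /hus[i iN [[h1 h2 h3] [z cz ez]]].
    by exists i => //; exists z.
  + by move=> tw z [cz [h _ _]]; exact: h.
  + move=> tw phi tphi hphi z z' cz cz' e; have cr (y : 'rV[R]_n.+1) : open_cube n.+1 y -> open_cube n.+1 (rho id y) by exact: rho_cube.
    have [cp [_ tp _]] := hphi _ (cr z cz); have [cp' _] := hphi _ (cr z' cz').
    by apply: tp => //; apply: tphi; rewrite ?/hd ?mxE //; exact: cr.
  have [B3 hB3] := @jet_comp R r n n B B2.
  apply: (Pfull0 r1 hP (T := TU) (B := B3)) => //.
  + by move=> j; have := dF j => ?; ddef.
  + by move=> j tw z [h _ _] /h/VX[cx Ex]; exact: F01.
  + move=> j tw z [h h2 h3] cz.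
    apply: (@Cr_comp R r n.+1 n.+1 (open_cube n.+1) (V tw.1) (F j tw.1) (Psi tw.2) (@open_cube_open R _) (oV _)) => //.
      by move=> y /inn_sub[_ /inn_sub].
    by move=> l y cy; case: (h3 l y cy).
  move=> j tw z w [h h2 h3] cz sw; rewrite leqn0 => /eqP cw.
  have [|w' ew] := @map_unlift n w.
    apply/allP => l lw; apply/eqP => l0; have : has (pred1 ord0) w by apply/hasP; exists l; rewrite //= l0.
    by rewrite has_count cw.
  have /cube_hdtl[hz cty] := cz; rewrite ew -(cons_hd_tl z).
  rewrite -(congr1 (fun f => f (tl z)) (dw_cons w' (fun z => F j tw.1 (Psi tw.2 z)) (hd z))).
  (* By [tri], the slice through [z] is mapped into the slice of first coordinate [s0]. *)
  pose s0 := hd (Psi tw.2 z).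
  have hs0 : E tw.1 s0 by have [_] := VX _ _ (h _ cz).
  have cz' y : open_cube n y -> open_cube n.+1 (cons (hd z) y) by move=> cy; apply/cube_cons.
  have jj : jet r B3 (fun y => F j tw.1 (Psi tw.2 (cons (hd z) y))).
    apply: (jet_ext (f := fun y => F j tw.1 (cons s0 (tl (Psi tw.2 (cons (hd z) y)))))).
      move=> y cy; congr (F j tw.1 _); rewrite -[RHS]cons_hd_tl; congr cons; apply: h2 => //.
        exact: cz'.
      by rewrite hd_cons.
    apply: (hB3 (fun y => F j tw.1 (cons s0 y)) (fun y => tl (Psi tw.2 (cons (hd z) y)))).
    - by move=> y cy; have [/cube_hdtl[]] := VX _ _ (h _ (cz' _ cy)).
    - exact: hj.
    - move=> l; apply: (jet_ext (f := fun y => Psi tw.2 (cons (hd z) y) 0 (lift ord0 l))).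
        by move=> y cy; rewrite tlE.
      exact: (@jet_slice _ _ _ (fun z => Psi tw.2 z 0 (lift ord0 l)) _ hz (h3 _)).
  have [_ hb] := jj _ cty; apply: bnd_dw hb; by move: sw; rewrite ew size_map.
apply: (Sol_thin hP) => //.
- by rewrite /=; ddef.
- by move=> t x [[]].
- by move=> j t x [[cx Ex] _]; exact: F01.
move=> t Q oQ hQ; apply: contrapT => /eqP/set0P Q0.
have dLt : def (fun x => ~ L t x) by ddef.
have [Q' [oQ' [y Qy] QQ QL]] := thinP dLt (@thin_locCr R r T J n.+1 F t dF) oQ Q0.
have [_] := hQ _ (QQ _ Qy); apply; move/open_boxP : oQ' => /(_ _ Qy)[e e0 he].
exists e; split=> // z /he Qz; split; first by have [] := hQ _ (QQ _ Qz).
by apply: contrapT; exact: QL.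
Qed.

End Induction.

(** * The induction step *)

Section Reparametrization.
Context {R : realType}.
Implicit Types (T U : dtype R) (I J : finType).

(** Tuples of [N.+1] parameters taken as one. To cover a set is a condition on several maps at once,
    so definable choice has to pick their parameters together. *)
Fixpoint dpow U N : dtype R := if N is N'.+1 then prod_dtype U (dpow U N') else U.

Fixpoint dget U N : dpow U N -> nat -> U :=
  match N with
  | 0 => fun u _ => u
  | N'.+1 => fun u i => if i is i'.+1 then dget u.2 i' else u.1
  end.

Lemma defm_dget T U N i (f : T -> dpow U N) : defm f -> defm (fun t => dget (f t) i).
Proof.
elim: N i f => [|N ih] i f df //=.
have d1 : defm (fun t => (f t).1) by exact: (defm_comp df (@defm_fst _ U (dpow U N))).
have d2 : defm (fun t => (f t).2) by exact: (defm_comp df (@defm_snd _ U (dpow U N))).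
by case: i => [|i]; [exact: d1|exact: ih].
Qed.

Lemma dget_onto U N (us : nat -> U) : exists u : dpow U N, forall i, (i < N)%N -> dget u i = us i.
Proof.
elim: N us => [|N ih] us; first by exists (us 0%N).
by have [u hu] := ih (fun i => us i.+1); exists (us 0%N, u) => -[|i] //= iN; exact: hu.
Qed.

Lemma def_good T n r B J (X : T -> set 'rV[R]_n.+1) (F : J -> T -> 'rV[R]_n.+1 -> R)
    (phi : T -> 'rV[R]_n.+1 -> 'rV[R]_n.+1) :
  def (fun p => X p.1 p.2) -> (forall j, defm (fun p => F j p.1 p.2)) ->
  defm (fun p => phi p.1 p.2) -> def (fun t => good r B (X t) (fun j => F j t) (phi t)).
Proof.
move=> dX dF dphi.
apply: (@def_ext _ T (fun t => (forall z, open_cube n.+1 z -> X t (phi t z)) /\ tri (phi t) /\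
  forall j, jet r B (fun z => F j t (phi t z)))).
  by move=> t; split=> [[? [? ?]]|[? ? ?]].
apply: def_and; first by rewrite /open_cube /=; apply: (@def_all _ _ (row_dtype n.+1)); ddef.
apply: def_and.
  rewrite /tri /open_cube /=; apply: (@def_all _ _ (row_dtype n.+1)); apply: (@def_all _ _ (row_dtype n.+1)).
  by ddef.
apply: def_finall => j; apply: (@def_jet R T n.+1 r B (fun t z => F j t (phi t z))).
by have := dF j => ?; ddef.
Qed.

(** The induction hypothesis covers each slice by [N] maps, but with parameters not known to be
    definable in the first coordinate [s]. Definable choice among all such coverings repairs this:
    index by index, the maps of slices assemble into a map [g i] that preserves the first coordinate
    and has bounded derivatives on slices, as [Pfib_all] wants. *)
Lemma Pcube k r T J (c : T -> Prop) (F : J -> T -> 'rV[R]_k.+2 -> R) : (1 <= r)%N -> @Pn R k r ->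
  def c -> (forall j, defm (fun p => F j p.1 p.2)) ->
  (forall j t x, c t -> open_cube k.+2 x -> 0 <= F j t x <= 1) ->
  Sol r (fun t => [set x | open_cube k.+2 x /\ c t]) F.
Proof.
move=> r1 hP dc dF F01; pose n := k.+1.
pose T1 : dtype R := prod_dtype T real_dtype.
pose X1 (p : T1) : set 'rV[R]_n := [set y | open_cube n y /\ (c p.1 /\ 0 < p.2 < 1)].
pose F1 j (p : T1) (y : 'rV[R]_n) := F j p.1 (cons p.2 y).
have dX1 : def (fun p : T1 * 'rV[R]_n => X1 p.1 p.2) by rewrite /X1 /open_cube /=; ddef.
have dF1 j : defm (fun p : T1 * 'rV[R]_n => F1 j p.1 p.2) by have := dF j => ?; rewrite /F1; ddef.
have [||U [Phi [N [B [dPhi hPhi]]]]] := hP T1 J X1 F1 dX1 dF1.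
- by move=> p y [].
- by move=> j p y [cy [cp hp]]; apply: F01 => //; apply/cube_cons.
pose gd (p : T1) (u : U) := good r B (X1 p) (fun j => F1 j p) (Phi u).
have dgd : def (fun q : T1 * U => gd q.1 q.2).
  apply: (@def_good (prod_dtype T1 U) k r B J (fun q => X1 q.1) (fun j q => F1 j q.1) (fun q => Phi q.2)).
  - by ddef.
  - by move=> j; have := dF1 j => ?; ddef.
  - by ddef.
pose Rl (p : T1) (u : dpow U N) := forall y, X1 p y -> exists i : 'I_N, gd p (dget u i) /\
  exists z, open_cube n z /\ Phi (dget u i) z = y.
have dRl : def (fun q : T1 * dpow U N => Rl q.1 q.2).
  rewrite /Rl; apply: (@def_all _ _ (row_dtype n)); apply: def_imp; first by ddef.
  apply: def_finex => i; have h : defm (fun p : (T1 * dpow U N) * 'rV[R]_n => dget p.1.2 i).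
    by apply: defm_dget; ddef.
  apply: def_and; first by apply: (@def_comp2 _ _ _ _ gd) => //; ddef.
  apply: (@def_ex _ _ (row_dtype n)); apply: def_and; first by rewrite /open_cube /=; ddef.
  apply: def_eq; last by ddef.
  apply: (@defm_comp2 _ _ _ _ _ Phi) => //; last by ddef.
  exact: (defm_comp (@defm_fst R (prod_dtype (prod_dtype T1 (dpow U N)) (row_dtype n)) (row_dtype n)) h).
have [u du hu] := dchoiceT dRl.
have uP p y : X1 p y -> exists i : 'I_N, gd p (dget (u p) i) /\
    exists z, open_cube n z /\ Phi (dget (u p) i) z = y.
  have [us hus] := hPhi p; have [u0 hu0] := @dget_onto U N us.
  apply: (hu p u0) => y' /hus[i iN [h1 [z cz e]]]; exists (Ordinal iN); rewrite /= hu0 //.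
  by split=> //; exists z.
pose ph (i : 'I_N) (p : T1) := Phi (dget (u p) i).
have dph i : defm (fun q : T1 * 'rV[R]_n => ph i q.1 q.2).
  apply: (@defm_comp2 _ _ _ _ _ Phi) => //; last by ddef.
  by apply: defm_dget; ddef.
pose E (i : 'I_N) t s := [/\ c t, 0 < s < 1 & gd (t, s) (dget (u (t, s)) i)].
have dE i : def (fun p : T1 => E i p.1 p.2).
  apply: (@def_ext _ T1 (fun p => c p.1 /\ 0 < p.2 < 1 /\ gd p (dget (u p) i))).
    by move=> [t s]; split=> [[? [? ?]]|[? ? ?]].
  apply: def_and; first by ddef.
  apply: def_and; first by ddef.
  apply: (@def_comp2 _ _ _ _ gd) => //; first by ddef.
  by apply: defm_dget; ddef.
pose g (i : 'I_N) t (x : 'rV[R]_n.+1) := cons (hd x) (ph i (t, hd x) (tl x)).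
have dg i : defm (fun p : T * 'rV[R]_n.+1 => g i p.1 p.2).
  by have := dph i => ?; rewrite /g; ddef.
have gP i t x : open_cube n.+1 x -> E i t (hd x) -> open_cube n.+1 (g i t x) /\ c t.
  move=> /cube_hdtl[hx cx] [ct _ [h1 _ _]]; split=> //; apply/cube_cons; split=> //.
  by have [] := h1 _ cx.
apply: (@Sol_finU _ _ _ _ _ _ _ (fun (i : 'I_N) t => [set x | (open_cube n.+1 x /\ c t) /\
   exists2 x', open_cube n.+1 x' /\ E i t (hd x') & g i t x' = x])).
  move=> t x; split=> [[cx ct]|[i []]//].
  have /cube_hdtl[hx cty] := cx; have [|i [h1 [z [cz ez]]]] := uP (t, hd x) (tl x); first by [].
  exists i; split=> //; exists (cons (hd x) z).
    by split; [apply/cube_cons|rewrite hd_cons].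
  by rewrite /g hd_cons tl_cons /ph ez cons_hd_tl.
move=> i; apply: (@Sol_img _ _ _ r T real_dtype J _ F
    (fun tw => [set x | open_cube n.+1 x /\ E i tw.1 (hd x)]) (fun tw => g i tw.1) id) => //.
- by have := dg i => ?; ddef.
- exists 1%N => t; exists (fun=> 0) => x [_ [x' [cx' Ex'] e]]; exists 0%N => //; exists x' => //.
- move=> [t w] x [cx Ex]; split; last by exists x.
  exact: gP.
- move=> [t w] phi tphi _ z z' cz cz' e; rewrite /g !hd_cons.
  by apply: tphi; [exact: rho_cube|exact: rho_cube|rewrite /hd !mxE].
apply: (@Pfib_all R k r r1 hP (prod_dtype T real_dtype) J (fun tw => E i tw.1)
  (fun j tw x => F j tw.1 (g i tw.1 x)) B).
- by have := dE i => ?; ddef.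
- by move=> j; have := dF j => ?; have := dg i => ?; ddef.
- by move=> tw s [].
- by move=> j [t w] x cx Ex; have [cg ct] := gP _ _ _ cx Ex; exact: F01.
move=> j [t w] s [ct hs [_ _ h3]] /=; apply: jet_ext (h3 j) => y _.
by rewrite /F1 /g hd_cons tl_cons.
Qed.

(** [Sol_id] replaces the domain by cubes, whatever this does to the functions; [Pcube] then treats
    the composites. *)
Lemma Pn_step k r : (1 <= r)%N -> @Pn R k r -> @Pn R k.+1 r.
Proof.
move=> r1 hP T J X F dX dF cX F01.
have [U [Psi [N [B [dPsi hPsi]]]]] := Sol_id hP dX cX.
pose TU : dtype R := prod_dtype T U.
pose c (tw : TU) := (forall z, open_cube k.+2 z -> X tw.1 (Psi tw.2 z)) /\ tri (Psi tw.2).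
have dc : def c.
  apply: def_and; first by rewrite /open_cube /=; apply: (@def_all _ _ (row_dtype k.+2)); ddef.
  rewrite /tri /open_cube /=; apply: (@def_all _ _ (row_dtype k.+2)); apply: (@def_all _ _ (row_dtype k.+2)).
  by ddef.
apply: (@Sol_img _ _ _ r T U J X F (fun tw => [set x | open_cube k.+2 x /\ c tw]) (fun tw z => Psi tw.2 z) id) => //.
- by ddef.
- exists N => t; have [us hus] := hPsi t; exists us => x /hus[i iN [[h1 h2 h3] [z cz ez]]].
  by exists i => //; exists z.
- by move=> tw z [cz [h _]]; exact: h.
- move=> tw phi tphi hphi z z' cz cz' e.
  have cr (y : 'rV[R]_k.+2) : open_cube k.+2 y -> open_cube k.+2 (rho id y) by exact: rho_cube.
  have [cp [_ tp]] := hphi _ (cr z cz); have [cp' _] := hphi _ (cr z' cz').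
  by apply: tp => //; apply: tphi; rewrite ?/hd ?mxE //; exact: cr.
apply: Pcube => //.
- by move=> j; have := dF j => ?; ddef.
- by move=> j tw x [h _] cx; apply: F01; exact: h.
Qed.

Theorem Pn_all k r : (1 <= r)%N -> @Pn R k r.
Proof. by move=> r1; elim: k => [|k ih]; [exact: Pn0|exact: Pn_step]. Qed.

End Reparametrization.

(** * Degrees of presentations *)

Section Presentations.
Context {R : realType}.
Implicit Types (T U : dtype R).

Lemma ex_least (P : nat -> Prop) : (exists n, P n) -> exists n, P n /\ forall m, P m -> (n <= m)%N.
Proof.
move=> [n Pn]; elim/ltn_ind: n Pn => n ih Pn.
have [[m [mn Pm]]|h] := pselect (exists m, (m < n)%N /\ P m); first exact: ih Pm.
by exists n; split=> // m Pm; rewrite leqNgt; apply/negP => mn; apply: h; exists m.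
Qed.

Lemma sa_degreeP d (A : set 'rV[R]_d) : semialgebraic A ->
  has_presentation_of_degree A (sa_degree A) /\
  forall m, has_presentation_of_degree A m -> (sa_degree A <= m)%N.
Proof.
move=> [p Ap]; have [|n hn] := @ex_least (has_presentation_of_degree A).
  by exists (presentation_degree p), p.
exact: (@xgetPex _ 0%N [set n | has_presentation_of_degree A n /\ _] (ex_intro _ n hn)).
Qed.

Lemma term_mpoly m k (u : qe_rcf.term R) : exists N, forall e : seq R, size e = k ->
  exists P : mpoly.mpoly m R, (mpoly.msize P <= N)%N /\
  forall x : 'rV[R]_m, mpoly.meval (x 0) P = qe_rcf.eval (e ++ denc x) u.
Proof.
elim: u => [i|c|n|u [N1 h1] v [N2 h2]|u [N1 h1]|u [N1 h1] n|u [N1 h1] v [N2 h2]|u [N1 h1] n].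
- exists 2 => e se; have [ik|ki] := ltnP i k.
    exists (mpoly.mpolyC m e`_i); split; first by rewrite mpoly.msizeC; case: eqP.
    by move=> x; rewrite mpoly.mevalC /= nth_cat se ik.
  have [h|h] := ltnP (i - k) m; last first.
    (* A variable beyond the [k + m] available ones evaluates to the default value 0. *)
    exists 0; split; first by rewrite mpoly.msize0.
    move=> x; rewrite mpoly.meval0 /= nth_cat se ltnNge ki /= nth_default //.
    by rewrite (size_denc (x : row_dtype m)).
  exists (mpoly.mpolyX R (mpoly.mnm1 (Ordinal h))); split; first by rewrite mpoly.msizeX mpoly.mdeg1.
  move=> x; rewrite mpoly.mevalXU /= nth_cat se ltnNge ki /=.
  have en : nth (Ordinal h) (enum 'I_m) (i - k) = Ordinal h by apply: val_inj; rewrite /= nth_enum_ord.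
  by rewrite (nth_map (Ordinal h)) ?size_enum_ord // en.
- exists 1%N => e _; exists (mpoly.mpolyC m c); split; first by rewrite mpoly.msizeC; case: eqP.
  by move=> x; rewrite mpoly.mevalC.
- exists 1%N => e _; exists (mpoly.mpolyC m n%:R); split; first by rewrite mpoly.msizeC; case: eqP.
  by move=> x; rewrite mpoly.mevalC.
- exists (maxn N1 N2) => e se; have [P [dP eP]] := h1 e se; have [Q [dQ eQ]] := h2 e se.
  exists (P + Q); split; last by move=> x; rewrite mpoly.mevalD eP eQ.
  by apply: leq_trans (mpoly.msizeD_le _ _) _; rewrite geq_max !leq_max dP dQ orbT.
- exists N1 => e se; have [P [dP eP]] := h1 e se.
  by exists (- P); split=> [|x]; rewrite ?mpoly.msizeN // mpoly.mevalN eP.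
- elim: n => [|n [N hN]].
    by exists 0%N => e se; exists 0; split=> [|x]; rewrite ?mpoly.msize0 // mpoly.meval0.
  exists (maxn N1 N) => e se; have [P [dP eP]] := h1 e se; have [Q [dQ eQ]] := hN e se.
  exists (P + Q); split; last by move=> x; rewrite mpoly.mevalD eP eQ /= mulrS.
  by apply: leq_trans (mpoly.msizeD_le _ _) _; rewrite geq_max !leq_max dP dQ orbT.
- exists (N1 + N2).+1 => e se; have [P [dP eP]] := h1 e se; have [Q [dQ eQ]] := h2 e se.
  exists (P * Q); split; last by move=> x; rewrite mpoly.mevalM eP eQ.
  by apply: leq_trans (mpoly.msizeM_le _ _) _; rewrite ltnS leq_add.
- elim: n => [|n [N hN]].
    exists 1%N => e se; exists (mpoly.mpolyC m 1); split; first by rewrite mpoly.msizeC; case: eqP.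
    by move=> x; rewrite mpoly.mevalC /=.
  exists (N1 + N).+1 => e se; have [P [dP eP]] := h1 e se; have [Q [dQ eQ]] := hN e se.
  exists (P * Q); split; last by move=> x; rewrite mpoly.mevalM eP eQ /= exprS.
  by apply: leq_trans (mpoly.msizeM_le _ _) _; rewrite ltnS leq_add.
Qed.

(** A union of sign classes is split by the sign of one polynomial [P] at a time; the negative case
    is a positivity condition on [- P]. *)
Lemma signs_presentation m k (ts : seq (qe_rcf.term R)) : exists M, forall (e : seq R) (X : set 'rV[R]_m),
  size e = k -> (forall x y, sgv (e ++ denc x) ts = sgv (e ++ denc y) ts -> X x -> X y) ->
  exists p : presentation m, [/\ X = presented_set p, (size p <= M)%N & (presentation_degree p <= M)%N].
Proof.
elim: ts => [|u ts [M ih]].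
  exists 1%N => e X se hX; have [[x Xx]|nX] := pselect (exists x, X x).
    exists [:: ([::], [::])]; split=> //; last by rewrite /presentation_degree big_seq1 /= !big_nil.
    apply/seteqP; split=> y; last by move=> _; exact: hX Xx.
    by move=> _; exists ([::], [::]); rewrite ?mem_head.
  exists [::]; split=> //; last by rewrite /presentation_degree big_nil.
  by apply/seteqP; split=> [y Xy|y []//]; case: nX; exists y.
have [N hN] := term_mpoly m k u.
(* Three signs, and for each of them at most [M] blocks receive one more polynomial of degree at
   most [N]. This is why the number of blocks is bounded along with the degree. *)
exists (3 * M + 3 * (M * N + M))%N => e X se hX; have [P [dP eP]] := hN e se.
pose ev (x : 'rV[R]_m) := qe_rcf.eval (e ++ denc x) u.
(* The part of [X] where [u] has sign [s], saturated into a union of sign classes of [ts] so that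
   the induction hypothesis applies. *)
pose Xs (s : R) : set 'rV[R]_m := [set x | exists y, [/\ Num.sg (ev y) = s, X y & sgv (e ++ denc y) ts = sgv (e ++ denc x) ts]].
have hs s : exists p : presentation m, [/\ Xs s = presented_set p, (size p <= M)%N & (presentation_degree p <= M)%N].
  by apply: ih (se) _ => x y exy [z [h1 h2 h3]]; exists z; split=> //; rewrite h3.
have [p1 [e1 s1 d1]] := hs 1; have [p2 [e2 s2 d2]] := hs (-1); have [p3 [e3 s3 d3]] := hs 0.
have XE x : X x <-> [\/ 0 < ev x /\ Xs 1 x, ev x < 0 /\ Xs (-1) x | ev x = 0 /\ Xs 0 x].
  split.
    move=> Xx; have [h|h|h] := ltgtP 0 (ev x).
    - by apply: Or31; split=> //; exists x; rewrite gtr0_sg.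
    - by apply: Or32; split=> //; exists x; rewrite ltr0_sg.
    - by apply: Or33; split=> //; exists x; rewrite -h sgr0.
  by case=> -[h [y [sy Xy ey]]]; apply: hX Xy; rewrite /sgv /= -/(ev x) -/(ev y) sy;
    rewrite /sgv in ey; rewrite ey; [rewrite gtr0_sg|rewrite ltr0_sg|rewrite h sgr0].
pose addp (Q : mpoly.mpoly m R) (p : presentation m) : presentation m := [seq (Q :: b.1, b.2) | b <- p].
pose addz (Q : mpoly.mpoly m R) (p : presentation m) : presentation m := [seq (b.1, Q :: b.2) | b <- p].
have addpP Q p : presented_set (addp Q p) = [set x : 'rV[R]_m | 0 < mpoly.meval (x 0) Q /\ presented_set p x].
  apply/seteqP; split=> x.
    move=> [_ /mapP[b bp ->] [h1 h2]]; split; first by apply: h1; rewrite mem_head.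
    by exists b => //; split=> // q qb; apply: h1; rewrite inE qb orbT.
  move=> [h [b bp [h1 h2]]]; exists (Q :: b.1, b.2); first by apply/mapP; exists b.
  by split=> //= q; rewrite inE => /predU1P[->//|]; exact: h1.
have addzP Q p : presented_set (addz Q p) = [set x : 'rV[R]_m | mpoly.meval (x 0) Q = 0 /\ presented_set p x].
  apply/seteqP; split=> x.
    move=> [_ /mapP[b bp ->] [h1 h2]]; split; first by apply: h2; rewrite mem_head.
    by exists b => //; split=> // q qb; apply: h2; rewrite inE qb orbT.
  move=> [h [b bp [h1 h2]]]; exists (b.1, Q :: b.2); first by apply/mapP; exists b.
  by split=> //= q; rewrite inE => /predU1P[->//|]; exact: h2.
have td Q : (mpoly.msize Q <= N)%N -> (total_degree Q <= N)%N.
  by move=> h; apply: leq_trans (leq_pred _) h.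
have addpd Q p : (mpoly.msize Q <= N)%N -> (size p <= M)%N -> (presentation_degree p <= M)%N ->
    (presentation_degree (addp Q p) <= M * N + M)%N.
  move=> hQ sp dp; rewrite /presentation_degree big_map.
  under eq_bigr => b _ do rewrite /= big_cons -addnA.
  by rewrite big_split /= leq_add // big_const_seq count_predT iter_addn_0 mulnC leq_mul ?td.
have addzd Q p : (mpoly.msize Q <= N)%N -> (size p <= M)%N -> (presentation_degree p <= M)%N ->
    (presentation_degree (addz Q p) <= M * N + M)%N.
  move=> hQ sp dp; rewrite /presentation_degree big_map.
  under eq_bigr => b _ do rewrite /= big_cons addnCA.
  by rewrite big_split /= leq_add // big_const_seq count_predT iter_addn_0 mulnC leq_mul ?td.
have dN : (mpoly.msize (- P) <= N)%N by rewrite mpoly.msizeN.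
exists (addp P p1 ++ addp (- P) p2 ++ addz P p3); split.
- have cat_set p q : presented_set (p ++ q) = presented_set p `|` presented_set q :> set 'rV[R]_m.
    apply/seteqP; split=> x; first by move=> [b]; rewrite mem_cat => /orP[] h hb; [left|right]; exists b.
    by case=> -[b h hb]; exists b; rewrite // mem_cat h ?orbT.
  rewrite !cat_set !addpP addzP -e1 -e2 -e3; apply/seteqP; split=> x.
    move=> /XE[] [h hx]; [left|right; left|right; right]; split=> //; rewrite ?mpoly.mevalN eP //.
    by rewrite oppr_gt0.
  rewrite /= mpoly.mevalN eP => h; apply/XE; case: h => [[h hx]|[[h hx]|[h hx]]].
  - by apply: Or31.
  - by apply: Or32; rewrite -oppr_gt0.
  - by apply: Or33.
- rewrite !size_cat !size_map; lia.
- rewrite /presentation_degree !big_cat /= -!/(presentation_degree _).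
  have := addpd P p1 dP s1 d1; have := addpd (- P) p2 dN s2 d2; have := addzd P p3 dP s3 d3; lia.
Qed.

Lemma def_degree T m (X : T -> set 'rV[R]_m) : def (fun p => X p.1 p.2) ->
  exists M, forall t, semialgebraic (X t) /\ (sa_degree (X t) <= M)%N.
Proof.
move=> [f hf]; have [g [g1 g2 hg]] := holds_qf f; have [ts hts] := qf_signs g1 g2.
have [M hM] := signs_presentation m (ddim T) ts; exists M => t.
have XE (x : 'rV[R]_m) : X t x <-> ord.qf_eval (denc t ++ denc x) g.
  by rewrite -hg; have := hf (t, x) [::]; rewrite cats0 /= => ->.
have [|x y exy /XE h|p [Xp sp dp]] := hM (denc t) (X t); first exact: size_denc.
  by apply/XE; rewrite -(hts _ _ exy).
have sX : semialgebraic (X t) by exists p.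
by split=> //; have [_ h] := sa_degreeP sX; apply: leq_trans dp; apply: h; exists p.
Qed.

End Presentations.

(** * One definable family for all sets of bounded degree *)

Section Universal.
Context {R : realType} (d : nat).
Implicit Types (T U : dtype R) (A B : set 'rV[R]_d) (C D : set 'rV[R]_d -> Prop).

Definition covered C := exists (T : dtype R) (X : T -> set 'rV[R]_d),
  def (fun p => X p.1 p.2) /\ forall A, C A -> exists t, X t = A.

Definition trivset A := A = setT \/ A = set0.

Lemma covered_triv : covered trivset.
Proof.
exists real_dtype, (fun s => [set x | s = 0]); split; first by rewrite /=; ddef.
move=> A [->|->]; first by exists 0; apply/seteqP; split.
exists 1; apply/seteqP; split=> // x; rewrite /= => /eqP; by rewrite oner_eq0.
Qed.

Lemma covered_sub C D : (forall A, C A -> D A) -> covered D -> covered C.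
Proof. by move=> CD [T [X [dX hX]]]; exists T, X; split=> // A /CD/hX. Qed.

Lemma covered_setI C D : covered C -> covered D ->
  covered (fun A => exists B1 B2, [/\ C B1, D B2 & A = B1 `&` B2]).
Proof.
move=> [T1 [X1 [d1 h1]]] [T2 [X2 [d2 h2]]].
exists (prod_dtype T1 T2), (fun t => [set x | X1 t.1 x /\ X2 t.2 x]); split; first by rewrite /=; ddef.
by move=> A [B1 [B2 [/h1[t1 <-] /h2[t2 <-] ->]]]; exists (t1, t2).
Qed.

Lemma covered_setU C D : covered C -> covered D ->
  covered (fun A => exists B1 B2, [/\ C B1, D B2 & A = B1 `|` B2]).
Proof.
move=> [T1 [X1 [d1 h1]]] [T2 [X2 [d2 h2]]].
exists (prod_dtype T1 T2), (fun t => [set x | X1 t.1 x \/ X2 t.2 x]); split; first by rewrite /=; ddef.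
by move=> A [B1 [B2 [/h1[t1 <-] /h2[t2 <-] ->]]]; exists (t1, t2).
Qed.

Section Fold.
Variables (op : set 'rV[R]_d -> set 'rV[R]_d -> set 'rV[R]_d) (e z : set 'rV[R]_d) (C : set 'rV[R]_d -> Prop).
Hypothesis opC : forall A B, op A B = op B A.
Hypothesis ope : forall A, op e A = A.
Hypothesis opz : forall A, op z A = z.
Hypothesis ezT : forall A, trivset A <-> A = e \/ A = z.
Hypothesis trivC : forall A, trivset A -> C A.
Hypothesis covop : forall C D, covered C -> covered D ->
  covered (fun A => exists B1 B2, [/\ C B1, D B2 & A = op B1 B2]).

Fixpoint nfold n A : Prop :=
  if n is n'.+1 then exists B1 B2, [/\ nfold n' B1, C B2 & A = op B1 B2] else trivset A.

Lemma covered_nfold n : covered C -> covered (nfold n).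
Proof. by move=> cC; elim: n => [|n ih]; [exact: covered_triv|exact: covop]. Qed.

Lemma nfoldS n A : nfold n A -> nfold n.+1 A.
Proof.
move=> h; exists A, e; split=> //; first by apply: trivC; apply/ezT; left.
by rewrite opC ope.
Qed.

Lemma nfold_le n n' A : (n <= n')%N -> nfold n A -> nfold n' A.
Proof. by move=> /subnK <-; elim: (n' - n)%N => // k ih /ih; exact: nfoldS. Qed.

Lemma nfold_triv n A : trivset A -> nfold n A.
Proof. by move=> h; apply: (@nfold_le 0). Qed.

(** The degree does not bound the number of operands. Those of degree 0 are the neutral or the
    absorbing element of [op], so they either disappear or decide the result; the others number at
    most [n]. *)
Lemma nfold_foldr (V : Type) (f : V -> set 'rV[R]_d) (dg : V -> nat) delta (s : seq V) n :
  (forall v, dg v = 0%N -> trivset (f v)) -> (forall v, (dg v <= delta)%N -> C (f v)) ->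
  (\sum_(v <- s) dg v <= n)%N -> (n <= delta)%N -> nfold n (foldr op e (map f s)).
Proof.
move=> h0 hC; elim: s n => [|v s ih] n; first by move=> _ _; apply: nfold_triv; apply/ezT; left.
rewrite big_cons /= => sn nd; case E: (dg v) => [|k].
  have {}ih : nfold n (foldr op e (map f s)) by apply: ih => //; rewrite E in sn.
  have /ezT[->|->] := h0 v E; first by rewrite ope.
  by rewrite opz; apply: nfold_triv; apply/ezT; right.
case: n sn nd => [|n] sn nd; first by rewrite E in sn.
exists (foldr op e (map f s)), (f v); split; last exact: opC.
- by apply: ih; [move: sn; rewrite E addSn ltnS; apply: leq_trans; exact: leq_addl|exact: ltnW].
- by apply: hC; apply: leq_trans nd; apply: leq_trans sn; exact: leq_addr.
Qed.

End Fold.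

Definition polyset (v : bool * mpoly.mpoly d R) : set 'rV[R]_d :=
  [set x : 'rV[R]_d | if v.1 then is_true (0 < mpoly.meval (x 0) v.2) else mpoly.meval (x 0) v.2 = 0].

Lemma covered_poly n : covered (fun A => exists v : bool * mpoly.mpoly d R, (mpoly.msize v.2 <= n)%N /\ A = polyset v).
Proof.
pose I : finType := mpoly.bmultinom d n.
pose q (t : 'rV[R]_(#|I|)) (x : 'rV[R]_d) : R :=
  \sum_(m : I) t 0 (enum_rank m) * \prod_(i < d) x 0 i ^+ (mpoly.bmnm m i).
have dq : defm (fun p : 'rV[R]_(#|I|) * 'rV[R]_d => q p.1 p.2) by rewrite /q; ddef.
exists (prod_dtype (row_dtype #|I|) real_dtype), (fun t => [set x | (t.2 = 0 /\ 0 < q t.1 x) \/ (t.2 <> 0 /\ q t.1 x = 0)]).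
split; first by rewrite /=; ddef.
move=> A [[b P] [/= sP ->]].
(* The flag is 0 for a positivity condition and -1 for an equation. *)
exists (\row_i mpoly.mcoeff (mpoly.bmnm (enum_val i : I)) P, b%:R - 1).
have qE x : q (\row_i mpoly.mcoeff (mpoly.bmnm (enum_val i : I)) P) x = mpoly.meval (x 0) P.
  rewrite [in RHS](mpoly.mpolywE sP) raddf_sum; apply: eq_bigr => m _.
  by rewrite mxE enum_rankK /= mpoly.mevalZ mpoly.mevalX.
have n10 : (0 - 1 : R) <> 0 by apply/eqP; rewrite sub0r oppr_eq0 oner_eq0.
apply/seteqP; split=> x; rewrite /polyset /= qE; case: b => /=; rewrite ?subrr.
- by case=> -[].
- by case=> -[].
- by move=> h; left.
- by move=> h; right.
Qed.

Lemma polyset_triv (v : bool * mpoly.mpoly d R) : total_degree v.2 = 0%N -> trivset (polyset v).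
Proof.
case: v => b P; rewrite /total_degree /= => h.
have : (mpoly.msize P <= 1)%N by case: (mpoly.msize P) h => [|[]].
move=> /mpoly.msize1_polyC ->; set c := mpoly.mcoeff _ _; rewrite /polyset.
have [h'|h'] := pselect (if b then is_true (0 < c) else c = 0); [left|right].
  by apply/seteqP; split=> x // _; rewrite /= mpoly.mevalC.
by apply/seteqP; split=> x //; rewrite /= mpoly.mevalC.
Qed.

(** [nfold_foldr] is used twice, for the intersections inside a block and for the union of the
    blocks; a block of degree 0 is again a trivial set. *)
Lemma covered_degree delta : covered (fun A => semialgebraic A /\ (sa_degree A <= delta)%N).
Proof.
pose C1 A := exists v : bool * mpoly.mpoly d R, (mpoly.msize v.2 <= delta.+1)%N /\ A = polyset v.
have t1 A : trivset A -> C1 A.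
  move=> [->|->]; [exists (false, 0)|exists (true, 0)]; rewrite /= mpoly.msize0; split=> //;
  by apply/seteqP; split=> x; rewrite /polyset /= mpoly.meval0 ?ltxx.
have ezI A : trivset A <-> A = setT \/ A = set0 by [].
have ezU A : trivset A <-> A = set0 \/ A = setT by rewrite /trivset; tauto.
pose C2 := nfold setI C1 delta.
have cC2 : covered C2 by apply: covered_nfold; [exact: covered_setI|exact: covered_poly].
have t2 A : trivset A -> C2 A by apply: (nfold_triv (@setIC _) (@setTI _) ezI t1).
apply: (@covered_sub _ (nfold setU C2 delta)); last first.
  by apply: covered_nfold; [exact: covered_setU|].
move=> A [sA dA]; have [[p Ap dp] _] := sa_degreeP sA; rewrite Ap.
pose bl (b : seq (mpoly.mpoly d R) * seq (mpoly.mpoly d R)) := [seq (true, P) | P <- b.1] ++ [seq (false, P) | P <- b.2].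
have blE b : basic_set b = foldr setI setT (map polyset (bl b)).
  have fE s x : (foldr setI setT (map polyset s)) x <-> forall v, v \in s -> polyset v x.
    elim: s => [|v s ih] //=; rewrite /setI /= ih; split=> [[h1 h2] v'|h].
      by rewrite inE => /predU1P[->|/h2].
    by split=> [|v' hv']; apply: h; rewrite inE ?eqxx // hv' orbT.
  apply/seteqP; split=> x; rewrite fE; last first.
    move=> h; split=> P bP; first by apply: (h (true, P)); rewrite mem_cat map_f.
    by apply: (h (false, P)); rewrite mem_cat [X in _ || X]map_f ?orbT.
  by move=> [h1 h2] v; rewrite mem_cat => /orP[] /mapP[P bP ->]; [exact: h1|exact: h2].
pose dg (b : seq (mpoly.mpoly d R) * seq (mpoly.mpoly d R)) := (\sum_(P <- b.1) total_degree P + \sum_(P <- b.2) total_degree P)%N.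
have dgE b : (\sum_(v <- bl b) total_degree v.2 = dg b)%N.
  by rewrite /bl big_cat !big_map.
have foldb b n : (dg b <= n)%N -> (n <= delta)%N -> nfold setI C1 n (basic_set b).
  move=> h nd; rewrite blE.
  apply: (nfold_foldr (dg := fun v => total_degree v.2) (delta := delta) (@setIC _) (@setTI _) (@set0I _) ezI t1) => //.
  - exact: polyset_triv.
  - by move=> v hv; exists v; split=> //; move: hv; rewrite /total_degree; case: (mpoly.msize _).
  - by rewrite dgE.
have -> : presented_set p = foldr setU set0 (map (@basic_set R d) p).
  have fE s x : (foldr setU set0 (map (@basic_set R d) s)) x <-> exists2 b, b \in s & basic_set b x.
    elim: s => [|b s ih] /=; first by split=> // -[].
    rewrite /setU /= ih; split=> [[h|[b' b's h]]|[b']].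
    - by exists b; rewrite ?mem_head.
    - by exists b'; rewrite // inE b's orbT.
    - by rewrite inE => /predU1P[->|b's] h; [left|right; exists b'].
  by apply/seteqP; split=> x; rewrite fE.
apply: (nfold_foldr (dg := dg) (delta := delta) (@setUC _) (@set0U _) (@setTU _) ezU t2) => //.
- by move=> b hb; apply: (foldb b 0%N) => //; rewrite hb.
- by move=> b hb; exact: foldb.
- by apply: leq_trans dA; rewrite -dp.
Qed.

Lemma def_semialgebraic A : semialgebraic A -> def A.
Proof.
move=> sA; have [T [X [dX /(_ A)[|t <-]]]] := covered_degree (sa_degree A); first by split.
exact: (def_comp2 dX (@defm_const _ _ T t) (@defm_id _ (row_dtype d))).
Qed.

End Universal.

(** * Maps with unit derivatives *)

Section CoverFamily.
Context {R : realType}.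
Implicit Types (T U W : dtype R).

Definition covers d l r (B : R) (A : set 'rV[R]_d) (W : Type) (Psi : W -> 'rV[R]_l -> 'rV[R]_d) N :=
  exists ws : nat -> W, forall x, A x -> exists2 i, (i < N)%N &
    [/\ forall z, open_cube l z -> A (Psi (ws i) z),
        forall j, jet r B (fun z => Psi (ws i) z 0 j) &
        exists2 z, open_cube l z & Psi (ws i) z = x].

Lemma jet_row0 r B (f : 'rV[R]_0 -> R) : `|f 0| <= B -> jet r B f.
Proof.
move=> h; rewrite (_ : f = fun=> f 0); first exact: jet_cst.
by apply/funext => x; rewrite [x]thinmx0.
Qed.

(** A finite index read from a real parameter, so that finitely many maps form a single definable
    family. *)
Definition pick_nat (V : Type) (g : nat -> V) : nat -> R -> V :=
  fix f K s := if K is K'.+1 then (if `[< s = K'%:R >] then g K' else f K' s) else g 0%N.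

Lemma pick_natE (V : Type) (g : nat -> V) K k : (k < K)%N -> pick_nat g K k%:R = g k.
Proof.
elim: K => //= K ih; rewrite ltnS leq_eqVlt => /predU1P[->|kK]; first by rewrite asboolT.
by rewrite asboolF ?ih // => /eqP; rewrite eqr_nat => /eqP e; rewrite e ltnn in kK.
Qed.
Lemma defm_pick_nat T U (g : nat -> T -> U) K (s : T -> R) : (forall k, defm (g k)) -> defm s ->
  defm (fun t => pick_nat (fun k => g k t) K (s t)).
Proof.
move=> dg ds; elim: K => [|K ih] /=; first exact: dg.
by apply: defm_if => //; ddef.
Qed.

(** The functions to regularize are the coordinates of the maps of [dle_cover], on the set of points
    sent into [A t]. The case [l = 0] is apart because [Pn] starts with one variable. *)
Lemma cover_family d l r T (A : T -> set 'rV[R]_d) : (1 <= r)%N -> def (fun p => A p.1 p.2) ->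
  (forall t x, A t x -> open_cube d x) ->
  exists (W : dtype R) (Psi : W -> 'rV[R]_l -> 'rV[R]_d) N B, defm (fun p => Psi p.1 p.2) /\
    forall t, dle l (A t) -> covers r B (A t) Psi N.
Proof.
move=> r1 dA cA; have [K [g [dg hg]]] := dle_cover l dA cA.
pose TR : dtype R := prod_dtype T real_dtype.
pose G (p : TR) (y : 'rV[R]_l) := pick_nat (fun k => g k p.1 y) K p.2.
have dG : defm (fun p : TR * 'rV[R]_l => G p.1 p.2).
  by apply: (@defm_pick_nat (prod_dtype TR (row_dtype l)) (row_dtype d) (fun k p => g k p.1.1 p.2)); [move=> k; have := dg k => ?|]; ddef.
have GE k t y : (k < K)%N -> G (t, k%:R) y = g k t y by move=> kK; rewrite /G pick_natE.
case: l => [|l] in g dg hg G dG GE *.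
  exists TR, G, K, 1; split=> // t dl; exists (fun i => (t, i%:R)) => x Ax.
  have [k kK [y cy gy]] := hg t dl x Ax; exists k => //.
  have E z : G (t, k%:R) z = x by rewrite GE // -gy; congr (g k t _); rewrite [z]thinmx0 [y]thinmx0.
  split; [by move=> z _; rewrite E|move=> j|by exists y].
  by apply: jet_row0; rewrite E; have := cA t x Ax j; rewrite ler_norml; lra.
pose X (p : TR) : set 'rV[R]_l.+1 := [set y | open_cube l.+1 y /\ A p.1 (G p y)].
have [||||U [Phi [N [B [dPhi hPhi]]]]] := @Pn_all R l r r1 TR 'I_d X (fun j p y => G p y 0 j).
- by rewrite /X /open_cube /=; ddef.
- by move=> j; ddef.
- by move=> p y [].
- by move=> j p y [_ /cA /(_ j)]; lra.
exists (prod_dtype TR U), (fun w z => G w.1 (Phi w.2 z)), (K * N)%N, B; split; first by ddef.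
move=> t dl; have /choice[us hus] := fun k : nat => hPhi (t, k%:R).
exists (fun m => ((t, (m %/ N)%:R), us (m %/ N)%N (m %% N)%N)) => x Ax.
have [k kK [y cy gy]] := hg t dl x Ax.
have [|i iN [[h1 _ h3] [z cz ez]]] := hus k y; first by split=> //=; rewrite GE // gy.
have N0 : (0 < N)%N by exact: leq_ltn_trans iN.
exists (k * N + i)%N.
  by rewrite (leq_trans (_ : _ < k * N + N)%N) ?ltn_add2l // addnC -mulSn leq_mul2r kK orbT.
rewrite divnMDl // divn_small // addn0 modnMDl modn_small //=.
split=> //; first by move=> v /h1[].
by exists z => //; rewrite ez GE.
Qed.

(** Length 2 with unit steps: open intervals have to overlap in order to cover the integers. *)
Lemma half_steps n (y : R) : 0 < y < n.+2%:R -> exists2 c, (c < n.+1)%N & c%:R < y < c.+2%:R.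
Proof.
elim: n => [|n ih] hy; first by exists 0%N.
have [h|h] := ltP y n.+2%:R.
  have [|c cn hc] := ih; first by lra.
  by exists c => //; exact: ltnW.
exists n.+1 => //; apply/andP; split; last by case/andP: hy.
by apply: lt_le_trans h; rewrite ltr_nat.
Qed.

Lemma unit_family d l r T (A : T -> set 'rV[R]_d) : (1 <= r)%N -> def (fun p => A p.1 p.2) ->
  (forall t x, A t x -> open_cube d x) ->
  exists (W : dtype R) (Psi : W -> 'rV[R]_l -> 'rV[R]_d) N, defm (fun p => Psi p.1 p.2) /\
    forall t, dle l (A t) -> covers r 1 (A t) Psi N.
Proof.
move=> r1 dA cA; have [W [Psi [N [B0 [dPsi hPsi]]]]] := cover_family l r1 dA cA.
(* An integer bound, so that cubes of side [1 / B] divide the unit cube evenly. *)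
pose q := (Num.truncn `|B0|).+1; pose B : R := q%:R.
have B0B : B0 <= B by apply: le_trans (ler_norm _) _; apply: ltW; exact: truncnS_gt.
have Bp : 0 < B by rewrite ltr0n.
pose ka : R := B^-1; have k0 : 0 < ka by rewrite invr_gt0.
have kB : ka * B = 1 by rewrite mulVf ?gt_eqF.
have k1 : ka <= 1 by rewrite invf_le1 // ler1n.
(* The corners run over a grid of step [ka / 2], half the side of the subcubes, because open
   subcubes with disjoint interiors would miss their common faces. *)
pose I : finType := {ffun 'I_l -> 'I_(q + q).-1}.
have q2 : (q + q).-1 = (q + q).-2.+1 by rewrite /q addnS addSn.
pose a (c : I) : 'rV[R]_l := \row_i ((c i)%:R * (ka / 2)).
have hac (c : I) x : open_cube l x -> open_cube l (ka *: x + a c).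
  move=> cx i; have := cx i; rewrite !mxE.
  have : (c i)%:R + 2 <= B + B.
    by rewrite /B -[X in X <= _](natrD R (c i) 2) -natrD ler_nat; have := ltn_ord (c i); move: (nat_of_ord (c i)) => v; rewrite /q; lia.
  set v := (c i)%:R => hv hx; have v0 : 0 <= v by rewrite ler0n.
  have : ka * (v + 2) <= ka * (B + B) by rewrite ler_pM2l.
  rewrite !mulrDr kB; nra.
exists (prod_dtype W (row_dtype l)), (fun w z => Psi w.1 (ka *: z + w.2)), (N * #|I|)%N; split.
  apply: (@defm_comp2 _ _ _ _ _ Psi) => //; first by ddef.
  rewrite (_ : (fun p => _) = fun p : W * 'rV[R]_l * 'rV[R]_l => \row_i (ka * p.2 0 i + p.1.2 0 i)); last first.
    by apply/funext => p; apply/rowP => i; rewrite !mxE.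
  by ddef.
move=> t /hPsi[ws hws]; have c0 : I := [ffun i => cast_ord (esym q2) ord0].
exists (fun m => (ws (m %/ #|I|)%N, a (nth c0 (enum I) (m %% #|I|)%N))) => x /hws[i iN [h1 h2 [z cz ez]]].
have /choice[c hc] : forall k : 'I_l, exists c : 'I_(q + q).-1, c%:R < 2 * B * z 0 k < c.+2%:R.
  move=> k; have [|c cn hc] := @half_steps (q + q).-2 (2 * B * z 0 k).
    rewrite -q2 (_ : (q + q).-1.+1 = q + q)%N; last by rewrite /q addnS.
    by rewrite natrD -/B; have := cz k; nra.
  have cn' : (c < (q + q).-1)%N by rewrite q2.
  by exists (Ordinal cn').
pose c' : I := [ffun k => c k]; pose m := enum_rank c'.
have I0 : (0 < #|I|)%N by apply/card_gt0P; exists c'.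
exists (i * #|I| + m)%N.
  by rewrite (leq_trans (_ : _ < i * #|I| + #|I|)%N) ?ltn_add2l // addnC -mulSn leq_mul2r iN orbT.
rewrite divnMDl // divn_small // addn0 modnMDl modn_small //= -enum_val_nth enum_rankK.
split.
- by move=> y /(hac c') /h1.
- have ka1 : 0 < ka <= 1 by rewrite k0.
  have kaB : ka * B <= 1 by rewrite kB.
  move=> j; apply: (@jet_scale R l r B ka (a c') (fun z => Psi (ws i) z 0 j) ka1 kaB (ltW Bp) (hac c')).
  + by move=> y /h1 /cA /(_ j); rewrite ler_norml; lra.
  + exact: jet_le (h2 j).
exists (B *: (z - a c')).
  move=> k; rewrite !mxE ffunE; have := hc k; set v := (c k)%:R.
  rewrite -[(c k).+2%:R]natr1 -[(c k).+1%:R]natr1 -/v => hv.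
  have -> : B * (z 0 k - v * (ka / 2)) = (2 * B * z 0 k - (ka * B) * v) / 2 by field.
  by rewrite kB; lra.
by rewrite scalerA kB scale1r subrK.
Qed.

End CoverFamily.

(** * Extension to the closed cube *)

Section Extension.
Context {R : realType} (l : nat).
Implicit Types (f : 'rV[R]_l -> R) (x y z : 'rV[R]_l).

Definition l1 x y : R := \sum_i `|x 0 i - y 0 i|.

(* The McShane extension of a Lipschitz function on the cube. *)
Definition mcs f x : R := inf [set f z + l1 x z | z in open_cube l].

(** The infimum in first-order terms, through which the graphs of the extensions are definable. *)
Definition mcs_rel f x (v : R) := (forall z, open_cube l z -> v <= f z + l1 x z) /\
  forall e, 0 < e -> exists z, open_cube l z /\ f z + l1 x z < v + e.

Lemma l1_tri x y z : l1 x z <= l1 x y + l1 y z.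
Proof.
rewrite /l1 -big_split /=; apply: ler_sum => i _.
by rewrite -[x 0 i - z 0 i](subrKA (y 0 i)) ler_normD.
Qed.

Lemma l1C x y : l1 x y = l1 y x.
Proof. by apply: eq_bigr => i _; rewrite distrC. Qed.

Lemma l1_ge0 x y : 0 <= l1 x y.
Proof. by apply: sumr_ge0 => i _; exact: normr_ge0. Qed.

Lemma sum_ord_le (F : 'I_l -> R) (c : R) : (forall i, F i <= c) -> \sum_i F i <= l%:R * c.
Proof.
by move=> h; rewrite mulr_natl -[X in _ *+ X](card_ord l) -sumr_const; apply: ler_sum.
Qed.

Lemma l1_box x y e : 0 < e -> box x e y -> l1 y x <= l%:R * e.
Proof.
by move=> e0 h; apply: sum_ord_le => i; exact/ltW/h.
Qed.

Lemma mcsP f x v : (forall z, open_cube l z -> `|f z| <= 1) -> mcs_rel f x v <-> mcs f x = v.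
Proof.
move=> hf; pose S := [set f z + l1 x z | z in open_cube l].
have hS : has_inf S.
  split; first by exists (f (\row_i 2^-1) + l1 x (\row_i 2^-1)), (\row_i 2^-1) => //; exact: half_cube.
  exists (-1) => _ [z cz <-]; have := hf z cz; rewrite ler_norml; have := l1_ge0 x z; lra.
have le z : open_cube l z -> mcs f x <= f z + l1 x z.
  by move=> cz; apply: (ge_inf (proj2 hS)); exists z.
split=> [[h1 h2]|<-].
  apply/eqP; rewrite eq_le; apply/andP; split.
    rewrite leNgt; apply/negP => lt; have [|z [cz hz]] := h2 (mcs f x - v); first by rewrite subr_gt0.
    have := le z cz; lra.
  apply: lb_le_inf; first by case: hS.
  by move=> _ [z cz <-]; exact: h1.
split=> // e e0; have [_ [z cz <-] h] := inf_adherent e0 hS.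
by exists z.
Qed.

(** First derivatives bounded by 1 give the constant 1 for the distance [l1], the one built into
    [mcs]. *)
Lemma jet_lip f r : (1 <= r)%N -> jet r 1 f -> forall x y, open_cube l x -> open_cube l y -> `|f y - f x| <= l1 y x.
Proof.
move=> r1 hf x y cx cy; have hf1 := jet_low r1 hf.
have := @mvt R l (open_cube l) f (fun=> 0) 1 x y (@cube_convex R l).
rewrite mul1r big1 => [|i _]; last by rewrite mul0r.
rewrite subr0; apply=> // z i cz; rewrite subr0.
by have [[_ /(_ i)[d _]] [_ /(_ i)[h _]]] := hf1 z cz.
Qed.

Lemma mcs_eq f x : (forall z, open_cube l z -> `|f z| <= 1) ->
  (forall x y, open_cube l x -> open_cube l y -> `|f y - f x| <= l1 y x) ->
  open_cube l x -> mcs f x = f x.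
Proof.
move=> hf lf cx; apply/mcsP => //; split.
  move=> z cz; have := lf z x cz cx; rewrite ler_norml; lra.
move=> e e0; exists x; split=> //; rewrite /l1 big1 => [|i _]; last by rewrite subrr normr0.
lra.
Qed.

Lemma mcs_lip f x y : (forall z, open_cube l z -> `|f z| <= 1) -> `|mcs f x - mcs f y| <= l1 x y.
Proof.
move=> hf.
have key u w : mcs f u <= mcs f w + l1 u w.
  have [h1 _] : mcs_rel f u (mcs f u) by apply/mcsP.
  have [_ h2] : mcs_rel f w (mcs f w) by apply/mcsP.
  rewrite leNgt; apply/negP => lt.
  have [|z [cz hz]] := h2 (mcs f u - (mcs f w + l1 u w)); first by rewrite subr_gt0.
  have := h1 z cz; have := l1_tri u w z; lra.
by have := key x y; have := key y x; rewrite (l1C y x) ler_norml; lra.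
Qed.

Lemma cube_approx x e : closed_cube l x -> 0 < e -> exists2 z, open_cube l z & l1 z x < e.
Proof.
move=> cx e0; pose s := Num.min 1 (e / (l.+1)%:R).
have l0 : 0 < l.+1%:R :> R by rewrite ltr0n.
have s0 : 0 < s by rewrite lt_min ltr01 divr_gt0.
have s1 : s <= 1 by rewrite ge_min lexx.
exists (\row_i ((1 - s) * x 0 i + s / 2)).
  by move=> i; rewrite mxE; have := cx i => /andP[h1 h2]; apply/andP; split; nra.
apply: le_lt_trans (_ : l%:R * s < e).
  apply: sum_ord_le => i; rewrite mxE (_ : _ - _ = s * (2^-1 - x 0 i)); last by ring.
  rewrite normrM (gtr0_norm s0) ler_piMr ?(ltW s0) // ler_norml; have := cx i; lra.
apply: le_lt_trans (_ : l%:R * (e / l.+1%:R) < e).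
  by rewrite ler_wpM2l // ge_min lexx orbT.
by rewrite mulrA ltr_pdivrMr // mulrC ltr_pM2l // ltr_nat.
Qed.

End Extension.

(** * Regularity and norm of maps, from their coordinates *)

Section Smooth.
Context {R : realType} (l d : nat).
Implicit Types (f : 'rV[R]_l -> 'rV[R]_d).

Lemma cont_row f x : (forall j, cont (fun y => f y 0 j) x) -> {for x, continuous f}.
Proof.
move=> h; move=> A /nbhs_boxP[e e0 he]; apply/nbhs_boxP.
have [||D [D0 hD]] := @fin_pos R 'I_d (fun j D => forall y, box x D y -> `|f y 0 j - f x 0 j| < e).
- by move=> j D D' /andP[_ DD'] hD y hy; apply: hD => i; exact: lt_le_trans (hy i) DD'.
- by move=> j; have := proj1 (contP _ _) (h j) e e0.
by exists D => // y hy; apply: he => j; exact: hD.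
Qed.

Lemma Cr_class r U f : open U -> (forall j x, U x -> Cr r (fun y => f y 0 j) x) -> class_C r U f.
Proof.
move=> oU; elim: r f => [|r ih] f hf; split=> //.
- apply: continuous_in_subspaceT => x /set_mem Ux; apply: cont_row => j; exact: Cr_cont (hf j x Ux).
- apply: continuous_in_subspaceT => x /set_mem Ux; apply: cont_row => j; exact: Cr_cont (hf j x Ux).
move=> i; have dr x : U x -> derivable f x (delta_mx 0 i).
  move=> Ux; apply/derivable_mxP => a j; rewrite (ord1 a).
  by have [_ /(_ i)[]] := hf j x Ux.
split=> //; apply: ih => j x Ux.
apply: (Cr_ext (f := pd i (fun y => f y 0 j)) oU Ux); last by have [_ /(_ i)[]] := hf j x Ux.
by move=> y Uy; rewrite /partial derive_mx ?mxE //; exact: dr.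
Qed.

(** Taking coordinates commutes with the partial derivatives on [U] because the successive
    derivatives exist there. *)
Lemma partial_words r U f : open U -> (forall j x, U x -> Cr r (fun y => f y 0 j) x) ->
  forall b (s : seq 'I_l), (\sum_(i <- s) mpoly.fun_of_multinom b i <= r)%N -> exists2 w : seq 'I_l,
    size w = (\sum_(i <- s) mpoly.fun_of_multinom b i)%N &
    forall j x, U x -> foldr (fun i g => iter (mpoly.fun_of_multinom b i) (partial i) g) f s x 0 j =
      dw w (fun y => f y 0 j) x.
Proof.
move=> oU hf b; elim=> [|i s ih]; first by rewrite big_nil; exists [::].
rewrite big_cons /=; elim: (mpoly.fun_of_multinom b i) => [|k ihk].
  by rewrite add0n => /ih.
rewrite addSn => kr; have [w sw hw] := ihk (ltnW kr).
exists (i :: w) => [|j x Ux]; first by rewrite /= sw.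
set g := iter k _ _ in hw *; rewrite [iter _ _ _]/= -/g /partial.
have dg y : U y -> derivable g y (delta_mx 0 i).
  move=> Uy; apply/derivable_mxP => a j'; rewrite (ord1 a).
  have C1 v : U v -> Cr 1 (dw w (fun y => f y 0 j')) v.
    by move=> Uv; apply: Cr_dw; apply: Cr_le (hf j' v Uv); rewrite sw addn1.
  have : Cr 1 (fun y => g y 0 j') y.
    by apply: (Cr_ext oU Uy _ (C1 y Uy)) => v Uv; rewrite hw.
  by case=> _ /(_ i)[].
rewrite derive_mx ?mxE; last exact: dg.
exact: (pd_ext i oU (f := fun y => g y 0 j) (g := dw w (fun y => f y 0 j)) Ux (hw j)).
Qed.

Lemma Cr_norm r U f : open U -> (forall j x, U x -> Cr r (fun y => f y 0 j) x) ->
  (forall j x, U x -> bnd r 1 (fun y => f y 0 j) x) -> (C_norm r U f <= 1)%E.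
Proof.
move=> oU hC hB; apply/bigmax_leP; split=> [|b _]; first by rewrite lee_fin ler01.
apply: ge_ereal_sup => _ [x Ux <-]; rewrite lee_fin.
have sb : (\sum_(i <- enum 'I_l) mpoly.fun_of_multinom (mpoly.bmnm b) i <= r)%N.
  by have := mpoly.bmdeg b; rewrite mpoly.mdegE ltnS big_enum.
have [w sw hw] := partial_words oU hC sb.
rewrite [`|_|]/Num.norm /= mx_normrE; apply/bigmax_leP; split=> [|[a j] _]; first exact: ler01.
by rewrite (ord1 a) /partial_multi hw //; apply: bnd_dw (hB j x Ux); rewrite sw.
Qed.

End Smooth.

(** * Dimension of Nash strata *)

Section Analytic.
Context {R : realType}.

Lemma nat_half (n : nat) : n%:R * 2^-1 ^+ n <= 1 :> R.
Proof.
rewrite exprVn ler_pdivrMr ?exprn_gt0 // mul1r -natrX ler_nat; exact: ltnW (ltn_expl _ _).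
Qed.

(** With [s = rho / 2], a monomial of degree [n] varies on the box of radius [s] by at most
    [n * s ^ (n - 1) * D]. Halving the radius absorbs the factor [n], since [n / 2 ^ n <= 1], and
    leaves a term of the series at radius [rho]. *)
Lemma monomial_lip d (rho D : R) (a : mpoly.multinom d) (u v : 'rV[R]_d) : 0 < rho -> 0 <= D ->
  (forall i, `|u 0 i| <= rho / 2) -> (forall i, `|v 0 i| <= rho / 2) -> (forall i, `|u 0 i - v 0 i| <= D) ->
  (rho / 2) * `|monomial_at a u - monomial_at a v| <= rho ^+ mpoly.mdeg a * D.
Proof.
move=> rho0 D0 hu hv hD; pose s := rho / 2; have s0 : 0 < s by rewrite /s; lra.
pose K (n : nat) (U V : R) := [/\ `|U| <= s ^+ n, `|V| <= s ^+ n & s * `|U - V| <= n%:R * s ^+ n * D].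
have KM n U V n' U' V' : K n U V -> K n' U' V' -> K (n + n')%N (U * U') (V * V').
  move=> [h1 h2 h3] [h1' h2' h3']; split; [by rewrite normrM exprD ler_pM|by rewrite normrM exprD ler_pM|rewrite exprD].
  have -> : U * U' - V * V' = U * (U' - V') + (U - V) * V' by ring.
  apply: le_trans (_ : s * (`|U| * `|U' - V'| + `|U - V| * `|V'|) <= _).
    by rewrite ler_pM2l // -!normrM ler_normD.
  rewrite mulrDr mulrCA [s * (_ * `|V'|)]mulrA natrD.
  have e1 : `|U| * (s * `|U' - V'|) <= s ^+ n * (n'%:R * s ^+ n' * D).
    by apply: ler_pM => //; rewrite mulr_ge0 // ltW.
  have e2 : s * `|U - V| * `|V'| <= n%:R * s ^+ n * D * s ^+ n'.
    by apply: ler_pM => //; rewrite mulr_ge0 // ltW.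
  by apply: le_trans (lerD e1 e2) _; rewrite le_eqVlt; apply/orP; left; apply/eqP; ring.
have K0 : K 0%N 1 1 by split; rewrite ?normr1 ?expr0 // subrr normr0 mulr0 !mul0r.
have K1 i : K 1%N (u 0 i ^+ 1) (v 0 i ^+ 1).
  rewrite !expr1; split; [exact: hu|exact: hv|rewrite mul1r].
  by rewrite ler_pM2l //; exact: hD.
have [_ _ H] : K (mpoly.mdeg a) (monomial_at a u) (monomial_at a v).
  rewrite /monomial_at mpoly.mdegE.
  apply: (big_ind3 K K0) => [n n' U U' V V' h h'|i _]; first exact: KM.
  elim: (mpoly.fun_of_multinom a i) => [|k ih]; first by rewrite !expr0.
  by rewrite -add1n !exprD; apply: KM ih; exact: K1.
apply: le_trans H _; rewrite ler_wpM2r // /s exprMn mulrCA -[leRHS]mulr1; apply: ler_wpM2l; last exact: nat_half.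
exact/exprn_ge0/ltW.
Qed.

Lemma summable_finite d (c : mpoly.multinom d -> R) : summable [set: mpoly.multinom d] (fun a => (c a)%:E) ->
  exists2 S : R, 0 <= S & forall n, \sum_(a : mpoly.bmultinom d n) `|c (mpoly.bmnm a)| <= S.
Proof.
move=> hs; set s := esum setT (fun a => `|(c a)%:E|)%E in hs.
have s0 : (0 <= s)%E by apply: esum_ge0 => a _; exact: abse_ge0.
have fs : (fine s)%:E = s by rewrite fineK // ge0_fin_numE.
exists (fine s); first exact: fine_ge0.
move=> n; rewrite -lee_fin fs; apply: esum_ge.
pose r := [seq mpoly.bmnm a | a <- enum (mpoly.bmultinom d n : finType)].
have ur : uniq r by rewrite map_inj_uniq ?enum_uniq // => a b e; exact: val_inj.
exists [set` r]; first by split; [exact: finite_seq|].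
rewrite -fsbig_seq // big_map -sumEFin big_enum /=.
by rewrite le_eqVlt; apply/orP; left; apply/eqP; apply: eq_bigr.
Qed.

(** At [ys], whose offsets from [x] all equal [rho], the absolute values of the terms are
    [|c a| * rho ^ |a|], with bounded partial sums. By [monomial_lip] the partial sums of the series
    share one Lipschitz constant on the box of radius [rho / 2], which passes to the limit. *)
Lemma analytic_lip d (f : 'rV[R]_d -> R) x : analytic_at f x ->
  exists e C, [/\ 0 < e, 0 <= C & forall y y', box x e y -> box x e y' ->
    forall D, 0 <= D -> (forall i, `|y 0 i - y' 0 i| <= D) -> `|f y - f y'| <= C * D].
Proof.
move=> [c /nbhs_boxP[e1 e10 he1]]; pose rho := e1 / 2.
have rho0 : 0 < rho by rewrite /rho; lra.
pose ys : 'rV[R]_d := \row_i (x 0 i + rho).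
have mys a : monomial_at a (ys - x) = rho ^+ mpoly.mdeg a.
  rewrite /monomial_at mpoly.mdegE (big_morph _ (exprD rho) (expr0 rho)); apply: eq_bigr => i _.
  by rewrite !mxE addrAC subrr add0r.
have [|hsum _] := he1 ys; first by move=> i; rewrite mxE addrAC subrr add0r ger0_norm ?ltW // /rho; lra.
have [S S0 hS] := summable_finite hsum.
exists (rho / 2), ((rho / 2)^-1 * S); split; [by lra|by rewrite mulr_ge0 // invr_ge0; lra|].
move=> y y' hy hy' D D0 hD.
have bb v : box x (rho / 2) v -> box x e1 v by move=> h i; apply: lt_trans (h i) _; rewrite /rho; lra.
have [_ cy] := he1 y (bb _ hy); have [_ cy'] := he1 y' (bb _ hy').
apply: (cvgr_to_le (cvg_norm (cvgB cy cy'))); apply: nearW => n.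
rewrite [X in `|X|](_ : _ = \sum_(a : mpoly.bmultinom d n) c (mpoly.bmnm a) *
  (monomial_at (mpoly.bmnm a) (y - x) - monomial_at (mpoly.bmnm a) (y' - x))); last first.
  by rewrite -[LHS]sumrB; apply: eq_bigr => a _; rewrite mulrBr.
apply: le_trans (ler_norm_sum _ _ _) _.
rewrite -mulrA ler_pdivlMl; last by lra.
rewrite mulr_sumr; apply: le_trans (_ : \sum_(a : mpoly.bmultinom d n) `|c (mpoly.bmnm a) * monomial_at (mpoly.bmnm a) (ys - x)| * D <= _).
  apply: ler_sum => a _; rewrite !normrM mulrCA -[leRHS]mulrA; apply: ler_wpM2l => //.
  have -> : `|monomial_at (mpoly.bmnm a) (ys - x)| = rho ^+ mpoly.mdeg (mpoly.bmnm a).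
    by rewrite mys ger0_norm //; exact/exprn_ge0/ltW.
  apply: monomial_lip => //.
  - by move=> i; rewrite !mxE ltW.
  - by move=> i; rewrite !mxE ltW.
  - by move=> i; rewrite !mxE opprD addrACA subrr addr0; exact: hD.
by rewrite -mulr_suml ler_wpM2r.
Qed.

End Analytic.

Section Strata.
Context {R : realType}.

Lemma trunc_close (x y : R) : 0 <= x -> 0 <= y -> Num.truncn x = Num.truncn y -> `|x - y| <= 1.
Proof.
move=> x0 y0 e; have := truncn_itv x0; have := truncn_itv y0; rewrite e -natr1 => h1 h2.
by rewrite ler_norml; lra.
Qed.

(* By the pigeonhole principle, on two grids of comparable mesh. *)
Lemma no_lip_embedding m k d (kd : (k <= d)%N) (q0 : 'rV[R]_m) (eta : R) (z : 'rV[R]_m -> 'rV[R]_d) (z0 : 'rV[R]_d) (ep C : R) :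
  (k < m)%N -> 0 < eta -> 0 < ep -> 0 <= C ->
  (forall q, box q0 eta q -> box z0 ep (z q) /\ forall i : 'I_d, (k <= i)%N -> z q 0 i = 0) ->
  (forall q q', box q0 eta q -> box q0 eta q' -> forall D, 0 <= D -> (forall i, `|z q 0 i - z q' 0 i| <= D) ->
     forall j, `|q 0 j - q' 0 j| <= C * D) -> False.
Proof.
move=> km eta0 ep0 C0 hz hl.
(* There are [p ^ m] source points with step [eta / p], and [n ^ k] target cells of side
   [2 * ep / n]. Since [p > Dd ^ k], [p ^ k.+1 > n ^ k] and two points share a cell; [Dd] makes [C]
   times the side smaller than the step. *)
pose Dd := (Num.truncn (2 * ep * C / eta)).+1; pose p := (Dd ^ k).+1; pose n := (Dd * p)%N.
have hD : 2 * ep * C < eta * Dd%:R.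
  by rewrite [eta * _]mulrC -ltr_pdivrMr //; exact: truncnS_gt.
have p0 : 0 < p%:R :> R by rewrite ltr0n.
have D0 : 0 < Dd%:R :> R by rewrite ltr0n.
have n0 : 0 < n%:R :> R by rewrite natrM mulr_gt0.
pose qc (c : {ffun 'I_m -> 'I_p}) : 'rV[R]_m := \row_j (q0 0 j + eta * ((c j)%:R / p%:R)).
have bqc c : box q0 eta (qc c).
  move=> j; rewrite mxE addrAC subrr add0r normrM (gtr0_norm eta0) gtr_pMr //.
  by rewrite ger0_norm ?divr_ge0 // ltr_pdivrMr // mul1r ltr_nat.
pose u (c : {ffun 'I_m -> 'I_p}) (i : 'I_d) : R := (z (qc c) 0 i - z0 0 i + ep) / (2 * ep) * n%:R.
have hu c i : 0 <= u c i < n%:R.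
  have [/(_ i) + _] := hz _ (bqc c); rewrite ltr_norml => /andP[h1 h2]; rewrite /u.
  apply/andP; split; first by rewrite mulr_ge0 ?ler0n // divr_ge0; lra.
  by rewrite gtr_pMl // ltr_pdivrMr; lra.
have hcell c i : (Num.truncn (u c i) < n)%N.
  have /andP[h1 h2] := hu c i; rewrite -(ltr_nat R); apply: le_lt_trans h2.
  by have /andP[] := truncn_itv h1.
pose f (c : {ffun 'I_m -> 'I_p}) : {ffun 'I_k -> 'I_n} :=
  [ffun i => Ordinal (hcell c (widen_ord kd i))].
have /injectivePn[c [c' cc' e]] : ~~ injectiveb f.
  apply/negP => /injectiveP /leq_card; rewrite !card_ffun !card_ord.
  apply/negP; rewrite -ltnNge; apply: leq_trans (_ : p ^ k.+1 <= _)%N; last by apply: leq_pexp2l.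
  by rewrite /n expnMn expnS ltn_mul2r expn_gt0 /= /p.
have [j cj] : exists j, c j != c' j.
  apply/existsP; rewrite -negb_forall; apply: contra cc' => /forallP h; apply/eqP/ffunP => j; exact/eqP/h.
pose D := 2 * ep / n%:R.
have Dp : 0 <= D by rewrite divr_ge0 //; lra.
have hzz i : `|z (qc c) 0 i - z (qc c') 0 i| <= D.
  have [ik|ki] := ltnP i k; last first.
    have [_ /(_ i ki)->] := hz _ (bqc c); have [_ /(_ i ki)->] := hz _ (bqc c').
    by rewrite subrr normr0.
  have wi : widen_ord kd (Ordinal ik) = i by exact: val_inj.
  have := congr1 (fun g : {ffun 'I_k -> 'I_n} => val (g (Ordinal ik))) e; rewrite !ffunE /= wi.
  have /andP[h1 _] := hu c i; have /andP[h2 _] := hu c' i.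
  move=> /(trunc_close h1 h2).
  have -> : u c i - u c' i = (z (qc c) 0 i - z (qc c') 0 i) / D.
    by rewrite /u /D; field; rewrite !gt_eqF //; lra.
  have Dpos : 0 < D by rewrite divr_gt0 //; lra.
  by rewrite normrM [`|D^-1|]gtr0_norm ?invr_gt0 // ler_pdivrMr // mul1r.
have := hl _ _ (bqc c) (bqc c') D Dp hzz j; rewrite !mxE.
have -> : q0 0 j + eta * ((c j)%:R / p%:R) - (q0 0 j + eta * ((c' j)%:R / p%:R)) =
    (eta / p%:R) * ((c j)%:R - (c' j)%:R) by field; rewrite gt_eqF.
rewrite normrM [`|eta / _|]gtr0_norm ?divr_gt0 //.
have h1 : 1 <= `|(c j)%:R - (c' j)%:R| :> R.
  have := @dist_natr R (c j) (c' j) cj; rewrite -!natr1 opprD addrACA subrr addr0 //.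
have h2 : eta / p%:R <= eta / p%:R * `|(c j)%:R - (c' j)%:R| by rewrite ler_peMr // divr_ge0 // ltW.
move=> h3; have := le_trans h2 h3; rewrite leNgt => /negP; apply.
have -> : C * D = (2 * ep * C) / Dd%:R / p%:R.
  by rewrite /D /n natrM; field; rewrite !gt_eqF.
by rewrite ltr_pM2r ?invr_gt0 // ltr_pdivrMr.
Qed.

Lemma analytic_map_lip d (U : set 'rV[R]_d) (h : 'rV[R]_d -> 'rV[R]_d) x : analytic_map_on U h -> U x ->
  exists e C, [/\ 0 < e, 0 <= C & forall y y', box x e y -> box x e y' ->
    forall D, 0 <= D -> (forall i, `|y 0 i - y' 0 i| <= D) -> forall j, `|h y 0 j - h y' 0 j| <= C * D].
Proof.
move=> ha Ux.
have /choice[eC heC] : forall j : 'I_d, exists eC : R * R, [/\ 0 < eC.1, 0 <= eC.2 & forall y y', box x eC.1 y -> box x eC.1 y' ->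
    forall D, 0 <= D -> (forall i, `|y 0 i - y' 0 i| <= D) -> `|h y 0 j - h y' 0 j| <= eC.2 * D].
  by move=> j; have [e [C h1]] := analytic_lip (ha x Ux j); exists (e, C).
have [||e [e0 he]] := @fin_pos R 'I_d (fun j e => e <= (eC j).1).
- by move=> j D D' /andP[_ /le_trans]; apply.
- by move=> j; have [] := heC j; exists (eC j).1.
exists e, (\sum_j (eC j).2); have C0 j : 0 <= (eC j).2 by have [] := heC j.
split=> //; first by apply: sumr_ge0.
move=> y y' hy hy' D D0 hD j; have [_ _ h1] := heC j.
have sub v : box x e v -> box x (eC j).1 v by move=> hv i; exact: lt_le_trans (hv i) (he j).
apply: le_trans (h1 y y' (sub _ hy) (sub _ hy') D D0 hD) _; rewrite ler_wpM2r //.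
by rewrite (bigD1 j) //= lerDl sumr_ge0.
Qed.

(* A definable section of a projection with nonempty interior runs, over a smaller open
   set, inside a single stratum, whose charts are locally Lipschitz. *)
Lemma max_dimension_dle d (A : set 'rV[R]_d) l : def A -> max_dimension A l -> dle l A.
Proof.
move=> dA [n [S [k [[hS AS _ _] lk]]]]; apply: contrapT => nd.
have [sg [Q [oQ Q0 hQ]]] := not_dle dA nd.
pose Rl (q : 'rV[R]_l.+1) (x : 'rV[R]_d) := A x /\ rho sg x = q.
have dRl : def (fun p : 'rV[R]_l.+1 * 'rV[R]_d => Rl p.1 p.2).
  apply: def_and; first by ddef.
  by apply: def_eq; [apply: defm_rho; ddef|ddef].
have [c dc hc] := dchoiceT dRl.
have cP q : Q q -> A (c q) /\ rho sg (c q) = q.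
  by move=> /hQ[x Ax e]; exact: (hc q x (conj Ax e)).
pose F (j : 'I_d) (t : R) (q : 'rV[R]_l.+1) := c q 0 j.
have dF j : defm (fun p : R * 'rV[R]_l.+1 => F j p.1 p.2) by rewrite /F; ddef.
pose L : set 'rV[R]_l.+1 := [set q | inn [set y | forall j, Cr 0 (F j 0) y] q].
have dL : def (fun q => ~ L q).
  have := def_locCr 0 dF => h.
  exact: def_not (def_comp2 (P := fun t q => inn [set y | forall j, Cr 0 (F j t) y] q) h (@defm_const _ (row_dtype l.+1) real_dtype 0) (@defm_id _ _)).
have [Q1 [oQ1 Q10 Q1Q Q1L]] := thinP dL (@thin_locCr R 0 real_dtype _ _ F 0 dF) oQ Q0.
pose E (i : 'I_n) : set 'rV[R]_l.+1 := [set q | S i (c q)].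
have dE i : def (E i).
  have [_ _ [_ /def_semialgebraic dS]] := hS i.
  exact: (def_comp dc dS).
have [|i [Q2 [oQ2 [q0 Q2q0] Q2Q1 Q2E]]] := dbaire dE oQ1 Q10.
  by move=> q /Q1Q/cP[]; rewrite AS => -[i _ Si] _; exists i.
have [_ _ [[kd hch] _]] := hS i.
have Sx0 : S i (c q0) by exact: Q2E.
have [U [V [h [g [[oU Ux] oV [ah ag] [hg gh] hSk]]]]] := hch _ Sx0.
have [Vz gz] := hg _ Ux.
have [e1 [C1 [e10 C10 h1]]] := analytic_map_lip ah Ux.
have [e2 [C2 [e20 C20 h2]]] := analytic_map_lip ag Vz.
have [e3 e30 h3] := proj1 (open_boxP _) oU _ Ux.
(* Within [del], the Lipschitz chart [h] stays in the box where the estimate for [g] holds; adding 1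
   avoids a division by 0. *)
pose del := Num.min (Num.min e1 e3) (e2 / (C1 + 1) / 2).
have C1p : 0 < C1 + 1 by lra.
have del0 : 0 < del by rewrite !lt_min e10 e30 /= !divr_gt0.
have [dl1 dl3 dl2] : [/\ del <= e1, del <= e3 & del <= e2 / (C1 + 1) / 2].
  by split; rewrite !ge_min lexx ?orbT.
have contc : {for q0, continuous c}.
  apply: cont_row => j; have /Q1L := Q2Q1 _ Q2q0 => /contrapT /inn_sub /(_ j)[]; exact.
have : nbhs q0 (c @^-1` (box (c q0) del)) by apply: contc; exact: nbhs_box.
move=> /nbhs_boxP[e4 e40 h4].
have [e5 e50 h5] := proj1 (open_boxP _) oQ2 _ Q2q0.
pose eta := Num.min e4 e5; have eta0 : 0 < eta by rewrite lt_min e40.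
have b4 q : box q0 eta q -> box (c q0) del (c q).
  by move=> hq; apply: h4 => j; apply: lt_le_trans (hq j) _; rewrite ge_min lexx.
have b5 q : box q0 eta q -> Q2 q.
  by move=> hq; apply: h5 => j; apply: lt_le_trans (hq j) _; rewrite ge_min lexx orbT.
have bU q : box q0 eta q -> U (c q).
  by move=> /b4 hq; apply: h3 => j; exact: lt_le_trans (hq j) dl3.
have bh q : box q0 eta q -> box (h (c q0)) e2 (h (c q)).
  move=> /b4 hq j; apply: le_lt_trans (_ : C1 * del < e2).
    apply: h1; [by move=> j'; exact: lt_le_trans (hq j') dl1|exact: box_center|exact: ltW|].
    by move=> j'; exact/ltW/hq.
  apply: le_lt_trans (_ : (C1 + 1) * (e2 / (C1 + 1) / 2) < e2).
    by apply: ler_pM => //; [exact: ltW|rewrite lerDl].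
  by rewrite mulrA mulrCA divff ?gt_eqF // mulr1; lra.
apply: (@no_lip_embedding l.+1 (k i) d kd q0 eta (fun q => h (c q)) (h (c q0)) e2 C2) => //.
- by rewrite ltnS lk; exact: leq_bigmax.
- move=> q hq; split; first exact: bh.
  by move=> i' ki; apply: (proj1 (hSk _ (bU q hq))) => //; apply: Q2E; exact: b5.
move=> q q' hq hq' D D0 hD j.
have co v : box q0 eta v -> v 0 j = g (h (c v)) 0 (sg j).
  move=> hv; have [_ ->] := hg _ (bU v hv); have [_ {1}<-] := cP v (Q1Q _ (Q2Q1 _ (b5 v hv))).
  by rewrite mxE.
rewrite (co q hq) (co q' hq'); apply: h2 => //; exact: bh.
Qed.

End Strata.

(** * Conclusion *)

Section Conclusion.
Context {R : realType}.

Definition phib l d (f : 'rV[R]_l -> 'rV[R]_d) (x : 'rV[R]_l) : 'rV[R]_d :=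
  \row_j mcs (fun z => f z 0 j) x.

Section OneMap.
Variables (r l d : nat) (r1 : (1 <= r)%N) (A : set 'rV[R]_d) (f : 'rV[R]_l -> 'rV[R]_d).
Hypothesis fA : forall z, open_cube l z -> A (f z).
Hypothesis jf : forall j, jet r 1 (fun z => f z 0 j).

Let f1 j z : open_cube l z -> `|f z 0 j| <= 1.
Proof. by move=> cz; exact: (jet_bound (jf j) cz). Qed.

Lemma phib_eq z : open_cube l z -> phib f z = f z.
Proof.
move=> cz; apply/rowP => j; rewrite mxE (@mcs_eq R l (fun z => f z 0 j)) //; first by move=> z'; exact: f1.
exact: (jet_lip r1 (jf j)).
Qed.

Lemma phib_lip x y j : `|phib f x 0 j - phib f y 0 j| <= l1 x y.
Proof. by rewrite !mxE; apply: mcs_lip => z; exact: f1. Qed.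

Lemma phib_cont : continuous (phib f).
Proof.
move=> x; apply: cont_row => j; apply/contP => e e0; exists (e / l.+1%:R).
have l0 : 0 < l.+1%:R :> R by rewrite ltr0n.
split=> [|y hy]; first exact: divr_gt0.
apply: le_lt_trans (phib_lip y x j) _; apply: le_lt_trans (l1_box (divr_gt0 e0 l0) hy) _.
by rewrite mulrA ltr_pdivrMr // mulrC ltr_pM2l // ltr_nat.
Qed.

(** Points of the closed cube are limits of points of the open one, the extension is Lipschitz, and
    [A] is closed. *)
Lemma phib_image : compact A -> phib f @` closed_cube l `<=` A.
Proof.
move=> /(compact_closed (@norm_hausdorff _ _)) cA _ [x cx <-]; apply: contrapT => nA.
have [e e0 he] := proj1 (open_boxP _) (closed_openC cA) _ nA.
have [z cz hz] := cube_approx cx e0.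
apply: (he (phib f z)); last by rewrite phib_eq //; exact: fA.
by move=> j; apply: le_lt_trans hz; exact: phib_lip.
Qed.

Lemma phib_Cr j x : open_cube l x -> Cr r (fun y => phib f y 0 j) x.
Proof.
move=> cx; have [h _] := jf j cx.
by apply: (Cr_ext (@open_cube_open R l) cx _ h) => y cy; rewrite phib_eq.
Qed.

Lemma phib_bnd j x : open_cube l x -> bnd r 1 (fun y => phib f y 0 j) x.
Proof.
move=> cx; have [_ h] := jf j cx.
by apply: (bnd_ext (@open_cube_open R l) cx _ h) => y cy; rewrite phib_eq.
Qed.

Lemma phib_graph : graph_on (closed_cube l) (phib f) =
  [set u | closed_cube l (lsubmx u) /\ forall j, mcs_rel (fun z => f z 0 j) (lsubmx u) (u 0 (rshift l j))].
Proof.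
apply/seteqP; split=> u.
  move=> [x cx <-]; rewrite /= row_mxKl; split=> // j; rewrite row_mxEr.
  by apply/mcsP; [move=> z; exact: f1|rewrite mxE].
move=> [cx h]; exists (lsubmx u) => //; rewrite -[RHS]hsubmxK; congr row_mx.
apply/rowP => j; rewrite !mxE; apply/mcsP; [by move=> z; exact: f1|exact: h].
Qed.

End OneMap.

Lemma reparametrization_dim r d delta l : (1 <= r)%N -> exists M : nat, forall A : set 'rV[R]_d,
  compact A -> A `<=` open_cube d -> semialgebraic A -> (sa_degree A <= delta)%N -> dle l A ->
  exists (N : nat) (phi : 'I_N -> 'rV[R]_l -> 'rV[R]_d),
    [/\ forall i, [/\ {within closed_cube l, continuous (phi i)},
                      semialgebraic_map (closed_cube l) (phi i),
                      phi i @` closed_cube l `<=` open_cube d &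
                      class_C r (open_cube l) (phi i)],
        \bigcup_i (phi i @` closed_cube l) = A,
        forall i, (C_norm r (open_cube l) (phi i) <= 1)%E,
        (N <= M)%N &
        forall i, (map_degree (closed_cube l) (phi i) <= M)%N].
Proof.
move=> r1; have [T [X [dX hX]]] := @covered_degree R d delta.
pose Xc t : set 'rV[R]_d := [set x | X t x /\ open_cube d x].
have [||W [Psi [N [dPsi hPsi]]]] := @unit_family R d l r T Xc r1.
- by rewrite /Xc /open_cube /=; ddef.
- by move=> t x [].
(* All the graphs belong to this one definable family, whose degrees are bounded together. *)
pose Gr (w : W) : set 'rV[R]_(l + d) := [set u | closed_cube l (lsubmx u) /\
  forall j, mcs_rel (fun z => Psi w z 0 j) (lsubmx u) (u 0 (rshift l j))].
have dGr : def (fun p : W * 'rV[R]_(l + d) => Gr p.1 p.2).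
  have dl : defm (fun u : 'rV[R]_(l + d) => lsubmx u).
    rewrite (_ : (fun u => _) = fun u : 'rV[R]_(l + d) => \row_i u 0 (lshift d i)); first by ddef.
    by apply/funext => u; apply/rowP => i; rewrite !mxE.
  by rewrite /Gr /mcs_rel /l1 /closed_cube /open_cube /=; ddef.
have [M hM] := def_degree dGr.
exists (N + M)%N => A kA Ac sA dA lA.
have [t XA] := hX A (conj sA dA).
have XcA : Xc t = A by rewrite /Xc XA; apply/seteqP; split=> [x []//|x Ax]; split=> //; exact: Ac.
have := hPsi t; rewrite XcA => /(_ lA)[ws hws].
pose gd i := (forall z, open_cube l z -> A (Psi (ws i) z)) /\ forall j, jet r 1 (fun z => Psi (ws i) z 0 j).
have [[x0 Ax0]|A0] := pselect (exists x, A x); last first.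
  exists 0%N, (fun _ _ => 0); split=> //; try by case.
  by apply/seteqP; split=> [x [[]]//|x Ax]; case: A0; exists x.
have [i0 _ [g1 g2 _]] := hws x0 Ax0.
(* The covering controls only the maps that are used for some point; any other index that is not
   good receives the map of [i0], which exists because [A] has a point. *)
pose w (i : 'I_N) := if `[< gd i >] then ws i else ws i0.
have gw i : (forall z, open_cube l z -> A (Psi (w i) z)) /\ forall j, jet r 1 (fun z => Psi (w i) z 0 j).
  by rewrite /w; case: asboolP.
have grE i : graph_on (closed_cube l) (phib (Psi (w i))) = Gr (w i).
  by have [_ h] := gw i; exact: phib_graph.
exists N, (fun i => phib (Psi (w i))); split.
- move=> i; have [h1 h2] := gw i; split.
  + by apply: continuous_subspaceT; exact: phib_cont h2.
  + by rewrite /semialgebraic_map grE; have [] := hM (w i).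
  + by apply: subset_trans Ac; exact: (phib_image r1 h1 h2 kA).
  + by apply: Cr_class; [exact: open_cube_open|move=> j x; exact: phib_Cr].
- apply/seteqP; split=> [x [i _]|x Ax].
    by have [h1 h2] := gw i; exact: (phib_image r1 h1 h2 kA).
  have [i iN [h1 h2 [z cz ez]]] := hws x Ax.
  exists (Ordinal iN) => //; exists z; first by move=> k; have /andP[/ltW-> /ltW->] := cz k.
  have [_ h2'] := gw (Ordinal iN); rewrite (phib_eq r1 h2' cz).
  by rewrite /w asboolT.
- move=> i; have [h1 h2] := gw i; apply: Cr_norm; first exact: open_cube_open.
    by move=> j x; exact: phib_Cr.
  by move=> j x; exact: phib_bnd.
- exact: leq_addr.
- by move=> i; rewrite /map_degree grE; have [_ h] := hM (w i); apply: leq_trans h _; exact: leq_addl.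
Qed.

End Conclusion.

Theorem theorem1 (R : realType) (r d delta : nat) (hr : (1 <= r)%N) :
  exists M : nat,
  forall (A : set 'rV[R]_d) (l : nat),
    compact A -> A `<=` open_cube d ->
    semialgebraic A -> max_dimension A l -> (sa_degree A <= delta)%N ->
  exists (N : nat) (phi : 'I_N -> 'rV[R]_l -> 'rV[R]_d),
    [/\ forall i, [/\ {within closed_cube l, continuous (phi i)},
                      semialgebraic_map (closed_cube l) (phi i),
                      phi i @` closed_cube l `<=` open_cube d &
                      class_C r (open_cube l) (phi i)],
        \bigcup_i (phi i @` closed_cube l) = A,
        forall i, (C_norm r (open_cube l) (phi i) <= 1)%E,
        (N <= M)%N &
        forall i, (map_degree (closed_cube l) (phi i) <= M)%N].
Proof.
have /choice[M hM] := fun l => @reparametrization_dim R r d delta l hr.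
(* The bound has to be independent of [l], which is at most [d] because the strata are submanifolds
   of a space of dimension [d]. *)
exists (\sum_(l < d.+1) M l)%N => A l kA Ac sA mA dA.
have ld : (l < d.+1)%N.
  have [n [S [k [[hS _ _ _] ->]]]] := mA.
  by rewrite ltnS; apply/bigmax_leqP => i _; have [_ _ [[]]] := hS i.
have lM : (M l <= \sum_(l < d.+1) M l)%N by rewrite (bigD1 (Ordinal ld)) //= leq_addr.
have dl := max_dimension_dle (def_semialgebraic sA) mA.
have [N [phi [h1 h2 h3 h4 h5]]] := hM l A kA Ac sA dA dl.
exists N, phi; split=> //; first exact: leq_trans h4 lM.
by move=> i; exact: leq_trans (h5 i) lM.
Qed.
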